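(* Let $d\in\mathbb{N}$ ($d\ge 1$), $\alpha\in(1,2)$, $q_0=(\alpha-1)/d$, $b\in\mathbb{R}^d$ and $q\ge q_0$. Let $u_0\ge 0$ with $\|u_0\|_1>0$, and assume that one of the following holds: (a) $q=q_0$ and $u_0\in L^1(\mathbb{R}^d)$; or (b) $q>q_0$ and $u_0\in L^1(\mathbb{R}^d)\cap L^\infty(\mathbb{R}^d)$. Let $u(t,x)$ be the solution of $$u_t-\Delta^{\alpha/2}u+b\cdot\nabla\left(u|u|^q\right)=0,\qquad u(0,x)=u_0(x),$$ and put $u^*(t,x)=t^{d/\alpha}u(t,t^{1/\alpha}x)$ and $(P_t^*u_0)(x)=t^{d/\alpha}(P_tu_0)(t^{1/\alpha}x)$. Then $$\lim_{|x|\to\infty}\ \sup_{t>0}\left|1-\frac{u^*(t,x)}{(P^*_tu_0)(x)}\right|=0.$$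
   Context: $\Delta^{\alpha/2}$ is the fractional Laplacian, $\widehat{\Delta^{\alpha/2}\phi}(\xi)=-|\xi|^\alpha\widehat\phi(\xi)$. Its heat kernel is $p(t,x)=(2\pi)^{-d}\int_{\mathbb{R}^d}e^{-ix\cdot\xi}e^{-t|\xi|^\alpha}\,d\xi$ for $t>0$, $x\in\mathbb{R}^d$, and $(P_tf)(x)=\int_{\mathbb{R}^d}p(t,x-y)f(y)\,dy$ is the stable semigroup. ''Solution'' means the (unique, global) mild solution: $u\in C([0,\infty);L^1(\mathbb{R}^d))\cap C((0,\infty);L^\infty(\mathbb{R}^d))$ with $u(0)=u_0$ and, for $t>0$, $x\in\mathbb{R}^d$, $$u(t,x)=(P_tu_0)(x)+\int_0^t\int_{\mathbb{R}^d} b\cdot\nabla_z p(t-s,x-z)\,u(s,z)|u(s,z)|^{q}\,dz\,ds.$$ For $u_0\ge0$ the solution is non-negative. *)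

(* Defs.v *)
From HB Require Import structures.
From mathcomp Require Import all_boot all_order all_algebra.
From mathcomp Require Import all_classical all_reals all_analysis.
From mathcomp Require Import measurable_realfun complex.

Set Implicit Arguments.
Unset Strict Implicit.
Unset Printing Implicit Defensive.

Import Order.TTheory GRing.Theory Num.Theory.
Import numFieldNormedType.Exports.

Local Open Scope classical_set_scope.
Local Open Scope ring_scope.

Definition measure_rV_display : measure_display -> measure_display.
Proof. exact. Qed.

(* The sigma-algebra on row vectors generated by the coordinates, as the library
   does for [n.-tuple T]; for [T := R] it is the Borel sigma-algebra. *)
Section measurable_rV.
Context {d} {T : measurableType d} (n : nat).

Let coors : 'I_n -> 'rV[T]_n -> T := fun i x => x ord0 i.

Let rV_set0 : g_sigma_preimage coors set0.
Proof. exact: sigma_algebra0. Qed.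

Let rV_setC A : g_sigma_preimage coors A -> g_sigma_preimage coors (~` A).
Proof. exact: sigma_algebraC. Qed.

Let rV_bigcup (F : (set 'rV[T]_n)^nat) :
  (forall i, g_sigma_preimage coors (F i)) ->
  g_sigma_preimage coors (\bigcup_i (F i)).
Proof. exact: sigma_algebra_bigcup. Qed.

HB.instance Definition _ := @isMeasurable.Build (measure_rV_display d)
  'rV[T]_n (g_sigma_preimage coors) rV_set0 rV_setC rV_bigcup.

End measurable_rV.

Lemma measurable_coord_rV d (T : measurableType d) n (i : 'I_n) :
  measurable_fun [set: 'rV[T]_n] (fun x : 'rV[T]_n => x ord0 i).
Proof.
move=> _ Y mY; rewrite setTI; apply: sub_sigma_algebra => /=.
rewrite -bigcup_seq/=; exists i => /=; first by rewrite mem_index_enum.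
by exists Y => //; rewrite setTI.
Qed.

Lemma measurable_fun_rV d1 d2 (T1 : measurableType d1) (T2 : measurableType d2)
    n (f : T1 -> 'rV[T2]_n) :
  (forall i, measurable_fun [set: T1] (fun x => f x ord0 i)) ->
  measurable_fun [set: T1] f.
Proof.
move=> mf _ A mA.
have {mA} : preimage_set_system [set: T1] f (@measurable _ 'rV[T2]_n)
    ([set: T1] `&` f @^-1` A) by exists A.
rewrite /measurable /= -g_sigma_preimage_comp.
move: {A}([set: T1] `&` f @^-1` A); apply: smallest_sub.
  exact: sigma_algebra_measurable.
case: n f mf => [|n] f mf; first by rewrite big_ord0.
rewrite -bigcup_mkord_ord; apply: bigcup_sub => i _ _ [B mB <-].
exact: mf.
Qed.

Section lebesgue_measure_rV.
Context {R : realType}.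

Definition cons_rV n (p : measurableTypeR R * 'rV[R]_n) : 'rV[R]_n.+1 :=
  row_mx p.1%:M p.2.

Definition uncons_rV n (x : 'rV[R]_n.+1) : measurableTypeR R * 'rV[R]_n :=
  (x ord0 ord0, \row_i x ord0 (lift ord0 i)).

Lemma cons_rV0 n (p : measurableTypeR R * 'rV[R]_n) :
  cons_rV p ord0 ord0 = p.1.
Proof.
have -> : ord0 = lshift n (ord0 : 'I_1) :> 'I_(1 + n) by exact: val_inj.
by rewrite [LHS]row_mxEl mxE eqxx mulr1n.
Qed.

Lemma cons_rVS n (p : measurableTypeR R * 'rV[R]_n) i :
  cons_rV p ord0 (lift ord0 i) = p.2 ord0 i.
Proof.
have -> : lift ord0 i = rshift 1 i :> 'I_(1 + n) by exact: val_inj.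
by rewrite [LHS]row_mxEr.
Qed.

Lemma cons_rVK n : cancel (@cons_rV n) (@uncons_rV n).
Proof.
case=> a x; rewrite /uncons_rV cons_rV0; congr (_, _).
by apply/rowP => i; rewrite mxE cons_rVS.
Qed.

Lemma measurable_cons_rV n :
  measurable_fun [set: measurableTypeR R * 'rV[R]_n] (@cons_rV n).
Proof.
apply: measurable_fun_rV => i.
have [j ->|->] := unliftP ord0 i.
- under eq_fun do rewrite cons_rVS.
  exact: (measurableT_comp (measurable_coord_rV j) measurable_snd).
- under eq_fun do rewrite cons_rV0.
  exact: measurable_fst.
Qed.

Lemma measurable_uncons_rV n :
  measurable_fun [set: 'rV[R]_n.+1] (@uncons_rV n).
Proof.
apply/measurable_fun_pair => /=; first exact: measurable_coord_rV.
apply: measurable_fun_rV => i; under eq_fun do rewrite mxE.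
exact: measurable_coord_rV.
Qed.

HB.instance Definition _ n :=
  isMeasurableFun.Build _ _ _ _ (@cons_rV n) (@measurable_cons_rV n).

Section step.
Variables (n : nat) (mu : {sigma_finite_measure set 'rV[R]_n -> \bar R}).
Local Open Scope ereal_scope.

Definition lebesgue_step : set 'rV[R]_n.+1 -> \bar R :=
  pushforward (@lebesgue_measure R \x mu) (@cons_rV n).

Let lebesgue_step0 : lebesgue_step set0 = 0.
Proof. exact: measure0. Qed.

Let lebesgue_step_ge0 A : 0 <= lebesgue_step A.
Proof. exact: measure_ge0. Qed.

Let lebesgue_step_sigma_additive : semi_sigma_additive lebesgue_step.
Proof. exact: measure_semi_sigma_additive. Qed.

HB.instance Definition _ := isMeasure.Build _ _ _ lebesgue_step
  lebesgue_step0 lebesgue_step_ge0 lebesgue_step_sigma_additive.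

Let lebesgue_step_sigma_finite : sigma_finite setT lebesgue_step.
Proof.
have /sigma_finiteP[F [TF ndF Foo]] := sigma_finiteT (@lebesgue_measure R).
have /sigma_finiteP[G [TG ndG Goo]] := sigma_finiteT mu.
exists (fun k => @uncons_rV n @^-1` (F k `*` G k)).
  rewrite -preimage_bigcup (_ : \bigcup_k _ = setT) ?preimage_setT//.
  rewrite -setXTT TF TG predeqE => -[x y]; split.
    by move=> [n' _ []/= ? ?]; split; exists n'.
  move=> [/= [i _ Fix] [j _ Gjy]]; exists (maxn i j) => //; split.
  - by move: x Fix; exact/subsetPset/ndF/leq_maxl.
  - by move: y Gjy; exact/subsetPset/ndG/leq_maxr.
move=> k; have [mF Fk] := Foo k; have [mG Gk] := Goo k; split.
  rewrite -[X in measurable X]setTI; apply: measurable_uncons_rV => //.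
  exact: measurableX.
rewrite /lebesgue_step /pushforward -comp_preimage.
rewrite (_ : @uncons_rV n \o _ = id); last first.
  by apply/funext => p; exact: cons_rVK.
by rewrite preimage_id product_measure1E// lte_mul_pinfty// ge0_fin_numE.
Qed.

HB.instance Definition _ := Measure_isSigmaFinite.Build _ _ _ lebesgue_step
  lebesgue_step_sigma_finite.

End step.

(* The d-fold product of the one-dimensional Lebesgue measure;
   [lebesgue_rV_box] gives its value on boxes. *)
Fixpoint lebesgue_rV n : {sigma_finite_measure set 'rV[R]_n -> \bar R} :=
  match n with
  | 0 => \d_(0 : 'rV[R]_0)
  | n.+1 => lebesgue_step (lebesgue_rV n)
  end.

Lemma measurable_box_rV n (A : 'I_n -> set (measurableTypeR R)) :
  (forall i, measurable (A i)) ->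
  measurable [set x : 'rV[R]_n | forall i, A i (x ord0 i)].
Proof.
move=> mA; rewrite (_ : mkset _ = \bigcap_(i in [set: 'I_n])
    ((fun x : 'rV[R]_n => x ord0 i) @^-1` A i)); last first.
  by apply/seteqP; split => x /= xA i => [_|]; exact: xA.
apply: fin_bigcap_measurable => // i _.
rewrite -[X in measurable X]setTI.
exact: (@measurable_coord_rV _ R n i measurableT (A i) (mA i)).
Qed.

Lemma lebesgue_rV_box n (A : 'I_n -> set (measurableTypeR R)) :
  (forall i, measurable (A i)) ->
  lebesgue_rV n [set x | forall i, A i (x ord0 i)] =
  (\prod_(i < n) lebesgue_measure (A i))%E.
Proof.
elim: n A => [|n IHn] A mA.
  by rewrite big_ord0 /= diracE mem_set//; case.
have mA' i : measurable (A (lift ord0 i)) by exact: mA.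
rewrite big_ord_recl -(IHn _ mA') -product_measure1E//; last first.
  exact: (measurable_box_rV mA').
rewrite /= /lebesgue_step /pushforward; congr (_ _).
apply/seteqP; split => -[a x] /=.
  move=> xA; split; first by move: (xA ord0); rewrite cons_rV0.
  by move=> i; move: (xA (lift ord0 i)); rewrite cons_rVS.
move=> [aA xA] i; have [j ->|->] := unliftP ord0 i.
  by rewrite cons_rVS; exact: xA.
by rewrite cons_rV0.
Qed.

Lemma measurable_opp_rV n : measurable_fun [set: 'rV[R]_n] (@GRing.opp 'rV[R]_n).
Proof.
apply: measurable_fun_rV => i; under eq_fun do rewrite mxE.
exact: (measurableT_comp _ (measurable_coord_rV i)).
Qed.

HB.instance Definition _ n :=
  isMeasurableFun.Build _ _ _ _ (@GRing.opp 'rV[R]_n) (@measurable_opp_rV n).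

Lemma lebesgue_rVN n (A : set 'rV[R]_n) : measurable A ->
  lebesgue_rV n (-%R @^-1` A) = lebesgue_rV n A.
Proof.
elim: n A => [|n IHn] A mA.
  rewrite /= !diracE; congr (_%:R%:E); congr (nat_of_bool _).
  by apply/idP/idP; rewrite !inE /= oppr0.
pose opp (p : measurableTypeR R * 'rV[R]_n) : measurableTypeR R * 'rV[R]_n :=
  (- (p.1 : R), - p.2).
have mopp : measurable_fun setT opp.
  apply: measurable_fun_pair; last first.
    by apply: (measurableT_comp (@measurable_opp_rV n) measurable_snd).
  exact: (@measurableT_comp _ _ _ _ _ _ (-%R : R -> R) _ fst
    (@oppr_measurable R _) measurable_fst).
pose nu : {measure set (measurableTypeR R * 'rV[R]_n)%type -> \bar R} :=
  pushforward (@lebesgue_measure R \x lebesgue_rV n)%E opp.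
have mcA : measurable (@cons_rV n @^-1` A).
  by rewrite -[X in measurable X]setTI; exact: measurable_cons_rV.
have /= E := @product_measure_unique _ _ _ _ _ _ _ (nu mopp) _ _ mcA.
rewrite /= /lebesgue_step /pushforward E /nu /pushforward; last first.
  move=> B C mB mC.
  rewrite -(IHn _ mC) -[X in _ = (X * _)%E](lebesgue_measureN mB).
  rewrite /pushforward -product_measure1E//.
    rewrite -[X in measurable X]setTI.
    exact: (@oppr_measurable R setT measurableT B mB).
  rewrite -[X in measurable X]setTI; exact: measurable_opp_rV.
congr (_ _); apply/seteqP.
have cN p : cons_rV (opp p) = - cons_rV p.
  apply/rowP => i; rewrite [RHS]mxE; have [j ->|->] := unliftP ord0 i.
    by rewrite !cons_rVS [LHS]mxE.
  by rewrite !cons_rV0.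
by split => p /=; rewrite cN.
Qed.
End lebesgue_measure_rV.

Section euclidean.
Context {R : realType} {d : nat}.
Implicit Types (x y : 'rV[R]_d) (f : 'rV[R]_d -> R).

Definition dotp x y : R := \sum_i x ord0 i * y ord0 i.

(* The library's norm on matrices is the max norm. *)
Definition enorm x : R := Num.sqrt (dotp x x).

Definition grad f x : 'rV[R]_d := \row_i 'D_(delta_mx ord0 i) f x.

(* The neighbourhoods of infinity, i.e. the filter |x| --> +oo. *)
Definition enorm_infty : set_system 'rV[R]_d :=
  [set A | exists M : R, forall x, M < enorm x -> A x].

Lemma measurable_dotp x : measurable_fun setT (dotp x).
Proof.
apply: measurable_sum => i; apply: measurable_funM => //.
exact: measurable_coord_rV.
Qed.

Lemma measurable_enorm : measurable_fun setT enorm.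
Proof.
apply: (measurableT_comp (continuous_measurable_fun (@sqrt_continuous R))).
by apply: measurable_sum => i; apply: measurable_funM;
  exact: measurable_coord_rV.
Qed.

End euclidean.

Global Instance enorm_infty_filter (R : realType) d : Filter (@enorm_infty R d).
Proof.
split; first by exists 0.
  move=> A B [M MA] [N NB]; exists (Num.max M N) => x.
  by rewrite gt_max => /andP[Mx Nx]; split; [exact: MA|exact: NB].
by move=> A B AB [M MA]; exists M => x /MA /AB.
Qed.

Section heat_kernel.
Context {R : realType} {d : nat}.
Implicit Types (x : 'rV[R]_d) (f : 'rV[R]_d -> R).

Definition expi (theta : R) : R[i] := (cos theta +i* sin theta)%C.

Definition Cintegral (f : 'rV[R]_d -> R[i]) : R[i] :=
  ((\int[lebesgue_rV d]_x complex.Re (f x)) +i*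
   (\int[lebesgue_rV d]_x complex.Im (f x)))%C.

Definition heat_kernelC (alpha t : R) x : R[i] :=
  (((2 * pi) ^- d)%:C * Cintegral (fun xi =>
    expi (- dotp x xi) * (expR (- t * enorm xi `^ alpha))%:C))%C.

(* The imaginary part vanishes: [Im_heat_kernelC]. *)
Definition heat_kernel (alpha t : R) x : R :=
  complex.Re (heat_kernelC alpha t x).

Lemma Rintegral_odd_rV f : measurable_fun setT f ->
  (forall x, f (- x) = - f x) -> \int[lebesgue_rV d]_x f x = 0.
Proof.
move=> mf fN; rewrite /Rintegral integralE.
have mg : measurable_fun setT (EFin \o f) by exact: measurableT_comp.
have -> : (\int[lebesgue_rV d]_x (fun x => (f x)%:E)^\+ x =
    \int[lebesgue_rV d]_x (fun x => (f x)%:E)^\- x)%E.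
  have mN := @measurable_opp_rV R d.
  pose nu : {measure set 'rV[R]_d -> \bar R} :=
    pushforward (lebesgue_rV d) (-%R : 'rV[R]_d -> 'rV[R]_d).
  rewrite (eq_measure_integral (nu mN)); last first.
    by move=> A mA _; rewrite -[LHS]lebesgue_rVN.
  rewrite ge0_integral_pushforward//=; last exact: measurable_funepos.
  rewrite preimage_setT; apply: eq_integral => x _.
  by rewrite funeposE funenegE fN EFinN.
by case: (integral _ _ _) => [r| |] //=; rewrite subrr.
Qed.

Lemma Im_heat_kernelC alpha t x : complex.Im (heat_kernelC alpha t x) = 0.
Proof.
rewrite /heat_kernelC /Cintegral /= mul0r addr0.
under eq_Rintegral do rewrite mulr0 add0r.
rewrite Rintegral_odd_rV ?mulr0//.
  apply: measurable_funM.
    apply: (measurableT_comp (continuous_measurable_fun (@continuous_sin R))).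
    by apply: measurableT_comp => //; exact: measurable_dotp.
  apply: (measurableT_comp (@measurable_expR R)).
  apply: measurable_funM => //.
  apply: (measurableT_comp (measurable_powR alpha)).
  exact: measurable_enorm.
move=> y.
have -> : dotp x (- y) = - dotp x y.
  by rewrite -sumrN; apply: eq_bigr => i _; rewrite mxE mulrN.
have -> : enorm (- y) = enorm y.
  by congr Num.sqrt; apply: eq_bigr => i _; rewrite !mxE mulrNN.
by rewrite sinN mulNr.
Qed.

Definition stable_semigroup (alpha t : R) f x : R :=
  \int[lebesgue_rV d]_y (heat_kernel alpha t (x - y) * f y).

End heat_kernel.

Section mild_solution.
Context {R : realType} {d : nat}.
Implicit Types (u : R -> 'rV[R]_d -> R) (b : 'rV[R]_d).

Definition Lp_continuous (p : \bar R) (I : set R) u : Prop :=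
  (forall t, I t -> u t \in Lfun (lebesgue_rV d) p) /\
  (forall t, I t ->
    'N[lebesgue_rV d]_p[EFin \o (u s \- u t)%R]%E @[s --> within I (nbhs t)]
      --> 0%E).

(* The gradient is that of z |-> p(t - s, x - z), so b . grad of it is
   - b . (grad p)(t - s, x - z), as integration by parts requires. *)
Definition duhamel (alpha q : R) b u (t : R) (x : 'rV[R]_d) (s : R) z : R :=
  dotp b (grad (fun z => heat_kernel alpha (t - s) (x - z)) z) *
    (u s z * `|u s z| `^ q).

(* Integrals of non-integrable functions have default values, so the absolute
   convergence of the double integral is stated explicitly. *)
Definition mild_solution (alpha q : R) b (u0 : 'rV[R]_d -> R) u : Prop :=
  [/\ Lp_continuous 1%E `[0, +oo[ u,
      Lp_continuous +oo%E `]0, +oo[ u,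
      {ae lebesgue_rV d, forall x, u 0 x = u0 x} &
      forall t x, 0 < t ->
        (lebesgue_measure \x lebesgue_rV d)%E.-integrable (`]0, t[ `*` setT)
          (fun sz => (duhamel alpha q b u t x sz.1 sz.2)%:E) /\
        u t x = stable_semigroup alpha t u0 x +
          \int[lebesgue_measure]_(s in `]0, t[)
            \int[lebesgue_rV d]_z duhamel alpha q b u t x s z].

(* The rescaling written u^* for u and P_t^* u_0 for t |-> P_t u_0. *)
Definition selfsim (alpha : R) u (t : R) (x : 'rV[R]_d) : R :=
  t `^ (d%:R / alpha) * u t (t `^ alpha^-1 *: x).

End mild_solution.

(* Main.v *)
(** The kernel p(t,.) and its gradient are obtained as mixtures of Gaussians:
    s |-> exp(-s^(alpha/2)) is completely monotone (binomial series), so every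
    linear inequality valid for Gaussians holds for the stable weight. This gives
    p(1,x) ~ (1 + |x|)^(-d-alpha) and |v . grad p(t,x)| <= C |v| p(t,x) / |x|.

    The mild solution is the L^1 limit of a monotone scheme (upwind transport,
    then diffusion by p). The scheme conserves mass, decreases the integral of
    (u - c)^+ and obeys a Nash-type L^2 inequality, hence u >= 0, u conserves mass
    and u(t) <= H t^(-d/alpha). By this decay u^(1+q) <= A s^(-(1 - 1/alpha)) u, and
    the Duhamel integral of s^(-(1 - 1/alpha)) (t - s)^(-1/alpha) is scale
    invariant: a smallness argument on short (multiplicative) time steps yields
    u(t + r) <= 2 P_r u(t).

    At |x| >= M t^(1/alpha) the Duhamel term is at most e F P_t u0(x) as soon as
    u(s) <= F P_s u0 for s < t: where |z| < |x|/2 the kernel gains 1/|x|, elsewhere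
    u(s,z) <= e s^(-d/alpha), since u is tight at the scale t^(1/alpha). Applied
    first with a finite-horizon F (iterating F |-> 1 + F/2) this gives
    u <= K P_t u0 for all times, and then the claim. *)
From HB Require Import structures.
Require Import Defs.
From mathcomp Require Import all_boot all_order all_algebra.
From mathcomp Require Import all_classical all_reals all_analysis.
From mathcomp Require Import measurable_realfun complex zify ring lra.
Import Order.TTheory GRing.Theory Num.Theory.
Import numFieldNormedType.Exports.
Local Open Scope classical_set_scope.
Local Open Scope ring_scope.
Set Implicit Arguments.
Unset Strict Implicit.
Unset Printing Implicit Defensive.

Local Notation meas := (measurable_fun setT).
Local Notation mcomp := measurableT_comp.
Local Notation mmul := measurable_funM.

(** The solution is only given by the mild formula from time 0, with absolute convergence of its
    double integral at each [(t, x)]. Two obstacles shape the proof. First, joint measurability of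
    [u] is recovered by dividing the Duhamel integrand by the kernel, which vanishes only where
    [dotp b x = 0]. Second, no L^1 bound on [u^(1+q)] near time 0 is available at that stage, so
    Fubini does not directly turn the formula from 0 into one started at [tau > 0]. Differences of
    the kernel along [b] decay better: they are dominated by the kernels at [x + b] and [x - b],
    whose integrals converge by hypothesis. The restarted formula thus holds up to a [b]-periodic
    integrable function, that is, up to 0 almost everywhere. Sign, mass and positive parts are
    invisible in the mild formula; both steps of the scheme respect them, and on a window
    [[tau, t]], where [u] is bounded, the scheme converges to [u]. Cases (a) and (b) meet in one
    inequality [|u|^q <= A |u|^((alpha-1)/d)]. The drift [b = 0] is set apart at the end. *)

Lemma measurable_cos {R : realType} : meas (@cos R).
Proof. exact: continuous_measurable_fun (@continuous_cos R). Qed.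

Lemma measurable_sin {R : realType} : meas (@sin R).
Proof. exact: continuous_measurable_fun (@continuous_sin R). Qed.

Lemma eq_leW {disp} {T : porderType disp} (x y : T) : x = y -> (x <= y)%O.
Proof. by move=> ->. Qed.

Section almost_everywhere.
Context {disp : measure_display} {T : measurableType disp} {R : realType}.
Variable mu : {measure set T -> \bar R}.
Implicit Types P Q : T -> Prop.

Lemma aeS P Q : (forall x, P x -> Q x) -> {ae mu, forall x, P x} -> {ae mu, forall x, Q x}.
Proof. exact: (@filterS _ _ (ae_filter_ringOfSetsType mu)). Qed.

Lemma aeS2 P Q S : (forall x, P x -> Q x -> S x) ->
  {ae mu, forall x, P x} -> {ae mu, forall x, Q x} -> {ae mu, forall x, S x}.
Proof. exact: (@filterS2 _ _ (ae_filter_ringOfSetsType mu)). Qed.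

Lemma aeI P Q : {ae mu, forall x, P x} -> {ae mu, forall x, Q x} -> {ae mu, forall x, P x /\ Q x}.
Proof. exact: aeS2. Qed.

End almost_everywhere.

(** * Euclidean geometry on row vectors *)

Section geometry.
Context {R : realType} {d : nat}.
Implicit Types (x y z b : 'rV[R]_d) (c : R).

Lemma dotpC x y : dotp x y = dotp y x.
Proof. by apply: eq_bigr => i _; rewrite mulrC. Qed.

Lemma dotpDl x y z : dotp (x + y) z = dotp x z + dotp y z.
Proof. by rewrite -big_split; apply: eq_bigr => i _; rewrite mxE mulrDl. Qed.

Lemma dotpZl c x y : dotp (c *: x) y = c * dotp x y.
Proof. by rewrite mulr_sumr; apply: eq_bigr => i _; rewrite mxE mulrA. Qed.

Lemma dotpDr x y z : dotp x (y + z) = dotp x y + dotp x z.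
Proof. by rewrite dotpC dotpDl !(dotpC x). Qed.

Lemma dotpZr c x y : dotp x (c *: y) = c * dotp x y.
Proof. by rewrite dotpC dotpZl dotpC. Qed.

Lemma dotpNl x y : dotp (- x) y = - dotp x y.
Proof. by rewrite -scaleN1r dotpZl mulN1r. Qed.

Lemma dotpNr x y : dotp x (- y) = - dotp x y.
Proof. by rewrite dotpC dotpNl dotpC. Qed.

Lemma dotpBr x y z : dotp x (y - z) = dotp x y - dotp x z.
Proof. by rewrite dotpDr dotpNr. Qed.

Lemma dotpBl x y z : dotp (x - y) z = dotp x z - dotp y z.
Proof. by rewrite dotpDl dotpNl. Qed.

Lemma dotp0r x : dotp x 0 = 0.
Proof. by rewrite -(scale0r x) dotpZr mul0r. Qed.

Lemma dotpp_ge0 x : 0 <= dotp x x.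
Proof. by apply: sumr_ge0 => i _; rewrite -expr2 sqr_ge0. Qed.

Lemma dotpp_eq0 x : (dotp x x == 0) = (x == 0).
Proof.
apply/eqP/eqP => [/eqP|->]; last by rewrite dotp0r.
rewrite psumr_eq0 => [/allP x0|i _]; last by rewrite -expr2 sqr_ge0.
apply/rowP => i; rewrite mxE; apply/eqP.
by have := x0 i (mem_index_enum _); rewrite /= mulf_eq0 orbb.
Qed.

Lemma dotp_sqr_le x y : dotp x y ^+ 2 <= dotp x x * dotp y y.
Proof.
have [->|y0] := eqVneq y 0; first by rewrite !dotp0r expr0n mulr0.
have yy : 0 < dotp y y by rewrite lt_def dotpp_eq0 y0 dotpp_ge0.
have := dotpp_ge0 (dotp y y *: x - dotp x y *: y).
rewrite !(dotpBr, dotpBl, dotpZl, dotpZr) (dotpC y x) => H.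
rewrite -subr_ge0 -(pmulr_lge0 _ yy); lra.
Qed.

Lemma enorm_ge0 x : 0 <= enorm x. Proof. exact: sqrtr_ge0. Qed.

Lemma sqr_enorm x : enorm x ^+ 2 = dotp x x.
Proof. by rewrite sqr_sqrtr// dotpp_ge0. Qed.

Lemma enorm_eq0 x : (enorm x == 0) = (x == 0).
Proof. by rewrite -dotpp_eq0 -sqr_enorm sqrf_eq0. Qed.

Lemma enorm_gt0 x : (0 < enorm x) = (x != 0).
Proof. by rewrite lt_def enorm_eq0 enorm_ge0 andbT. Qed.

Lemma enormZ c x : enorm (c *: x) = `|c| * enorm x.
Proof.
by rewrite /enorm dotpZl dotpZr mulrA -expr2 sqrtrM ?sqr_ge0// sqrtr_sqr.
Qed.

Lemma enormN x : enorm (- x) = enorm x.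
Proof. by rewrite -scaleN1r enormZ normrN1 mul1r. Qed.

Lemma dotp_le x y : `|dotp x y| <= enorm x * enorm y.
Proof.
rewrite -(@ler_pXn2r _ 2)// ?nnegrE ?mulr_ge0 ?enorm_ge0//.
by rewrite exprMn !sqr_enorm real_normK ?num_real// dotp_sqr_le.
Qed.

Lemma enormD x y : enorm (x + y) <= enorm x + enorm y.
Proof.
rewrite -(@ler_pXn2r _ 2)// ?nnegrE ?addr_ge0 ?enorm_ge0//.
have := dotp_le x y; have := ler_norm (dotp x y).
rewrite sqrrD !sqr_enorm dotpDl !dotpDr (dotpC y x); lra.
Qed.

(** Submultiplicative under addition ([brkD]), so a translation changes its powers only by a
    constant factor; unlike the norm, it keeps decay profiles finite at the origin. *)
Definition brk x : R := 1 + enorm x.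

Lemma brk_ge1 x : 1 <= brk x. Proof. by rewrite lerDl enorm_ge0. Qed.

Lemma brk_gt0 x : 0 < brk x. Proof. exact: lt_le_trans (brk_ge1 x). Qed.

Lemma brkN x : brk (- x) = brk x. Proof. by rewrite /brk enormN. Qed.

Lemma brkD x y : brk (x + y) <= brk x * brk y.
Proof.
have := enormD x y; have := mulr_ge0 (enorm_ge0 x) (enorm_ge0 y).
rewrite /brk; lra.
Qed.

Lemma measurable_brk : meas brk.
Proof. by apply: measurable_funD => //; exact: measurable_enorm. Qed.

End geometry.

Section measurable_maps.
Context {R : realType} {d : nat}.

Lemma measurable_funD_rV d1 (T : measurableType d1) (f g : T -> 'rV[R]_d) :
  meas f -> meas g ->
  meas (fun t => f t + g t).
Proof.
move=> mf mg; apply: measurable_fun_rV => i.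
under eq_fun do rewrite mxE.
by apply: measurable_funD; exact: mcomp (measurable_coord_rV i) _.
Qed.

Lemma measurable_funN_rV d1 (T : measurableType d1) (f : T -> 'rV[R]_d) :
  meas f -> meas (fun t => - f t).
Proof.
by move=> mf; exact: mcomp (@measurable_opp_rV R d) mf.
Qed.

Lemma measurable_funB_rV d1 (T : measurableType d1) (f g : T -> 'rV[R]_d) :
  meas f -> meas g ->
  meas (fun t => f t - g t).
Proof.
by move=> mf mg; apply: measurable_funD_rV => //; exact: measurable_funN_rV.
Qed.

Lemma measurable_funZ_rV d1 (T : measurableType d1) (c : T -> R)
    (f : T -> 'rV[R]_d) :
  meas c -> meas f ->
  meas (fun t => c t *: f t).
Proof.
move=> mc mf; apply: measurable_fun_rV => i.
under eq_fun do rewrite mxE.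
by apply: mmul => //; exact: mcomp (measurable_coord_rV i) _.
Qed.

Lemma measurable_fun_dotp d1 (T : measurableType d1) (f g : T -> 'rV[R]_d) :
  meas f -> meas g ->
  meas (fun t => dotp (f t) (g t)).
Proof.
move=> mf mg; apply: measurable_sum => i.
by apply: mmul; exact: mcomp (measurable_coord_rV i) _.
Qed.

End measurable_maps.

(** * Affine changes of variables for the product Lebesgue measure *)

Section change_of_variables.
Context {R : realType}.
Local Open Scope ereal_scope.
Local Notation leb := (@lebesgue_measure R).

(** Uniqueness of Lebesgue measure: the rescaled image measure agrees with it on half-open
    intervals. *)
Lemma lebesgue_measure_affine (c a : R) (A : set (measurableTypeR R)) :
  (0 < c)%R -> measurable A ->
  c%:E * leb [set t | A (c * t + a)%R] = leb A.
Proof.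
move=> c0 mA.
pose g : measurableTypeR R -> measurableTypeR R := fun t => (c * t + a)%R.
have mg : meas g.
  by apply: measurable_funD => //; apply: mmul.
pose nu : {measure set (measurableTypeR R) -> \bar R} := pushforward leb g.
pose c' : {nonneg R} := NngNum (ltW c0).
apply/esym; have -> := @lebesgue_measure_unique R (mscale c' (nu mg)) _ A mA => //.
move=> _ [[u v]] _ <- /=; rewrite /mscale/= /nu /pushforward.
rewrite (_ : g @^-1` _ = `](u - a) / c, (v - a) / c]%classic)%R; last first.
  apply/seteqP; split => t /=; rewrite !in_itv/= /g => /andP[].
  - by move=> ? ?; rewrite ltr_pdivrMr// ler_pdivlMr//; apply/andP; split; lra.
  - by rewrite ltr_pdivrMr// ler_pdivlMr// => ? ?; apply/andP; split; lra.
rewrite !lebesgue_measure_itv/= !lte_fin.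
have -> : ((u - a) / c < (v - a) / c)%R = (u < v)%R.
  by rewrite ltr_pM2r ?invr_gt0// ltrD2r.
case: ifPn => uv; last by rewrite mule0.
by rewrite -!EFinB -EFinM; congr EFin; field; rewrite gt_eqF.
Qed.

Lemma ge0_integral_affine1 (c a : R) (f : R -> \bar R) :
  (0 < c)%R -> meas f -> (forall t, 0 <= f t) ->
  c%:E * \int[leb]_t f (c * t + a)%R = \int[leb]_t f t.
Proof.
move=> c0 mf f0.
pose g : measurableTypeR R -> measurableTypeR R := fun t => (c * t + a)%R.
have mg : meas g.
  by apply: measurable_funD => //; apply: mmul.
pose nu : {measure set (measurableTypeR R) -> \bar R} := pushforward leb g.
pose c' : {nonneg R} := NngNum (ltW c0).
rewrite [RHS](@eq_measure_integral _ (measurableTypeR R) _ _ (mscale c' (nu mg))); last first.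
  by move=> A mA _; exact: (esym (lebesgue_measure_affine a c0 mA)).
rewrite ge0_integral_mscale//= ge0_integral_pushforward//.
Qed.

Lemma ge0_integral_rVS n (f : 'rV[R]_n.+1 -> \bar R) :
  meas f -> (forall x, 0 <= f x) ->
  \int[lebesgue_rV n.+1]_x f x =
  \int[leb]_a \int[lebesgue_rV n]_x f (cons_rV (a, x)).
Proof.
move=> mf f0; rewrite /= /lebesgue_step ge0_integral_pushforward//.
rewrite preimage_setT fubini_tonelli1//=.
by apply: mcomp => //; exact: measurable_cons_rV.
Qed.

Lemma cons_rV_affine n (c : R) (u : 'rV[R]_n.+1) (p : measurableTypeR R * 'rV[R]_n) :
  (c *: cons_rV p + u = cons_rV ((c * p.1 + (uncons_rV u).1 : measurableTypeR R),
    c *: p.2 + (uncons_rV u).2))%R.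
Proof.
apply/rowP => i; rewrite [LHS]mxE [X in (X + _)%R]mxE.
by have [j ->|->] := unliftP ord0 i; rewrite ?cons_rVS ?cons_rV0 //= !mxE.
Qed.

(** Induction on the dimension: Tonelli peels off the first coordinate, on which the one-dimensional
    rule applies, and each coordinate contributes one factor [c]. *)
Lemma ge0_integral_affine n (c : R) (u : 'rV[R]_n) (f : 'rV[R]_n -> \bar R) :
  (0 < c)%R -> meas f -> (forall x, 0 <= f x) ->
  (c ^+ n)%:E * \int[lebesgue_rV n]_x f (c *: x + u)%R = \int[lebesgue_rV n]_x f x.
Proof.
move=> c0; elim: n u f => [|n IH] u f mf f0.
  rewrite expr0 mul1e; apply: eq_integral => x _; congr f.
  by apply/rowP; case.
have maff : meas (fun x : 'rV[R]_n.+1 => c *: x + u)%R.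
  by apply: measurable_funD_rV => //; apply: measurable_funZ_rV.
have mcons : meas (fun p => f (@cons_rV R n p)).
  by apply: mcomp => //; exact: measurable_cons_rV.
have mF : meas (fun a : measurableTypeR R =>
    \int[lebesgue_rV n]_x f (cons_rV (a, x))).
  exact: (@measurable_fun_fubini_tonelli_F _ _ _ _ _ (lebesgue_rV n) _ mcons).
rewrite [RHS]ge0_integral_rVS// ge0_integral_rVS//; last exact: mcomp.
rewrite -[RHS](ge0_integral_affine1 (uncons_rV u).1 c0 mF); last first.
  by move=> t; exact: integral_ge0.
rewrite exprS EFinM -muleA; congr (_ * _).
rewrite -ge0_integralZl//=; last 3 first.
- apply: (@measurable_fun_fubini_tonelli_F _ _ _ _ _ (lebesgue_rV n) (fun p => f (c *: cons_rV p + u)%R)) => //.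
  apply: mcomp => //; apply: measurable_funD_rV => //.
  by apply: measurable_funZ_rV => //; exact: measurable_cons_rV.
- by move=> t _; exact: integral_ge0.
- by rewrite lee_fin exprn_ge0// ltW.
apply: eq_integral => a _.
under eq_integral do rewrite cons_rV_affine.
rewrite -[RHS](IH (uncons_rV u).2)//.
by apply: (mcomp mcons); exact: measurable_pair1.
Qed.

Lemma ge0_integralN_rV n (f : 'rV[R]_n -> \bar R) :
  meas f -> (forall x, 0 <= f x) ->
  \int[lebesgue_rV n]_x f (- x)%R = \int[lebesgue_rV n]_x f x.
Proof.
move=> mf f0; have mN := @measurable_opp_rV R n.
pose nu : {measure set 'rV[R]_n -> \bar R} :=
  pushforward (lebesgue_rV n) (-%R : 'rV[R]_n -> 'rV[R]_n).
rewrite [RHS](eq_measure_integral (nu mN)); last first.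
  by move=> A mA _; rewrite -[LHS]lebesgue_rVN.
by rewrite ge0_integral_pushforward.
Qed.

End change_of_variables.

Notation intg mu f := (integrable mu setT (EFin \o f)).

(** * Real-valued integrals, Fubini, and transfer along maps *)

Section real_integrals.
Context {disp : measure_display} {T : measurableType disp} {R : realType}.
Variable mu : {measure set T -> \bar R}.
Implicit Types (f g : T -> R).

Lemma intg_meas f : intg mu f -> meas f.
Proof. by move=> /measurable_int/measurable_EFinP. Qed.

Lemma intgP f : meas f -> (\int[mu]_x `|f x|%:E < +oo)%E ->
  intg mu f.
Proof. by move=> mf fi; apply/integrableP; split => //; exact/measurable_EFinP. Qed.

Lemma intg_lty f : intg mu f -> (\int[mu]_x `|f x|%:E < +oo)%E.
Proof. by move=> /integrableP[]. Qed.

Lemma intg_ltyr f : intg mu f -> (\int[mu]_x (f x)%:E < +oo)%E.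
Proof. exact: integrable_lty. Qed.

Lemma intg_le f g : meas f -> (forall x, `|f x| <= g x) ->
  intg mu g -> intg mu f.
Proof.
move=> mf fg; apply: le_integrable => //; first exact/measurable_EFinP.
by move=> x _; rewrite /= lee_fin (le_trans (fg x))// ler_norm.
Qed.

Lemma intgD f g : intg mu f -> intg mu g -> intg mu (fun x => f x + g x).
Proof. exact: integrableD. Qed.

Lemma intgB f g : intg mu f -> intg mu g -> intg mu (fun x => f x - g x).
Proof. exact: integrableB. Qed.

Lemma intgN f : intg mu f -> intg mu (fun x => - f x).
Proof. exact: integrableN. Qed.

Lemma intgZl (c : R) f : intg mu f -> intg mu (fun x => c * f x).
Proof. exact: integrableZl. Qed.

Lemma intgZr (c : R) f : intg mu f -> intg mu (fun x => f x * c).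
Proof. by move=> /(intgZl c); under eq_fun do rewrite mulrC. Qed.

Lemma intg_norm f : intg mu f -> intg mu (fun x => `|f x|).
Proof. exact: integrable_norm. Qed.

Lemma intg0 : intg mu (fun=> 0).
Proof. exact: integrable0. Qed.

Lemma intgMl (M : R) f g : meas f -> (forall x, `|f x| <= M) ->
  intg mu g -> intg mu (fun x => f x * g x).
Proof.
move=> mf fM ig.
have iMg : intg mu (fun x => M * `|g x|) by exact/intgZl/intg_norm.
apply: intg_le iMg; first exact/mmul/intg_meas.
by move=> x; rewrite normrM ler_wpM2r.
Qed.

Lemma intgMr (M : R) f g : meas g -> (forall x, `|g x| <= M) ->
  intg mu f -> intg mu (fun x => f x * g x).
Proof.
by move=> mg gM fi; under eq_fun do rewrite mulrC; exact: intgMl mg gM fi.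
Qed.

Lemma intg_sum (I : Type) (s : seq I) (f : I -> T -> R) :
  (forall i, intg mu (f i)) -> intg mu (fun x => \sum_(i <- s) f i x).
Proof.
move=> fi; elim: s => [|i s IH].
  by under eq_fun do rewrite big_nil; exact: intg0.
by under eq_fun do rewrite big_cons; exact: intgD.
Qed.

Lemma RintD f g : intg mu f -> intg mu g ->
  \int[mu]_x (f x + g x) = \int[mu]_x f x + \int[mu]_x g x.
Proof. exact: RintegralD. Qed.

Lemma RintB f g : intg mu f -> intg mu g ->
  \int[mu]_x (f x - g x) = \int[mu]_x f x - \int[mu]_x g x.
Proof. exact: RintegralB. Qed.

Lemma RintZl c f : intg mu f -> \int[mu]_x (c * f x) = c * \int[mu]_x f x.
Proof. exact: RintegralZl. Qed.

Lemma RintZr c f : intg mu f -> \int[mu]_x (f x * c) = (\int[mu]_x f x) * c.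
Proof. exact: RintegralZr. Qed.

Lemma RintN f : intg mu f -> \int[mu]_x (- f x) = - \int[mu]_x f x.
Proof.
move=> fi; rewrite -mulN1r -RintZl//; congr Rintegral.
by apply/funext => x; rewrite mulN1r.
Qed.

Lemma Rint0 : \int[mu]_x (0 : R) = 0.
Proof. by rewrite /Rintegral integral0. Qed.

Lemma Rint_sum (I : Type) (s : seq I) (f : I -> T -> R) :
  (forall i, intg mu (f i)) ->
  \int[mu]_x (\sum_(i <- s) f i x) = \sum_(i <- s) \int[mu]_x f i x.
Proof.
move=> fi; elim: s => [|i s IH].
  by rewrite big_nil; under eq_Rintegral do rewrite big_nil; rewrite Rint0.
rewrite big_cons -IH -RintD//; last exact: intg_sum.
by apply: eq_Rintegral => x _; rewrite big_cons.
Qed.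

Lemma le_Rint f g : intg mu f -> intg mu g -> (forall x, f x <= g x) ->
  \int[mu]_x f x <= \int[mu]_x g x.
Proof. by move=> fi gi fg; exact: le_Rintegral. Qed.

Lemma Rint_ge0 f : (forall x, 0 <= f x) -> 0 <= \int[mu]_x f x.
Proof. by move=> f0; exact: Rintegral_ge0. Qed.

Lemma EFin_Rint f : intg mu f ->
  (\int[mu]_x f x)%:E = (\int[mu]_x (f x)%:E)%E.
Proof. by move=> fi; rewrite /Rintegral fineK// integrable_fin_num. Qed.

Lemma le_norm_Rint f : intg mu f -> `|\int[mu]_x f x| <= \int[mu]_x `|f x|.
Proof. by move=> fi; exact: le_normr_Rintegral. Qed.

(** If [f] is not integrable the left side is a default value while the right side is [+oo].
    Absolute bounds on convolutions can therefore be derived first, and integrability read off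
    afterwards. *)
Lemma le_norm_Rinte f : meas f ->
  (`|\int[mu]_x f x|%:E <= \int[mu]_x `|f x|%:E)%E.
Proof.
move=> mf; have [fi|fi] := boolP (intg mu f).
  by rewrite EFin_normr_Rintegral//; apply: le_abse_integral => //; exact/measurable_EFinP.
suff -> : (\int[mu]_x `|f x|%:E = +oo)%E by rewrite leey.
apply/eqP; rewrite -leye_eq leNgt; apply/negP => H.
by move/negP: fi; apply; exact: intgP.
Qed.

Lemma le_inte f g : meas f -> meas g ->
  (forall x, 0 <= f x) -> (forall x, f x <= g x) ->
  (\int[mu]_x (f x)%:E <= \int[mu]_x (g x)%:E)%E.
Proof.
move=> mf mg f0 fg; apply: ge0_le_integral => //.
- by move=> x _; rewrite lee_fin.
- exact/measurable_EFinP.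
- exact/measurable_EFinP.
- by move=> x _; rewrite lee_fin.
Qed.

Lemma inte_ge0 f : (forall x, 0 <= f x) -> (0 <= \int[mu]_x (f x)%:E)%E.
Proof. by move=> f0; apply: integral_ge0 => x _; rewrite lee_fin. Qed.

Lemma inteD f g : meas f -> meas g ->
  (forall x, 0 <= f x) -> (forall x, 0 <= g x) ->
  (\int[mu]_x (f x + g x)%:E = \int[mu]_x (f x)%:E + \int[mu]_x (g x)%:E)%E.
Proof.
move=> mf mg f0 g0; rewrite -ge0_integralD//.
- by move=> x _; rewrite lee_fin.
- exact/measurable_EFinP.
- by move=> x _; rewrite lee_fin.
- exact/measurable_EFinP.
Qed.

Lemma inteZl (c : R) f : meas f -> (forall x, 0 <= f x) ->
  0 <= c -> (\int[mu]_x (c * f x)%:E = c%:E * \int[mu]_x (f x)%:E)%E.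
Proof.
move=> mf f0 c0; rewrite -ge0_integralZl//.
- exact/measurable_EFinP.
- by move=> x _; rewrite lee_fin.
Qed.

Lemma dct (f_ : nat -> T -> R) f g :
  (forall n, meas (f_ n)) ->
  (forall x, f_ n x @[n --> \oo] --> f x) -> intg mu g ->
  (forall n x, `|f_ n x| <= g x) ->
  [/\ intg mu f, \int[mu]_x `|f_ n x - f x| @[n --> \oo] --> (0 : R) &
      \int[mu]_x f_ n x @[n --> \oo] --> \int[mu]_x f x].
Proof.
move=> mf_ ff ig fg.
have mf : meas f by apply: (measurable_fun_cvg mf_) => x _; exact: ff.
have ff' x : (f_ n x)%:E @[n --> \oo] --> (f x)%:E.
  by apply: cvg_EFin; [near=> n | exact: ff].
have [fi h0 h1] := @dominated_convergence _ _ _ mu _ measurableT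
    (fun n => EFin \o f_ n) (EFin \o f) (EFin \o g)
    (fun n => (measurable_EFinP _ _).2 (mf_ n)) ((measurable_EFinP _ _).2 mf)
    (aeW _ (fun x _ => ff' x)) ig (aeW _ (fun x n _ => fg n x)).
split => //; apply: fine_cvg.
- exact: h0.
- by rewrite EFin_Rint//; exact: h1.
Unshelve. all: by end_near. Qed.

Lemma integral_fineK (F : T -> \bar R) : mu.-integrable setT F ->
  (\int[mu]_x (fine (F x))%:E = \int[mu]_x F x)%E.
Proof.
move=> Fi; have mF := measurable_int _ Fi.
apply: ae_eq_integral => //; first exact/measurable_EFinP/mcomp.
by apply: filterS (integrable_ae measurableT Fi) => x /= Fx _; rewrite fineK// Fx.
Qed.

Lemma integrable_fineK (F : T -> \bar R) : mu.-integrable setT F ->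
  intg mu (fine \o F).
Proof.
move=> Fi; have mF := measurable_int _ Fi.
have mf : meas (fine \o F) by exact: mcomp.
apply: intgP => //; apply: le_lt_trans (integrableP _ _ _ Fi).2.
apply: ge0_le_integral => //; first exact/measurable_EFinP/mcomp.
  exact: mcomp.
by move=> x _ /=; case: (F x) => //=; rewrite normr0 leey.
Qed.

Lemma ae_eq_inte f g : meas f -> meas g ->
  {ae mu, forall x, f x = g x} ->
  (\int[mu]_x (f x)%:E = \int[mu]_x (g x)%:E)%E.
Proof.
move=> mf mg fg; apply: ae_eq_integral => //; try exact/measurable_EFinP.
by apply: filterS fg => x /= -> _.
Qed.

Lemma ae_eq_Rint f g : meas f -> meas g ->
  {ae mu, forall x, f x = g x} -> \int[mu]_x f x = \int[mu]_x g x.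
Proof. by move=> mf mg fg; congr fine; exact: ae_eq_inte. Qed.

Lemma ae_le_inte f g : meas f -> meas g ->
  (forall x, 0 <= f x) -> (forall x, 0 <= g x) ->
  {ae mu, forall x, f x <= g x} ->
  (\int[mu]_x (f x)%:E <= \int[mu]_x (g x)%:E)%E.
Proof.
move=> mf mg f0 g0 fg; apply: ae_ge0_le_integral => //; try exact/measurable_EFinP.
- by move=> x _; rewrite lee_fin.
- by move=> x _; rewrite lee_fin.
- by apply: filterS fg => x /= + _; rewrite lee_fin.
Qed.

Lemma ae_intg f g : meas g -> {ae mu, forall x, f x = g x} ->
  intg mu f -> intg mu g.
Proof.
move=> mg fg fi; apply: intgP => //.
rewrite -(@ae_eq_inte (fun x => `|f x|)); first exact: intg_lty.
- by apply: mcomp => //; exact: intg_meas.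
- exact: mcomp.
- by apply: filterS fg => x ->.
Qed.

Lemma ae_le_Rint f g : intg mu f -> intg mu g ->
  {ae mu, forall x, f x <= g x} -> \int[mu]_x f x <= \int[mu]_x g x.
Proof.
move=> fi gi fg; have mf := intg_meas fi; have mg := intg_meas gi.
rewrite -subr_ge0 -RintB// (@ae_eq_Rint _ (fun x => Num.max (g x - f x) 0)).
- by apply: Rint_ge0 => x; rewrite le_max lexx orbT.
- exact: measurable_funB.
- by apply: measurable_maxr => //; exact: measurable_funB.
- by apply: filterS fg => x fgx; rewrite max_l// subr_ge0.
Qed.

Lemma inte_eq0 f : meas f -> (forall x, 0 <= f x) ->
  (\int[mu]_x (f x)%:E = 0)%E -> {ae mu, forall x, f x = 0}.
Proof.
move=> mf f0 If; have mfE : meas (EFin \o f) by exact/measurable_EFinP.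
have := (ae_eq_integral_abs mu measurableT mfE).1; rewrite /=.
under eq_integral do rewrite /= ger0_norm//.
by move=> /(_ If); apply: filterS => x /(_ I)[].
Qed.

End real_integrals.

Section real_fubini.
Context d1 d2 (T1 : measurableType d1) (T2 : measurableType d2) (R : realType).
Variables (m1 : {sigma_finite_measure set T1 -> \bar R})
  (m2 : {sigma_finite_measure set T2 -> \bar R}).
Implicit Types f : T1 -> T2 -> R.

Lemma measurable_uncurry1 f x : meas (uncurry f) ->
  meas (f x).
Proof. by move=> mf; exact: (mcomp mf (measurable_pair1 x)). Qed.

Lemma measurable_uncurry2 f y : meas (uncurry f) ->
  meas (f^~ y).
Proof. by move=> mf; exact: (mcomp mf (measurable_pair2 y)). Qed.

Lemma tonelli f : meas (uncurry f) -> (forall x y, 0 <= f x y) ->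
  (\int[m1]_x \int[m2]_y (f x y)%:E = \int[m2]_y \int[m1]_x (f x y)%:E)%E.
Proof.
move=> mf f0.
apply: (@fubini_tonelli _ _ _ _ _ m1 m2 (EFin \o uncurry f)).
  exact/measurable_EFinP.
by case=> x y; rewrite /= lee_fin; exact: f0.
Qed.

Lemma measurable_inte f : meas (uncurry f) ->
  (forall x y, 0 <= f x y) ->
  meas (fun x => \int[m2]_y (f x y)%:E)%E.
Proof.
move=> mf f0.
apply: (@measurable_fun_fubini_tonelli_F _ _ _ _ _ m2 (EFin \o uncurry f)).
  exact/measurable_EFinP.
by case=> x y; rewrite /= lee_fin; exact: f0.
Qed.

Lemma measurable_Rint f : meas (uncurry f) ->
  meas (fun x => \int[m2]_y f x y).
Proof.
move=> mf; apply: mcomp => //.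
have mfE : meas (EFin \o uncurry f) by exact/measurable_EFinP.
under eq_fun do rewrite integralE.
apply: emeasurable_funB.
- rewrite [X in measurable_fun _ X](_ : _ = fubini_F m2 ((EFin \o uncurry f)^\+)%E).
    by apply: measurable_fun_fubini_tonelli_F => //; exact: measurable_funepos.
  by apply/funext => x; apply: eq_integral => y _; rewrite !funeposE.
- rewrite [X in measurable_fun _ X](_ : _ = fubini_F m2 ((EFin \o uncurry f)^\-)%E).
    by apply: measurable_fun_fubini_tonelli_F => //; exact: measurable_funeneg.
  by apply/funext => x; apply: eq_integral => y _; rewrite !funenegE.
Qed.

Lemma intg_prod f : meas (uncurry f) ->
  (\int[m1]_x \int[m2]_y `|f x y|%:E < +oo)%E -> intg (m1 \x m2)%E (uncurry f).
Proof.
move=> mf foo; apply/integrable12ltyP => //; exact/measurable_EFinP.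
Qed.

Lemma Rfubini1 f : intg (m1 \x m2)%E (uncurry f) ->
  \int[m1]_x \int[m2]_y f x y = \int[(m1 \x m2)%E]_p f p.1 p.2.
Proof.
move=> fi; rewrite /Rintegral integral_fineK; last first.
  exact: (integrable_fubini_F fi).
congr fine; rewrite (integral12_prod_meas1 fi).
by apply: eq_integral => -[].
Qed.

Lemma integrable_fubini2 f : intg (m1 \x m2)%E (uncurry f) ->
  m2.-integrable setT (fun y => \int[m1]_x (f x y)%:E)%E.
Proof.
move=> fi; have mf := intg_meas fi; apply/integrableP; split.
  exact: (measurable_fubini_G fi).
have := (integrable21ltyP m1 m2 ((measurable_EFinP _ _).2 mf)).1 fi.
apply: le_lt_trans; apply: ge0_le_integral => //.
- exact: (mcomp _ (measurable_fubini_G fi)).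
- apply: (@measurable_fun_fubini_tonelli_G _ _ _ _ _ m1
    (fun z => `|(EFin \o uncurry f) z|)%E) => //.
  by apply: mcomp => //; exact/measurable_EFinP.
- move=> y _; apply: le_abse_integral => //.
  by apply/measurable_EFinP; exact: measurable_uncurry2.
Qed.

Lemma Rfubini2 f : intg (m1 \x m2)%E (uncurry f) ->
  \int[m2]_y \int[m1]_x f x y = \int[(m1 \x m2)%E]_p f p.1 p.2.
Proof.
move=> fi; rewrite /Rintegral integral_fineK; last first.
  exact: integrable_fubini2.
congr fine; rewrite (integral21_prod_meas1 fi).
by apply: eq_integral => -[].
Qed.

Lemma Rfubini f : intg (m1 \x m2)%E (uncurry f) ->
  \int[m1]_x \int[m2]_y f x y = \int[m2]_y \int[m1]_x f x y.
Proof. by move=> fi; rewrite Rfubini1// Rfubini2. Qed.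

Lemma intg_fubiniF f : intg (m1 \x m2)%E (uncurry f) ->
  intg m1 (fun x => \int[m2]_y f x y).
Proof. by move=> fi; exact/integrable_fineK/(integrable_fubini_F fi). Qed.

Lemma intg_fubiniG f : intg (m1 \x m2)%E (uncurry f) ->
  intg m2 (fun y => \int[m1]_x f x y).
Proof. by move=> fi; exact/integrable_fineK/integrable_fubini2. Qed.

End real_fubini.

Section transfer.
Context {disp : measure_display} {T : measurableType disp} {R : realType}.
Variables (mu : {measure set T -> \bar R}) (phi : T -> T) (c : R).
Hypothesis c0 : 0 < c.
Hypothesis mphi : meas phi.
Hypothesis phiE : forall f : T -> \bar R, meas f ->
  (forall x, 0 <= f x)%E -> (c%:E * \int[mu]_x f (phi x) = \int[mu]_x f x)%E.

Lemma intg_transfer (f : T -> R) : intg mu f -> intg mu (f \o phi).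
Proof.
move=> fi; have mf := intg_meas fi; apply: intgP; first exact: mcomp.
have := intg_lty fi; rewrite -phiE//; last first.
  by apply/measurable_EFinP; exact: mcomp.
rewrite !ltey; apply: contra_neq => H.
by rewrite [X in (_ * X)%E]H gt0_muley// lte_fin.
Qed.

(** When [f] is not integrable both sides are the default value 0: multiplying the positive and
    negative parts by [c > 0] does not change which of them are infinite. *)
Lemma Rint_transfer (f : T -> R) : meas f ->
  c * \int[mu]_x f (phi x) = \int[mu]_x f x.
Proof.
move=> mf; rewrite /Rintegral [in LHS]integralE [in RHS]integralE.
have mfE : meas (EFin \o f) by exact/measurable_EFinP.
rewrite -(phiE (measurable_funepos mfE))// -(phiE (measurable_funeneg mfE))//.
have -> : ((fun x => (f (phi x))%:E)^\+ = fun x => (EFin \o f)^\+ (phi x))%E.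
  by apply/funext => x; rewrite !funeposE.
have -> : ((fun x => (f (phi x))%:E)^\- = fun x => (EFin \o f)^\- (phi x))%E.
  by apply/funext => x; rewrite !funenegE.
move: (integral _ _ (fun x => ((EFin \o f)^\+ (phi x))%E)) => a.
move: (integral _ _ (fun x => ((EFin \o f)^\- (phi x))%E)) => b.
have cE : (0 < c%:E)%E by rewrite lte_fin.
case: a b => [a| |] [b| |] //=; rewrite ?gt0_muley ?gt0_muleNy//= ?mulr0//.
by rewrite mulrBr.
Qed.

End transfer.

Section integrals_rV.
Context {R : realType} {d : nat}.
Local Notation mu := (@lebesgue_rV R d).
Implicit Types (f : 'rV[R]_d -> R) (u x : 'rV[R]_d).

Lemma measurable_affine_rV (c : R) u :
  meas (fun x : 'rV[R]_d => c *: x + u).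
Proof. by apply: measurable_funD_rV => //; exact: measurable_funZ_rV. Qed.

Lemma inte_affine (c : R) u f : 0 < c -> meas f ->
  (forall x, 0 <= f x) ->
  ((c ^+ d)%:E * \int[mu]_x (f (c *: x + u))%:E = \int[mu]_x (f x)%:E)%E.
Proof.
move=> c0 mf f0; apply: (@ge0_integral_affine R d c u (EFin \o f)) => //.
exact/measurable_EFinP.
Qed.

Lemma Rint_affine (c : R) u f : 0 < c -> meas f ->
  c ^+ d * \int[mu]_x f (c *: x + u) = \int[mu]_x f x.
Proof.
move=> c0; apply: Rint_transfer; first exact: exprn_gt0.
by move=> g mg g0; exact: ge0_integral_affine.
Qed.

Lemma intg_affine (c : R) u f : 0 < c -> intg mu f ->
  intg mu (fun x => f (c *: x + u)).
Proof.
move=> c0; apply: (@intg_transfer _ _ _ mu (fun x => c *: x + u) (c ^+ d)).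
- exact: exprn_gt0.
- exact: measurable_affine_rV.
- by move=> g mg g0; exact: ge0_integral_affine.
Qed.

Lemma RintN_rV f : meas f ->
  \int[mu]_x f (- x) = \int[mu]_x f x.
Proof.
rewrite -[LHS]mul1r; apply: (@Rint_transfer _ _ _ mu -%R) => //.
by move=> g mg g0; rewrite mul1e; exact: ge0_integralN_rV.
Qed.

Lemma intgN_rV f : intg mu f -> intg mu (fun x => f (- x)).
Proof.
apply: (@intg_transfer _ _ _ mu (-%R : 'rV[R]_d -> 'rV[R]_d) 1 ltr01).
  exact: measurable_opp_rV.
by move=> g mg g0; rewrite mul1e; exact: ge0_integralN_rV.
Qed.

Lemma inte_shift u f : meas f -> (forall x, 0 <= f x) ->
  (\int[mu]_x (f (x + u))%:E = \int[mu]_x (f x)%:E)%E.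
Proof.
move=> mf f0; rewrite -(@inte_affine 1 u f)// expr1n mul1e.
by under [RHS]eq_integral do rewrite scale1r.
Qed.

Lemma Rint_shift u f : meas f ->
  \int[mu]_x f (x + u) = \int[mu]_x f x.
Proof.
move=> mf; rewrite -(@Rint_affine 1 u f)// expr1n mul1r.
by under [RHS]eq_Rintegral do rewrite scale1r.
Qed.

Lemma intg_shift u f : intg mu f -> intg mu (fun x => f (x + u)).
Proof.
move=> /(@intg_affine 1 u _ ltr01).
by under eq_fun do rewrite scale1r.
Qed.

Lemma inte_sub u f : meas f -> (forall x, 0 <= f x) ->
  (\int[mu]_x (f (u - x))%:E = \int[mu]_x (f x)%:E)%E.
Proof.
move=> mf f0; rewrite -[RHS](inte_shift u)//.
rewrite -[RHS]ge0_integralN_rV.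
- by apply: eq_integral => x _; rewrite addrC.
- apply/measurable_EFinP; apply: mcomp mf _.
  exact: measurable_funD_rV.
- by move=> x; rewrite lee_fin.
Qed.

Lemma measurable_shift_rV u : meas (fun x : 'rV[R]_d => x + u).
Proof. exact: measurable_funD_rV. Qed.

Lemma measurable_sub_rV u : meas (fun x : 'rV[R]_d => u - x).
Proof. exact: measurable_funB_rV. Qed.

Lemma Rint_sub u f : meas f ->
  \int[mu]_x f (u - x) = \int[mu]_x f x.
Proof.
move=> mf; rewrite -[RHS](Rint_shift u)// -[RHS]RintN_rV.
  by apply: eq_Rintegral => x _; rewrite addrC.
exact: mcomp (measurable_shift_rV u).
Qed.

Lemma intg_sub u f : intg mu f -> intg mu (fun x => f (u - x)).
Proof.
move=> /(intg_shift u)/intgN_rV.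
by under eq_fun do rewrite addrC.
Qed.

End integrals_rV.

Lemma is_derive_Rint {R : realType} {disp} {Y : measurableType disp}
    (mu : {measure set Y -> \bar R}) (f f' : R -> Y -> R) (G : Y -> R) (a u v : R) :
  u < a < v ->
  (forall x, u < x < v -> intg mu (f x)) ->
  (forall x y, u < x < v -> is_derive x (1 : R) (f ^~ y) (f' x y)) ->
  intg mu G -> (forall x y, u < x < v -> `|f' x y| <= G y) ->
  is_derive a (1 : R) (fun x => \int[mu]_y f x y) (\int[mu]_y f' a y).
Proof.
move=> auv fi df Gi fG.
have itvP x : `]u, v[%classic x -> u < x < v by rewrite /= in_itv.
have auv' : `]u, v[%classic a by rewrite /= in_itv.
have pE x y : u < x < v -> partial1of2 f x y = f' x y.
  by move=> xuv; rewrite partial1of2E; have [_ ->] := df x y xuv.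
have der x y : `]u, v[%classic x -> setT y -> derivable (f^~ y) x 1.
  by move=> /itvP xuv _; have [] := df x y xuv.
have G0 y : 0 <= G y by apply: le_trans (fG a y auv).
have bd x y : `]u, v[%classic x -> setT y -> `|partial1of2 f x y| <= G y.
  by move=> /itvP xuv _; rewrite pE//; exact: fG.
have fi' x : `]u, v[%classic x -> intg mu (f x) by move=> /itvP; exact: fi.
apply: DeriveDef.
  exact: (derivable_under_integral measurableT auv' fi' der G0 Gi bd).
rewrite -derive1E (differentiation_under_integral measurableT auv' fi' der G0 Gi bd).
by apply: eq_Rintegral => y _; exact: pE.
Qed.

(** * Fourier transform of the Gaussian on the line *)

Section gaussian_1d.
Context {R : realType}.
Local Notation leb := (@lebesgue_measure R).
Implicit Types (s x t : R).

Lemma measurable_gauss s : meas (fun x : R => expR (- (s * x ^+ 2))).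
Proof.
apply: mcomp => //; apply: mcomp => //.
by apply: mmul => //; exact: measurable_funX.
Qed.

Lemma inte_gauss s : 0 < s ->
  (\int[leb]_x (expR (- (s * x ^+ 2)))%:E = (Num.sqrt (pi / s))%:E)%E.
Proof.
move=> s0; have rs0 : 0 < Num.sqrt s by rewrite sqrtr_gt0.
have := @ge0_integral_affine1 R (Num.sqrt s) 0 (EFin \o @gauss_fun R) rs0.
move=> /(_ _ _)/=; rewrite [in RHS]integralT_gauss => H.
have {H}: ((Num.sqrt s)%:E * \int[leb]_x (expR (- (s * x ^+ 2)))%:E =
    (Num.sqrt pi)%:E)%E.
  rewrite -H; last 2 first.
  - apply/measurable_EFinP; have := measurable_gauss 1.
    by under eq_fun do rewrite mul1r.
  - by move=> t; rewrite lee_fin gauss_fun_ge0.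
  congr (_ * _)%E; apply: eq_integral => x _; rewrite /gauss_fun addr0.
  by rewrite exprMn sqr_sqrtr// ltW.
have : (0 <= \int[leb]_x (expR (- (s * x ^+ 2)))%:E)%E.
  by apply: integral_ge0 => x _; rewrite lee_fin expR_ge0.
case: (integral _ _ _) => [r| |]//=.
- rewrite lee_fin => r0; rewrite -EFinM => -[H]; congr EFin.
  apply: (mulfI (lt0r_neq0 rs0)); rewrite H -sqrtrM ?ltW//.
  by congr Num.sqrt; field; rewrite gt_eqF.
- by rewrite gt0_muley ?lte_fin.
Qed.

Lemma intg_gauss s : 0 < s -> intg leb (fun x => expR (- (s * x ^+ 2))).
Proof.
move=> s0; apply: intgP; first exact: measurable_gauss.
under eq_integral do rewrite (ger0_norm (expR_ge0 _)).
by rewrite inte_gauss// ltry.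
Qed.

Lemma norm_le_expR t : `|t| <= expR `|t|.
Proof. by have := expR_ge1Dx `|t|; lra. Qed.

Lemma ge0_integralN1 (f : R -> \bar R) : meas f ->
  (forall x, 0 <= f x)%E -> (\int[leb]_x f (- x)%R = \int[leb]_x f x)%E.
Proof.
move=> mf f0; have mN := @oppr_measurable R setT.
pose nu : {measure set (measurableTypeR R) -> \bar R} :=
  pushforward leb (-%R : measurableTypeR R -> measurableTypeR R).
rewrite [RHS](@eq_measure_integral _ (measurableTypeR R) _ _ (nu mN)); last first.
  by move=> A mA _; rewrite -[LHS]lebesgue_measureN.
by rewrite ge0_integral_pushforward.
Qed.

Lemma Rint_odd (f : R -> R) : meas f ->
  (forall x, f (- x) = - f x) -> intg leb f -> \int[leb]_x f x = 0.
Proof.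
move=> mf fN fi; have : \int[leb]_x f (- x) = \int[leb]_x f x.
  rewrite -[LHS]mul1r; apply: (@Rint_transfer _ _ _ leb -%R) => //.
  by move=> g mg g0; rewrite mul1e; exact: ge0_integralN1.
under eq_Rintegral do rewrite fN.
by rewrite RintN//; lra.
Qed.

Lemma is_derive_cos_affine (a c t : R) :
  is_derive t (1 : R) (fun t => cos (a + t * c)) (- (c * sin (a + t * c))).
Proof.
have H : is_derive t (1 : R) (fun t => a + t * c) c.
  rewrite [X in is_derive _ _ X _](_ : _ = cst a + (c \*: (@id R))).
    by apply: is_derive_eq; rewrite add0r /GRing.scale/= mulr1.
  by apply/funext => y; rewrite /cst/= mulrC.
have := @is_derive1_comp _ cos (fun t => a + t * c) t _ c (is_derive_cos _) H.
by rewrite mulNr mulrC.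
Qed.

Lemma is_derive_sin_affine (a c t : R) :
  is_derive t (1 : R) (fun t => sin (a + t * c)) (c * cos (a + t * c)).
Proof.
have H : is_derive t (1 : R) (fun t => a + t * c) c.
  rewrite [X in is_derive _ _ X _](_ : _ = cst a + (c \*: (@id R))).
    by apply: is_derive_eq; rewrite add0r /GRing.scale/= mulr1.
  by apply/funext => y; rewrite /cst/= mulrC.
have := @is_derive1_comp _ sin (fun t => a + t * c) t _ c (is_derive_sin _) H.
by rewrite mulrC.
Qed.

Lemma expR_gauss_bound (c x : R) :
  expR (c * `|x| - x ^+ 2) <= expR (c ^+ 2 / 2) * expR (- (2^-1 * x ^+ 2)).
Proof.
rewrite -expRD ler_expR -[x ^+ 2]real_normK ?num_real//.
have := sqr_ge0 (`|x| - c); rewrite sqrrB; lra.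
Qed.

Let F x := \int[leb]_y (cos (y * x) * expR (- y ^+ 2)).
Let S x := \int[leb]_y (y * sin (y * x) * expR (- y ^+ 2)).

Let intg_half : intg leb (fun y => expR (- (2^-1 * y ^+ 2))).
Proof. exact: intg_gauss. Qed.

Let mexp : meas (fun y : R => expR (- y ^+ 2)).
Proof.
have := @measurable_gauss 1; by under eq_fun do rewrite mul1r.
Qed.

Let mcos x : meas (fun y : R => cos (y * x)).
Proof.
apply: (mcomp measurable_cos).
exact: mmul.
Qed.

Let msin x : meas (fun y : R => sin (y * x)).
Proof.
apply: (mcomp measurable_sin).
exact: mmul.
Qed.

Let normcos t : `|cos t| <= 1 :> R.
Proof. by rewrite ler_norml cos_geN1 cos_le1. Qed.

Let normsin t : `|sin t| <= 1 :> R.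
Proof. by rewrite ler_norml sin_geN1 sin_le1. Qed.

Let ig1 : intg leb (fun y => expR (- y ^+ 2)).
Proof.
have := @intg_gauss 1 ltr01.
by rewrite (_ : (fun y => _) = fun y => expR (- y ^+ 2))//; apply/funext => y; rewrite mul1r.
Qed.

Let intg_F x : intg leb (fun y => cos (y * x) * expR (- y ^+ 2)).
Proof.
apply: (@intgMl _ _ _ _ 1 _ _ _ _ ig1) => //; exact: mcos.
Qed.

Let bnd1 (y : R) : `|y| * expR (- y ^+ 2) <= expR (1 / 2) * expR (- (2^-1 * y ^+ 2)).
Proof.
rewrite -[X in expR (X / 2)](expr1n R 2).
apply: le_trans (expR_gauss_bound 1 y).
by rewrite mul1r expRD ler_wpM2r ?expR_ge0// norm_le_expR.
Qed.

Let intg_S x : intg leb (fun y => y * sin (y * x) * expR (- y ^+ 2)).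
Proof.
apply: intg_le (intgZl (expR (1 / 2)) intg_half).
  by apply: mmul => //; apply: mmul => //; exact: msin.
move=> y; rewrite !normrM (ger0_norm (expR_ge0 _)); apply: le_trans (bnd1 y).
by rewrite ler_wpM2r ?expR_ge0// ler_piMr.
Qed.

Let dF x : is_derive x (1 : R) F (- S x).
Proof.
have -> : - S x = \int[leb]_y (- (y * sin (0 + x * y)) * expR (- y ^+ 2)).
  rewrite /S -RintN; last exact: intg_S.
  by apply: eq_Rintegral => y _; rewrite add0r (mulrC x) mulNr.
have -> : F = fun x => \int[leb]_y (cos (0 + x * y) * expR (- y ^+ 2)).
  apply/funext => z; apply: eq_Rintegral => y _.
  by rewrite add0r (mulrC z).
apply: (@is_derive_Rint _ _ _ leb _
  (fun x y => - (y * sin (0 + x * y)) * expR (- y ^+ 2))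
  (fun y => expR (1 / 2) * expR (- (2^-1 * y ^+ 2))) x (x - 1) (x + 1)).
- by apply/andP; split; lra.
- move=> z _; have := intg_F z.
  by under eq_fun do rewrite (mulrC _ z) -[z * _]add0r.
- move=> z y _.
  have H := is_derive_cos_affine 0 y z.
  rewrite [X in is_derive _ _ X _](_ : _ =
    (expR (- y ^+ 2)) \*: (fun t => cos (0 + t * y))).
    by apply: is_derive_eq; rewrite /GRing.scale/= mulrC.
  by apply/funext => t; rewrite /GRing.scale/= mulrC.
- exact/intgZl/intg_half.
- move=> z y _; rewrite normrM normrN normrM (ger0_norm (expR_ge0 _)).
  apply: le_trans (bnd1 y).
  by rewrite ler_wpM2r ?expR_ge0// ler_piMr.
Qed.

(* Differentiating at [t = 0] the identity
   [\int sin (x (y + t)) e^{-(y + t)^2} dy = 0] plays the role of an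
   integration by parts. *)
Let SF x : x * F x = 2 * S x.
Proof.
pose f (t y : R) := sin (y * x + t * x) * expR (t * (- 2 * y)) * expR (- y ^+ 2).
pose f' (t y : R) := (x * cos (y * x + t * x) * expR (t * (- 2 * y)) +
   sin (y * x + t * x) * (- 2 * y * expR (t * (- 2 * y)))) * expR (- y ^+ 2).
(* The [3] comes from [|y| * e^(2 |y|) <= e^(3 |y|)]; completing the square then leaves half of the
   Gaussian exponent. The factor [|x| + 2] collects the two terms of [f']. *)
pose G y := (`|x| + 2) * expR (3 ^+ 2 / 2) * expR (- (2^-1 * y ^+ 2)).
have iG : intg leb G by exact/intgZl/intg_half.
have mf t : meas (f t).
  apply: mmul => //; apply: mmul.
    apply: (mcomp measurable_sin).
    by apply: measurable_funD => //; exact: mmul.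
  by apply: mcomp => //; apply: mmul => //; exact: mmul.
have ef (t y : R) : -1 < t < 1 -> expR (t * (-2 * y)) <= expR (2 * `|y|).
  move=> t1; rewrite ler_expR mulrA.
  have : `|t| <= 1 by rewrite ler_norml; lra.
  move=> /(ler_wpM2r (normr_ge0 y)); rewrite -normrM => H.
  have := ler_norm (- (t * y)); rewrite normrN; lra.
have e3 (y : R) : `|y| * expR (2 * `|y|) * expR (- y ^+ 2) <=
    expR (3 ^+ 2 / 2) * expR (- (2^-1 * y ^+ 2)).
  apply: le_trans (expR_gauss_bound 3 y).
  have -> : 3 * `|y| - y ^+ 2 = `|y| + 2 * `|y| + - y ^+ 2 by ring.
  rewrite expRD ler_wpM2r ?expR_ge0// expRD ler_wpM2r ?expR_ge0//.
  exact: norm_le_expR.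
have e2 (y : R) : expR (2 * `|y|) * expR (- y ^+ 2) <=
    expR (3 ^+ 2 / 2) * expR (- (2^-1 * y ^+ 2)).
  apply: le_trans (expR_gauss_bound 3 y).
  by rewrite -expRD ler_expR; have := normr_ge0 y; lra.
have ifn t : -1 < t < 1 -> intg leb (f t).
  move=> t1; apply: intg_le iG; first exact: mf.
  move=> y.
  rewrite /f /G !normrM !(ger0_norm (expR_ge0 _)).
  apply: (@le_trans _ _ (1 * (expR (2 * `|y|) * expR (- y ^+ 2)))).
    rewrite mulrA ler_wpM2r ?expR_ge0// ler_pM ?expR_ge0//; exact: ef.
  rewrite -mulrA ler_pM ?mulr_ge0 ?expR_ge0//.
  by have := normr_ge0 x; lra.
(* Completing the square, [f t y = e^(t^2) * sin ((y + t) x) * e^(-(y + t)^2)]: up to a constant, a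
   translate of an odd function. *)
have Ff t : -1 < t < 1 -> \int[leb]_y f t y = 0.
  move=> t1.
  have -> : \int[leb]_y f t y =
      \int[leb]_y (expR (t ^+ 2) * (sin ((1 * y + t) * x) * expR (- (1 * y + t) ^+ 2))).
    apply: eq_Rintegral => y _.
    rewrite /f -mulrA -expRD [RHS]mulrCA -expRD mul1r mulrDl.
    by congr (_ * expR _); ring.
  rewrite RintZl; last first.
    pose g y := sin (y * x) * expR (- y ^+ 2).
    apply: (@intg_transfer _ _ _ leb (fun y => 1 * y + t) 1 _ _ _ g) => //.
    - by apply: measurable_funD => //; exact: mmul.
    - by move=> h mh h0; exact: ge0_integral_affine1.
    - by apply: (@intgMl _ _ _ _ 1 _ _ _ _ ig1) => //; exact: msin.
  rewrite -[X in _ * X = _]mul1r.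
  rewrite (@Rint_transfer _ _ _ leb (fun y => 1 * y + t) 1 _ _ (fun y => sin (y * x) * expR (- y ^+ 2)))//.
  - rewrite Rint_odd ?mulr0//.
    + exact: (mmul (msin x) mexp).
    + by move=> y; rewrite mulNr sinN sqrrN mulNr.
    + by apply: (@intgMl _ _ _ _ 1 _ _ _ _ ig1) => //; exact: msin.
  - by move=> h mh h0; exact: ge0_integral_affine1.
  - exact: (mmul (msin x) mexp).
have der : is_derive (0 : R) (1 : R) (fun t => \int[leb]_y f t y) (\int[leb]_y f' 0 y).
  apply: (@is_derive_Rint _ _ _ leb f f' G 0 (-1) 1) => //.
  - by apply/andP; split; lra.
  - move=> t y _.
    have H1 := is_derive_sin_affine (y * x) x t.
    have H2 : is_derive t (1 : R) (fun t => expR (t * (- 2 * y))) (- 2 * y * expR (t * (- 2 * y))).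
      have H : is_derive t (1 : R) (fun t => t * (- 2 * y)) (- 2 * y).
        rewrite [X in is_derive _ _ X _](_ : _ = (- 2 * y) \*: (@id R)).
          by apply: is_derive_eq; rewrite /GRing.scale/= mulr1.
        by apply/funext => w; rewrite /GRing.scale/= mulrC.
      have := @is_derive1_comp _ expR (fun t => t * (- 2 * y)) t _ _ (is_derive_expR _) H.
      by rewrite [X in is_derive _ _ _ X -> _]mulrC.
    rewrite [X in is_derive _ _ X _](_ : _ = (expR (- y ^+ 2)) \*:
      ((fun t => sin (y * x + t * x)) * (fun t => expR (t * (- 2 * y))))).
      apply: is_derive_eq; rewrite /f' /GRing.scale/=; ring.
    by apply/funext => w; rewrite /f /GRing.scale/= mulrC.
  - move=> t y t1; rewrite /f' /G normrM (ger0_norm (expR_ge0 _)).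
    have E := ef t y t1.
    apply: (@le_trans _ _ ((`|x| * expR (2 * `|y|) + 2 * `|y| * expR (2 * `|y|)) * expR (- y ^+ 2))).
      rewrite ler_wpM2r ?expR_ge0//; apply: le_trans (ler_normD _ _) _.
      rewrite !normrM !(ger0_norm (expR_ge0 _)) normrN (ger0_norm (_ : 0 <= 2 :> R))//.
      apply: lerD.
        by rewrite ler_pM ?mulr_ge0 ?expR_ge0// ler_piMr.
      rewrite -[leRHS]mul1r ler_pM ?mulr_ge0 ?expR_ge0//.
      by rewrite ler_wpM2l ?mulr_ge0.
    have := ler_wpM2l (normr_ge0 x) (e2 y); have := e3 y; lra.
have := der.
have -> : \int[leb]_y f' 0 y = x * F x - 2 * S x.
  rewrite /F /S -!RintZl// -RintB; [|exact: intgZl|exact: intgZl].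
  apply: eq_Rintegral => y _; rewrite /f' !mul0r addr0 expR0; ring.
move=> [_ D]; apply/eqP; rewrite -subr_eq0 -D; apply/eqP.
rewrite (@near_eq_derive _ _ _ (fun t => \int[leb]_y f t y) (cst 0) 0 1) ?derive_cst//.
have : \forall t \near (0 : R), `|t| < 1 by exact: nbhs0_lt.
by apply: filterS => t; rewrite ltr_norml => /Ff.
Qed.

(** [F' = - S] and [x F = 2 S] make [F] a solution of [F' = - x F / 2]; hence
    [F x * expR (x ^+ 2 / 4)] is constant, and its value at 0 is the Gaussian integral. *)
Lemma gauss_fourier1 x : \int[leb]_y (cos (y * x) * expR (- y ^+ 2)) =
  Num.sqrt pi * expR (- (x ^+ 2 / 4)).
Proof.
pose E x := F x * expR (x ^+ 2 / 4).
have dE z : is_derive z (1 : R) E 0.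
  have H : is_derive z (1 : R) (fun x => expR (x ^+ 2 / 4)) (z / 2 * expR (z ^+ 2 / 4)).
    have H : is_derive z (1 : R) (fun t => t ^+ 2 / 4) (z / 2).
      rewrite [X in is_derive _ _ X _](_ : _ = 4^-1 \*: ((@id R) ^+ 2)).
        by apply: is_derive_eq; rewrite /GRing.scale/=; field.
      by apply/funext => w; rewrite /GRing.scale/= exprfctE mulrC.
    have := @is_derive1_comp _ expR (fun t => t ^+ 2 / 4) z _ _ (is_derive_expR _) H.
    by rewrite [X in is_derive _ _ _ X -> _]mulrC.
  have D := dF z; rewrite /E.
  rewrite [X in is_derive _ _ X _](_ : _ = F * (fun x => expR (x ^+ 2 / 4)))//.
  apply: is_derive_eq; rewrite /GRing.scale/=; have := SF z; move=> HS.
  have -> : S z = z * F z / 2 by rewrite HS; field.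
  ring.
have : E x = E 0 by exact: is_derive_0_is_cst.
rewrite /E expr0n/= mul0r expR0 mulr1.
have -> : F 0 = Num.sqrt pi.
  rewrite /F /Rintegral; under eq_integral do rewrite mulr0 cos0 mul1r.
  by have := @integralT_gauss R; rewrite /gauss_fun => ->.
move=> <-; rewrite -mulrA -expRD subrr expR0 mulr1//.
Qed.

(** The phase [th] prepares the induction on the dimension: once the other coordinates are
    integrated out, the remaining one enters through a shifted cosine. *)
Lemma gauss_fourier_phase s th x : 0 < s ->
  \int[leb]_y (cos (th + x * y) * expR (- (s * y ^+ 2))) =
  cos th * (Num.sqrt (pi / s) * expR (- (x ^+ 2 / (4 * s)))).
Proof.
move=> s0; have rs0 : 0 < Num.sqrt s by rewrite sqrtr_gt0.
have ig (g : R -> R) : meas g -> (forall y, `|g y| <= 1) ->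
    intg leb (fun y : R => g y * expR (- (s * y ^+ 2))).
  by move=> mg g1; apply: (@intgMl _ _ _ _ 1) => //; exact: intg_gauss.
have mx (h : R -> R) : meas h -> meas (fun y => h (x * y)).
  by move=> mh; apply: mcomp => //; exact: mmul.
have mc := mx _ measurable_cos.
have ms := mx _ measurable_sin.
under eq_Rintegral do rewrite cosD mulrBl -!mulrA.
rewrite RintB; [|exact/intgZl/ig|exact/intgZl/ig].
rewrite !RintZl; [|exact: ig|exact: ig].
rewrite [X in _ - _ * X]Rint_odd ?mulr0 ?subr0//; last 3 first.
- by apply: mmul => //; exact: measurable_gauss.
- by move=> y; rewrite mulrN sinN sqrrN mulNr.
- exact: ig.
congr (_ * _); apply: (mulfI (lt0r_neq0 rs0)).
pose g y := cos (y * (x / Num.sqrt s)) * expR (- y ^+ 2).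
have := @Rint_transfer _ _ _ leb (fun y => Num.sqrt s * y + 0) (Num.sqrt s) rs0.
move=> /(_ (fun h mh h0 => ge0_integral_affine1 0 rs0 mh h0) g).
move=> /(_ (mmul (mcos _) mexp)).
rewrite {2}/g gauss_fourier1.
have -> : (x / Num.sqrt s) ^+ 2 / 4 = x ^+ 2 / (4 * s).
  rewrite expr_div_n sqr_sqrtr ?ltW//; field; exact: lt0r_neq0.
have -> : Num.sqrt s * (Num.sqrt (pi / s) * expR (- (x ^+ 2 / (4 * s)))) =
    Num.sqrt pi * expR (- (x ^+ 2 / (4 * s))).
  rewrite mulrA -sqrtrM ?ltW//; congr (Num.sqrt _ * _); field; exact: lt0r_neq0.
move=> <-; congr (_ * _); apply: eq_Rintegral => y _.
rewrite /g addr0 exprMn sqr_sqrtr ?ltW//; congr (cos _ * _).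
by field; exact: lt0r_neq0.
Qed.

End gaussian_1d.

Lemma powR_le1 {R : realType} (x p : R) : 0 <= x <= 1 -> 0 <= p -> x `^ p <= 1.
Proof.
move=> /andP[x0 x1] p0; rewrite -[leRHS](_ : 1 `^ p = 1); last by rewrite powR1.
by apply: ge0_ler_powR; rewrite ?nnegrE.
Qed.

Lemma le_powR_id {R : realType} (x p : R) : 0 <= x <= 1 -> 0 <= p <= 1 -> x <= x `^ p.
Proof.
move=> /andP[x0 x1] /andP[p0 p1]; move: x0; rewrite le_eqVlt => /predU1P[<-|x0].
  exact: powR_ge0.
rewrite /powR gt_eqF// -[leLHS]lnK ?posrE// ler_expR.
have : ln x <= 0 by exact: ln_le0.
move=> H; have : 0 <= (1 - p) * - ln x by rewrite mulr_ge0//; lra.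
lra.
Qed.

(** * The binomial series of [1 - (1 - z)^beta] *)

Section binomial_series.
Context {R : realType}.
Variable beta : R.
Hypothesis beta01 : 0 < beta < 1.

(* [1 - (1 - z)^beta = \sum_k bcoef k * z^(k+1)], with [bcoef k >= 0]. *)
Fixpoint bcoef (k : nat) : R :=
  if k is k'.+1 then bcoef k' * (k'.+1%:R - beta) / k'.+2%:R else beta.

Definition bsum (n : nat) (z : R) : R := \sum_(k < n) bcoef k * z ^+ k.+1.

Let beta0 : 0 < beta. Proof. by case/andP: beta01. Qed.
Let beta1 : beta < 1. Proof. by case/andP: beta01. Qed.

Lemma bcoef_ge0 k : 0 <= bcoef k.
Proof.
elim: k => [|k IH] /=; first exact: ltW.
rewrite mulr_ge0 ?invr_ge0// mulr_ge0// subr_ge0 (le_trans (ltW beta1))//.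
by rewrite ler1n.
Qed.

Let a k := k.+1%:R * bcoef k.

Let aS k : a k.+1 = a k - beta * bcoef k.
Proof. by rewrite /a /= mulrCA divff ?pnatr_eq0// mulr1; ring. Qed.

Let a_ge0 k : 0 <= a k.
Proof. by rewrite mulr_ge0// bcoef_ge0. Qed.

Let a_le k : a k <= beta.
Proof.
elim: k => [|k IH]; first by rewrite /a mul1r.
apply: le_trans IH; rewrite aS gerDl oppr_le0.
by rewrite mulr_ge0 ?bcoef_ge0// ltW.
Qed.

Let dsum n z := \sum_(k < n) a k * z ^+ k.

(** The function [f = 1 - (1 - z)^beta] solves [(1 - z) f' = beta (1 - f)]. The recursion [aS] makes
    the partial sums solve it up to the telescoping remainder [a n * z ^+ n]. *)
Let dsumE n z : (1 - z) * dsum n z = beta * (1 - bsum n z) - a n * z ^+ n.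
Proof.
rewrite /dsum /bsum; elim: n => [|n IH].
  by rewrite !big_ord0 expr0 /a mul1r /=; ring.
rewrite !big_ord_recr /= mulrDr IH aS exprS; ring.
Qed.

Let is_derive_bsum n z : is_derive z (1 : R) (bsum n) (dsum n z).
Proof.
rewrite /dsum; elim: n => [|n IH].
  rewrite big_ord0 (_ : bsum 0 = cst 0); last first.
    by apply/funext => w; rewrite /bsum big_ord0.
  exact: is_derive_cst.
rewrite (_ : bsum n.+1 = bsum n + bcoef n \*: (@id R) ^+ n.+1); last first.
  by apply/funext => w; rewrite /bsum big_ord_recr/= exprfctE.
rewrite big_ord_recr/=; apply: is_derive_eq.
by rewrite /GRing.scale/= mulr1 mulrA (mulrC (bcoef n)).
Qed.

Let w (z : R) := expR (- beta * ln (1 - z)).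

Let is_derive_w (z : R) : z < 1 -> is_derive z (1 : R) w (beta / (1 - z) * w z).
Proof.
move=> z1; have H1 : is_derive z (1 : R) (fun z : R => 1 - z) (-1).
  rewrite (_ : (fun z => _) = cst 1 - @id R); last by apply/funext.
  by apply: is_derive_eq; rewrite add0r.
have H2 : is_derive z (1 : R) (fun z : R => ln (1 - z)) (- (1 - z)^-1).
  have p : 0 < 1 - z by lra.
  have := @is_derive1_comp _ (@ln R) (fun z => 1 - z) z _ _ (is_derive1_ln p) H1.
  by rewrite mulrN1.
have H3 : is_derive z (1 : R) (fun z : R => - beta * ln (1 - z)) (beta / (1 - z)).
  rewrite (_ : (fun z => _) = (- beta) \*: (fun z : R => ln (1 - z))); last first.
    by apply/funext.
  by apply: is_derive_eq; rewrite /GRing.scale/= mulrNN.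
have := @is_derive1_comp _ expR (fun z => - beta * ln (1 - z)) z _ _ (is_derive_expR _) H3.
by rewrite [X in is_derive _ _ _ X -> _]mulrC.
Qed.

(** Here [w] is [(1 - z)^(-beta)], the integrating factor. By [dsumE] the product [(1 - bsum n) * w]
    has derivative [a n * y ^+ n * w / (1 - y)], and the mean value theorem on [[0, z]] bounds its
    departure from 1. *)
Let bsum_bound n (z : R) : 0 <= z < 1 ->
  0 <= (1 - bsum n z) * w z - 1 <= beta * z ^+ n * (w z / (1 - z)).
Proof.
move=> /andP[z0 z1].
pose g y := (1 - bsum n y) * w y.
have dg (y : R) : y < 1 -> is_derive y (1 : R) g (a n * y ^+ n * (w y / (1 - y))).
  move=> y1; have H1 := is_derive_bsum n y; have H2 := is_derive_w y1.
  rewrite (_ : g = (cst 1 - bsum n) * w); last by apply/funext.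
  apply: is_derive_eq; rewrite /GRing.scale/= add0r /cst/=.
  have y10 : 1 - y != 0 by lra.
  have -> : (1 - bsum n y) * (beta / (1 - y) * w y) =
      (beta * (1 - bsum n y)) * (w y / (1 - y)) by field.
  have -> : w y * - dsum n y = - ((1 - y) * dsum n y) * (w y / (1 - y)) by field.
  rewrite dsumE; ring.
have [c cz ->] : exists2 c, c \in `[0, z] & g z - 1 = a n * c ^+ n * (w c / (1 - c)) * (z - 0).
  have -> : g z - 1 = g z - g 0.
    have b0 : bsum n 0 = 0 by rewrite /bsum big1// => i _; rewrite exprS mul0r mulr0.
    by rewrite /g /w b0 subr0 ln1 mulr0 expR0 mulr1.
  apply: (@MVT_segment _ g (fun c => a n * c ^+ n * (w c / (1 - c)))) => //.
    by move=> x; rewrite in_itv/= => /andP[_ xz]; apply: dg; lra.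
  apply: derivable_within_continuous => x; rewrite in_itv/= => /andP[_ xz].
  by have [] := dg x (le_lt_trans xz z1).
move: cz; rewrite in_itv/= => /andP[c0 cz]; have c1 : c < 1 by lra.
have w0 y : 0 <= w y by exact: expR_ge0.
apply/andP; split.
  have c10 : 0 <= 1 - c by lra.
  by rewrite subr0 mulr_ge0// mulr_ge0 ?divr_ge0// mulr_ge0// exprn_ge0.
have c10 : 0 <= 1 - c by lra.
rewrite subr0 -[leRHS]mulr1; apply: ler_pM => //; last exact: ltW.
  by rewrite mulr_ge0 ?divr_ge0// mulr_ge0// exprn_ge0.
apply: ler_pM; [by rewrite mulr_ge0// exprn_ge0|by rewrite divr_ge0| |].
  by apply: ler_pM; rewrite ?exprn_ge0// lerXn2r.
apply: ler_pM => //; first by rewrite invr_ge0.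
  rewrite ler_expR !mulNr lerN2 ler_wpM2l ?(ltW beta0)//.
  by rewrite ler_ln ?posrE; lra.
by rewrite lef_pV2 ?posrE; lra.
Qed.

Let wE z : z < 1 -> w z = ((1 - z) `^ beta)^-1.
Proof.
by move=> z1; rewrite /w /powR gt_eqF ?subr_gt0// mulNr expRN.
Qed.

Lemma bsum_ge0 n z : 0 <= z -> 0 <= bsum n z.
Proof. by move=> z0; apply: sumr_ge0 => k _; rewrite mulr_ge0 ?bcoef_ge0 ?exprn_ge0. Qed.

Lemma bsum_le1 n z : 0 <= z <= 1 -> bsum n z <= 1.
Proof.
move=> /andP[z0 z1]; apply: (@le_trans _ _ (bsum n 1)).
  apply: ler_sum => k _; rewrite ler_wpM2l ?bcoef_ge0//.
  by rewrite expr1n exprn_ile1.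
(* At [z = 1] the identity reads [beta * (1 - bsum n 1) = a n], which is nonnegative. *)
have := dsumE n 1; rewrite subrr mul0r expr1n mulr1 => /esym/eqP.
rewrite subr_eq0 => /eqP H; rewrite -subr_ge0 -(pmulr_rge0 _ beta0) H.
exact: a_ge0.
Qed.

Let bsum_cvg_lt (z : R) : 0 <= z < 1 -> bsum n z @[n --> \oo] --> 1 - (1 - z) `^ beta.
Proof.
move=> z01; have /andP[z0 z1] := z01.
have w0 : 0 < w z by exact: expR_gt0.
suff : (1 - bsum n z) * w z @[n --> \oo] --> (1 : R).
  move=> /(@cvgMr_tmp _ _ _ _ _ _ (w z)^-1); rewrite mul1r wE// invrK => H.
  rewrite (_ : (fun n => bsum n z) = fun n => 1 - (1 - bsum n z) / (1 - z) `^ beta * (1 - z) `^ beta).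
    by apply: cvgB => //; exact: cvg_cst.
  apply/funext => n; rewrite mulfVK ?gt_eqF ?powR_gt0 ?subr_gt0//; ring.
apply/subr_cvg0; apply: (@squeeze_cvgr _ _ _ _ (cst 0) (fun n => beta * z ^+ n * (w z / (1 - z)))).
- by near=> n; exact: bsum_bound.
- exact: cvg_cst.
- rewrite -[X in _ --> X](mul0r (w z / (1 - z))); apply: cvgMr_tmp.
  rewrite -[X in _ --> X](mulr0 beta); apply: cvgMl_tmp.
  by apply: cvg_expr; rewrite ger0_norm.
Unshelve. all: by end_near. Qed.

Lemma bsum_cvg (z : R) : 0 <= z <= 1 -> bsum n z @[n --> \oo] --> 1 - (1 - z) `^ beta.
Proof.
move=> /andP[z0]; rewrite le_eqVlt => /predU1P[->|z1]; last first.
  by apply: bsum_cvg_lt; rewrite z0.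
rewrite subrr powR0 ?gt_eqF// subr0; apply/cvgrPdist_le => e e0.
(* The endpoint [z = 1] is reached by monotonicity in [z]: [bsum n y <= bsum n 1 <= 1], with [y]
   such that the limit at [y] is at least [1 - e / 2]. The minimum with [1/2] keeps [y]
   nonnegative. *)
pose y := 1 - (Num.min (e / 2) 2^-1) `^ beta^-1.
have m0 : 0 < Num.min (e / 2) 2^-1 by rewrite lt_min; apply/andP; split; lra.
have y01 : 0 <= y < 1.
  rewrite /y; apply/andP; split; last by rewrite gtrBl powR_gt0.
  rewrite subr_ge0; apply: powR_le1; last by rewrite invr_ge0 ltW.
  by rewrite (ltW m0)/= ge_min; apply/orP; right; lra.
have ye : (1 - y) `^ beta <= e / 2.
  rewrite /y opprB addrC subrK -powRrM mulVf ?gt_eqF// powRr1; last exact: ltW.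
  by rewrite ge_min lexx.
have /cvgrPdist_le/(_ (e / 2)) := bsum_cvg_lt y01.
have e20 : 0 < e / 2 by lra.
move=> /(_ e20); apply: filterS => n.
have H1 : bsum n 1 <= 1 by apply: bsum_le1; rewrite lexx ler01.
have H2 : bsum n y <= bsum n 1.
  apply: ler_sum => k _; rewrite ler_wpM2l ?bcoef_ge0//.
  by case/andP: y01 => y0 y1; rewrite expr1n exprn_ile1// ltW.
rewrite (ger0_norm (_ : 0 <= 1 - bsum n 1)) ?subr_ge0//.
by move=> /ler_normlP[]; lra.
Qed.

End binomial_series.

(** * Complete monotonicity of the stable symbol, by duality *)

Section completely_monotone.
Context {R : realType}.
Implicit Types (phi psi : R -> R) (l : (R -> R) -> R).

Definition bm phi := meas phi /\
  exists M : R, forall x, 0 <= x -> `|phi x| <= M.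

(** The properties of integration against a finite signed measure on the half-line: linearity, and
    continuity under bounded pointwise convergence. The functionals used later are integrals against
    a density in [xi], through [dotp xi xi], and point evaluations. *)
Definition functional l :=
  [/\ forall phi psi, bm phi -> bm psi ->
        l (fun x => phi x + psi x) = l phi + l psi,
      forall c phi, bm phi -> l (fun x => c * phi x) = c * l phi &
      forall (phi_ : nat -> R -> R) phi M,
        (forall n, meas (phi_ n)) -> meas phi ->
        (forall n x, 0 <= x -> `|phi_ n x| <= M) ->
        (forall x, 0 <= x -> phi_ n x @[n --> \oo] --> phi x) ->
        l (phi_ n) @[n --> \oo] --> l phi].

Definition dexp (s x : R) : R := expR (- (s * x)).

(* The bipolar of the exponentials: by Bernstein's theorem these are the
   bounded completely monotone functions on [0, +oo[, that is the Laplace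
   transforms of finite measures. *)
Definition cmono phi := bm phi /\
  forall l, functional l -> (forall s, 0 <= s -> 0 <= l (dexp s)) -> 0 <= l phi.

Lemma bmD phi psi : bm phi -> bm psi -> bm (fun x => phi x + psi x).
Proof.
move=> [mf [M fM]] [mg [N gN]]; split; first exact: measurable_funD.
by exists (M + N) => x x0; rewrite (le_trans (ler_normD _ _))// lerD ?fM ?gN.
Qed.

Lemma bmM phi psi : bm phi -> bm psi -> bm (fun x => phi x * psi x).
Proof.
move=> [mf [M fM]] [mg [N gN]]; split; first exact: mmul.
by exists (M * N) => x x0; rewrite normrM; apply: ler_pM; rewrite ?fM ?gN.
Qed.

Lemma bm_cst c : bm (fun=> c).
Proof. by split => //; exists `|c|. Qed.

Lemma bmZ c phi : bm phi -> bm (fun x => c * phi x).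
Proof. exact/bmM/bm_cst. Qed.

Lemma measurable_dexp s : meas (dexp s).
Proof.
by apply: mcomp => //; apply: mcomp => //; apply: mmul.
Qed.

Lemma dexp_ge0 s x : 0 <= dexp s x. Proof. exact: expR_ge0. Qed.

Lemma dexp_le1 s x : 0 <= s -> 0 <= x -> dexp s x <= 1.
Proof. by move=> s0 x0; rewrite /dexp expR_le1 oppr_le0 mulr_ge0. Qed.

Lemma bm_dexp s : 0 <= s -> bm (dexp s).
Proof.
move=> s0; split; first exact: measurable_dexp.
by exists 1 => x x0; rewrite ger0_norm ?dexp_ge0// dexp_le1.
Qed.

Lemma dexpD s t x : dexp (s + t) x = dexp s x * dexp t x.
Proof. by rewrite /dexp -expRD mulrDl opprD. Qed.

Lemma functional_mulr l psi : functional l -> bm psi ->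
  functional (fun phi => l (fun x => psi x * phi x)).
Proof.
move=> [lD lZ lc] bpsi; split.
- move=> f g bf bg; rewrite -lD; [|exact: bmM|exact: bmM].
  by congr l; apply/funext => x; rewrite mulrDr.
- move=> c f bf; rewrite -lZ; last exact: bmM.
  by congr l; apply/funext => x; rewrite mulrCA.
- have [mpsi [N psiN]] := bpsi => f_ f M mf_ mf f_M f_f.
  apply: (lc _ _ (N * M)).
  + by move=> n; apply: mmul.
  + by apply: mmul.
  + by move=> n x x0; rewrite normrM; apply: ler_pM; rewrite ?psiN ?f_M.
  + by move=> x x0; apply: cvgMl_tmp; exact: f_f.
Qed.

Lemma cmono_dexp s : 0 <= s -> cmono (dexp s).
Proof. by move=> s0; split; [exact: bm_dexp | move=> l _; exact]. Qed.

Lemma cmono1 : cmono (fun=> 1).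
Proof.
have := cmono_dexp (lexx 0); congr cmono; apply/funext => x.
by rewrite /dexp mul0r oppr0 expR0.
Qed.

Lemma cmonoD phi psi : cmono phi -> cmono psi -> cmono (fun x => phi x + psi x).
Proof.
move=> [bf fl] [bg gl]; split; first exact: bmD.
by move=> l lf l0; have [lD _ _] := lf; rewrite (lD _ _ bf bg); apply: addr_ge0; [exact: fl | exact: gl].
Qed.

Lemma cmonoZ c phi : 0 <= c -> cmono phi -> cmono (fun x => c * phi x).
Proof.
move=> c0 [bf fl]; split; first exact: bmZ.
by move=> l lf l0; have [_ lZ _] := lf; rewrite (lZ _ _ bf); apply: mulr_ge0 => //; exact: fl.
Qed.

(** Duality is used twice: [psi] is tested against [g |-> l (phi g)], which requires
    [l (phi * dexp s) >= 0]; for this [phi] is tested against [g |-> l (dexp s * g)], and a product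
    of two exponentials is again one. *)
Lemma cmonoM phi psi : cmono phi -> cmono psi -> cmono (fun x => phi x * psi x).
Proof.
move=> [bf fl] [bg gl]; split; first exact: bmM.
move=> l lf l0; apply: (gl (fun g => l (fun x => phi x * g x))).
  exact: functional_mulr.
move=> s s0.
have -> : (fun x => phi x * dexp s x) = (fun x => dexp s x * phi x).
  by apply/funext => x; rewrite mulrC.
apply: (fl (fun g => l (fun x => dexp s x * g x))).
  exact/functional_mulr/bm_dexp.
move=> t t0; rewrite (_ : (fun x => _) = dexp (s + t)).
  by apply: l0; exact: addr_ge0.
by apply/funext => x; rewrite dexpD.
Qed.

Lemma cmonoX phi n : cmono phi -> cmono (fun x => phi x ^+ n).
Proof.
move=> cf; elim: n => [|n IH].
  by under eq_fun do rewrite expr0; exact: cmono1.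
by under eq_fun do rewrite exprS; exact: cmonoM.
Qed.

Lemma cmono0 : cmono (fun=> 0).
Proof.
have := cmonoZ (lexx 0) cmono1; congr cmono; apply/funext => x.
by rewrite mul0r.
Qed.

Lemma cmono_sum n (c : nat -> R) (f : nat -> R -> R) :
  (forall k, 0 <= c k) -> (forall k, cmono (f k)) ->
  cmono (fun x => \sum_(k < n) c k * f k x).
Proof.
move=> c0 cf; elim: n => [|n IH].
  by under eq_fun do rewrite big_ord0; exact: cmono0.
under eq_fun do rewrite big_ord_recr/=.
by apply: cmonoD => //; exact: cmonoZ.
Qed.

Lemma cmono_lim (phi_ : nat -> R -> R) phi M :
  (forall n, cmono (phi_ n)) -> meas phi ->
  (forall n x, 0 <= x -> `|phi_ n x| <= M) ->
  (forall x, 0 <= x -> phi_ n x @[n --> \oo] --> phi x) -> cmono phi.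
Proof.
move=> cf mf f_M f_f.
have fM x : 0 <= x -> `|phi x| <= M.
  move=> x0; apply: (@cvgr_to_le nat \oo _ R (fun n => `|phi_ n x|)).
    by apply: cvg_norm; exact: f_f.
  by near=> n; exact: f_M.
split; first by split => //; exists M.
move=> l lf l0; have [_ _ lc] := lf.
have lcv : l (phi_ n) @[n --> \oo] --> l phi.
  by apply: (lc _ _ M) => // n; have [[]] := cf n.
apply: (@cvgr_to_ge nat \oo _ R _ _ _ lcv).
by near=> n; have [_] := cf n; exact.
Unshelve. all: by end_near. Qed.

Lemma cmono_expR phi : (forall x, 0 <= x -> 0 <= phi x) -> cmono phi ->
  cmono (fun x => expR (phi x)).
Proof.
move=> f0 cf; have [[mf [M fM]] _] := cf.
apply: (@cmono_lim (fun n x => \sum_(k < n) (k`!%:R)^-1 * phi x ^+ k) _ (expR M)).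
- move=> n; apply: (@cmono_sum n (fun k => (k`!%:R)^-1) (fun k x => phi x ^+ k)).
    by move=> k; rewrite invr_ge0.
  by move=> k; exact: cmonoX.
- exact: mcomp.
- move=> n x x0; have fx := f0 x x0.
  rewrite ger0_norm; last first.
    by apply: sumr_ge0 => k _; rewrite mulr_ge0 ?invr_ge0 ?exprn_ge0.
  have fxM : phi x <= M by rewrite (le_trans (ler_norm _))// fM.
  apply: (@le_trans _ _ (expR (phi x))); last by rewrite ler_expR.
  apply: le_trans (nondecreasing_cvgn_le _ (is_cvg_series_exp_coeff (phi x)) n).
    rewrite /series/= big_mkord ler_sum// => k _.
    by rewrite /exp_coeff/= mulrC.
  move=> m k mk; rewrite /series/= (big_cat_nat _ mk)//= lerDl sumr_ge0//.
  by move=> i _; rewrite /exp_coeff/= divr_ge0 ?exprn_ge0.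
- move=> x x0; have := is_cvg_series_exp_coeff (phi x).
  move=> /cvg_ex[e]; rewrite [X in X -> _](_ : _ = (series (exp_coeff (phi x)) n @[n --> \oo] --> e))// => He.
  have <- : e = expR (phi x) by rewrite /expR (cvg_lim _ He).
  apply: cvg_trans He; apply: near_eq_cvg; near=> n.
  by rewrite /series/= big_mkord; apply: eq_bigr => k _; rewrite /exp_coeff/= mulrC.
Unshelve. all: by end_near. Qed.

Section fractional_power.
Variable beta : R.
Hypothesis beta01 : 0 < beta < 1.
Let beta0 : 0 < beta. Proof. by case/andP: beta01. Qed.
Let beta1 : beta < 1. Proof. by case/andP: beta01. Qed.

Let mpow : meas (fun x : R => x `^ beta).
Proof. exact: measurable_powR. Qed.

Lemma cmono_bern (e : R) : 0 < e ->
  cmono (fun x => 1 - (1 - dexp e x) `^ beta).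
Proof.
move=> e0; have dexp01 x : 0 <= x -> 0 <= dexp e x <= 1.
  by move=> x0; rewrite dexp_ge0 dexp_le1// ltW.
apply: (@cmono_lim (fun n x => bsum beta n (dexp e x)) _ 1).
- move=> n; apply: (@cmono_sum n _ (fun k x => dexp e x ^+ k.+1)).
    exact: bcoef_ge0.
  by move=> k; apply: cmonoX; apply: cmono_dexp; exact: ltW.
- apply: measurable_funB => //; apply: mcomp mpow _.
  by apply: measurable_funB => //; exact: measurable_dexp.
- move=> n x x0; rewrite ger0_norm; first by apply: bsum_le1 => //; exact: dexp01.
  by apply: bsum_ge0 => //; exact: dexp_ge0.
- by move=> x x0; apply: bsum_cvg => //; exact: dexp01.
Qed.

(** Write the function as [e^(-t) * exp (t (1 - (1 - e^(-e x))^beta))]. The inner function is a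
    series in powers of [dexp e] with nonnegative coefficients, and so is the exponential of a
    nonnegative completely monotone function. *)
Lemma cmono_stable_approx (t e : R) : 0 <= t -> 0 < e ->
  cmono (fun x => expR (- (t * (1 - dexp e x) `^ beta))).
Proof.
move=> t0 e0.
have H : cmono (fun x => expR (- t) * expR (t * (1 - (1 - dexp e x) `^ beta))).
  apply: cmonoZ; first exact: expR_ge0.
  apply: cmono_expR; last exact/cmonoZ/cmono_bern.
  move=> x x0; rewrite mulr_ge0// subr_ge0 powR_le1 ?(ltW beta0)//.
  by rewrite subr_ge0 dexp_le1 ?(ltW e0)//= gerBl dexp_ge0.
move: H; congr cmono; apply/funext => x; rewrite -expRD; congr expR; ring.
Qed.

Lemma one_sub_dexp_bounds (e x : R) : 0 <= e -> 0 <= x ->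
  e * x / (1 + e * x) <= 1 - dexp e x <= e * x.
Proof.
move=> e0 x0; have ex := mulr_ge0 e0 x0; have p : 0 < 1 + e * x by lra.
apply/andP; split; last first.
  by have := expR_ge1Dx (- (e * x)); rewrite /dexp; lra.
rewrite /dexp expRN; have H := expR_ge1Dx (e * x).
have -> : e * x / (1 + e * x) = 1 - (1 + e * x)^-1 by field; lra.
by rewrite lerD2l lerN2 lef_pV2 ?posrE ?expR_gt0.
Qed.

Lemma cmono_stable (t : R) : 0 <= t -> cmono (fun x => expR (- (t * x `^ beta))).
Proof.
move=> t0; pose e n : R := n.+1%:R^-1.
have e0 n : 0 < e n by rewrite invr_gt0.
(* [n.+1 * (1 - dexp (e n) x)] tends to [x]; the factor [n.+1 ^ beta] put on [t] makes the
   approximant of [cmono_stable_approx] use exactly this quantity. *)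
pose phi n x := expR (- ((t * n.+1%:R `^ beta) * (1 - dexp (e n) x) `^ beta)).
apply: (@cmono_lim phi _ 1).
- by move=> n; apply: cmono_stable_approx => //; rewrite mulr_ge0 ?powR_ge0.
- apply: mcomp => //; apply: mcomp => //.
  exact: mmul.
- move=> n x x0; rewrite ger0_norm ?expR_ge0// expR_le1 oppr_le0.
  by rewrite !mulr_ge0 ?powR_ge0.
- move=> x x0; suff H : - (t * n.+1%:R `^ beta * (1 - dexp (e n) x) `^ beta)
      @[n --> \oo] --> - (t * x `^ beta).
    exact: (cvg_comp _ _ H (@continuous_expR R (- (t * x `^ beta)))).
  apply: cvgN; under eq_fun do rewrite -mulrA.
  apply: cvgMl_tmp.
  have E n : n.+1%:R `^ beta * (1 - dexp (e n) x) `^ beta =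
      (n.+1%:R * (1 - dexp (e n) x)) `^ beta.
    by rewrite powRM// subr_ge0 dexp_le1// ltW.
  under eq_fun do rewrite E.
  apply: (@squeeze_cvgr _ _ _ _ (fun n => x `^ beta * (1 + e n * x)^-1) (fun=> x `^ beta)).
  + near=> n; have en := ltW (e0 n); have /andP[H1 H2] := one_sub_dexp_bounds en x0.
    have ex := mulr_ge0 en x0; have p : 0 < 1 + e n * x by lra.
    have n0 : (0 : R) < n.+1%:R by [].
    have ne : n.+1%:R * e n = 1 by rewrite /e mulfV.
    apply/andP; split; last first.
      apply: ge0_ler_powR; rewrite ?nnegrE ?(ltW beta0)//.
        by rewrite mulr_ge0// subr_ge0 dexp_le1.
      rewrite [leRHS](_ : _ = n.+1%:R * (e n * x)); last by rewrite mulrA ne mul1r.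
      by rewrite ler_wpM2l.
    apply: (@le_trans _ _ ((x / (1 + e n * x)) `^ beta)).
      rewrite powRM// ?invr_ge0; last lra.
      rewrite ler_wpM2l ?powR_ge0// le_powR_id ?(ltW beta0) ?(ltW beta1)//.
      rewrite invr_ge0 (ltW p)/= invf_le1//; lra.
    apply: ge0_ler_powR; rewrite ?nnegrE ?(ltW beta0)//.
    * by rewrite divr_ge0//; lra.
    * by rewrite mulr_ge0// subr_ge0 dexp_le1.
    * rewrite [leLHS](_ : _ = n.+1%:R * (e n * x / (1 + e n * x))).
        by rewrite ler_wpM2l.
      by rewrite !mulrA ne mul1r.
  + rewrite -[X in _ --> X]mulr1; apply: cvgMl_tmp.
    rewrite -[X in _ --> X]invr1; apply: cvgV => //.
    rewrite -[X in _ --> X]addr0; apply: cvgD; first exact: cvg_cst.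
    by rewrite -[X in _ --> X](mul0r x); apply: cvgMr_tmp; exact: cvg_harmonic.
  + exact: cvg_cst.
Unshelve. all: by end_near. Qed.

End fractional_power.
End completely_monotone.

(** * Gaussians in several variables *)

Section gaussian_rV.
Context {R : realType}.
Implicit Types (s th : R).

Lemma uncons_rVK n : cancel (@uncons_rV R n) (@cons_rV R n).
Proof.
move=> x; apply/rowP => i.
by have [j ->|->] := unliftP ord0 i; rewrite ?cons_rVS ?cons_rV0 //= mxE.
Qed.

Lemma dotp_cons n (p q : measurableTypeR R * 'rV[R]_n) :
  dotp (cons_rV p) (cons_rV q) = (p.1 : R) * q.1 + dotp p.2 q.2.
Proof.
rewrite /dotp big_ord_recl !cons_rV0; congr (_ + _).
by apply: eq_bigr => i _; rewrite !cons_rVS.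
Qed.

Lemma Rint_rVS n (f : 'rV[R]_n.+1 -> R) : intg (lebesgue_rV n.+1) f ->
  \int[lebesgue_rV n.+1]_x f x =
  \int[@lebesgue_measure R]_a \int[lebesgue_rV n]_x f (cons_rV (a, x)).
Proof.
move=> fi; have mf := intg_meas fi.
have mcons := @measurable_cons_rV R n.
have fic : intg (@lebesgue_measure R \x lebesgue_rV n)%E
    (uncurry (fun a x => f (cons_rV (a, x)))).
  apply: intg_prod.
    rewrite (_ : uncurry _ = f \o @cons_rV R n); last by apply/funext => -[].
    exact: mcomp.
  have := intg_lty fi; rewrite ge0_integral_rVS//.
  by apply/measurable_EFinP; exact: mcomp.
have fic' : (@lebesgue_measure R \x lebesgue_rV n)%E.-integrable
    (@cons_rV R n @^-1` setT) ((EFin \o f) \o @cons_rV R n).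
  by rewrite preimage_setT; apply: eq_integrable fic => // -[].
have mfE : meas (EFin \o f) by exact/measurable_EFinP.
have := integral_pushforward mcons mfE fic' measurableT.
rewrite (Rfubini1 fic) /Rintegral preimage_setT => H.
by rewrite [X in fine X = _]H; congr fine; apply: eq_integral => -[].
Qed.

Definition gaussw n s (xi : 'rV[R]_n) : R := expR (- (s * dotp xi xi)).

Lemma measurable_gaussw n s : meas (@gaussw n s).
Proof.
apply: mcomp => //; apply: mcomp => //.
by apply: mmul => //; exact: measurable_fun_dotp.
Qed.

Lemma gaussw_cons n s (p : measurableTypeR R * 'rV[R]_n) :
  gaussw s (cons_rV p) = expR (- (s * (p.1 : R) ^+ 2)) * gaussw s p.2.
Proof. by rewrite /gaussw dotp_cons -expRD expr2; congr expR; ring. Qed.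

Lemma inte_gaussw n s : 0 < s ->
  (\int[lebesgue_rV n]_x (gaussw s x)%:E = (Num.sqrt (pi / s) ^+ n)%:E)%E.
Proof.
move=> s0; elim: n => [|n IH].
  have mg : meas (EFin \o @gaussw 0 s).
    by apply/measurable_EFinP; exact: measurable_gaussw.
  rewrite /= (integral_dirac _ _ mg)// diracT mul1e /= /gaussw /dotp big_ord0.
  by rewrite mulr0 oppr0 expR0.
rewrite ge0_integral_rVS.
- have E (a : measurableTypeR R) : (\int[lebesgue_rV n]_x (gaussw s (cons_rV (a, x)))%:E =
      (Num.sqrt (pi / s) ^+ n * expR (- (s * a ^+ 2)))%:E)%E.
    under eq_integral do rewrite gaussw_cons /=.
    rewrite (inteZl _ (@measurable_gaussw n s)) ?expR_ge0//; last first.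
      by move=> x; exact: expR_ge0.
    by rewrite IH -EFinM mulrC.
  under eq_integral do rewrite E.
  have := @inteZl _ _ _ (@lebesgue_measure R) (Num.sqrt (pi / s) ^+ n) _
    (measurable_gauss s) (fun x => expR_ge0 _).
  by rewrite exprn_ge0 ?sqrtr_ge0// => ->//; rewrite inte_gauss// -EFinM exprSr.
- by apply/measurable_EFinP; exact: measurable_gaussw.
- by move=> x; rewrite lee_fin expR_ge0.
Qed.

Lemma intg_gaussw n s : 0 < s -> intg (lebesgue_rV n) (@gaussw n s).
Proof.
move=> s0; apply: intgP; first exact: measurable_gaussw.
under eq_integral do rewrite (ger0_norm (expR_ge0 _)).
by have := @inte_gaussw n s s0; rewrite /gaussw => ->; rewrite ltry.
Qed.

Lemma norm_cos_le1 th : `|cos th| <= 1.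
Proof. by rewrite ler_norml cos_geN1 cos_le1. Qed.

Lemma norm_sin_le1 th : `|sin th| <= 1.
Proof. by rewrite ler_norml sin_geN1 sin_le1. Qed.

Lemma measurable_cos_dotp n th (x : 'rV[R]_n) :
  meas (fun xi => cos (th + dotp x xi)).
Proof.
apply: (mcomp measurable_cos).
by apply: measurable_funD => //; exact: measurable_dotp.
Qed.

Lemma measurable_sin_dotp n th (x : 'rV[R]_n) :
  meas (fun xi => sin (th + dotp x xi)).
Proof.
apply: (mcomp measurable_sin).
by apply: measurable_funD => //; exact: measurable_dotp.
Qed.

Lemma gauss_fourier n s th (x : 'rV[R]_n) : 0 < s ->
  \int[lebesgue_rV n]_xi (cos (th + dotp x xi) * gaussw s xi) =
  cos th * (Num.sqrt (pi / s) ^+ n * expR (- (dotp x x / (4 * s)))).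
Proof.
move=> s0; elim: n th x => [|n IH] th x.
  have mg : meas (EFin \o (fun xi => cos (th + dotp x xi) * @gaussw 0 s xi)).
    apply/measurable_EFinP; apply: mmul; last exact: measurable_gaussw.
    exact: measurable_cos_dotp.
  rewrite /Rintegral /= (integral_dirac _ _ mg)// diracT mul1e /= /gaussw.
  by rewrite /dotp !big_ord0 addr0 mulr0 mul0r oppr0 expR0 !mulr1.
have [a [y ->]] : exists (a : R) y, x = cons_rV ((a : measurableTypeR R), y).
  by exists (uncons_rV x).1, (uncons_rV x).2; rewrite -[LHS]uncons_rVK; case: uncons_rV.
rewrite Rint_rVS; last first.
  apply: (@intgMl _ _ _ _ 1); [exact: measurable_cos_dotp| |exact: intg_gaussw].
  by move=> xi; exact: norm_cos_le1.
rewrite dotp_cons/=.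
have E (t : R) : \int[lebesgue_rV n]_x0
    (cos (th + dotp (cons_rV ((a : measurableTypeR R), y)) (cons_rV ((t : measurableTypeR R), x0))) *
     gaussw s (cons_rV ((t : measurableTypeR R), x0))) =
    (cos (th + a * t) * expR (- (s * t ^+ 2))) *
      (Num.sqrt (pi / s) ^+ n * expR (- (dotp y y / (4 * s)))).
  under eq_Rintegral => z _ do rewrite dotp_cons gaussw_cons/= addrA mulrCA.
  rewrite RintZl; first by rewrite IH mulrA (mulrC (expR _)).
  apply: (@intgMl _ _ _ _ 1); [exact: measurable_cos_dotp| |exact: intg_gaussw].
  by move=> xi; exact: norm_cos_le1.
under eq_Rintegral => t _ do rewrite E.
rewrite RintZr; last first.
  apply: (@intgMl _ _ _ _ 1); last exact: intg_gauss.
    apply: (mcomp measurable_cos).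
    by apply: measurable_funD => //; apply: mmul.
  by move=> t; exact: norm_cos_le1.
rewrite gauss_fourier_phase// -!mulrA; congr (_ * _).
rewrite exprS -!mulrA; congr (_ * _); rewrite mulrCA; congr (_ * _).
rewrite -expRD -opprD; congr (expR (- _)); by rewrite (mulrDl (a * a)) mulrA.
Qed.

End gaussian_rV.

(** * Cosine and sine transforms of integrable weights *)

Section cosine_transform.
Context {R : realType} {d : nat}.
Local Notation mu := (@lebesgue_rV R d).
Implicit Types (w : 'rV[R]_d -> R) (x v xi : 'rV[R]_d).

(* [costr w x] and [sintr w v x] are, for even [w], the Fourier transform of
   [w] and minus its derivative in the direction [v]. *)
Definition costr w x : R := \int[mu]_xi (cos (dotp x xi) * w xi).

Definition sintr w v x : R := \int[mu]_xi (dotp v xi * sin (dotp x xi) * w xi).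

Lemma measurable_cosd x : meas (fun xi => cos (dotp x xi)).
Proof. by have := measurable_cos_dotp 0 x; under eq_fun do rewrite add0r. Qed.

Lemma measurable_sind x : meas (fun xi => sin (dotp x xi)).
Proof. by have := measurable_sin_dotp 0 x; under eq_fun do rewrite add0r. Qed.

Lemma intg_cosM x w : intg mu w -> intg mu (fun xi => cos (dotp x xi) * w xi).
Proof.
move=> wi; apply: (@intgMl _ _ _ _ 1) => //; first exact: measurable_cosd.
by move=> xi; exact: norm_cos_le1.
Qed.

Lemma intg_enormM v w : intg mu (fun xi => enorm xi * w xi) -> meas w ->
  intg mu (fun xi => enorm v * (enorm xi * `|w xi|)).
Proof.
move=> wi mw; apply: intgZl; have := intg_norm wi.
by apply: eq_integrable => // xi _; rewrite /= normrM (ger0_norm (enorm_ge0 _)).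
Qed.

Lemma sintr_bound v x xi w :
  `|dotp v xi * sin (dotp x xi) * w xi| <= enorm v * (enorm xi * `|w xi|).
Proof.
rewrite !normrM mulrA ler_wpM2r//.
by rewrite -[leRHS]mulr1 ler_pM ?dotp_le// norm_sin_le1.
Qed.

Lemma intg_sinM v x w : intg mu (fun xi => enorm xi * w xi) -> meas w ->
  intg mu (fun xi => dotp v xi * sin (dotp x xi) * w xi).
Proof.
move=> wi mw; apply: intg_le (intg_enormM v wi mw).
  apply: mmul => //; apply: mmul; first exact: measurable_dotp.
  exact: measurable_sind.
by move=> xi; exact: sintr_bound.
Qed.

Lemma is_derive_costr w x v : intg mu w -> intg mu (fun xi => enorm xi * w xi) ->
  is_derive (0 : R) (1 : R) (fun h => costr w (x + h *: v)) (- sintr w v x).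
Proof.
move=> wi ewi; have mw := intg_meas wi.
have -> : - sintr w v x = \int[mu]_xi
   (w xi * (- (dotp v xi * sin (dotp x xi + 0 * dotp v xi)))).
  rewrite /sintr -RintN; last exact: intg_sinM.
  by apply: eq_Rintegral => xi _; rewrite mul0r addr0 mulrN (mulrC (w xi)).
have -> : (fun h => costr w (x + h *: v)) = fun h =>
    \int[mu]_xi (w xi * cos (dotp x xi + h * dotp v xi)).
  apply/funext => h; apply: eq_Rintegral => xi _.
  by rewrite dotpDl dotpZl mulrC.
apply: (@is_derive_Rint _ _ _ mu (fun h xi => w xi * cos (dotp x xi + h * dotp v xi))
  (fun h xi => w xi * (- (dotp v xi * sin (dotp x xi + h * dotp v xi))))
  (fun xi => enorm v * (enorm xi * `|w xi|)) 0 (-1) 1).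
- by apply/andP; split; lra.
- move=> h _; have := intg_cosM (x + h *: v) wi.
  apply: eq_integrable => // xi _ /=.
  by rewrite dotpDl dotpZl mulrC.
- move=> h xi _; have H := is_derive_cos_affine (dotp x xi) (dotp v xi) h.
  rewrite [X in is_derive _ _ X _](_ : _ =
    w xi \*: (fun t => cos (dotp x xi + t * dotp v xi))).
    by apply: is_derive_eq.
  by apply/funext.
- exact: intg_enormM.
- move=> h xi _; rewrite mulrC mulNr normrN.
  have := sintr_bound v (x + h *: v) xi w.
  by rewrite dotpDl dotpZl.
Qed.

Lemma intg_gaussw_enorm s : 0 < s -> intg mu (fun xi => enorm xi * gaussw s xi).
Proof.
move=> s0; have s20 : 0 < s / 2 by lra.
apply: (@intg_le _ _ _ _ _ (fun xi => expR ((2 * s)^-1) * gaussw (s / 2) xi)).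
- apply: mmul; [exact: measurable_enorm|exact: measurable_gaussw].
- move=> xi; rewrite ger0_norm ?mulr_ge0 ?enorm_ge0 ?expR_ge0//.
  rewrite /gaussw -expRD -sqr_enorm.
  apply: (@le_trans _ _ (expR (enorm xi) * expR (- (s * enorm xi ^+ 2)))).
    rewrite ler_wpM2r ?expR_ge0//.
    by have := expR_ge1Dx (enorm xi); lra.
  rewrite -expRD ler_expR.
  have := sqr_ge0 (s * enorm xi - 1); rewrite -(pmulr_lge0 _ (_ : 0 < (2 * s)^-1)) ?invr_gt0; last lra.
  have -> : (s * enorm xi - 1) ^+ 2 * (2 * s)^-1 =
     s / 2 * enorm xi ^+ 2 - enorm xi + (2 * s)^-1 by field; rewrite gt_eqF.
  lra.
- exact/intgZl/intg_gaussw.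
Qed.

Lemma costr_gauss s x : 0 < s ->
  costr (gaussw s) x = Num.sqrt (pi / s) ^+ d * expR (- (dotp x x / (4 * s))).
Proof.
move=> s0; have := gauss_fourier 0 x s0; rewrite cos0 mul1r => <-.
by apply: eq_Rintegral => xi _; rewrite add0r.
Qed.

Lemma is_derive_quad (c c1 c2 : R) :
  is_derive (0 : R) (1 : R) (fun h => c + h * c1 + h ^+ 2 * c2) c1.
Proof.
rewrite [X in is_derive _ _ X _](_ : _ = cst c + c1 \*: (@id R) + c2 \*: (@id R) ^+ 2).
  by apply: is_derive_eq; rewrite /GRing.scale/=; ring.
apply/funext => h; change (c + h * c1 + h ^+ 2 * c2 = c + c1 * h + c2 * ((@id R) ^+ 2) h).
by rewrite exprfctE; ring.
Qed.

(** Read off from the derivative along [v] of the explicit transform [costr_gauss], since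
    [is_derive_costr] identifies [sintr] with minus that derivative. *)
Lemma sintr_gauss s v x : 0 < s ->
  sintr (gaussw s) v x = dotp x v / (2 * s) *
    (Num.sqrt (pi / s) ^+ d * expR (- (dotp x x / (4 * s)))).
Proof.
move=> s0.
have [_ D] := is_derive_costr x v (intg_gaussw d s0) (intg_gaussw_enorm s0).
have -> : sintr (gaussw s) v x = - 'D_1 (fun h : R => costr (gaussw s) (x + h *: v)) 0.
  by rewrite D opprK.
have -> : (fun h : R => costr (gaussw s) (x + h *: v)) = fun h : R =>
   Num.sqrt (pi / s) ^+ d * expR (- ((dotp x x + h * (2 * dotp x v) + h ^+ 2 * dotp v v) / (4 * s))).
  apply/funext => h; rewrite costr_gauss//.
  have -> // : dotp (x + h *: v) (x + h *: v) =
    dotp x x + h * (2 * dotp x v) + h ^+ 2 * dotp v v.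
  by rewrite !(dotpDl, dotpDr, dotpZl, dotpZr) (dotpC v x); ring.
pose c : R := dotp x x; pose c1 : R := 2 * dotp x v; pose c2 : R := dotp v v.
have H : is_derive (0 : R) (1 : R) (fun h => - ((c + h * c1 + h ^+ 2 * c2) / (4 * s))) (- (c1 / (4 * s))).
  have := is_derive_quad (- (c / (4 * s))) (- (c1 / (4 * s))) (- (c2 / (4 * s))).
  congr is_derive; apply/funext => h; rewrite !mulrDl !opprD !mulrN; ring.
have H2 := @is_derive1_comp _ expR _ 0 _ _ (is_derive_expR _) H.
move: H2; rewrite !mul0r expr0n mul0r !addr0 => H2.
have H3 := is_deriveZ (Num.sqrt (pi / s) ^+ d) H2.
have [_ ->] := H3.
rewrite /GRing.scale/= /c1 -/c; field; exact: lt0r_neq0.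
Qed.

End cosine_transform.

Section functionals.
Context {R : realType} {d : nat}.
Local Notation mu := (@lebesgue_rV R d).
Implicit Types (l : (R -> R) -> R) (k : 'rV[R]_d -> R).

Lemma functionalD l1 l2 : functional l1 -> functional l2 ->
  functional (fun phi => l1 phi + l2 phi).
Proof.
move=> [D1 Z1 c1] [D2 Z2 c2]; split.
- by move=> f g bf bg; rewrite D1// D2//; ring.
- by move=> c f bf; rewrite Z1// Z2//; ring.
- move=> f_ f M mf_ mf fM ff; apply: cvgD; [exact: (c1 _ _ M)|exact: (c2 _ _ M)].
Qed.

Lemma functionalZ c l : functional l -> functional (fun phi => c * l phi).
Proof.
move=> [D1 Z1 c1]; split.
- by move=> f g bf bg; rewrite D1//; ring.
- by move=> c' f bf; rewrite Z1//; ring.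
- by move=> f_ f M mf_ mf fM ff; apply: cvgMl_tmp; exact: (c1 _ _ M).
Qed.

Lemma functional_eval (x : R) : 0 <= x -> functional (fun phi => phi x).
Proof. by move=> x0; split => // f_ f M _ _ _ ff; exact: ff. Qed.

Lemma intg_kbm k (phi : R -> R) : intg mu k -> bm phi ->
  intg mu (fun xi => k xi * phi (dotp xi xi)).
Proof.
move=> ik [mf [M fM]]; apply: (@intgMr _ _ _ _ M) => //.
  by apply: mcomp => //; exact: measurable_fun_dotp.
by move=> xi; rewrite fM// dotpp_ge0.
Qed.

Lemma functional_int k : intg mu k ->
  functional (fun phi => \int[mu]_xi (k xi * phi (dotp xi xi))).
Proof.
move=> ik; split.
- move=> f g bf bg; rewrite -RintD; [|exact: intg_kbm|exact: intg_kbm].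
  by apply: eq_Rintegral => xi _; rewrite mulrDr.
- move=> c f bf; rewrite -RintZl; last exact: intg_kbm.
  by apply: eq_Rintegral => xi _; rewrite mulrCA.
- move=> f_ f M mf_ mf fM ff.
  have mk := intg_meas ik.
  have [] // := @dct _ _ _ mu (fun n xi => k xi * f_ n (dotp xi xi))
    (fun xi => k xi * f (dotp xi xi)) (fun xi => M * `|k xi|).
  + move=> n; apply: mmul => //.
    by apply: mcomp => //; exact: measurable_fun_dotp.
  + by move=> xi; apply: cvgMl_tmp; apply: ff; exact: dotpp_ge0.
  + exact/intgZl/intg_norm.
  + by move=> n xi; rewrite normrM mulrC ler_wpM2r// fM// dotpp_ge0.
Qed.

End functionals.

Section exponential_weight.
Context {R : realType}.

Lemma intg_exp_abs (c : R) : 0 < c -> intg (@lebesgue_measure R) (fun x => expR (- (c * `|x|))).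
Proof.
move=> c0; have i1 := integrable_exponential_pdf c0.
have i2 : intg (@lebesgue_measure R) (fun x => exponential_pdf c (- x)).
  apply: (@intg_transfer _ _ _ (@lebesgue_measure R) -%R 1) => //.
  by move=> g mg g0; rewrite mul1e; exact: ge0_integralN1.
apply: intg_le (intgZl c^-1 (intgD i1 i2)).
  apply: (mcomp (@measurable_expR R)).
  apply: (mcomp (@oppr_measurable R setT)).
  by apply: mmul => //; exact: measurable_normr.
move=> x; rewrite ger0_norm ?expR_ge0//.
have e0 (y : R) : 0 <= exponential_pdf c y by apply: exponential_pdf_ge0; exact: ltW.
have [x0|x0] := leP 0 x.
  apply: (@le_trans _ _ (c^-1 * exponential_pdf c x)).
    by rewrite exponential_pdfE//= ger0_norm// mulNr mulKf// gt_eqF.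
  by rewrite ler_wpM2l ?invr_ge0 ?(ltW c0)// lerDl.
apply: (@le_trans _ _ (c^-1 * exponential_pdf c (- x))).
  rewrite exponential_pdfE; last by rewrite oppr_ge0 ltW.
  by rewrite /= ltr0_norm// mulNr mulKf// gt_eqF.
by rewrite ler_wpM2l ?invr_ge0 ?(ltW c0)// lerDr.
Qed.

Definition l1exp n (c : R) (xi : 'rV[R]_n) : R := expR (- (c * \sum_i `|xi ord0 i|)).

Lemma measurable_l1exp n c : meas (@l1exp n c).
Proof.
apply: mcomp => //; apply: mcomp => //.
apply: mmul => //; apply: measurable_sum => i.
by apply: mcomp => //; exact: measurable_coord_rV.
Qed.

Lemma inte_l1exp n (c : R) : 0 < c ->
  (\int[lebesgue_rV n]_x (l1exp c x)%:E < +oo)%E.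
Proof.
move=> c0; elim: n => [|n IH].
  have mg : meas (EFin \o @l1exp 0 c).
    by apply/measurable_EFinP; exact: measurable_l1exp.
  by rewrite /= (integral_dirac _ _ mg)// diracT mul1e ltry.
rewrite ge0_integral_rVS; last 2 first.
- by apply/measurable_EFinP; exact: measurable_l1exp.
- by move=> x; rewrite lee_fin expR_ge0.
have I0 : (0 <= \int[lebesgue_rV n]_x (l1exp c x)%:E)%E.
  by apply: inte_ge0 => x; exact: expR_ge0.
have [r r0 rE] : exists2 r : R, 0 <= r & (\int[lebesgue_rV n]_x (l1exp c x)%:E = r%:E)%E.
  by move: IH I0; case: integral => [r| |]// _; rewrite lee_fin => r0; exists r.
have E (a : measurableTypeR R) : (\int[lebesgue_rV n]_x (l1exp c (cons_rV (a, x)))%:E =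
    (r * expR (- (c * `|a : R|)))%:E)%E.
  have H x : l1exp c (cons_rV (a, x)) = expR (- (c * `|a : R|)) * l1exp c x.
    rewrite /l1exp big_ord_recl cons_rV0 mulrDr opprD expRD; congr (_ * expR (- (c * _))).
    by apply: eq_bigr => i _; rewrite cons_rVS.
  under eq_integral do rewrite H.
  rewrite (inteZl _ (@measurable_l1exp n c)) ?expR_ge0//; last first.
    by move=> x; exact: expR_ge0.
  by rewrite rE -EFinM mulrC.
under eq_integral do rewrite E.
have := intg_ltyr (intgZl r (intg_exp_abs c0)).
by [].
Qed.

Lemma coord_le_enorm n (x : 'rV[R]_n) i : `|x ord0 i| <= enorm x.
Proof.
rewrite -sqrtr_sqr ler_sqrt ?dotpp_ge0// /dotp (bigD1 i)//= -expr2 lerDl.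
by apply: sumr_ge0 => j _; rewrite -expr2 sqr_ge0.
Qed.

Lemma intg_exp_enorm n (c : R) : 0 < c ->
  intg (lebesgue_rV n) (fun xi => expR (- (c * enorm xi))).
Proof.
(* The sum of the absolute coordinates is at most [n * enorm x]; dividing by [n.+1] rather than [n]
   also covers dimension 0. *)
move=> c0; have c'0 : 0 < c / n.+1%:R by rewrite divr_gt0.
have i1 : intg (lebesgue_rV n) (l1exp (c / n.+1%:R)).
  apply: intgP; first exact: measurable_l1exp.
  under eq_integral do rewrite (ger0_norm (expR_ge0 _)).
  exact: inte_l1exp.
apply: intg_le i1.
  apply: (mcomp (@measurable_expR R)).
  apply: mcomp => //; apply: mmul => //.
  exact: measurable_enorm.
move=> x; rewrite ger0_norm ?expR_ge0// ler_expR lerN2 -mulrA ler_wpM2l ?(ltW c0)//.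
rewrite mulrC ler_pdivrMr//.
apply: (@le_trans _ _ (\sum_(i < n) enorm x)).
  by apply: ler_sum => i _; exact: coord_le_enorm.
rewrite sumr_const card_ord -[X in X <= _]mulr_natr.
by apply: ler_wpM2l; rewrite ?enorm_ge0// ler_nat.
Qed.

End exponential_weight.

(** * Scalar inequalities that carry Gaussian bounds over to the stable kernel *)

Section elementary_bounds.
Context {R : realType}.
Implicit Types (y : R) (m : nat).

Lemma expR_ge_pow (n : nat) (x : R) : 0 <= x -> (x / n.+1%:R) ^+ n.+1 <= expR x.
Proof.
move=> x0; have -> : x = n.+1%:R * (x / n.+1%:R) by rewrite mulrCA divff ?mulr1// pnatr_eq0.
rewrite [X in (X / _) ^+ _]mulrC mulfK ?pnatr_eq0// expRM_natl.
apply: lerXn2r; rewrite ?nnegrE ?expR_ge0 ?divr_ge0//.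
by move: (x / _) => z; have := expR_ge1Dx z; lra.
Qed.

Lemma one_sub_expN_ge (u : R) : 0 <= u -> u / (1 + u) <= 1 - expR (- u).
Proof.
move=> u0; rewrite expRN; have H := expR_ge1Dx u; have p : 0 < 1 + u by lra.
have -> : u / (1 + u) = 1 - (1 + u)^-1 by field; lra.
by rewrite lerD2l lerN2 lef_pV2 ?posrE ?expR_gt0.
Qed.

Lemma one_sub_expN_le (u : R) : 1 - expR (- u) <= u.
Proof. by have := expR_ge1Dx (- u); lra. Qed.

Lemma expN_le1 (u : R) : 0 <= u -> expR (- u) <= 1.
Proof. by move=> u0; rewrite expR_le1 oppr_le0. Qed.

(* [gpro m (X / s)] is [s^(-m/2) e^(-X/(4s))] up to a power of [X]. *)
Definition gpro m y : R := Num.sqrt y ^+ m * expR (- (y / 4)).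

Lemma gpro_ge0 m y : 0 <= gpro m y.
Proof. by rewrite mulr_ge0 ?exprn_ge0 ?sqrtr_ge0 ?expR_ge0. Qed.

(** With [y = X / s] the right side is [C * (dexp s 0 - dexp s X^-1)], a combination of point
    evaluations. For the stable symbol the same combination is [C * (1 - exp (- X^(-alpha/2)))], of
    order [X^(-alpha/2)]: this is where the polynomial tail comes from. *)
Lemma gpro_upper m : exists2 C : R, 0 < C &
  forall y, 0 < y -> gpro m y <= C * (1 - expR (- y^-1)).
Proof.
pose C : R := (4 * m.+1%:R) ^+ m.+1 * expR (4^-1).
exists C; first by rewrite mulr_gt0 ?expR_gt0// exprn_gt0// mulr_gt0.
move=> y y0; have y1 : 0 < 1 + y by lra.
have H1 : (1 + y)^-1 <= 1 - expR (- y^-1).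
  have := one_sub_expN_ge (u := y^-1); rewrite invr_ge0 (ltW y0) => /(_ isT).
  by apply: le_trans; apply: eq_leW; field; lra.
apply: (@le_trans _ _ (C * (1 + y)^-1)); last first.
  by rewrite ler_wpM2l// mulr_ge0 ?expR_ge0// exprn_ge0// mulr_ge0.
rewrite ler_pdivlMr// /gpro.
have sy : Num.sqrt y <= 1 + y.
  have := sqr_sqrtr (ltW y0); have := sqr_ge0 (Num.sqrt y - 1).
  have := sqrtr_ge0 y; nra.
apply: (@le_trans _ _ ((1 + y) ^+ m.+1 * expR (- (y / 4)))).
  rewrite exprSr mulrAC ler_wpM2r ?expR_ge0// ler_wpM2r ?(ltW y1)//.
  by apply: lerXn2r; rewrite ?nnegrE ?sqrtr_ge0 ?(ltW y1).
have := @expR_ge_pow m ((1 + y) / 4); rewrite divr_ge0 ?(ltW y1)// => /(_ isT) H.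
have -> : (1 + y) ^+ m.+1 = (4 * m.+1%:R) ^+ m.+1 * ((1 + y) / 4 / m.+1%:R) ^+ m.+1.
  by rewrite -exprMn; congr (_ ^+ _); field; rewrite nat1r pnatr_eq0.
rewrite /C -mulrA ler_wpM2l ?exprn_ge0 ?mulr_ge0//.
apply: le_trans (ler_wpM2r (expR_ge0 (- (y / 4))) H) _.
by rewrite -expRD ler_expR; lra.
Qed.

(** For [y = X / s] this is a combination of values of [dexp s] at [0], [1/X], [th/X] and [T/X]. It
    is at most 1, and nonpositive outside []th, T[]. For the stable symbol the two subtracted terms
    scale like [th^(alpha/2)] and [T^(alpha/2 - 1)], so they are small for [th] small and [T]
    large. *)
Definition probe (th T y : R) : R := (1 - expR (- y^-1)) - 2 * (1 - expR (- (th / y)))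
  - 2 / T * (1 - expR (- (T / y))).

(** Outside []th, T[] the probe is nonpositive; inside it is at most 1, and [c] is a lower bound for
    [gpro m] there. *)
Lemma gpro_lower m (th T : R) : 0 < th -> 0 < T ->
  exists2 c : R, 0 < c & forall y, 0 < y -> c * probe th T y <= gpro m y.
Proof.
move=> th0 T0; pose c : R := Num.sqrt th ^+ m * expR (- (T / 4)).
have c0 : 0 < c by rewrite mulr_gt0 ?expR_gt0// exprn_gt0// sqrtr_gt0.
exists c => // y y0.
have e1 u : 0 <= u -> 0 <= 1 - expR (- u) :> R by move=> u0; rewrite subr_ge0 expN_le1.
have yi : 0 <= y^-1 by rewrite invr_ge0 ltW.
have thy : 0 <= th / y by rewrite divr_ge0 ?ltW.
have Ty : 0 <= T / y by rewrite divr_ge0 ?ltW.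
have T2 : 0 <= 2 / T by rewrite divr_ge0 ?ltW.
have [Ty1|yT] := leP T y.
  suff p0 : probe th T y <= 0 by rewrite (le_trans _ (gpro_ge0 _ _))// mulr_ge0_le0 ?(ltW c0).
  have H1 := one_sub_expN_le y^-1.
  have H2 : y^-1 <= 2 / T * (1 - expR (- (T / y))).
    apply: (@le_trans _ _ (2 / T * (T / y / (1 + T / y)))); last first.
      by rewrite ler_wpM2l// one_sub_expN_ge.
    have -> : 2 / T * (T / y / (1 + T / y)) = 2 * y^-1 / (1 + T / y).
      by field; rewrite !gt_eqF//; lra.
    have Ty2 : T / y <= 1 by rewrite ler_pdivrMr// mul1r.
    by rewrite ler_pdivlMr; [nra|lra].
  have := e1 _ thy; rewrite /probe; lra.
have [yth|thy1] := leP y th.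
  suff p0 : probe th T y <= 0 by rewrite (le_trans _ (gpro_ge0 _ _))// mulr_ge0_le0 ?(ltW c0).
  have H2 : 2^-1 <= 1 - expR (- (th / y)).
    apply: (le_trans _ (one_sub_expN_ge thy)).
    have : 1 <= th / y by rewrite ler_pdivlMr// mul1r.
    by move=> ?; rewrite ler_pdivlMr; lra.
  have H3 : 0 <= 2 / T * (1 - expR (- (T / y))) by rewrite mulr_ge0// e1.
  have := expR_ge0 (- y^-1); rewrite /probe; lra.
apply: (@le_trans _ _ (c * 1)).
  rewrite ler_wpM2l ?(ltW c0)//.
  have H3 : 0 <= 2 / T * (1 - expR (- (T / y))) by rewrite mulr_ge0// e1.
  have := e1 _ thy; have := expR_ge0 (- y^-1); rewrite /probe; lra.
rewrite mulr1 /c /gpro ler_pM ?expR_ge0 ?exprn_ge0 ?sqrtr_ge0//.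
  by apply: lerXn2r; rewrite ?nnegrE ?sqrtr_ge0// ler_sqrt// ltW.
by rewrite ler_expR lerN2 ler_wpM2r// ltW.
Qed.

End elementary_bounds.

Section integral_complements.
Context {disp : measure_display} {T : measurableType disp} {R : realType}.
Variable mu : {measure set T -> \bar R}.

Lemma fatou_le (f_ : nat -> T -> R) (f : T -> R) (M : \bar R) :
  (forall n, meas (f_ n)) -> (forall n x, 0 <= f_ n x) ->
  (forall x, f_ n x @[n --> \oo] --> f x) ->
  (forall n, (\int[mu]_x (f_ n x)%:E <= M)%E) -> (\int[mu]_x (f x)%:E <= M)%E.
Proof.
move=> mf f0 ff fM.
have E x : (f x)%:E = limn_einf (fun n => (f_ n x)%:E).
  have h : (f_ n x)%:E @[n --> \oo] --> (f x)%:E.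
    by apply: cvg_EFin; [near=> n | exact: ff].
  by rewrite (cvg_limn_einf_sup h).1.
under eq_integral do rewrite E.
apply: le_trans (fatou mu measurableT _ _) _.
- by move=> n; apply/measurable_EFinP; exact: mf.
- by move=> n x _; rewrite lee_fin.
rewrite limn_einf_lim; apply: lime_le; first exact: is_cvg_einfs.
by apply: nearW => n; apply: le_trans (fM n); apply: ereal_inf_lbound; exists n => /=.
Unshelve. all: by end_near. Qed.

End integral_complements.

Lemma intg_tensor {R : realType} (d1 d2 : measure_display) (T1 : measurableType d1)
    (T2 : measurableType d2) (m1 : {sigma_finite_measure set T1 -> \bar R})
    (m2 : {sigma_finite_measure set T2 -> \bar R}) (f : T1 -> R) (g : T2 -> R)
    (h : T1 -> T2 -> R) : meas (uncurry h) ->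
  (forall x y, `|h x y| <= f x * g y) -> intg m1 f -> intg m2 g ->
  intg (m1 \x m2)%E (uncurry h).
Proof.
move=> mh hfg fi gi; apply: intg_prod => //.
have mf := intg_meas fi; have mg := intg_meas gi.
apply: (@le_lt_trans _ _ (\int[m1]_x (`|f x|%:E * \int[m2]_y `|g y|%:E)))%E.
  apply: ge0_le_integral => //.
  - by move=> x _; apply: inte_ge0.
  - apply: (@measurable_inte _ _ _ _ _ m2 (fun x y => `|h x y|)) => //.
    by rewrite (_ : uncurry _ = fun p => `|uncurry h p|); [exact: mcomp|apply/funext => -[]].
  - apply: emeasurable_funM => //; apply/measurable_EFinP; exact: mcomp.
  - move=> x _; rewrite -inteZl//; last exact: mcomp.
    apply: le_inte => //.
    + by apply: mcomp => //; exact: (measurable_uncurry1 x mh).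
    + by apply: mmul => //; exact: mcomp.
    + move=> y; apply: (le_trans (hfg x y)).
      by rewrite -normrM ler_norm.
have g0 : (0 <= \int[m2]_y `|g y|%:E)%E by apply: inte_ge0.
have := intg_lty gi; move: g0; case: (\int[m2]_y `|g y|%:E)%E => [r| |]// r0 _.
rewrite ge0_integralZr//; last by apply/measurable_EFinP; exact: mcomp.
have := intg_lty fi; move: (@inte_ge0 _ _ _ m1 _ (fun x => normr_ge0 (f x))).
by case: (\int[m1]_x `|f x|%:E)%E => [a| |]//= _ _; rewrite -EFinM ltry.
Qed.

Lemma cvg_powR {R : realType} (u : nat -> R) (l a : R) : 0 < a ->
  (forall n, 0 <= u n) -> 0 <= l -> u n @[n --> \oo] --> l ->
  u n `^ a @[n --> \oo] --> l `^ a.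
Proof.
move=> a0 u0 l0 ul; have [l1|] := ltP 0 l.
  have ca : {for l, continuous (fun x : R => x `^ a)}.
    have [ex _] := is_derive1_powR a l1.
    by apply/differentiable_continuous/derivable1_diffP.
  exact: (cvg_comp u _ ul ca).
move=> l1; have {l1 l0}lE : l = 0 by apply/eqP; rewrite eq_le l0 l1.
subst l.
rewrite powR0 ?gt_eqF//; apply/cvgr0Pnorm_le => e e0.
have ea : 0 < e `^ a^-1 by exact: powR_gt0.
move/cvgr0Pnorm_le : ul => /(_ _ ea); apply: filterS => n.
rewrite !ger0_norm ?powR_ge0// => H.
have -> : e = (e `^ a^-1) `^ a by rewrite -powRrM mulVf ?gt_eqF// powRr1// ltW.
by apply: ge0_ler_powR; [exact: ltW|rewrite nnegrE|rewrite nnegrE ltW|].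
Qed.

(** * Singular time integrals *)

Section time_weights.
Context {R : realType}.
Local Notation leb := (@lebesgue_measure R).
Implicit Types (a s t r : R).

(** A numerical indicator of the open interval: time integrals run over the whole line with this
    factor, so Tonelli and changes of variables apply without restricted domains. *)
Definition oi a t s : R := ((a < s) && (s < t))%:R.

Lemma oi_ge0 a t s : 0 <= oi a t s. Proof. exact: ler0n. Qed.

Lemma oi_le1 a t s : oi a t s <= 1. Proof. by rewrite /oi; case: (_ && _). Qed.

Lemma oiT a t s : a < s -> s < t -> oi a t s = 1. Proof. by rewrite /oi => -> ->. Qed.

Lemma oi_le a t s (x y : R) : (a < s -> s < t -> x <= y) -> oi a t s * x <= oi a t s * y.
Proof.
move=> H; rewrite /oi; case: ltP => [l1|_]; last by rewrite !mul0r.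
case: ltP => [l2|_]; last by rewrite !mul0r.
by rewrite !mul1r; exact: H.
Qed.

Lemma oi_eq a t s (x y : R) : (a < s -> s < t -> x = y) -> oi a t s * x = oi a t s * y.
Proof. by move=> H; apply/eqP; rewrite eq_le; apply/andP; split; apply: oi_le => ? ?; rewrite H. Qed.

Lemma oi_norm a t s (x : R) : `|oi a t s * x| = oi a t s * `|x|.
Proof. by rewrite normrM ger0_norm ?oi_ge0. Qed.

Lemma measurable_oi a t : meas (oi a t).
Proof.
rewrite (_ : oi a t = \1_(`]a, t[%classic)); last first.
  by apply/funext => s; rewrite /oi indicE mem_setE in_itv.
exact: measurable_indic.
Qed.

Lemma inte_affine1 (c u : R) (f : R -> R) : 0 < c -> meas f -> (forall s, 0 <= f s) ->
  (c%:E * \int[leb]_s (f (c * s + u))%:E = \int[leb]_s (f s)%:E)%E.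
Proof.
move=> c0 mf f0; apply: (ge0_integral_affine1 u c0 (f := EFin \o f)).
  by apply/measurable_EFinP.
by move=> s; rewrite lee_fin.
Qed.

Lemma inte_reflect (r : R) (f : R -> R) : meas f -> (forall s, 0 <= f s) ->
  (\int[leb]_s (f (r - s))%:E = \int[leb]_s (f s)%:E)%E.
Proof.
move=> mf f0.
have mg : meas (fun s => f (s + r)).
  by apply: mcomp => //; apply: measurable_funD.
have H := @ge0_integralN1 R (fun s => (f (s + r))%:E).
have {}H : (\int[leb]_s (f (- s + r))%:E = \int[leb]_s (f (s + r))%:E)%E.
  by apply: H; [apply/measurable_EFinP|move=> s; rewrite lee_fin].
have := inte_affine1 r ltr01 mf f0; rewrite mul1e.
under [X in X = _ -> _]eq_integral do rewrite mul1r.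
by move=> <-; rewrite -H; apply: eq_integral => s _; rewrite addrC.
Qed.

Lemma measurable_oipow r a : meas (fun s => oi 0 r s * s `^ a).
Proof. by apply: mmul; [exact: measurable_oi|exact: measurable_powR]. Qed.

Lemma inte_oi a t : a <= t -> (\int[leb]_s (oi a t s)%:E = (t - a)%:E)%E.
Proof.
move=> at_; have E s : (oi a t s)%:E = (\1_(`]a, t[%classic) s)%:E :> \bar R.
  by rewrite /oi indicE mem_setE in_itv.
under eq_integral do rewrite E.
rewrite integral_indic//= setIT.
rewrite lebesgue_measure_itv/= lte_fin; case: ltP => [_|ta]; first by rewrite EFinB.
by have /eqP -> : a == t; rewrite ?subrr// eq_le at_ ta.
Qed.

(** Dyadic recursion on the truncations at [2^-n]: the part below [1/2] is the previous truncation
    rescaled, with factor [q = 2^(a-1) < 1], and the part above is at most [2^a]. The bound [K] is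
    the fixed point of [I |-> q I + 2^a]; Fatou removes the truncation. *)
Lemma inte_oipow_unit a : 0 <= a < 1 -> exists2 K : R, 0 < K &
  (\int[leb]_s (oi 0 1 s * s `^ (- a))%:E <= K%:E)%E.
Proof.
case/andP => a0 a1; pose q : R := 2 `^ (a - 1); pose K : R := 2 `^ a / (1 - q).
have p2 : 0 < 2 `^ a :> R by exact: powR_gt0.
have q0 : 0 < q by exact: powR_gt0.
have qE : q = 2 `^ a / 2.
  by rewrite /q powRD; [rewrite powR_inv1|rewrite pnatr_eq0 implybT].
have q1 : q < 1.
  by rewrite /q /powR pnatr_eq0/= expR_lt1 nmulr_rlt0 ?ln_gt0 ?ltr1n// subr_lt0.
have K0 : 0 < K by rewrite divr_gt0// subr_gt0.
have KE : q * K + 2 `^ a = K by rewrite /K; field; rewrite gt_eqF// subr_gt0.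
exists K => //.
pose f n s := oi (2 ^- n) 1 s * s `^ (- a).
have f0 n s : 0 <= f n s by rewrite mulr_ge0 ?oi_ge0 ?powR_ge0.
have mf n : meas (f n).
  by apply: mmul; [exact: measurable_oi|exact: measurable_powR].
apply: (@fatou_le _ _ _ leb f) => [n|n s|s|n]; [exact: mf|exact: f0| |].
  have [s0|s0] := leP s 0.
    apply: cvg_near_cst; apply: nearW => n; rewrite /f /oi (le_gtF s0) mul0r.
    by rewrite (le_gtF (le_trans s0 _)) ?mul0r// invr_ge0 exprn_ge0.
  have c : (2 ^- n : R) @[n --> \oo] --> (0 : R).
    rewrite [X in X @ _ --> _](_ : _ = (fun n => 2^-1 ^+ n)); last by apply/funext => n; rewrite exprVn.
    by apply: cvg_expr; rewrite ger0_norm// invf_lt1// ltr1n.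
  apply: cvg_near_cst.
  near=> n; rewrite /f /oi s0; congr ((_ && _)%:R * _).
  by near: n; exact: (cvgr_lt _ c _ s0).
elim: n => [|n IH].
  have E s : f 0%N s = 0.
    by rewrite /f /oi expr0 invr1; case: ltgtP => //= *; rewrite mul0r.
  by under eq_integral do rewrite E; rewrite integral0 lee_fin ltW.
have mg : meas (fun s => f n (2 * s + 0)).
  by apply: mcomp => //; apply: measurable_funD => //; exact: mmul.
apply: (@le_trans _ _ (\int[leb]_s (2 `^ a * f n (2 * s + 0) + 2 `^ a * oi 0 1 s)%:E)%E).
  apply: le_inte => //; first exact: (mf n.+1).
    apply: measurable_funD; apply: mmul => //; exact: measurable_oi.
  move=> s; have h1 : 0 <= 2 `^ a * f n (2 * s + 0) by rewrite mulr_ge0// ltW.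
  have h2 : 0 <= 2 `^ a * oi 0 1 s by rewrite mulr_ge0 ?oi_ge0// ltW.
  rewrite {1}/f {1}/oi; case: ltP => [l1|_]; last by rewrite mul0r addr_ge0.
  case: ltP => [l2|_]; last by rewrite mul0r addr_ge0.
  have s0 : 0 < s by apply: lt_trans l1; rewrite invr_gt0 exprn_gt0.
  rewrite mul1r; have [l3|l3] := ltP s 2^-1.
    apply: (@le_trans _ _ (2 `^ a * f n (2 * s + 0))); last by rewrite lerDl.
    rewrite addr0 /f oiT.
    - by rewrite mul1r powRM ?(ltW s0)// mulrA -powRD ?subrr ?powRr0 ?mul1r// pnatr_eq0 implybT.
    - by move: l1; rewrite exprS invfM mulrC ltr_pdivrMr// mulrC.
    - by rewrite mulrC -ltr_pdivlMr// mul1r.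
  apply: (@le_trans _ _ (2 `^ a * oi 0 1 s)); last by rewrite lerDr.
  rewrite oiT// mulr1 powRN; rewrite -[leRHS]invrK lef_pV2 ?posrE ?invr_gt0 ?powR_gt0//.
  have -> : (2 `^ a)^-1 = 2^-1 `^ a :> R by rewrite -powRN -[in RHS](powR_inv1 (ltW (ltr0n R 2))) -powRrM mulN1r.
  by apply: ge0_ler_powR => //; rewrite nnegrE ?invr_ge0// ltW.
rewrite inteD//; last 3 first.
- by apply: mmul => //; exact: measurable_oi.
- by move=> s; rewrite mulr_ge0// ltW.
- by move=> s; rewrite mulr_ge0 ?oi_ge0// ltW.
- rewrite inteZl; [|exact: mg|by move=> s; exact: f0|exact: ltW].
  rewrite inteZl; [|exact: measurable_oi|by move=> s; exact: oi_ge0|exact: ltW].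
  rewrite inte_oi// subr0 mule1.
  have H := inte_affine1 0 (ltr0n R 2) (mf n) (f0 n).
  have I0 : (0 <= \int[leb]_s (f n (2 * s + 0))%:E)%E by apply: inte_ge0.
  move: IH; rewrite -H; case: (\int[leb]_s (f n (2 * s + 0))%:E)%E I0 => [r| |] //.
    move=> r0; rewrite (_ : 2%:E * r%:E = (2 * r)%:E)%E // lee_fin => rK.
    rewrite -EFinM -EFinD lee_fin -KE qE lerD2r -mulrA ler_wpM2l ?(ltW p2)//.
    by rewrite ler_pdivlMl.
  by rewrite gt0_muley.
- by apply: mmul => //.
Unshelve. all: by end_near. Qed.

Lemma inte_oipow a : 0 <= a < 1 -> exists2 K : R, 0 < K & forall r, 0 < r ->
  (\int[leb]_s (oi 0 r s * s `^ (- a))%:E <= (K * r `^ (1 - a))%:E)%E.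
Proof.
move=> a01; have [K K0 HK] := inte_oipow_unit a01; exists K => // r r0.
have H := inte_affine1 0 r0 (measurable_oipow r (- a)) (fun s => mulr_ge0 (oi_ge0 0 r s) (powR_ge0 s (- a))).
rewrite -H.
have E s : oi 0 r (r * s + 0) * (r * s + 0) `^ (- a) = r `^ (- a) * (oi 0 1 s * s `^ (- a)).
  rewrite addr0 mulrCA; have -> : oi 0 r (r * s) = oi 0 1 s.
    by rewrite /oi pmulr_rgt0// -{2}(mulr1 r) ltr_pM2l.
  by apply: oi_eq => s0 _; rewrite powRM// ltW.
under eq_integral do rewrite E.
rewrite inteZl ?powR_ge0//; [|exact: measurable_oipow|by move=> s; rewrite mulr_ge0 ?oi_ge0 ?powR_ge0].
rewrite muleA -EFinM -[in X in X * _](powRr1 (ltW r0)) -powRD ?(gt_eqF r0) ?implybT//.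
by rewrite (mulrC K) EFinM lee_wpmul2l// lee_fin powR_ge0.
Qed.

Lemma inte_oipow_rev a : 0 <= a < 1 -> exists2 K : R, 0 < K & forall tau t, tau < t ->
  (\int[leb]_s (oi tau t s * (t - s) `^ (- a))%:E <= (K * (t - tau) `^ (1 - a))%:E)%E.
Proof.
move=> a01; have [K K0 HK] := inte_oipow a01; exists K => // tau t tt.
have := HK (t - tau); rewrite subr_gt0 => /(_ tt); apply: le_trans.
have H := inte_reflect t (measurable_oipow (t - tau) (- a))
  (fun s => mulr_ge0 (oi_ge0 0 (t - tau) s) (powR_ge0 s (- a))).
rewrite -H.
apply: eq_leW; apply: eq_integral => s _.
congr (_ * _)%:E; rewrite /oi subr_gt0 ltrD2l ltrN2 andbC//.
Qed.

Lemma measurable_oipow_rev tau t a : meas (fun s => oi tau t s * (t - s) `^ a).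
Proof.
apply: mmul; first exact: measurable_oi.
by apply: (mcomp (measurable_powR a)); exact: measurable_funB.
Qed.

(** The exponents add up to -1, so the bound is independent of [r]: this is the scale invariance of
    the Duhamel term at the critical power. Splitting at [r / 2] freezes whichever factor is not
    singular there. *)
Lemma inte_oibeta a : 0 < a < 1 -> exists2 K : R, 0 < K & forall r, 0 < r ->
  (\int[leb]_s (oi 0 r s * ((r - s) `^ (- a) * s `^ (- (1 - a))))%:E <= K%:E)%E.
Proof.
case/andP => a0 a1; have h1 : 0 <= a < 1 by rewrite (ltW a0).
have h2 : 0 <= 1 - a < 1 by apply/andP; split; lra.
have [K K0 HK] := inte_oipow_rev h1; have [L L0 HL] := inte_oipow h2.
pose c1 : R := 2^-1 `^ (- a); pose c2 : R := 2^-1 `^ (- (1 - a)).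
have c10 : 0 < c1 by exact: powR_gt0.
have c20 : 0 < c2 by exact: powR_gt0.
exists (c1 * L + c2 * K); first by rewrite addr_gt0// mulr_gt0.
move=> r r0.
have r2 e : (r / 2) `^ e = 2^-1 `^ e * r `^ e.
  by rewrite mulrC powRM ?(ltW r0)// invr_ge0.
have dec (x y : R) e : 0 <= e -> 0 < x -> x <= y -> y `^ (- e) <= x `^ (- e).
  move=> e0 x0 xy; rewrite !powRN lef_pV2 ?posrE ?powR_gt0//; last exact: lt_le_trans xy.
  by apply: ge0_ler_powR => //; rewrite nnegrE ?ltW//; exact: lt_le_trans xy.
apply: (@le_trans _ _ (\int[leb]_s (c1 * r `^ (- a) * (oi 0 r s * s `^ (- (1 - a))) +
    c2 * r `^ (- (1 - a)) * (oi 0 r s * (r - s) `^ (- a)))%:E)%E).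
  apply: le_inte.
  - apply: mmul; first exact: measurable_oi.
    apply: mmul; last exact: measurable_powR.
    by apply: (mcomp (measurable_powR _)); exact: measurable_funB.
  - apply: measurable_funD; apply: mmul => //; [exact: measurable_oipow|exact: measurable_oipow_rev].
  - by move=> s; rewrite !mulr_ge0 ?oi_ge0 ?powR_ge0.
  - move=> s.
    have -> : c1 * r `^ (- a) * (oi 0 r s * s `^ (- (1 - a))) + c2 * r `^ (- (1 - a)) * (oi 0 r s * (r - s) `^ (- a)) =
      oi 0 r s * (c1 * (r `^ (- a) * s `^ (- (1 - a))) + c2 * (r `^ (- (1 - a)) * (r - s) `^ (- a))) by ring.
    apply: oi_le => s0 sr.
    have p (x e : R) : 0 <= x `^ e by exact: powR_ge0.
    have [l|l] := leP s (r / 2).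
      apply: (@le_trans _ _ (c1 * (r `^ (- a) * s `^ (- (1 - a))))); last first.
        by rewrite lerDl !mulr_ge0// ltW.
      by rewrite mulrA ler_wpM2r// -r2; apply: dec; [exact: ltW|exact: divr_gt0|lra].
    apply: (@le_trans _ _ (c2 * (r `^ (- (1 - a)) * (r - s) `^ (- a)))); last first.
      by rewrite lerDr !mulr_ge0// ltW.
    by rewrite mulrC mulrA ler_wpM2r// -r2; apply: dec; [lra|exact: divr_gt0|exact: ltW].
have q1 : 0 <= c1 * r `^ (- a) by rewrite mulr_ge0 ?powR_ge0.
have q2 : 0 <= c2 * r `^ (- (1 - a)) by rewrite mulr_ge0 ?powR_ge0.
have g1 s : 0 <= oi 0 r s * s `^ (- (1 - a)) by rewrite mulr_ge0 ?oi_ge0 ?powR_ge0.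
have g2 s : 0 <= oi 0 r s * (r - s) `^ (- a) by rewrite mulr_ge0 ?oi_ge0 ?powR_ge0.
have m1 := measurable_oipow r (- (1 - a)); have m2 := measurable_oipow_rev 0 r (- a).
rewrite inteD; [|exact: mmul|exact: mmul|by move=> s; exact: mulr_ge0|by move=> s; exact: mulr_ge0].
rewrite inteZl// inteZl// EFinD; apply: leeD.
  apply: le_trans (lee_wpmul2l _ (HL r r0)) _; first by rewrite lee_fin.
  rewrite -EFinM lee_fin subKr.
  have -> : c1 * r `^ (- a) * (L * r `^ a) = c1 * L * (r `^ (- a) * r `^ a) by ring.
  by rewrite -powRD ?addNr ?powRr0 ?mulr1// (gt_eqF r0) implybT.
have := HK 0 r r0; rewrite subr0 => HK0.
apply: le_trans (lee_wpmul2l _ HK0) _; first by rewrite lee_fin.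
rewrite -EFinM lee_fin.
have -> : c2 * r `^ (- (1 - a)) * (K * r `^ (1 - a)) = c2 * K * (r `^ (- (1 - a)) * r `^ (1 - a)) by ring.
by rewrite -powRD ?addNr ?powRr0 ?mulr1// (gt_eqF r0) implybT.
Qed.

Lemma intg_oipow a r : 0 <= a < 1 -> intg leb (fun s => oi 0 r s * s `^ (- a)).
Proof.
move=> a01; have [r0|r0] := leP r 0.
  rewrite (_ : (fun s => _) = fun=> 0); first exact: intg0.
  apply/funext => s; rewrite /oi; case: ltP => //= [s0|]; last by rewrite mul0r.
  by rewrite ltNge (le_trans r0 (ltW s0)) mul0r.
apply: intgP; first exact: measurable_oipow.
under eq_integral => s _ do rewrite (ger0_norm (mulr_ge0 (oi_ge0 0 r s) (powR_ge0 s (- a)))).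
have [K K0 HK] := inte_oipow a01; exact: le_lt_trans (HK r r0) (ltry _).
Qed.

(** An exponential weight with large rate [mu] makes the weakly singular Volterra kernel arbitrarily
    small, uniformly on the window. It plays the role of a Gronwall inequality in the convergence of
    the scheme. *)
Lemma inte_oipow_exp a (T e : R) : 0 <= a < 1 -> 0 < e -> exists2 mu : R, 0 <= mu &
  forall r, r <= T ->
  (\int[leb]_s (oi 0 r s * ((r - s) `^ (- a) * expR (- (mu * (r - s)))))%:E <= e%:E)%E.
Proof.
move=> a01 e0.
have mf (r m : R) : meas (fun s => oi 0 r s * s `^ (- a) * expR (- (m * s))).
  apply: mmul; first exact: measurable_oipow.
  apply: (mcomp (@measurable_expR R)); apply: (mcomp (@oppr_measurable R setT)).
  exact: mmul.
have [] // := @dct _ _ _ leb (fun n s => oi 0 T s * s `^ (- a) * expR (- (n%:R * s))) (fun=> 0)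
   (fun s => oi 0 T s * s `^ (- a)).
- by move=> n; exact: mf.
- move=> s; have [s0|s0] := leP s 0.
    have E n : oi 0 T s * s `^ (- a) * expR (- (n%:R * s)) = 0 by rewrite /oi (le_gtF s0) !mul0r.
    by under eq_fun do rewrite E; exact: cvg_cst.
  rewrite -[X in _ --> X](mulr0 (oi 0 T s * s `^ (- a))); apply: cvgMl_tmp.
  have E n : expR (- (n%:R * s)) = expR (- s) ^+ n by rewrite -expRM_natl mulrN.
  under eq_fun do rewrite E.
  by apply: cvg_expr; rewrite ger0_norm ?expR_ge0// expR_lt1 oppr_lt0.
- exact: intg_oipow.
- move=> n s; have [s0|s0] := leP s 0.
    by rewrite /oi (le_gtF s0) !mul0r normr0.
  rewrite ger0_norm ?mulr_ge0 ?oi_ge0 ?powR_ge0 ?expR_ge0//.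
  by rewrite ler_piMr ?mulr_ge0 ?oi_ge0 ?powR_ge0// expN_le1// mulr_ge0// ltW.
move=> _ _; rewrite Rint0 => c.
have [N _ HN] := cvgr_lt _ c _ e0.
exists N%:R => // r rT.
have {HN} := HN N (leqnn N); set I := Rintegral _ _ _ => /= Ie.
have iN : intg leb (fun s => oi 0 T s * s `^ (- a) * expR (- (N%:R * s))).
  apply: intg_le (intg_oipow T a01) => [|s]; first exact: (mf T N%:R).
  have [s0|s0] := leP s 0; first by rewrite /oi (le_gtF s0) !mul0r normr0.
  rewrite ger0_norm ?mulr_ge0 ?oi_ge0 ?powR_ge0 ?expR_ge0//.
  by rewrite ler_piMr ?mulr_ge0 ?oi_ge0 ?powR_ge0// expN_le1// mulr_ge0// ltW.
apply: (@le_trans _ _ (I%:E)); last by rewrite lee_fin ltW.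
rewrite /I EFin_Rint//.
have E s : oi 0 r s * ((r - s) `^ (- a) * expR (- (N%:R * (r - s)))) =
   (fun s => oi 0 r s * s `^ (- a) * expR (- (N%:R * s))) (r - s).
  by rewrite /= mulrA; congr (_ * _ * _); rewrite /oi subr_gt0 ltrBlDr ltrDl andbC.
have g0 s : 0 <= oi 0 r s * s `^ (- a) * expR (- (N%:R * s)).
  by rewrite !mulr_ge0 ?oi_ge0 ?powR_ge0 ?expR_ge0.
have -> : (\int[leb]_s (oi 0 r s * ((r - s) `^ (- a) * expR (- (N%:R * (r - s)))))%:E =
    \int[leb]_s (oi 0 r s * s `^ (- a) * expR (- (N%:R * s)))%:E)%E.
  rewrite -(inte_reflect r (mf r N%:R) g0); apply: eq_integral => s _; congr EFin; exact: E.
apply: le_inte; [exact: mf|exact: mf|exact: g0|].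
move=> s; rewrite ler_wpM2r ?expR_ge0// ler_wpM2r ?powR_ge0// /oi.
by case: (0 < s) => //=; case: ltP => // sr; rewrite (lt_le_trans sr rT).
Qed.

End time_weights.

(** * Convolutions and L^1 bounds *)

Section convolution.
Context {R : realType} {d : nat}.
Local Notation mu := (@lebesgue_rV R d).
Implicit Types (k f g : 'rV[R]_d -> R) (x y z : 'rV[R]_d).

(** Extended-valued, so that integrability can be the outcome of an estimate ([n1_intg]). *)
Definition n1 f : \bar R := (\int[mu]_x `|f x|%:E)%E.

Definition conv k f x : R := \int[mu]_y (k (x - y) * f y).

Lemma n1_ge0 f : (0 <= n1 f)%E. Proof. by apply: inte_ge0. Qed.

Lemma intg_n1 f : intg mu f -> (n1 f)%E = (\int[mu]_x `|f x|)%:E.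
Proof. by move=> fi; rewrite EFin_Rint//; exact: intg_norm. Qed.

Lemma n1_intg f : meas f -> (n1 f < +oo)%E -> intg mu f.
Proof. exact: intgP. Qed.

Lemma n1_le f g : meas f -> meas g ->
  {ae mu, forall x, `|f x| <= g x} -> (n1 f <= n1 g)%E.
Proof.
move=> mf mg fg; apply: ae_le_inte; try exact: mcomp; rewrite //.
by apply: filterS fg => x /= H; exact: (le_trans H (ler_norm _)).
Qed.

Lemma n1_ae f g : meas f -> meas g ->
  {ae mu, forall x, f x = g x} -> n1 f = n1 g.
Proof.
move=> mf mg fg; apply: ae_eq_inte; try exact: mcomp.
by apply: filterS fg => x /= ->.
Qed.

Lemma measurable_conv_arg d1 (T : measurableType d1) (k : T -> 'rV[R]_d -> R) (g : T -> 'rV[R]_d -> R) :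
  meas (uncurry k) -> meas (uncurry g) ->
  meas (fun p : T * 'rV[R]_d * 'rV[R]_d => k p.1.1 (p.1.2 - p.2) * g p.1.1 p.2).
Proof.
move=> mk mg; apply: mmul.
  have H : meas (fun p : T * 'rV[R]_d * 'rV[R]_d => (p.1.1, p.1.2 - p.2)).
    apply/measurable_fun_pair => /=; first exact: (mcomp measurable_fst measurable_fst).
    apply: measurable_funB_rV => //; exact: (mcomp measurable_snd measurable_fst).
  exact: (mcomp mk H).
have H : meas (fun p : T * 'rV[R]_d * 'rV[R]_d => (p.1.1, p.2)).
  apply/measurable_fun_pair => //=; exact: (mcomp measurable_fst measurable_fst).
exact: (mcomp mg H).
Qed.

Lemma measurable_conv2 d1 (T : measurableType d1) (k : T -> 'rV[R]_d -> R) (g : T -> 'rV[R]_d -> R) :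
  meas (uncurry k) -> meas (uncurry g) ->
  meas (fun p : T * 'rV[R]_d => conv (k p.1) (g p.1) p.2).
Proof.
move=> mk mg; rewrite /conv; apply: (@measurable_Rint _ _ (T * 'rV[R]_d)%type 'rV[R]_d R mu (fun p y => k p.1 (p.2 - y) * g p.1 y)).
rewrite (_ : uncurry _ = fun p : T * 'rV[R]_d * 'rV[R]_d => k p.1.1 (p.1.2 - p.2) * g p.1.1 p.2); last first.
  by apply/funext => -[[? ?] ?].
exact: measurable_conv_arg.
Qed.

Lemma measurable_cprod k f : meas k -> meas f ->
  meas (uncurry (fun x y => k (x - y) * f y)).
Proof.
move=> mk mf; rewrite (_ : uncurry _ = fun p => k (p.1 - p.2) * f p.2); last by apply/funext => -[].
apply: mmul; last exact: mcomp.
by apply: (mcomp mk); exact: measurable_funB_rV.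
Qed.

Lemma measurable_conv k f : meas k -> meas f ->
  meas (conv k f).
Proof. by move=> mk mf; apply: measurable_Rint; exact: measurable_cprod. Qed.

Lemma young_abs k f : meas k -> meas f ->
  (\int[mu]_x \int[mu]_y `|k (x - y) * f y|%:E = n1 k * n1 f)%E.
Proof.
move=> mk mf; rewrite (@tonelli _ _ _ _ _ mu mu (fun x y => `|k (x - y) * f y|))//; last first.
  rewrite (_ : uncurry _ = fun p => `|uncurry (fun x y => k (x - y) * f y) p|); last by apply/funext => -[].
  by apply: mcomp => //; exact: measurable_cprod.
have mak : meas (fun x => `|k x|) by exact: mcomp.
have E y : (\int[mu]_x `|k (x - y) * f y|%:E = n1 k * `|f y|%:E)%E.
  have -> : (fun x => `|k (x - y) * f y|%:E) = fun x => (`|f y| * `|k (x - y)|)%:E.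
    by apply/funext => x; rewrite normrM mulrC.
  rewrite inteZl//.
    rewrite muleC; congr (_ * _)%E.
    by rewrite (inte_shift (- y) mak).
  by apply: (mcomp mak); exact: measurable_shift_rV.
under eq_integral do rewrite E.
rewrite ge0_integralZl//.
  by apply/measurable_EFinP; exact: mcomp.
exact: n1_ge0.
Qed.

Lemma n1_conv k f : meas k -> meas f ->
  (n1 (conv k f) <= n1 k * n1 f)%E.
Proof.
move=> mk mf; rewrite -young_abs//; apply: ge0_le_integral => //.
- by apply/measurable_EFinP; apply: mcomp => //; exact: measurable_conv.
- apply: (@measurable_inte _ _ _ _ _ mu (fun x y => `|k (x - y) * f y|)) => //.
  rewrite (_ : uncurry _ = fun p => `|uncurry (fun x y => k (x - y) * f y) p|); last by apply/funext => -[].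
  by apply: mcomp => //; exact: measurable_cprod.
- move=> x _; apply: le_norm_Rinte; exact: (measurable_uncurry1 x (measurable_cprod mk mf)).
Qed.

Lemma intg_cprod k f : intg mu k -> intg mu f ->
  intg (mu \x mu)%E (uncurry (fun x y => k (x - y) * f y)).
Proof.
move=> ik if_; have mk := intg_meas ik; have mf := intg_meas if_.
apply: intg_prod; first exact: measurable_cprod.
by rewrite young_abs// (intg_n1 ik) (intg_n1 if_) -EFinM ltry.
Qed.

Lemma intg_conv k f : intg mu k -> intg mu f -> intg mu (conv k f).
Proof. by move=> ik if_; exact: (intg_fubiniF (intg_cprod ik if_)). Qed.

Lemma Rint_conv k f : intg mu k -> intg mu f ->
  \int[mu]_x conv k f x = (\int[mu]_x k x) * \int[mu]_x f x.
Proof.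
move=> ik if_; rewrite (Rfubini (intg_cprod ik if_)).
have E y : \int[mu]_x (k (x - y) * f y) = (\int[mu]_x k x) * f y.
  rewrite RintZr; last exact: intg_shift.
  by rewrite (Rint_shift (- y) (f := k))//; exact: intg_meas ik.
by under eq_Rintegral do rewrite E; rewrite RintZl.
Qed.

Section bounded_kernel.
Variables (k : 'rV[R]_d -> R) (K : R).
Hypotheses (mk : meas k) (kK : forall x, `|k x| <= K).

Lemma intg_conv_arg f x : intg mu f -> intg mu (fun y => k (x - y) * f y).
Proof.
move=> if_; apply: (intgMl (M := K)) => //.
by apply: (mcomp mk); exact: measurable_sub_rV.
Qed.

Lemma conv_norm_le f x : intg mu f -> `|conv k f x| <= K * \int[mu]_y `|f y|.
Proof.
move=> if_; apply: (le_trans (le_norm_Rint (intg_conv_arg x if_))).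
rewrite -RintZl; last exact: intg_norm.
apply: le_Rint; [exact/intg_norm/intg_conv_arg|exact/intgZl/intg_norm|].
by move=> y; rewrite normrM ler_wpM2r.
Qed.

Lemma convD f g x : intg mu f -> intg mu g ->
  conv k (fun y => f y + g y) x = conv k f x + conv k g x.
Proof.
move=> if_ ig; rewrite -RintD; try exact: intg_conv_arg.
by apply: eq_Rintegral => y _; rewrite mulrDr.
Qed.

Lemma convB f g x : intg mu f -> intg mu g ->
  conv k (fun y => f y - g y) x = conv k f x - conv k g x.
Proof.
move=> if_ ig; rewrite -RintB; try exact: intg_conv_arg.
by apply: eq_Rintegral => y _; rewrite mulrBr.
Qed.

Lemma convZ (c : R) f x : intg mu f -> conv k (fun y => c * f y) x = c * conv k f x.
Proof.
move=> if_; rewrite -RintZl; last exact: intg_conv_arg.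
by apply: eq_Rintegral => y _; rewrite mulrCA.
Qed.

Lemma conv_shift f v x : meas f ->
  conv k (fun y => f (y - v)) x = conv (fun y => k (y - v)) f x.
Proof.
move=> mf; rewrite /conv -(Rint_shift v (f := fun y => k (x - y) * f (y - v))); last first.
  apply: mmul; first by apply: (mcomp mk); exact: measurable_sub_rV.
  by apply: (mcomp mf); exact: measurable_shift_rV.
by apply: eq_Rintegral => y _; rewrite addrK opprD addrA.
Qed.

Lemma conv_conv (k2 kk : 'rV[R]_d -> R) (K2 : R) f x : intg mu k2 -> (forall x, `|k2 x| <= K2) ->
  intg mu f -> (forall x, \int[mu]_z (k (x - z) * k2 z) = kk x) ->
  conv k (conv k2 f) x = conv kk f x.
Proof.
move=> i2 k2K if_ H; have m2 := intg_meas i2; have mf := intg_meas if_.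
have ic := intg_cprod i2 if_.
have ih : intg (mu \x mu)%E (uncurry (fun y z => k (x - y) * (k2 (y - z) * f z))).
  rewrite (_ : uncurry _ = fun p => k (x - p.1) * uncurry (fun y z => k2 (y - z) * f z) p); last first.
    by apply/funext => -[].
  apply: (intgMl (M := K)) => //.
  by apply: (mcomp mk); apply: (mcomp (measurable_sub_rV x)).
transitivity (\int[mu]_y \int[mu]_z (k (x - y) * (k2 (y - z) * f z))).
  apply: eq_Rintegral => y _; rewrite RintZl//.
  apply: (intgMl (M := K2)) => //.
  by apply: (mcomp m2); exact: measurable_sub_rV.
rewrite (Rfubini ih); apply: eq_Rintegral => z _.
have -> : (fun y => k (x - y) * (k2 (y - z) * f z)) = fun y => (k (x - y) * k2 (y - z)) * f z.
  by apply/funext => y; rewrite mulrA.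
rewrite RintZr; last first.
  apply: (intgMl (M := K)) => //; last exact: intg_shift.
  by apply: (mcomp mk); exact: measurable_sub_rV.
congr (_ * _); rewrite -H -(Rint_shift z (f := fun y => k (x - y) * k2 (y - z))); last first.
  apply: mmul; first by apply: (mcomp mk); exact: measurable_sub_rV.
  by apply: (mcomp m2); exact: measurable_shift_rV.
by apply: eq_Rintegral => y _; rewrite addrK opprD addrAC addrA.
Qed.

Lemma conv_le f g x : (forall x, 0 <= k x) -> intg mu f -> intg mu g ->
  {ae mu, forall y, f y <= g y} -> conv k f x <= conv k g x.
Proof.
move=> k0 if_ ig fg; apply: ae_le_Rint; try exact: intg_conv_arg.
by apply: filterS fg => y /= H; rewrite ler_wpM2l.
Qed.

Lemma conv_ae f g x : meas f -> meas g ->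
  {ae mu, forall y, f y = g y} -> conv k f x = conv k g x.
Proof.
move=> mf mg fg; apply: ae_eq_Rint.
- by apply: mmul => //; apply: (mcomp mk); exact: measurable_sub_rV.
- by apply: mmul => //; apply: (mcomp mk); exact: measurable_sub_rV.
by apply: filterS fg => y /= ->.
Qed.

End bounded_kernel.

Lemma conv_norm_le_sup k f (M : R) x : intg mu k -> meas f ->
  {ae mu, forall y, `|f y| <= M} -> 0 <= M ->
  intg mu (fun y => k (x - y) * f y) /\ `|conv k f x| <= M * \int[mu]_y `|k y|.
Proof.
move=> ik mf fM M0; have mk := intg_meas ik; have isk := intg_sub x ik.
have mkf : meas (fun y => k (x - y) * f y).
  by apply: mmul => //; exact: intg_meas isk.
have ins := intg_norm isk.
have H : {ae mu, forall y, `|k (x - y) * f y| <= M * `|k (x - y)|}.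
  by apply: filterS fM => y /= H; rewrite normrM mulrC ler_wpM2r.
have i : intg mu (fun y => k (x - y) * f y).
  apply: intgP => //; apply: le_lt_trans (intg_lty (intgZl M ins)).
  apply: ae_le_inte => //; try exact: mcomp.
    by apply: mcomp => //; apply: mmul => //; exact: intg_meas ins.
  by apply: filterS H => y /= /le_trans; apply; exact: ler_norm.
split => //; apply: (le_trans (le_norm_Rint i)).
rewrite -(Rint_sub x (f := fun y => `|k y|)); last exact: mcomp.
rewrite -RintZl//; apply: ae_le_Rint => //; [exact: intg_norm|exact: intgZl].
Qed.

End convolution.

Section minkowski.
Context {R : realType} {d : nat} d1 (T : measurableType d1).
Variable m : {sigma_finite_measure set T -> \bar R}.
Local Notation mu := (@lebesgue_rV R d).

Lemma n1_Rint (phi : T -> 'rV[R]_d -> R) : meas (uncurry phi) ->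
  (n1 (fun x => (\int[m]_s phi s x)%R) <= \int[m]_s n1 (phi s))%E.
Proof.
move=> mphi.
have mphi' : meas (uncurry (fun x s => phi s x)).
  rewrite (_ : uncurry _ = uncurry phi \o (fun p => (p.2, p.1))); last by apply/funext => -[].
  by apply: (mcomp mphi); exact: measurable_fun_pair.
have ma : meas (uncurry (fun x s => `|phi s x|)).
  rewrite (_ : uncurry _ = fun p => `|uncurry (fun x s => phi s x) p|); last by apply/funext => -[].
  exact: mcomp.
rewrite (_ : (\int[m]_s n1 (phi s) = \int[mu]_x \int[m]_s `|phi s x|%:E)%E).
  apply: ge0_le_integral => //.
  - by apply/measurable_EFinP; apply: mcomp => //; exact: measurable_Rint.
  - exact: (@measurable_inte _ _ _ _ _ m).
  - by move=> x _; apply: le_norm_Rinte; exact: (measurable_uncurry1 x mphi').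
by rewrite (@tonelli _ _ _ _ _ mu m (fun x s => `|phi s x|)).
Qed.

End minkowski.

Section positive_part.
Context {R : realType}.
Implicit Types c s u v : R.

Definition posp c s : R := Num.max (s - c) 0.

Lemma posp_ge0 c s : 0 <= posp c s. Proof. by rewrite /posp le_max lexx orbT. Qed.

Lemma posp_mono c u v : u <= v -> posp c u <= posp c v.
Proof. by move=> uv; rewrite /posp ge_max !le_max lexx orbT andbT lerD2r uv. Qed.

Lemma measurable_posp c : meas (posp c).
Proof. by apply: nondecreasing_measurable => // u v; exact: posp_mono. Qed.

End positive_part.

(** * Step functions on a time grid *)

Section grid.
Context {R : realType}.
Local Notation leb := (@lebesgue_measure R).
Implicit Types (a s t r k : R).

(** Half-open, unlike [oi]: consecutive cells tile the time axis, and every [s] in [[0, J k[]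
    belongs to exactly one of them. *)
Definition ci a t s : R := ((a <= s) && (s < t))%R%:R.

Lemma ci_ge0 a t s : 0 <= ci a t s. Proof. exact: ler0n. Qed.

Lemma measurable_ci a t : meas (ci a t).
Proof.
rewrite (_ : ci a t = \1_(`[a, t[%classic)); first exact: measurable_indic.
by apply/funext => s; rewrite /ci indicE mem_setE in_itv.
Qed.

Lemma ci_oi_ae a t : {ae leb, forall s, ci a t s = oi a t s}.
Proof.
exists [set a]; split; [exact: measurable_set1|exact: lebesgue_measure_set1|].
move=> s /=; apply: contra_notP => /eqP sa; rewrite /ci /oi.
by case: (ltgtP a s) sa => //= ->; rewrite eqxx.
Qed.

Lemma Rint_ci a t (f : R -> R) : meas f ->
  \int[leb]_s (ci a t s * f s) = \int[leb]_s (oi a t s * f s).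
Proof.
move=> mf; apply: ae_eq_Rint.
- by apply: mmul => //; exact: measurable_ci.
- by apply: mmul => //; exact: measurable_oi.
- by apply: (aeS _ (ci_oi_ae a t)) => s /= ->.
Qed.

Lemma inte_ci a t (f : R -> R) : meas f -> (forall s, 0 <= f s) ->
  (\int[leb]_s (ci a t s * f s)%:E = \int[leb]_s (oi a t s * f s)%:E)%E.
Proof.
move=> mf f0; apply: ae_eq_inte.
- by apply: mmul => //; exact: measurable_ci.
- by apply: mmul => //; exact: measurable_oi.
- by apply: (aeS _ (ci_oi_ae a t)) => s /= ->.
Qed.

Lemma intg_ci a t (f : R -> R) : meas f -> intg leb (fun s => oi a t s * f s) ->
  intg leb (fun s => ci a t s * f s).
Proof.
move=> mf; apply: ae_intg; first by apply: mmul => //; exact: measurable_ci.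
by apply: (aeS _ (ci_oi_ae a t)) => s /= ->.
Qed.

Lemma intg_oi a t : a <= t -> intg leb (oi a t).
Proof.
move=> at_; apply: intgP; first exact: measurable_oi.
under eq_integral => s _ do rewrite (ger0_norm (oi_ge0 a t s)).
by rewrite inte_oi// ltry.
Qed.

Lemma Rint_ci_cst a t (c : R) : a <= t -> \int[leb]_s (ci a t s * c) = (t - a) * c.
Proof.
move=> at_; rewrite Rint_ci; last exact: measurable_cst.
have i := intg_oi at_.
by rewrite RintZr// /Rintegral inte_oi.
Qed.

Definition grid (X : Type) k J (f : nat -> X -> R) (s : R) (x : X) : R :=
  \sum_(i < J) ci (i%:R * k) (i.+1%:R * k) s * f i x.

Lemma grid_pick (X : Type) k J i (f : nat -> X -> R) s x : 0 < k -> (i < J)%N ->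
  i%:R * k <= s -> s < i.+1%:R * k -> grid k J f s x = f i x.
Proof.
move=> k0 iJ l1 l2; rewrite /grid (bigD1 (Ordinal iJ))//= /ci l1 l2 mul1r.
rewrite big1 ?addr0// => j; rewrite -val_eqE /= neq_ltn => /orP[ji|ij].
  have : j.+1%:R * k <= i%:R * k by rewrite ler_wpM2r ?(ltW k0)// ler_nat.
  by move=> /le_trans/(_ l1) H; rewrite (le_gtF H) andbF mul0r.
have : i.+1%:R * k <= j%:R * k by rewrite ler_wpM2r ?(ltW k0)// ler_nat.
by move=> /(lt_le_trans l2) H; rewrite leNgt H mul0r.
Qed.

Lemma grid_ex k J s : 0 < k -> 0 <= s -> s < J%:R * k ->
  exists2 i, (i < J)%N & i%:R * k <= s /\ s < i.+1%:R * k.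
Proof.
move=> k0 s0; elim: J => [|J IH]; first by rewrite mul0r ltNge s0.
have [sJ _|Js l] := ltP s (J%:R * k); last by exists J.
by have [i iJ H] := IH sJ; exists i => //; exact: ltnW.
Qed.

Lemma grid_out (X : Type) k J (f : nat -> X -> R) s x : 0 < k ->
  ~~ ((0 <= s) && (s < J%:R * k)) -> grid k J f s x = 0.
Proof.
move=> k0 H; rewrite /grid big1// => i _; rewrite /ci.
case: (leP (i%:R * k) s) => [l1|_]; last by rewrite /= mul0r.
case: (ltP s (i.+1%:R * k)) => [l2|_]; last by rewrite /= mul0r.
case/negP: H; rewrite (le_trans _ l1) ?mulr_ge0 ?(ltW k0)//=.
by apply: (lt_le_trans l2); rewrite ler_wpM2r ?(ltW k0)// ler_nat.
Qed.

(** Rounds a time lag up to the grid; rounding upwards means that the kernel of the scheme is never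
    more singular than the exact one at lag [s]. *)
Definition sigk k s : R := k * (Num.ceil (s / k))%:~R.

Lemma sigk_ge k s : 0 < k -> s <= sigk k s.
Proof. by move=> k0; rewrite /sigk mulrC -ler_pdivrMr// ceil_ge. Qed.

Lemma sigk_lt k s : 0 < k -> sigk k s < s + k.
Proof.
move=> k0; have /andP[+ _] := ceil_itv (s / k).
by rewrite rmorphB/= ltrBlDr -(ltr_pM2l k0) mulrDr mulr1 mulrCA divff ?gt_eqF// mulr1.
Qed.

Lemma sigk_grid k s (n : nat) : 0 < k -> n%:R * k < s -> s <= n.+1%:R * k -> sigk k s = n.+1%:R * k.
Proof.
move=> k0 l1 l2; rewrite /sigk mulrC; congr (_ * _).
have -> : Num.ceil (s / k) = n.+1%:Z; last by [].
apply: ceil_def; rewrite ler_pdivrMr// ltr_pdivlMr//.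
by rewrite (_ : n.+1%:Z - 1 = n%:Z) -?pmulrn ?l1//; lia.
Qed.

Lemma measurable_sigk k : 0 < k -> meas (sigk k).
Proof.
move=> k0; apply: nondecreasing_measurable => // s t st.
rewrite /sigk ler_wpM2l ?(ltW k0)// ler_int le_ceil// ler_wpM2r// invr_ge0 ltW//.
Qed.

End grid.

(** * The nonlinearity and its truncation *)

Section nonlinearity.
Context {R : realType}.
Variable q : R.
Hypothesis q0 : 0 < q.
Implicit Types (s u v M : R).

Definition pwn s : R := s * `|s| `^ q.

Lemma pwnN s : pwn (- s) = - pwn s.
Proof. by rewrite /pwn normrN mulNr. Qed.

Lemma pwn_ge0 s : 0 <= s -> 0 <= pwn s.
Proof. by move=> s0; rewrite mulr_ge0 ?powR_ge0. Qed.

Lemma pwn0 : pwn 0 = 0. Proof. by rewrite /pwn mul0r. Qed.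

Lemma norm_pwn s : `|pwn s| = `|s| `^ q * `|s|.
Proof. by rewrite /pwn normrM mulrC ger0_norm ?powR_ge0. Qed.

Lemma norm_pwn_le M s : `|s| <= M -> `|pwn s| <= M `^ q * `|s|.
Proof.
move=> sM; rewrite norm_pwn ler_wpM2r// ge0_ler_powR ?nnegrE ?(ltW q0)//.
exact: le_trans sM.
Qed.

Let pwn_mono_ge0 u v : 0 <= u -> u <= v -> pwn u <= pwn v.
Proof.
move=> u0 uv; have v0 := le_trans u0 uv; rewrite /pwn !ger0_norm//.
by apply: ler_pM => //; [exact: powR_ge0|apply: ge0_ler_powR; rewrite ?nnegrE// ltW].
Qed.

Lemma pwn_mono u v : u <= v -> pwn u <= pwn v.
Proof.
move=> uv; have [u0|u0] := leP 0 u; first exact: pwn_mono_ge0.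
have [v0|v0] := leP 0 v.
  apply: (@le_trans _ _ 0); last exact: pwn_ge0.
  by rewrite -oppr_ge0 -pwnN pwn_ge0// oppr_ge0 ltW.
by rewrite -lerN2 -!pwnN pwn_mono_ge0 ?oppr_ge0 ?(ltW v0)// lerN2.
Qed.

Lemma measurable_pwn : meas pwn.
Proof.
apply: mmul => //; apply: (mcomp (measurable_powR q)).
exact: (@normr_measurable R setT).
Qed.

Let one_subX (r : R) n : 0 <= r <= 1 -> 1 - r ^+ n <= n%:R * (1 - r).
Proof.
move=> /andP[r0 r1]; elim: n => [|n IH]; first by rewrite expr0 subrr mul0r.
have -> : 1 - r ^+ n.+1 = (1 - r ^+ n) + r ^+ n * (1 - r) by rewrite exprSr; ring.
rewrite -natr1 mulrDl mul1r lerD// ler_piMl ?subr_ge0// exprn_ile1//.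
Qed.

(** For [0 <= u <= v] and [r = u / v], homogeneity gives [pwn v - pwn u = v^(1+q) (1 - r^(1+q))].
    With an integer [n >= q], [1 - r^(1+q) <= 1 - r^(n+1) <= (n+1)(1 - r)]. Oddness settles the
    other signs. *)
Lemma pwn_lip M : 0 < M -> exists2 L : R, 0 <= L &
  forall u v, - M <= u -> u <= v -> v <= M -> pwn v - pwn u <= L * (v - u).
Proof.
move=> M0; pose n := Num.bound q; have qn : q <= n%:R.
  by apply/ltW/(le_lt_trans (ler_norm q)); rewrite ger0_norm ?(ltW q0)// archi_boundP// ltW.
pose L := n.+1%:R * M `^ q; have L0 : 0 <= L by rewrite mulr_ge0 ?powR_ge0.
exists L => //.
have pos u v : 0 <= u -> u <= v -> v <= M -> pwn v - pwn u <= L * (v - u).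
  move=> u0 uv vM; have [v0|v0] := eqVneq v 0.
    have -> : u = 0 by apply/le_anti; rewrite u0 andbT -v0.
    by rewrite v0 !subrr mulr0.
  have vp : 0 < v by rewrite lt0r v0 (le_trans u0).
  pose r := u / v; have r0 : 0 <= r by rewrite divr_ge0// ltW.
  have r1 : r <= 1 by rewrite ler_pdivrMr// mul1r.
  have uE : u = r * v by rewrite /r divfK.
  have rq : r ^+ n <= r `^ q.
    have [->|rn] := eqVneq r 0.
      case: (n) qn => [|k] qn; last by rewrite expr0n powR_ge0.
      by move: q0; rewrite ltNge qn.
    have rp : 0 < r by rewrite lt0r rn.
    rewrite -powR_mulrn// (_ : n%:R = q + (n%:R - q)); last by rewrite addrC subrK.
    rewrite powRD; last by rewrite rn implybT.
    by rewrite ler_piMr ?powR_ge0// powR_le1// ?r0 ?r1 ?subr_ge0.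
  have E : pwn v - pwn u = v * v `^ q * (1 - r * r `^ q).
    by rewrite /pwn !ger0_norm ?(ltW vp)// uE powRM ?(ltW vp)//; ring.
  have -> : v - u = v * (1 - r) by rewrite uE; ring.
  rewrite E /L mulrACA; apply: (@le_trans _ _ (v * v `^ q * (n.+1%:R * (1 - r)))).
    rewrite ler_wpM2l ?mulr_ge0 ?powR_ge0 ?(ltW vp)//.
    apply: le_trans (one_subX n.+1 (andb_true_intro (conj r0 r1))).
    by rewrite lerD2l lerN2 exprS ler_wpM2l.
  rewrite [leLHS](_ : _ = n.+1%:R * (v * v `^ q * (1 - r))); last by ring.
  rewrite [leRHS](_ : _ = n.+1%:R * (v * M `^ q * (1 - r))); last by ring.
  rewrite ler_wpM2l// ler_wpM2r ?subr_ge0// ler_wpM2l ?(ltW vp)//.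
  by apply: ge0_ler_powR; rewrite ?nnegrE ?(ltW q0) ?(ltW vp) ?(ltW M0).
move=> u v Mu uv vM; have [u0|u0] := leP 0 u; first exact: pos.
have Nu : - u <= M by rewrite lerNl.
have [v0|v0] := leP 0 v.
  have p1 := pos 0 v (lexx _) v0 vM; have nu0 : 0 <= - u by rewrite oppr_ge0 ltW.
  have p2 := pos 0 (- u) (lexx _) nu0 Nu.
  rewrite pwn0 pwnN !subr0 in p1 p2.
  by rewrite mulrBr; lra.
have := pos (- v) (- u); rewrite !pwnN oppr_ge0 (ltW v0) lerN2 uv => /(_ isT isT Nu).
by rewrite !opprK [leLHS]addrC [X in _ <= _ * X]addrC.
Qed.

(** Inverts the nonlinearity by a measurable formula: measurability of [u] will be deduced from that
    of [pwn q u]. *)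
Lemma pwnK s : pwn s * `|pwn s| `^ (- (q / (1 + q))) = s.
Proof.
have [->|s0] := eqVneq s 0; first by rewrite pwn0 mul0r.
have q1 : 1 + q != 0 by rewrite gt_eqF// addr_gt0.
have ns : 0 < `|s| by rewrite normr_gt0.
have -> : `|pwn s| = `|s| `^ (1 + q).
  by rewrite norm_pwn powRD ?(gt_eqF ns) ?implybT// powRr1 ?(ltW ns)// mulrC.
rewrite -powRrM (_ : (1 + q) * _ = - q); last by field.
by rewrite powRN /pwn mulfK// gt_eqF// powR_gt0.
Qed.

(** The scheme asks for a flux that is bounded and globally Lipschitz. On a time window where
    [|u| <= M] the truncation leaves the equation unchanged. *)
Definition tpw M s := pwn (Num.max (- M) (Num.min M s)).

Lemma tpwE M s : `|s| <= M -> tpw M s = pwn s.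
Proof. by rewrite ler_norml => /andP[l1 l2]; rewrite /tpw min_r// max_r. Qed.

Lemma tpw_facts M : 0 < M -> exists L B : R, [/\ tpw M 0 = 0,
  forall u v, u <= v -> tpw M u <= tpw M v,
  forall u v, u <= v -> tpw M v - tpw M u <= L * (v - u) &
  forall u, `|tpw M u| <= B].
Proof.
move=> M0; have [L L0 HL] := pwn_lip M0; exists L, (M `^ q * M).
pose cl s := Num.max (- M) (Num.min M s).
have NM : - M <= M by rewrite ge0_cp ?ltW.
have c1 s : - M <= cl s by rewrite /cl le_max lexx.
have c2 s : cl s <= M by rewrite /cl ge_max NM ge_min lexx.
have cm u v : u <= v -> cl u <= cl v.
  move=> uv; rewrite /cl ge_max le_max lexx /= le_max; apply/orP; right.
  by rewrite le_min !ge_min lexx uv orbT.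
have cl1 u v : u <= v -> cl v - cl u <= v - u.
  move=> uv; rewrite /cl; have [|] := leP M v; have [|] := leP M u; have [|] := leP (- M) u; have [|] := leP (- M) v; have [|] := leP (- M) M; lra.
split => //.
- by rewrite tpwE ?normr0 ?pwn0// ltW.
- by move=> u v uv; apply/pwn_mono/cm.
- by move=> u v uv; apply: le_trans (HL _ _ (c1 u) (cm _ _ uv) (c2 v)) _; rewrite ler_wpM2l// cl1.
- move=> u; apply: (@le_trans _ _ (M `^ q * `|cl u|)).
    by apply: norm_pwn_le; rewrite ler_norml c1 c2.
  by rewrite ler_wpM2l ?powR_ge0// ler_norml c1 c2.
Qed.

End nonlinearity.

(** Compactness of a segment for properties indexed by a natural number: local bounds become one
    bound. It gives boundedness and uniform continuity of the solution on compact time intervals. *)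
Lemma segment_near {R : realType} (a c : R) (P : nat -> R -> Prop) :
  (forall n m s, (n <= m)%N -> P n s -> P m s) ->
  (forall s, a <= s <= c -> exists2 del : R, 0 < del & exists N, forall s', `|s' - s| < del -> a <= s' <= c -> P N s') ->
  exists N, forall s, a <= s <= c -> P N s.
Proof.
move=> Pmono H.
have /compact_near_coveringP/(_ nat \oo (fun n s => a <= s <= c -> P n s)) := @segment_compact R a c.
case.
- move=> s; rewrite /= in_itv/= => /H[del del0 [N HN]].
  exists (ball s del, [set n | (N <= n)%N]); first by split => /=; [exact: nbhsx_ballx|exists N].
  move=> [s' n] /= [+ Nn] sac; rewrite /ball/= distrC => sd.
  exact: (Pmono N n s' Nn (HN s' sd sac)).
- move=> N _ HN; exists N => s sac; exact: (HN N (leqnn N)).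
Qed.

Lemma intg_oi_sub {R : realType} (a c t : R) (f : R -> R) : 0 <= a -> c <= t ->
  intg (@lebesgue_measure R) (fun s => oi 0 t s * f s) -> intg (@lebesgue_measure R) (fun s => oi a c s * f s).
Proof.
move=> a0 ct i; rewrite (_ : (fun s => _) = fun s => oi a c s * (oi 0 t s * f s)).
  apply: (intgMl (M := 1)) i; first exact: measurable_oi.
  by move=> s; rewrite ger0_norm ?oi_ge0 ?oi_le1.
apply/funext => s; apply: oi_eq => l1 l2.
by rewrite oiT ?mul1r//; [exact: le_lt_trans l1|exact: lt_le_trans ct].
Qed.

Section prodm.
Context {R : realType} {d1 d2 : measure_display} {T1 : measurableType d1} {T2 : measurableType d2}.
Variables (m1 : {sigma_finite_measure set T1 -> \bar R}) (m2 : {sigma_finite_measure set T2 -> \bar R}).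

(* A copy of [m1 \x m2]: sigma-finiteness of the latter is not inferred, the
   canonical instance keyed on [product_measure1] being that for probabilities. *)
Definition prodm : set (T1 * T2)%type -> \bar R := (m1 \x m2)%E.

Let prodm0 : prodm set0 = 0%E. Proof. exact: measure0. Qed.

Let prodm_ge0 A : (0 <= prodm A)%E. Proof. exact: measure_ge0. Qed.

Let prodm_additive : semi_sigma_additive prodm.
Proof. exact: measure_semi_sigma_additive. Qed.

HB.instance Definition _ := isMeasure.Build _ _ _ prodm prodm0 prodm_ge0 prodm_additive.

Let prodm_sigma_finite : sigma_finite setT prodm.
Proof.
have /sigma_finiteP[F [TF ndF Foo]] := sigma_finiteT m1.
have /sigma_finiteP[G [TG ndG Goo]] := sigma_finiteT m2.
exists (fun n => F n `*` G n).
  rewrite -setXTT TF TG predeqE => -[x y]; split.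
    move=> [/= [n _ Fnx] [k _ Gky]]; exists (maxn n k) => //; split.
    - by move: x Fnx; exact/subsetPset/ndF/leq_maxl.
    - by move: y Gky; exact/subsetPset/ndG/leq_maxr.
  by move=> [n _ []/= ? ?]; split; exists n.
move=> k; have [? ?] := Foo k; have [? ?] := Goo k; split; first exact: measurableX.
by rewrite /prodm product_measure1E// lte_mul_pinfty// ge0_fin_numE.
Qed.

HB.instance Definition _ := Measure_isSigmaFinite.Build _ _ _ prodm prodm_sigma_finite.

End prodm.

Section posp_facts.
Context {R : realType} {d : nat}.
Local Notation mu := (@lebesgue_rV R d).

Lemma posp_lip (c s t : R) : posp c s <= posp c t + `|s - t|.
Proof.
rewrite /posp ge_max; apply/andP; split; last by rewrite addr_ge0 ?posp_ge0// le_max lexx orbT.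
have : t - c <= Num.max (t - c) 0 by rewrite le_max lexx.
by have := ler_norm (s - t); lra.
Qed.

Lemma posp_norm_le (c s : R) : 0 <= c -> `|posp c s| <= `|s|.
Proof.
move=> c0; rewrite ger0_norm ?posp_ge0// /posp ge_max normr_ge0 andbT.
by have := ler_norm s; lra.
Qed.

Lemma posp0E (s : R) : 0 <= s -> posp 0 s = s.
Proof. by move=> s0; rewrite /posp subr0 max_l. Qed.

Lemma intg_posp (c : R) (f : 'rV[R]_d -> R) : 0 <= c -> intg mu f -> intg mu (fun x => posp c (f x)).
Proof.
move=> c0 i; apply: intg_le (intg_norm i) => [|x]; last exact: posp_norm_le.
exact: (mcomp (measurable_posp c) (intg_meas i)).
Qed.

Lemma Rint_posp_lip (c : R) (f g : 'rV[R]_d -> R) : 0 <= c -> intg mu f -> intg mu g ->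
  \int[mu]_x posp c (f x) <= \int[mu]_x posp c (g x) + \int[mu]_x `|f x - g x|.
Proof.
move=> c0 i j; rewrite -RintD; [|exact: intg_posp|exact/intg_norm/intgB].
apply: le_Rint; [exact: intg_posp|apply: intgD; [exact: intg_posp|exact/intg_norm/intgB]|].
by move=> x; exact: posp_lip.
Qed.

Lemma posp_ae0 (c : R) (f : 'rV[R]_d -> R) : 0 <= c -> intg mu f -> \int[mu]_x posp c (f x) <= 0 ->
  {ae mu, forall x, f x <= c}.
Proof.
move=> c0 i le0; have ip := intg_posp c0 i.
have E : \int[mu]_x posp c (f x) = 0 by apply/le_anti; rewrite le0 Rint_ge0// => x; exact: posp_ge0.
have := @inte_eq0 _ _ _ mu _ (intg_meas ip) (fun x => posp_ge0 c (f x)).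
rewrite -EFin_Rint// E => /(_ erefl); apply: aeS => x.
by rewrite /posp => h; rewrite -subr_le0 -[leRHS]h le_max lexx.
Qed.

Lemma ae_eq_Rint_norm (f g : 'rV[R]_d -> R) : intg mu f -> intg mu g ->
  {ae mu, forall x, f x = g x} -> \int[mu]_x `|f x| = \int[mu]_x `|g x|.
Proof.
move=> i j H; apply: ae_eq_Rint; [exact: intg_meas (intg_norm i)|exact: intg_meas (intg_norm j)|].
by apply: (aeS _ H) => x ->.
Qed.

End posp_facts.

Lemma Rint_shift1 {R : realType} (a : R) (f : R -> R) : meas f ->
  \int[@lebesgue_measure R]_s f (a + s) = \int[@lebesgue_measure R]_s f s.
Proof.
move=> mf; have H := @Rint_transfer _ _ _ (@lebesgue_measure R) (fun s : R => 1 * s + a) 1.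
rewrite -[RHS]H// ?mul1r.
- by apply: eq_Rintegral => s _; rewrite mul1r addrC.
- by move=> g mg g0; apply: ge0_integral_affine1.
Qed.

Section stable_flow.
Context {R : realType} {d : nat}.
Variable alpha : R.
Hypothesis alpha12 : 1 < alpha < 2.
Local Notation mu := (@lebesgue_rV R d).
Local Notation leb := (@lebesgue_measure R).
Local Notation ST := (measurableTypeR R * 'rV[R]_d)%type.

Lemma meas_fst : meas (fun p : ST => p.1 : R).
Proof. exact: measurable_fst. Qed.

Lemma meas_snd : meas (fun p : ST => p.2).
Proof. exact: measurable_snd. Qed.

(** * The stable symbol and the passage from Gaussians to it *)

Section stable_symbol.
Implicit Types (x v xi : 'rV[R]_d) (t : R).

(** The symbol as a function of [lam = |xi|^2], the variable in which it is completely monotone and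
    in which [dexp s] is a Gaussian. *)
Definition stsym t (lam : R) : R := expR (- (t * lam `^ (alpha / 2))).

Definition stw t (xi : 'rV[R]_d) : R := stsym t (dotp xi xi).

Let beta01 : 0 < alpha / 2 < 1.
Proof. by case/andP: alpha12 => ? ?; apply/andP; split; lra. Qed.

Lemma stwE t xi : stw t xi = expR (- t * enorm xi `^ alpha).
Proof.
rewrite /stw /stsym mulNr; congr (expR (- (t * _))).
rewrite -sqr_enorm -powR_mulrn ?enorm_ge0// -powRrM; congr powR.
by field.
Qed.

Lemma measurable_stsym t : meas (stsym t).
Proof.
apply: (mcomp (@measurable_expR R)).
apply: (mcomp (@oppr_measurable R setT)).
by apply: mmul => //; exact: measurable_powR.
Qed.

Lemma measurable_stw t : meas (stw t).
Proof.
by apply: (mcomp (measurable_stsym t)); exact: measurable_fun_dotp.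
Qed.

Lemma stw_ge0 t xi : 0 <= stw t xi. Proof. exact: expR_ge0. Qed.

Lemma stsym_le1 t lam : 0 <= t -> stsym t lam <= 1.
Proof. by move=> t0; rewrite expN_le1// mulr_ge0// powR_ge0. Qed.

Lemma stw_bound t xi : 0 <= t -> stw t xi <= expR t * expR (- (t * enorm xi)).
Proof.
move=> t0; rewrite stwE mulNr -expRD ler_expR.
have : enorm xi <= 1 + enorm xi `^ alpha.
  have [e1|e1] := leP (enorm xi) 1; first by have := powR_ge0 (enorm xi) alpha; lra.
  have a1 : 1 <= alpha by case/andP: alpha12 => /ltW.
  by have := le1r_powR (ltW e1) a1; lra.
by move=> /(ler_wpM2l t0); rewrite mulrDr mulr1; lra.
Qed.

Lemma intg_brk_stw t : 0 < t -> intg mu (fun xi => brk xi * stw t xi).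
Proof.
move=> t0; have t20 : 0 < t / 2 by lra.
pose C : R := (1 + 2 / t) * expR t.
apply: intg_le (intgZl C (@intg_exp_enorm R d _ t20)).
  by apply: mmul; [exact: measurable_brk|exact: measurable_stw].
move=> xi; rewrite ger0_norm ?mulr_ge0 ?stw_ge0 ?(ltW (brk_gt0 _))//.
apply: (le_trans (ler_wpM2l (ltW (brk_gt0 xi)) (stw_bound xi (ltW t0)))).
have e0 := enorm_ge0 xi.
have H : brk xi <= (1 + 2 / t) * expR (t / 2 * enorm xi).
  have H1 := expR_ge1Dx (t / 2 * enorm xi).
  have te : 0 <= t / 2 * enorm xi by rewrite mulr_ge0// ltW.
  have t2 : 0 <= 2 / t by rewrite divr_ge0// ltW.
  apply: (@le_trans _ _ ((1 + 2 / t) * (1 + t / 2 * enorm xi))).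
    have -> : (1 + 2 / t) * (1 + t / 2 * enorm xi) =
      1 + enorm xi + (2 / t + t / 2 * enorm xi) by field; lra.
    by rewrite /brk; lra.
  by rewrite ler_wpM2l//; lra.
have -> : expR (- (t * enorm xi)) = expR (- (t / 2 * enorm xi)) / expR (t / 2 * enorm xi).
  by rewrite -expRN -expRD; congr expR; field.
have p := expR_gt0 (t / 2 * enorm xi).
have q := expR_gt0 (- (t / 2 * enorm xi)).
have r := expR_gt0 t.
rewrite /C mulrA mulrA ler_pdivrMr//.
have -> : (1 + 2 / t) * expR t * expR (- (t / 2 * enorm xi)) * expR (t / 2 * enorm xi) =
  (1 + 2 / t) * expR (t / 2 * enorm xi) * expR t * expR (- (t / 2 * enorm xi)) by ring.
by rewrite -[leRHS]mulrA ler_wpM2r// mulr_ge0// ltW.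
Qed.

Lemma intg_stw t : 0 < t -> intg mu (stw t).
Proof.
move=> t0; apply: intg_le (intg_brk_stw t0); first exact: measurable_stw.
by move=> xi; rewrite ger0_norm ?stw_ge0// ler_peMl ?stw_ge0// brk_ge1.
Qed.

Lemma intg_enorm_stw t : 0 < t -> intg mu (fun xi => enorm xi * stw t xi).
Proof.
move=> t0; apply: intg_le (intg_brk_stw t0).
  by apply: mmul; [exact: measurable_enorm|exact: measurable_stw].
move=> xi; rewrite ger0_norm ?mulr_ge0 ?stw_ge0 ?enorm_ge0//.
by rewrite ler_wpM2r ?stw_ge0// /brk lerDr.
Qed.

Lemma cmono_stsym t : 0 <= t -> cmono (stsym t).
Proof. exact: cmono_stable. Qed.

Definition evals (es : seq (R * R)) (phi : R -> R) : R :=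
  \sum_(e <- es) e.1 * phi e.2.

(* An inequality that is linear in the weight and holds for Gaussians passes
   to the stable weight, which is a mixture of Gaussians. *)
Lemma gauss_to_stable (k : 'rV[R]_d -> R) (C t : R) (es : seq (R * R)) :
  0 < t -> meas k -> (forall xi, `|k xi| <= C * brk xi) ->
  all (fun e => 0 <= e.2) es ->
  (forall s, 0 < s -> 0 <= \int[mu]_xi (k xi * gaussw s xi) + evals es (dexp s)) ->
  0 <= \int[mu]_xi (k xi * stw t xi) + evals es (stsym t).
Proof.
move=> t0 mk kC es0 H.
have ikg s : 0 < s -> intg mu (fun xi => k xi * gaussw s xi).
  move=> s0; have i : intg mu (fun xi => C * (gaussw s xi + enorm xi * gaussw s xi)).
    by apply: intgZl; apply: intgD; [exact: intg_gaussw|exact: intg_gaussw_enorm].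
  apply: intg_le i.
    by apply: mmul => //; exact: measurable_gaussw.
  move=> xi; rewrite normrM (ger0_norm (expR_ge0 _)).
  apply: le_trans (ler_wpM2r (expR_ge0 _) (kC xi)) _.
  by rewrite /brk -mulrA mulrDl mul1r.
have evf del : functional (fun phi => evals es (fun lam => dexp del lam * phi lam)).
  elim: es es0 {H} => [_|e es IH /= /andP[e0 es0]].
    rewrite (_ : (fun phi => _) = (fun phi => 0 * phi 0)).
      by apply: functionalZ; exact: functional_eval.
    by apply/funext => phi; rewrite /evals big_nil mul0r.
  rewrite (_ : (fun phi => _) = (fun phi => e.1 * dexp del e.2 * phi e.2 +
      evals es (fun lam => dexp del lam * phi lam))).
    apply: functionalD; last exact: IH.
    by apply: functionalZ; exact: functional_eval.
  by apply/funext => phi; rewrite /evals big_cons mulrA.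
have cm := cmono_stsym (ltW t0).
(* [k] is only of linear growth, so it is damped by a Gaussian to define a functional. Since the
   damping factor is itself [dexp del], the hypothesis at [del + s] is the positivity required on
   exponentials; dominated convergence then removes [del]. *)
have Hdel del : 0 < del -> 0 <= \int[mu]_xi (k xi * gaussw del xi * stw t xi) +
    evals es (fun lam => dexp del lam * stsym t lam).
  move=> del0; have [_ Hl] := cm.
  apply: (Hl _ (functionalD (functional_int (ikg _ del0)) (evf del))).
  move=> s s0; have := H (del + s); rewrite ltr_wpDr// => /(_ isT).
  have -> : (fun xi => k xi * gaussw (del + s) xi) =
      fun xi => k xi * gaussw del xi * dexp s (dotp xi xi).
    by apply/funext => xi; rewrite -mulrA -dexpD.
  by have -> : dexp (del + s) = fun lam => dexp del lam * dexp s lam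
    by apply/funext => lam; rewrite dexpD.
pose del n : R := n.+1%:R^-1.
have del0 n : 0 < del n by rewrite invr_gt0.
have delc : del n @[n --> \oo] --> (0 : R) by exact: cvg_harmonic.
have dexpc (lam : R) : dexp (del n) lam @[n --> \oo] --> (1 : R).
  have -> : 1 = expR (- (0 * lam)) by rewrite mul0r oppr0 expR0.
  suff h : - (del n * lam) @[n --> \oo] --> - (0 * lam).
    exact: (cvg_comp _ _ h (@continuous_expR R (- (0 * lam)))).
  by apply: cvgN; exact: cvgMr_tmp.
have [] := @dct _ _ _ mu (fun n xi => k xi * gaussw (del n) xi * stw t xi)
   (fun xi => k xi * stw t xi) (fun xi => C * (brk xi * stw t xi)).
- move=> n; apply: mmul; last exact: measurable_stw.
  by apply: mmul => //; exact: measurable_gaussw.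
- move=> xi; apply: cvgMr_tmp; rewrite -[X in _ --> X]mulr1; apply: cvgMl_tmp.
  exact: dexpc.
- by apply: intgZl; exact: intg_brk_stw.
- move=> n xi; rewrite 2!normrM (ger0_norm (expR_ge0 _)) (ger0_norm (stw_ge0 _ _)).
  rewrite mulrA ler_wpM2r ?stw_ge0//; apply: le_trans (kC xi).
  rewrite ler_piMr// expN_le1// mulr_ge0 ?dotpp_ge0//; exact: ltW.
move=> _ _ c1.
have c2 : evals es (fun lam => dexp (del n) lam * stsym t lam) @[n --> \oo] -->
    evals es (stsym t).
  rewrite /evals; elim: es {es0 H evf Hdel} => [|e es IH].
    by rewrite big_nil; under eq_fun do rewrite big_nil; exact: cvg_cst.
  rewrite big_cons; under eq_fun do rewrite big_cons.
  apply: cvgD => //; apply: cvgMl_tmp.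
  by rewrite -[X in _ --> X]mul1r; apply: cvgMr_tmp; exact: dexpc.
apply: (@cvgr_to_ge nat \oo _ R _ _ _ (cvgD c1 c2)).
by near=> n; exact: Hdel.
Unshelve. all: by end_near. Qed.

End stable_symbol.

(** * Two-sided bounds for the transforms that define the kernel and its gradient *)

Section stable_kernel.
Implicit Types (x y v xi : 'rV[R]_d) (s t : R).

Let al0 : 0 < alpha. Proof. by case/andP: alpha12 => /(lt_trans ltr01). Qed.
Let beta0 : 0 < alpha / 2. Proof. by rewrite divr_gt0. Qed.
Let beta1 : alpha / 2 < 1. Proof. case/andP: alpha12 => ? ?; lra. Qed.

(** [jw d] is the profile of the kernel at time 1. The derivative along [v] has profile [jw d.+2]
    multiplied by a factor that grows at most like [dotp x v]. *)
Definition jw (m : nat) x : R := brk x `^ (- (m%:R + alpha)).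

Lemma jw_gt0 m x : 0 < jw m x. Proof. by rewrite powR_gt0// brk_gt0. Qed.

Lemma jw_pow (m : nat) (r : R) : 0 < r ->
  r^-1 ^+ m * ((r ^+ 2)^-1) `^ (alpha / 2) = r `^ (- (m%:R + alpha)).
Proof.
move=> r0; rewrite opprD powRD; last by rewrite (gt_eqF r0) implybT.
congr (_ * _).
  by rewrite powRN powR_mulrn ?ltW// exprVn.
have -> : (r ^+ 2)^-1 = r `^ (- 2) by rewrite powRN powR_mulrn// ltW.
by rewrite -powRrM; congr powR; field.
Qed.

Lemma sqrt_pi_div (r s : R) : 0 < r -> 0 < s ->
  Num.sqrt (pi / s) = Num.sqrt pi / r * Num.sqrt (r ^+ 2 / s).
Proof.
move=> r0 s0; rewrite sqrtrM ?pi_ge0// sqrtrM ?sqr_ge0// sqrtr_sqr ger0_norm ?ltW//.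
by field; rewrite gt_eqF.
Qed.

Let E (lam : R) := 1 - stsym 1 lam.

Let E_le lam : 0 <= lam -> E lam <= lam `^ (alpha / 2).
Proof. by move=> l0; rewrite /E /stsym mul1r one_sub_expN_le. Qed.

Let stsym0 t : stsym t 0 = 1.
Proof. by rewrite /stsym powR0 ?mulr0 ?oppr0 ?expR0// gt_eqF. Qed.

Let probe_stable : exists th T : R, [/\ 0 < th, 0 < T &
  forall X, 1 <= X -> X^-1 `^ (alpha / 2) / 4 <=
    E X^-1 - 2 * E (th / X) - 2 / T * E (T / X)].
Proof.
have i16 : 0 < (16^-1 : R) by rewrite invr_gt0.
(* Chosen so that [th^(alpha/2) = T^(alpha/2 - 1) = 1/16], which is possible because [alpha < 2].
   With [u = X^(-alpha/2)] the positive term is at least [u / 2], and the two subtracted ones are at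
   most [u / 8] each. *)
exists (16^-1 `^ (alpha / 2)^-1), (16 `^ (1 - alpha / 2)^-1); split; try exact: powR_gt0.
move=> X X1; have X0 : 0 < X by lra.
set th := (X in _ - 2 * E (X / _)); set T := (X in _ - _ / _ * E (X / _)).
have th0 : 0 < th by exact: powR_gt0.
have T0 : 0 < T by exact: powR_gt0.
set u := X^-1 `^ (alpha / 2).
have u0 : 0 <= u by exact: powR_ge0.
have u1 : u <= 1.
  apply: powR_le1; last exact: ltW.
  by rewrite invr_ge0 (ltW X0)/= invf_le1.
have H1 : u / 2 <= E X^-1.
  apply: (@le_trans _ _ (u / (1 + u))); last by rewrite /E /stsym mul1r one_sub_expN_ge.
  by rewrite ler_wpM2l// lef_pV2 ?posrE; lra.
have H2 : E (th / X) <= u / 16.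
  apply: (le_trans (E_le _)); first by rewrite divr_ge0 ?ltW.
  rewrite powRM ?invr_ge0 ?(ltW th0) ?(ltW X0)// mulrC ler_wpM2l//.
  by rewrite /th -powRrM mulVf ?gt_eqF// powRr1// ltW.
have H3 : 2 / T * E (T / X) <= u / 8.
  have : E (T / X) <= T `^ (alpha / 2) * u.
    apply: (le_trans (E_le _)); first by rewrite divr_ge0 ?ltW.
    by rewrite powRM ?invr_ge0 ?(ltW T0) ?(ltW X0).
  have T2 : 0 <= 2 / T by rewrite divr_ge0 ?ltW.
  move=> /(ler_wpM2l T2) H; apply: (le_trans H).
  have -> : 2 / T * (T `^ (alpha / 2) * u) = 2 * (T^-1 * T `^ (alpha / 2)) * u by ring.
  have -> : T^-1 * T `^ (alpha / 2) = 16^-1.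
    have <- : T `^ (-1) = T^-1 by rewrite powR_inv1// ltW.
    rewrite -powRD; last by rewrite (gt_eqF T0) implybT.
    rewrite /T -powRrM (_ : _ * _ = -1) ?powR_inv1//.
    have -> : -1 + alpha / 2 = - (1 - alpha / 2) by ring.
    by rewrite mulrN mulVf// gt_eqF// subr_gt0.
  by rewrite (_ : 2 * 16^-1 * u = u / 8)//; field.
rewrite -/T; move: (2 / T * _) (E X^-1) (E (th / X)) H1 H2 H3.
by clearbody u => *; lra.
Qed.

Definition stk t x : R := (2 * pi) ^- d * costr (stw t) x.

Definition dstk t v x : R := - ((2 * pi) ^- d * sintr (stw t) v x).

Let pid : 0 < (2 * pi : R) ^- d.
Proof. by rewrite invr_gt0 exprn_gt0// mulr_gt0// pi_gt0. Qed.

Lemma heat_kernelE t x : heat_kernel alpha t x = stk t x.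
Proof.
rewrite /heat_kernel /heat_kernelC /stk /Cintegral /= mul0r subr0; congr (_ * _).
apply: eq_Rintegral => xi _; rewrite mulr0 subr0 cosN; congr (_ * _).
by rewrite stwE.
Qed.

Lemma is_derive_stk t x v : 0 < t ->
  is_derive (0 : R) (1 : R) (fun h => stk t (x + h *: v)) (dstk t v x).
Proof.
move=> t0; have H := is_derive_costr x v (intg_stw t0) (intg_enorm_stw t0).
by rewrite /dstk -mulrN; exact: (is_deriveZ ((2 * pi) ^- d) H).
Qed.

Lemma stk_even t x : stk t (- x) = stk t x.
Proof.
by congr (_ * _); apply: eq_Rintegral => xi _; rewrite dotpNl cosN.
Qed.

Lemma dstkZ t c v x : 0 < t -> dstk t (c *: v) x = c * dstk t v x.
Proof.
move=> t0; rewrite /dstk mulrN mulrCA; congr (- (_ * _)).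
rewrite /sintr -RintZl; last first.
  by apply: intg_sinM; [exact: intg_enorm_stw|exact: measurable_stw].
by apply: eq_Rintegral => xi _; rewrite dotpZl -!mulrA.
Qed.

Lemma dstkD t u v x : 0 < t -> dstk t (u + v) x = dstk t u x + dstk t v x.
Proof.
move=> t0; rewrite /dstk -opprD -mulrDr; congr (- (_ * _)).
have i w : intg mu (fun xi => dotp w xi * sin (dotp x xi) * stw t xi).
  by apply: intg_sinM; [exact: intg_enorm_stw|exact: measurable_stw].
rewrite /sintr -RintD//.
by apply: eq_Rintegral => xi _; rewrite dotpDl !mulrDl.
Qed.

Lemma dstk_sum t (I : Type) (r : seq I) (c : I -> R) (v : I -> 'rV[R]_d) x : 0 < t ->
  dstk t (\sum_(i <- r) c i *: v i) x = \sum_(i <- r) c i * dstk t (v i) x.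
Proof.
move=> t0; elim: r => [|i r IH].
  by rewrite !big_nil -(scale0r 0) dstkZ// mul0r.
by rewrite !big_cons dstkD// dstkZ// IH.
Qed.

Lemma grad_stk t x z b : 0 < t ->
  dotp b (grad (fun z => stk t (x - z)) z) = - dstk t b (x - z).
Proof.
move=> t0.
have D i : grad (fun z => stk t (x - z)) z ord0 i = - dstk t (delta_mx ord0 i) (x - z).
  rewrite mxE /derive.
  have [] := is_derive_stk (x - z) (- delta_mx ord0 i) t0.
  rewrite -[- delta_mx _ _]scaleN1r dstkZ// mulN1r => _ <-.
  rewrite scaleN1r /derive.
  have -> : (fun h : R => h^-1 *: (((fun z0 => stk t (x - z0)) \o shift z) (h *: delta_mx ord0 i) -
      stk t (x - z))) = (fun h : R => h^-1 *: (((fun h => stk t (x - z + h *: - delta_mx ord0 i)) \o shift 0)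
      (h *: 1) - stk t (x - z + 0 *: - delta_mx ord0 i))).
    apply/funext => h /=; rewrite scale0r !addr0.
    have -> : h%:A = h :> R by exact: mulr1.
    by have -> : x - (h *: delta_mx ord0 i + z) = x - z + h *: - delta_mx ord0 i
      by rewrite scalerN opprD (addrC (- (_ *: _))) addrA.
  by [].
rewrite {2}(matrix_sum_delta b) big_ord1 dstk_sum// /dotp -sumrN.
by apply: eq_bigr => i _; rewrite D mulrN.
Qed.

Lemma measurable_stk2 : meas (fun p : R * 'rV[R]_d => stk p.1 p.2).
Proof.
apply: mmul => //.
apply: (@measurable_Rint _ _ _ _ R mu
   (fun p xi => cos (dotp p.2 xi) * stw p.1 xi)).
rewrite (_ : uncurry _ = fun q : R * 'rV[R]_d * 'rV[R]_d => cos (dotp q.1.2 q.2) * stw q.1.1 q.2); last by apply/funext => -[].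
 apply: mmul.
  apply: (mcomp measurable_cos).
  by apply: measurable_fun_dotp => //; exact: (mcomp measurable_snd measurable_fst).
apply: (mcomp (@measurable_expR R)).
apply: (mcomp (@oppr_measurable R setT)).
apply: mmul; first exact: (mcomp measurable_fst measurable_fst).
apply: (mcomp (measurable_powR _)).
by apply: measurable_fun_dotp.
Qed.

Lemma measurable_dstk2 v : meas (fun p : R * 'rV[R]_d => dstk p.1 v p.2).
Proof.
apply: mcomp => //; apply: mmul => //.
apply: (@measurable_Rint _ _ _ _ R mu
   (fun p xi => dotp v xi * sin (dotp p.2 xi) * stw p.1 xi)).
rewrite (_ : uncurry _ = fun q : R * 'rV[R]_d * 'rV[R]_d => dotp v q.2 * sin (dotp q.1.2 q.2) * stw q.1.1 q.2); last by apply/funext => -[].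
 apply: mmul.
  apply: mmul; first by apply: measurable_fun_dotp.
  apply: (mcomp measurable_sin).
  by apply: measurable_fun_dotp => //; exact: (mcomp measurable_snd measurable_fst).
apply: (mcomp (@measurable_expR R)).
apply: (mcomp (@oppr_measurable R setT)).
apply: mmul; first exact: (mcomp measurable_fst measurable_fst).
apply: (mcomp (measurable_powR _)).
by apply: measurable_fun_dotp.
Qed.

Let k_cos x xi : `|cos (dotp x xi)| <= 1 * brk xi.
Proof. by rewrite mul1r (le_trans (norm_cos_le1 _))// brk_ge1. Qed.

Let k_sin x v xi : `|dotp v xi * sin (dotp x xi)| <= enorm v * brk xi.
Proof.
rewrite normrM -[leRHS]mulr1 ler_pM ?norm_sin_le1//.
apply: (le_trans (dotp_le _ _)); rewrite ler_wpM2l ?enorm_ge0//.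
by rewrite /brk lerDr.
Qed.

Let msin x v : meas (fun xi => dotp v xi * sin (dotp x xi)).
Proof. by apply: mmul; [exact: measurable_dotp|exact: measurable_sind]. Qed.

Lemma costr_ge0 t x : 0 < t -> 0 <= costr (stw t) x.
Proof.
move=> t0; have := @gauss_to_stable (fun xi => cos (dotp x xi)) 1 t [::] t0
  (measurable_cosd x) (k_cos x) isT.
rewrite /evals big_nil addr0; apply => s s0; rewrite big_nil addr0.
by rewrite -[X in 0 <= X]/(costr (gaussw s) x) costr_gauss.
Qed.

Lemma stk_ge0 t x : 0 < t -> 0 <= stk t x.
Proof. by move=> t0; rewrite mulr_ge0 ?costr_ge0// ltW. Qed.

Let sqpi : 0 < Num.sqrt (pi : R). Proof. by rewrite sqrtr_gt0 pi_gt0. Qed.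

Lemma costr_upper : exists2 C : R, 0 < C & forall x, x != 0 ->
  costr (stw 1) x <= C * enorm x `^ (- (d%:R + alpha)).
Proof.
have [C C0 HC] := @gpro_upper R d.
exists (Num.sqrt pi ^+ d * C); first by rewrite mulr_gt0// exprn_gt0.
move=> x x0; have r0 : 0 < enorm x by rewrite enorm_gt0.
pose r := enorm x; pose X := r ^+ 2; have X0 : 0 < X by rewrite exprn_gt0.
pose A := (Num.sqrt pi / r) ^+ d * C.
have A0 : 0 < A by rewrite mulr_gt0// exprn_gt0// divr_gt0.
(* The evaluations at [0] and [X^-1] encode the bound of [gpro_upper] at [y = X / s]; the sign is
   reversed because [gauss_to_stable] transfers nonnegativity. *)
have := @gauss_to_stable (fun xi => - cos (dotp x xi)) 1 1
  [:: (A, 0); (- A, X^-1)] ltr01 _ _ _.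
rewrite /evals !big_cons big_nil /= stsym0 addr0.
have -> : \int[mu]_xi (- cos (dotp x xi) * stw 1 xi) = - costr (stw 1) x.
  rewrite /costr -RintN; last by apply: intg_cosM; exact: intg_stw.
  by apply: eq_Rintegral => xi _; rewrite mulNr.
move=> H; have : 0 <= - costr (stw 1) x + (A * 1 + - A * stsym 1 X^-1).
  apply: H.
  - by apply: mcomp => //; exact: measurable_cosd.
  - by move=> xi; rewrite normrN.
  - by rewrite lexx invr_ge0 ltW.
  - move=> s s0; rewrite !big_cons big_nil /= addr0.
    have -> : \int[mu]_xi (- cos (dotp x xi) * gaussw s xi) = - costr (gaussw s) x.
      rewrite /costr -RintN; last by apply: intg_cosM; exact: intg_gaussw.
      by apply: eq_Rintegral => xi _; rewrite mulNr.
    rewrite costr_gauss// (@sqrt_pi_div r)// exprMn -mulrA.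
    have Xs0 : 0 < X / s by rewrite divr_gt0.
    have := HC (X / s) Xs0; rewrite /gpro /dexp mulr0 oppr0 expR0 invf_div.
    have -> : X / s / 4 = dotp x x / (4 * s) by rewrite -sqr_enorm /X /r; field; lra.
    have p0 : 0 <= (Num.sqrt pi / r) ^+ d by rewrite exprn_ge0// divr_ge0// ltW.
    move=> /(ler_wpM2l p0); rewrite /A; lra.
have H1 := @E_le X^-1; rewrite invr_ge0 (ltW X0) in H1.
have := H1 isT => /(ler_wpM2l (ltW A0)); rewrite /E => H2 H3.
rewrite -jw_pow// -/r -/X.
have -> : Num.sqrt pi ^+ d * C * (r^-1 ^+ d * X^-1 `^ (alpha / 2)) = A * X^-1 `^ (alpha / 2).
  by rewrite /A exprMn; ring.
lra.
Qed.

(** The factor [1 / (2 s)] of the Gaussian derivative turns [gpro d] into [gpro d.+2] divided by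
    [2 X], with [X = |x|^2]. Linearity lets the transfer be run with either sign [sg], which yields
    the absolute value. *)
Lemma sintr_upper : exists2 C : R, 0 < C & forall x v, x != 0 ->
  `|sintr (stw 1) v x| <= C * `|dotp x v| * enorm x `^ (- (d.+2%:R + alpha)).
Proof.
have [C C0 HC] := @gpro_upper R d.+2.
exists (Num.sqrt pi ^+ d * C); first by rewrite mulr_gt0// exprn_gt0.
move=> x v x0; have r0 : 0 < enorm x by rewrite enorm_gt0.
pose r := enorm x; pose X := r ^+ 2; have X0 : 0 < X by rewrite exprn_gt0.
pose B := `|dotp x v| / (2 * X) * (Num.sqrt pi / r) ^+ d.
have B0 : 0 <= B by rewrite /B mulr_ge0 ?exprn_ge0 ?divr_ge0 ?mulr_ge0 ?(ltW X0) ?(ltW r0) ?(ltW sqpi).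
pose A := B * C.
have A0 : 0 <= A by rewrite mulr_ge0// ltW.
have key (sg : R) : `|sg| = 1 -> sg * sintr (stw 1) v x <= A * X^-1 `^ (alpha / 2).
  move=> sg1.
  have := @gauss_to_stable (fun xi => - sg * (dotp v xi * sin (dotp x xi))) (enorm v) 1
    [:: (A, 0); (- A, X^-1)] ltr01 _ _ _.
  rewrite /evals !big_cons big_nil /= stsym0 addr0.
  have -> : \int[mu]_xi (- sg * (dotp v xi * sin (dotp x xi)) * stw 1 xi) = - sg * sintr (stw 1) v x.
    rewrite /sintr -RintZl; last first.
      by apply: intg_sinM; [exact: intg_enorm_stw|exact: measurable_stw].
    by apply: eq_Rintegral => xi _; rewrite -!mulrA.
  move=> H; have : 0 <= - sg * sintr (stw 1) v x + (A * 1 + - A * stsym 1 X^-1).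
    apply: H.
    - exact: mmul.
    - by move=> xi; rewrite normrM normrN sg1 mul1r.
    - by rewrite lexx invr_ge0 ltW.
    - move=> s s0; rewrite !big_cons big_nil /= addr0.
      have -> : \int[mu]_xi (- sg * (dotp v xi * sin (dotp x xi)) * gaussw s xi) = - sg * sintr (gaussw s) v x.
        rewrite /sintr -RintZl; last first.
          by apply: intg_sinM; [exact: intg_gaussw_enorm|exact: measurable_gaussw].
        by apply: eq_Rintegral => xi _; rewrite -!mulrA.
      rewrite sintr_gauss// (@sqrt_pi_div r)// exprMn.
      have Xs0 : 0 < X / s by rewrite divr_gt0.
      have := HC (X / s) Xs0; rewrite /gpro /dexp mulr0 oppr0 expR0 invf_div.
      have -> : X / s / 4 = dotp x x / (4 * s) by rewrite -sqr_enorm /X /r; field; lra.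
      rewrite -/X; have -> : Num.sqrt (X / s) ^+ d.+2 = Num.sqrt (X / s) ^+ d * (X / s).
        by rewrite !exprSr -mulrA -expr2 sqr_sqrtr// ltW.
      move=> /(ler_wpM2l B0).
      set G := expR (- (dotp x x / _)); set S := Num.sqrt (X / s) ^+ d.
      set Q := (Num.sqrt pi / r) ^+ d in B B0 A A0 *.
      have -> : dotp x v / (2 * s) * (Q * S * G) = dotp x v / (2 * X) * Q * (S * (X / s) * G).
        by field; rewrite !gt_eqF.
      have T0 : 0 <= (2 * X)^-1 * Q * (S * (X / s) * G).
        by rewrite !mulr_ge0 ?invr_ge0 ?mulr_ge0 ?exprn_ge0 ?sqrtr_ge0 ?expR_ge0 ?divr_ge0 ?(ltW X0)// ltW.
      have : sg * dotp x v <= `|dotp x v|.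
        by apply: (le_trans (ler_norm _)); rewrite normrM sg1 mul1r.
      move=> /(ler_wpM2r T0); rewrite /A /B; lra.
  have H1 := @E_le X^-1; rewrite invr_ge0 (ltW X0) in H1.
  have := H1 isT => /(ler_wpM2l A0); rewrite /E => H2 H3.
  lra.
have eA : Num.sqrt pi ^+ d * C * `|dotp x v| * enorm x `^ (- (d.+2%:R + alpha)) = 2 * (A * X^-1 `^ (alpha / 2)).
  rewrite -jw_pow// -/r -/X /A /B exprMn !exprSr -/X.
  have -> : r^-1 ^+ d * r^-1 * r^-1 = r^-1 ^+ d * X^-1.
    by rewrite -mulrA -invfM -expr2.
  by field; rewrite gt_eqF.
have P0 : 0 <= A * X^-1 `^ (alpha / 2) by rewrite mulr_ge0// powR_ge0.
have k1 := key 1 (normr1 _); have k2 := key (-1) (normrN1 _).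
rewrite eA ler_norml; apply/andP; split; lra.
Qed.

(** [probe_stable] requires [X >= 1]; replacing [|x|] by [max 1 |x|] only lowers the Gaussian
    [exp (- |x|^2 / (4 s))], so lower bounds stay valid up to the origin. *)
Let rho x : R := Num.max 1 (enorm x).

Let rho1 x : 1 <= rho x. Proof. by rewrite /rho le_max lexx. Qed.

Let rho_brk x : rho x <= brk x.
Proof. by rewrite /rho ge_max brk_ge1 /brk lerDr ler01. Qed.

Let lower_aux (m : nat) : exists2 c : R, 0 < c & forall (k : 'rV[R]_d -> R) (A C : R) x,
  0 <= A -> meas k -> (forall xi, `|k xi| <= C * brk xi) ->
  (forall s, 0 < s -> A * gpro m (rho x ^+ 2 / s) <= \int[mu]_xi (k xi * gaussw s xi)) ->
  c * A * ((rho x ^+ 2)^-1) `^ (alpha / 2) <= \int[mu]_xi (k xi * stw 1 xi).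
Proof.
have [th [T [th0 T0 HP]]] := probe_stable.
have [c c0 Hc] := @gpro_lower R m th T th0 T0.
exists (c / 4); first by rewrite divr_gt0.
move=> k A C x A0 mk kC H; pose X := rho x ^+ 2.
have X1 : 1 <= X by rewrite /X expr_ge1// (le_trans ler01).
have X0 : 0 < X by lra.
pose a := c * A; have a0 : 0 <= a by rewrite mulr_ge0// ltW.
(* The six evaluations add up to [- a * probe th T (X / s)]. *)
have := @gauss_to_stable k C 1
  [:: (- a, 0); (a, X^-1); (2 * a, 0); (- (2 * a), th / X); (2 / T * a, 0); (- (2 / T * a), T / X)]
  ltr01 mk kC _ _.
rewrite /evals !big_cons big_nil /= !stsym0 addr0 => K.
have : 0 <= \int[mu]_xi (k xi * stw 1 xi) +
   (- a * 1 + (a * stsym 1 X^-1 + (2 * a * 1 + (- (2 * a) * stsym 1 (th / X) +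
    (2 / T * a * 1 + - (2 / T * a) * stsym 1 (T / X)))))).
  apply: K.
    by rewrite !lexx invr_ge0 !divr_ge0 ?ltW.
  move=> s s0; rewrite !big_cons big_nil /= addr0.
  have Xs0 : 0 < X / s by rewrite divr_gt0.
  have := Hc (X / s) Xs0; rewrite /probe /dexp !mulr0 oppr0 expR0 invf_div.
  have -> : th * (s / X) = s * (th / X) by ring.
  have -> : T * (s / X) = s * (T / X) by ring.
  have := H s s0; rewrite -/X => H1 /(ler_wpM2r A0); rewrite /a; lra.
have := HP X X1 => /(ler_wpM2l a0); rewrite -/X => K1.
have -> : (- a * 1 + (a * stsym 1 X^-1 + (2 * a * 1 + (- (2 * a) * stsym 1 (th / X) +
    (2 / T * a * 1 + - (2 / T * a) * stsym 1 (T / X)))))) =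
    - (a * (E X^-1 - 2 * E (th / X) - 2 / T * E (T / X))).
  by rewrite /E; move: (stsym _ _) (stsym _ _) (stsym _ _) => *; ring.
rewrite subr_ge0 => /(le_trans K1); apply: le_trans.
by rewrite /a; apply: eq_leW; field.
Qed.

Lemma costr_lower : exists2 c : R, 0 < c & forall x,
  c * jw d x <= costr (stw 1) x.
Proof.
have [c c0 Hc] := lower_aux d.
exists (c * Num.sqrt pi ^+ d); first by rewrite mulr_gt0// exprn_gt0.
move=> x; have r0 : 0 < rho x by have := rho1 x; lra.
have := Hc (fun xi => cos (dotp x xi)) ((Num.sqrt pi / rho x) ^+ d) 1 x.
move=> /(_ _ (measurable_cosd x) (k_cos x)) H.
apply: (@le_trans _ _ (c * (Num.sqrt pi / rho x) ^+ d * (rho x ^+ 2)^-1 `^ (alpha / 2))).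
  rewrite exprMn; have -> : c * (Num.sqrt pi ^+ d * (rho x)^-1 ^+ d) * (rho x ^+ 2)^-1 `^ (alpha / 2) =
     c * Num.sqrt pi ^+ d * ((rho x)^-1 ^+ d * (rho x ^+ 2)^-1 `^ (alpha / 2)) by ring.
  rewrite jw_pow// ler_wpM2l ?mulr_ge0 ?exprn_ge0 ?(ltW c0) ?(ltW sqpi)// /jw !powRN lef_pV2 ?posrE ?powR_gt0 ?brk_gt0//.
  by apply: ge0_ler_powR; rewrite ?nnegrE ?(ltW (brk_gt0 _)) ?(ltW r0)// addr_ge0// ltW.
apply: H; first by rewrite exprn_ge0// divr_ge0 ?ltW.
move=> s s0; rewrite -[X in _ <= X]/(costr (gaussw s) x) costr_gauss//.
rewrite (@sqrt_pi_div (rho x))// [X in _ <= X * _]exprMn -[leRHS]mulrA.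
rewrite ler_wpM2l ?exprn_ge0 ?divr_ge0 ?(ltW r0) ?(ltW sqpi)// /gpro.
rewrite ler_wpM2l ?exprn_ge0 ?sqrtr_ge0// ler_expR lerN2.
have -> : rho x ^+ 2 / s / 4 = rho x ^+ 2 / (4 * s) by field; lra.
rewrite ler_wpM2r ?invr_ge0 ?mulr_ge0 ?(ltW s0)// -sqr_enorm.
by apply: lerXn2r; rewrite ?nnegrE ?enorm_ge0 ?(ltW r0)// /rho le_max lexx orbT.
Qed.

(** A lower bound for the gradient has two uses: dividing by the transport kernel off the hyperplane
    [dotp b x = 0], and dominating kernel differences by values of that kernel. *)
Lemma sintr_lower : exists2 c : R, 0 < c & forall x v,
  c * `|dotp x v| * jw d.+2 x <= `|sintr (stw 1) v x|.
Proof.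
have [c c0 Hc] := lower_aux d.+2.
exists (c / 2 * Num.sqrt pi ^+ d); first by rewrite mulr_gt0 ?divr_gt0// exprn_gt0.
move=> x v; have r0 : 0 < rho x by have := rho1 x; lra.
pose sg : R := Num.sg (dotp x v).
have sgE : sg * dotp x v = `|dotp x v| by rewrite -normrEsg.
pose X := rho x ^+ 2; have X0 : 0 < X by rewrite exprn_gt0.
have := Hc (fun xi => sg * (dotp v xi * sin (dotp x xi))) (`|dotp x v| / (2 * X) * (Num.sqrt pi / rho x) ^+ d) (enorm v) x.
have -> : \int[mu]_xi (sg * (dotp v xi * sin (dotp x xi)) * stw 1 xi) = sg * sintr (stw 1) v x.
  rewrite /sintr -RintZl; last first.
    by apply: intg_sinM; [exact: intg_enorm_stw|exact: measurable_stw].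
  by apply: eq_Rintegral => xi _; rewrite -!mulrA.
have sg1 : `|sg| <= 1.
  by rewrite /sg; case: sgrP => _; rewrite ?normr0 ?normr1 ?normrN1.
move=> H.
apply: (@le_trans _ _ (sg * sintr (stw 1) v x)); last first.
  by apply: (le_trans (ler_norm _)); rewrite normrM ler_piMl.
apply: (le_trans _ (H _ _ _ _)).
- rewrite exprMn -/X.
  have -> : c * (`|dotp x v| / (2 * X) * (Num.sqrt pi ^+ d * (rho x)^-1 ^+ d)) * X^-1 `^ (alpha / 2) =
     c / 2 * Num.sqrt pi ^+ d * `|dotp x v| * ((rho x)^-1 ^+ d * X^-1 * X^-1 `^ (alpha / 2)).
    by field; rewrite gt_eqF.
  have -> : (rho x)^-1 ^+ d * X^-1 = (rho x)^-1 ^+ d.+2.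
    by rewrite [RHS]exprSr (exprSr _ d) -mulrA -invfM -expr2.
  rewrite jw_pow// ler_wpM2l ?mulr_ge0 ?exprn_ge0 ?(ltW c0) ?(ltW sqpi) ?divr_ge0// /jw !powRN lef_pV2 ?posrE ?powR_gt0 ?brk_gt0//.
  by apply: ge0_ler_powR; rewrite ?nnegrE ?(ltW (brk_gt0 _)) ?(ltW r0)// addr_ge0// ltW.
- by rewrite mulr_ge0 ?exprn_ge0 ?divr_ge0 ?mulr_ge0 ?(ltW r0) ?(ltW X0) ?(ltW sqpi).
- exact: mmul.
- move=> xi; rewrite normrM -[leRHS]mul1r ler_pM//; exact: k_sin.
- move=> s s0.
  have -> : \int[mu]_xi (sg * (dotp v xi * sin (dotp x xi)) * gaussw s xi) = sg * sintr (gaussw s) v x.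
    rewrite /sintr -RintZl; last first.
      by apply: intg_sinM; [exact: intg_gaussw_enorm|exact: measurable_gaussw].
    by apply: eq_Rintegral => xi _; rewrite -!mulrA.
  rewrite sintr_gauss// (@sqrt_pi_div (rho x))// [(_ / rho x * _) ^+ d]exprMn -/X.
  have Xs0 : 0 < X / s by rewrite divr_gt0.
  rewrite /gpro !exprSr -(mulrA (Num.sqrt (X / s) ^+ d)) -expr2 (sqr_sqrtr (ltW Xs0)).
  set S := Num.sqrt (X / s) ^+ d; set Q := (Num.sqrt pi / rho x) ^+ d.
  have S0 : 0 <= S by rewrite exprn_ge0 ?sqrtr_ge0.
  have Q0 : 0 <= Q by rewrite exprn_ge0 ?divr_ge0 ?(ltW r0) ?(ltW sqpi).
  have -> : sg * (dotp x v / (2 * s) * (Q * S * expR (- (dotp x x / (4 * s))))) =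
     `|dotp x v| / (2 * X) * Q * (S * (X / s)) * expR (- (dotp x x / (4 * s))).
    by rewrite -sgE; field; rewrite !gt_eqF.
  rewrite mulrA ler_wpM2l//.
    have Xs1 := ltW Xs0; have i2 : 0 <= (2 * X)^-1 by rewrite invr_ge0 mulr_ge0// ltW.
    by do ?[apply: mulr_ge0 => //].
  rewrite ler_expR lerN2.
  have -> : X / s / 4 = X / (4 * s) by field; lra.
  rewrite ler_wpM2r ?invr_ge0 ?mulr_ge0 ?(ltW s0)// -sqr_enorm.
  by apply: lerXn2r; rewrite ?nnegrE ?enorm_ge0 ?(ltW r0)// /rho le_max lexx orbT.
Qed.

End stable_kernel.

Section stable_bounds.
Implicit Types (x y v xi : 'rV[R]_d) (s t : R).

Let al0 : 0 < alpha. Proof. by case/andP: alpha12 => /(lt_trans ltr01). Qed.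

Let pid : 0 < (2 * pi : R) ^- d.
Proof. by rewrite invr_gt0 exprn_gt0// mulr_gt0// pi_gt0. Qed.

Lemma jwS m x : brk x * jw m.+1 x = jw m x.
Proof.
rewrite -{1}(powRr1 (ltW (brk_gt0 x))) /jw -powRD ?(gt_eqF (brk_gt0 x)) ?implybT//.
by congr powR; rewrite -natr1; ring.
Qed.

Lemma jw_le_mul m (A : R) x y : 0 < A -> brk y <= A * brk x ->
  jw m x <= A `^ (m%:R + alpha) * jw m y.
Proof.
move=> A0 H; rewrite /jw !powRN ler_pdivlMr ?powR_gt0 ?brk_gt0// mulrC.
rewrite ler_pdivrMr ?powR_gt0 ?brk_gt0// -powRM ?(ltW A0) ?(ltW (brk_gt0 _))//.
apply: ge0_ler_powR => //; rewrite ?nnegrE ?mulr_ge0 ?(ltW A0) ?(ltW (brk_gt0 _))//.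
by rewrite addr_ge0// ltW.
Qed.

(** Joins a decay bound off the origin to a uniform bound: [brk x <= 2 |x|] when [1 <= |x|], and
    [brk x <= 2] otherwise, whence the factor [2^p]. *)
Lemma origin_bound (p A B f : R) x : 0 <= p -> 0 <= A -> 0 <= B ->
  (x != 0 -> f <= A * enorm x `^ (- p)) -> f <= B ->
  f <= 2 `^ p * (A + B) * brk x `^ (- p).
Proof.
move=> p0 A0 B0 fA fB.
have b0 := brk_gt0 x; have bp : 0 < brk x `^ p by exact: powR_gt0.
have key (r : R) : 0 <= r -> brk x <= 2 * r -> brk x `^ p <= 2 `^ p * r `^ p.
  move=> r0 br; rewrite -powRM//; apply: ge0_ler_powR => //; rewrite nnegrE ?mulr_ge0//.
  exact: ltW.
have [x1|x1] := leP 1 (enorm x).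
  have e0 : 0 < enorm x by lra.
  have xn : x != 0 by rewrite -enorm_gt0.
  apply: (le_trans (fA xn)).
  have H := key (enorm x) (ltW e0); rewrite {1}/brk in H.
  have {}H : brk x `^ p <= 2 `^ p * enorm x `^ p by apply: H; lra.
  have ep : 0 < enorm x `^ p by exact: powR_gt0.
  rewrite !powRN ler_pdivlMr// mulrAC ler_pdivrMr//.
  have AB : A <= A + B by lra.
  apply: (le_trans (ler_wpM2l A0 H)).
  by rewrite mulrA [A * _]mulrC ler_wpM2r ?(ltW ep)// ler_wpM2l ?powR_ge0//; lra.
have H := key 1 ler01; rewrite {1}/brk in H.
have {}H : brk x `^ p <= 2 `^ p * 1 `^ p by apply: H; lra.
rewrite powR1 mulr1 in H.
rewrite powRN ler_pdivlMr//; apply: (@le_trans _ _ (B * brk x `^ p)).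
  by rewrite ler_wpM2r// ltW.
by rewrite mulrC; apply: ler_pM => //; rewrite ?(ltW bp)//; lra.
Qed.

Lemma stk1_upper : exists2 C : R, 0 < C & forall x, stk 1 x <= C * jw d x.
Proof.
have [C C0 HC] := costr_upper.
pose B := \int[mu]_xi stw 1 xi.
have B0 : 0 <= B by apply: Rint_ge0 => xi; exact: stw_ge0.
exists ((2 * pi) ^- d * (2 `^ (d%:R + alpha) * (C + B))).
  by rewrite !mulr_gt0 ?powR_gt0//; lra.
move=> x; rewrite /stk -mulrA ler_wpM2l ?(ltW pid)//.
apply: origin_bound; rewrite ?addr_ge0 ?(ltW al0) ?(ltW C0)//; first exact: HC.
apply: le_Rint; [exact/intg_cosM/intg_stw|exact: intg_stw|].
by move=> xi; rewrite ler_piMl ?stw_ge0// cos_le1.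
Qed.

Lemma stk1_lower : exists2 c : R, 0 < c & forall x, c * jw d x <= stk 1 x.
Proof.
have [c c0 Hc] := costr_lower.
exists ((2 * pi) ^- d * c); first by rewrite mulr_gt0.
by move=> x; rewrite /stk -mulrA ler_wpM2l ?(ltW pid).
Qed.

Lemma stk1_gt0 x : 0 < stk 1 x.
Proof.
have [c c0 Hc] := stk1_lower.
by apply: lt_le_trans (Hc x); rewrite mulr_gt0// jw_gt0.
Qed.

Lemma dstk1_upper : exists2 C : R, 0 < C & forall v x,
  `|dstk 1 v x| <= C * (`|dotp x v| + enorm v) * jw d.+2 x.
Proof.
have [C C0 HC] := sintr_upper.
pose J := \int[mu]_xi (enorm xi * stw 1 xi).
have J0 : 0 <= J by apply: Rint_ge0 => xi; rewrite mulr_ge0 ?stw_ge0 ?enorm_ge0.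
exists ((2 * pi) ^- d * 2 `^ (d.+2%:R + alpha) * (C + J)).
  by rewrite !mulr_gt0 ?powR_gt0//; lra.
move=> v x; rewrite /dstk normrN normrM (gtr0_norm pid) -!mulrA ler_wpM2l ?(ltW pid)//.
have i := intg_enorm_stw ltr01.
have H : `|sintr (stw 1) v x| <=
    2 `^ (d.+2%:R + alpha) * (C * `|dotp x v| + enorm v * J) * jw d.+2 x.
  apply: origin_bound.
  - by apply: addr_ge0 => //; exact: ltW.
  - by rewrite mulr_ge0// ltW.
  - by rewrite mulr_ge0// enorm_ge0.
  - exact: HC.
  apply: le_trans (le_norm_Rint _) _; first by apply: intg_sinM; rewrite //; exact: measurable_stw.
  rewrite -RintZl//; apply: le_Rint.
  - by apply/intg_norm/intg_sinM; rewrite //; exact: measurable_stw.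
  - exact: intgZl.
  - by move=> xi; have := sintr_bound v x xi (stw 1); rewrite (ger0_norm (stw_ge0 _ _)).
apply: (le_trans H); rewrite -mulrA ler_wpM2l ?powR_ge0// mulrA ler_wpM2r ?(ltW (jw_gt0 _ _))//.
have e0 := enorm_ge0 v; have n0 := normr_ge0 (dotp x v).
by rewrite mulrDl !mulrDr; have := mulr_ge0 (ltW C0) e0; have := mulr_ge0 J0 n0;
  rewrite (mulrC J (enorm v)); lra.
Qed.

Lemma dstk1_lower : exists2 c : R, 0 < c & forall v x,
  c * `|dotp x v| * jw d.+2 x <= `|dstk 1 v x|.
Proof.
have [c c0 Hc] := sintr_lower.
exists ((2 * pi) ^- d * c); first by rewrite mulr_gt0.
by move=> v x; rewrite /dstk normrN normrM (gtr0_norm pid) -!mulrA ler_wpM2l ?(ltW pid)// mulrA.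
Qed.

(** The inverse of the self-similar length [t^(1/alpha)]; [rs t ^+ d] is the decay rate
    [t^(-d/alpha)]. *)
Definition rs t : R := t `^ (- alpha^-1).

Lemma rs_gt0 t : 0 < t -> 0 < rs t. Proof. exact: powR_gt0. Qed.

Lemma rs1 : rs 1 = 1. Proof. by rewrite /rs powR1. Qed.

Lemma rsM s t : 0 <= s -> 0 <= t -> rs (s * t) = rs s * rs t.
Proof. by move=> s0 t0; rewrite /rs powRM. Qed.

Lemma stw_rs t xi : 0 < t -> stw t (rs t *: xi) = stw 1 xi.
Proof.
move=> t0; rewrite /stw /stsym dotpZl dotpZr mulrA -expr2; congr (expR (- _)).
rewrite powRM ?dotpp_ge0 ?sqr_ge0// mul1r.
have -> : (rs t ^+ 2) `^ (alpha / 2) = t^-1.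
  rewrite -powR_mulrn ?(ltW (rs_gt0 t0))// -!powRrM.
  have -> : - alpha^-1 * (2%:R * (alpha / 2)) = -1 by field; rewrite gt_eqF.
  by rewrite powR_inv1// ltW.
by rewrite mulrA mulfV ?mul1r// gt_eqF.
Qed.

Lemma stk_scale t x : 0 < t -> stk t x = rs t ^+ d * stk 1 (rs t *: x).
Proof.
move=> t0; have r0 := rs_gt0 t0; rewrite /stk mulrCA; congr (_ * _).
have H := @Rint_affine R d (rs t) 0 (fun xi => cos (dotp x xi) * stw t xi) r0.
rewrite /costr -H; last by apply: mmul; [exact: measurable_cosd|exact: measurable_stw].
have E xi : cos (dotp x (rs t *: xi + 0)) * stw t (rs t *: xi + 0) =
    cos (dotp (rs t *: x) xi) * stw 1 xi.
  by rewrite addr0 stw_rs// dotpZr dotpZl.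
by under eq_Rintegral do rewrite E.
Qed.

Lemma dstk_scale t v x : 0 < t ->
  dstk t v x = rs t ^+ d.+1 * dstk 1 v (rs t *: x).
Proof.
move=> t0; have r0 := rs_gt0 t0; rewrite /dstk mulrN mulrCA; congr (- (_ * _)).
have H := @Rint_affine R d (rs t) 0 (fun xi => dotp v xi * sin (dotp x xi) * stw t xi) r0.
rewrite /sintr -H; last first.
  apply: mmul; last exact: measurable_stw.
  by apply: mmul; [exact: measurable_dotp|exact: measurable_sind].
rewrite exprSr -mulrA; congr (_ * _).
have i : intg mu (fun xi => dotp v xi * sin (dotp (rs t *: x) xi) * stw 1 xi).
  by apply: intg_sinM; [exact: intg_enorm_stw|exact: measurable_stw].
rewrite -(RintZl _ i); apply: eq_Rintegral => xi _.
by rewrite addr0 stw_rs// !dotpZr dotpZl !mulrA.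
Qed.

Lemma stk_gt0 t x : 0 < t -> 0 < stk t x.
Proof. by move=> t0; rewrite stk_scale// mulr_gt0 ?stk1_gt0// exprn_gt0// rs_gt0. Qed.

Lemma stk_sup : exists2 C : R, 0 < C & forall t x, 0 < t -> stk t x <= C * rs t ^+ d.
Proof.
have [C C0 HC] := stk1_upper; exists C => // t x t0.
rewrite stk_scale// mulrC ler_wpM2r ?exprn_ge0 ?(ltW (rs_gt0 t0))//.
apply: (le_trans (HC _)); rewrite ler_piMr ?(ltW C0)// /jw powRN invf_le1 ?powR_gt0 ?brk_gt0//.
have p0 : 0 <= d%:R + alpha by apply: addr_ge0 => //; exact: ltW.
by have := ler_powR (brk_ge1 (rs t *: x)) p0; rewrite powRr0.
Qed.

(** Of the two extra powers of decay in [jw d.+2], one pays for the factor [dotp x v]; the other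
    survives as [1 / brk]. That surviving power is the gain [1 / |x|] used far from the origin. *)
Lemma dstk_le_stk : exists2 C : R, 0 < C & forall t v x, 0 < t ->
  `|dstk t v x| <= C * enorm v * rs t * stk t x / brk (rs t *: x).
Proof.
have [C C0 HC] := dstk1_upper; have [c c0 Hc] := stk1_lower.
exists (C / c); first by rewrite divr_gt0.
move=> t v x t0; have r0 := rs_gt0 t0.
rewrite dstk_scale// stk_scale// normrM (ger0_norm (exprn_ge0 _ (ltW r0))).
set y := rs t *: x; have b0 := brk_gt0 y.
apply: (@le_trans _ _ (rs t ^+ d.+1 * (C * enorm v * (stk 1 y / (c * brk y))))).
  rewrite ler_wpM2l ?exprn_ge0 ?(ltW r0)//; apply: (le_trans (HC _ _)).
  apply: (@le_trans _ _ (C * enorm v * jw d.+1 y)).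
    rewrite -(jwS d.+1) mulrA ler_wpM2r ?(ltW (jw_gt0 _ _))// -mulrA ler_wpM2l ?(ltW C0)//.
    by have := dotp_le y v; rewrite /brk; lra.
  rewrite ler_wpM2l ?mulr_ge0 ?enorm_ge0 ?(ltW C0)//.
  by rewrite ler_pdivlMr ?mulr_gt0// mulrC -mulrA jwS.
apply: eq_leW; rewrite exprSr.
by field; rewrite !gt_eqF.
Qed.

End stable_bounds.

(** * Fourier inversion, unit mass and the semigroup law *)

Section stable_fourier.
Local Notation pt := stk.
Local Notation dpt := dstk.
Local Notation sw := stw.
Implicit Types (x y v xi : 'rV[R]_d) (s t e : R).

Let al0 : 0 < alpha. Proof. by case/andP: alpha12 => /(lt_trans ltr01). Qed.

Lemma measurable_stk t : meas (pt t).
Proof.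
apply: (measurable_uncurry1 (f := pt) t).
by rewrite (_ : uncurry _ = fun p => pt p.1 p.2); [exact: measurable_stk2|apply/funext => -[]].
Qed.

Lemma measurable_dstk t v : meas (dpt t v).
Proof.
apply: (measurable_uncurry1 (f := fun t => dpt t v) t).
by rewrite (_ : uncurry _ = fun p => dpt p.1 v p.2); [exact: measurable_dstk2|apply/funext => -[]].
Qed.

Lemma stwN t xi : sw t (- xi) = sw t xi.
Proof. by rewrite /stw dotpNl dotpNr opprK. Qed.

Lemma gausswN e xi : gaussw e (- xi) = gaussw e xi.
Proof. by rewrite /gaussw dotpNl dotpNr opprK. Qed.

Lemma cvg_stw t (u : nat -> R) xi z : u n @[n --> \oo] --> 0 ->
  sw t (u n *: z + xi) @[n --> \oo] --> sw t xi.
Proof.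
move=> u0.
have c1 : dotp (u n *: z + xi) (u n *: z + xi) @[n --> \oo] --> dotp xi xi.
  have -> : (fun n => dotp (u n *: z + xi) (u n *: z + xi)) = fun n =>
     u n * (u n * dotp z z + 2 * dotp z xi) + dotp xi xi.
    by apply/funext => n; rewrite !dotpDl !dotpDr !dotpZl !dotpZr (dotpC xi z); ring.
  rewrite -[X in _ --> X]add0r; apply: cvgD; last exact: cvg_cst.
  rewrite -[X in _ --> X](mul0r (0 * dotp z z + 2 * dotp z xi)); apply: cvgM => //.
  by apply: cvgD; [exact: cvgMr_tmp|exact: cvg_cst].
have a20 : 0 < alpha / 2 by rewrite divr_gt0.
have c2 := cvg_powR a20 (fun n => dotpp_ge0 _) (dotpp_ge0 _) c1.
have c3 : - (t * dotp (u n *: z + xi) (u n *: z + xi) `^ (alpha / 2)) @[n --> \oo] -->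
    - (t * dotp xi xi `^ (alpha / 2)) by apply: cvgN; exact: cvgMl_tmp.
exact: (cvg_comp _ _ c3 (@continuous_expR R _)).
Qed.

(** The Gaussian factor justifies Fubini before the kernel is known to be integrable. The outcome is
    an average of the symbol around [xi], at scale [2 * Num.sqrt e]. *)
Lemma gauss_stk_fourier e t xi : 0 < e -> 0 < t ->
  \int[mu]_y (cos (dotp xi y) * (gaussw e y * pt t y)) =
  (Num.sqrt pi) ^- d * \int[mu]_z (sw t ((2 * Num.sqrt e) *: z + xi) * gaussw 1 z).
Proof.
move=> e0 t0.
have iw := intg_stw t0; have ig := intg_gaussw d e0.
pose h y eta := cos (dotp xi y) * gaussw e y * (cos (dotp y eta) * sw t eta).
have mh : meas (uncurry h).
  rewrite (_ : uncurry h = fun p => cos (dotp xi p.1) * gaussw e p.1 * (cos (dotp p.1 p.2) * sw t p.2)); last first.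
    by apply/funext => -[].
  apply: mmul.
    apply: mmul.
      by apply: (mcomp (measurable_cosd xi)).
    by apply: (mcomp (measurable_gaussw e)).
  apply: mmul; last by apply: (mcomp (measurable_stw t)).
  apply: (mcomp measurable_cos).
  exact: measurable_fun_dotp.
have ih : intg (mu \x mu)%E (uncurry h).
  apply: (intg_tensor mh _ ig iw) => y eta.
  rewrite /h !normrM (ger0_norm (expR_ge0 _)) (ger0_norm (stw_ge0 _ _)).
  by apply: ler_pM; rewrite ?mulr_ge0 ?expR_ge0 ?stw_ge0// ler_piMl ?expR_ge0 ?stw_ge0 ?norm_cos_le1.
have E1 : \int[mu]_y (cos (dotp xi y) * (gaussw e y * pt t y)) =
    (2 * pi) ^- d * \int[mu]_y \int[mu]_eta h y eta.
  rewrite -RintZl; last exact: (intg_fubiniF ih).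
  apply: eq_Rintegral => y _; rewrite /h RintZl; last exact: intg_cosM.
  by rewrite /stk /costr; ring.
rewrite E1 (Rfubini ih).
pose G (z : 'rV[R]_d) := costr (gaussw e) z.
pose S := Num.sqrt (pi / e) ^+ d.
have GE z : G z = S * gaussw (4 * e)^-1 z.
  by rewrite /G costr_gauss// /gaussw -/S (mulrC (4 * e)^-1).
have mG : meas G.
  rewrite (_ : G = fun z => S * gaussw (4 * e)^-1 z); last exact/funext.
  by apply: mmul => //; exact: measurable_gaussw.
have S0 : 0 <= S by rewrite exprn_ge0// sqrtr_ge0.
have Gb z : `|G z| <= S.
  rewrite GE ger0_norm ?mulr_ge0 ?expR_ge0// ler_piMr// expN_le1// mulr_ge0 ?dotpp_ge0//.
  by rewrite invr_ge0 mulr_ge0// ltW.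
have GN z : G (- z) = G z by rewrite !GE gausswN.
have iG u : intg mu (fun eta => sw t eta * G (eta + u)).
  apply: (intgMr (M := S)) => //; apply: mcomp => //; exact: measurable_shift_rV.
(* Product to sum; the two halves are exchanged by [eta |-> - eta], under which the symbol and [G]
   are invariant, so they have the same integral. *)
have E2 eta : \int[mu]_y h y eta = 2^-1 * (sw t eta * G (eta - xi) + sw t eta * G (eta + xi)).
  have -> : (fun y => h y eta) = fun y => 2^-1 * sw t eta *
     (cos (dotp (eta - xi) y) * gaussw e y + cos (dotp (eta + xi) y) * gaussw e y).
    by apply/funext => y; rewrite /h dotpBl dotpDl cosB cosD (dotpC y eta); field.
  rewrite RintZl; last by apply: intgD; exact: intg_cosM.
  rewrite RintD; [|exact: intg_cosM|exact: intg_cosM].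
  by rewrite /G /costr; ring.
have E3 : \int[mu]_eta \int[mu]_y h y eta = \int[mu]_eta (sw t eta * G (eta - xi)).
  under eq_Rintegral do rewrite E2.
  rewrite RintZl ?RintD; [|exact: iG|exact: iG|by apply: intgD; exact: iG].
  rewrite -[X in _ * (_ + X)]RintN_rV; last exact: (intg_meas (iG xi)).
  under [X in _ * (_ + X)]eq_Rintegral do rewrite stwN -GN opprD opprK.
  by field.
rewrite E3.
have c0 : 0 < 2 * Num.sqrt e by rewrite mulr_gt0// sqrtr_gt0.
have H := @Rint_affine R d (2 * Num.sqrt e) xi (fun eta => sw t eta * G (eta - xi)) c0.
rewrite -H; last exact: (intg_meas (iG (- xi))).
have E4 z : sw t ((2 * Num.sqrt e) *: z + xi) * G ((2 * Num.sqrt e) *: z + xi - xi) =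
    S * (sw t ((2 * Num.sqrt e) *: z + xi) * gaussw 1 z).
  rewrite addrK GE mulrCA; congr (_ * (_ * _)).
  rewrite /gaussw dotpZl dotpZr; congr (expR (- _)).
  have -> : (4 * e)^-1 * (2 * Num.sqrt e * (2 * Num.sqrt e * dotp z z)) =
    (4 * e)^-1 * (4 * Num.sqrt e ^+ 2) * dotp z z by ring.
  by rewrite sqr_sqrtr ?(ltW e0)// mulVf ?mul1r// gt_eqF// mulr_gt0.
under eq_Rintegral do rewrite E4.
have i1 : intg mu (fun z => sw t ((2 * Num.sqrt e) *: z + xi) * gaussw 1 z).
  apply: (intgMl (M := 1)); last exact: intg_gaussw.
    by apply: (mcomp (measurable_stw t)); exact: measurable_affine_rV.
  by move=> z; rewrite ger0_norm ?stw_ge0// stsym_le1// ltW.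
rewrite RintZl// !mulrA; congr (_ * _); rewrite /S -exprVn -!exprMn -exprVn; congr (_ ^+ _).
have sp : 0 < Num.sqrt (pi : R) by rewrite sqrtr_gt0 pi_gt0.
have se : 0 < Num.sqrt e by rewrite sqrtr_gt0.
rewrite sqrtrM ?pi_ge0// sqrtrV ?(ltW e0)// -[X in 2 * X](@sqr_sqrtr R pi) ?pi_ge0//.
by field; rewrite !gt_eqF.
Qed.

Lemma measurable_gauss_stk e t : meas (fun y => gaussw e y * pt t y).
Proof. by apply: mmul; [exact: measurable_gaussw|exact: measurable_stk]. Qed.

Let spd : 0 < Num.sqrt (pi : R) ^+ d.
Proof. by rewrite exprn_gt0// sqrtr_gt0 pi_gt0. Qed.

Let int_g1 : \int[mu]_z gaussw 1 z = Num.sqrt pi ^+ d.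
Proof.
have := @costr_gauss R d 1 0 ltr01; rewrite (divr1 (pi : R)) dotp0r mul0r oppr0 expR0 mulr1 => <-.
by apply: eq_Rintegral => z _; rewrite dotpC dotp0r cos0 mul1r.
Qed.

Let im e t xi : 0 < t -> intg mu (fun z => sw t (e *: z + xi) * gaussw 1 z).
Proof.
move=> t0; apply: (intgMl (M := 1)); last exact: intg_gaussw.
  by apply: (mcomp (measurable_stw t)); exact: measurable_affine_rV.
by move=> z; rewrite ger0_norm ?stw_ge0// stsym_le1// ltW.
Qed.

Let eps (n : nat) : R := n.+1%:R^-1.
Let eps0 n : 0 < eps n. Proof. by rewrite invr_gt0. Qed.
Let eps_cvg : eps n @[n --> \oo] --> (0 : R). Proof. exact: cvg_harmonic. Qed.

Let gauss_cvg y : gaussw (eps n) y @[n --> \oo] --> (1 : R).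
Proof.
have -> : 1 = expR (- (0 * dotp y y)) :> R by rewrite mul0r oppr0 expR0.
suff h : - (eps n * dotp y y) @[n --> \oo] --> - (0 * dotp y y).
  exact: (cvg_comp _ _ h (@continuous_expR R _)).
by apply: cvgN; exact: cvgMr_tmp.
Qed.

Let gauss_le1 n y : gaussw (eps n) y <= 1.
Proof. by rewrite expN_le1// mulr_ge0 ?dotpp_ge0//; exact: ltW. Qed.

(** Fatou as the Gaussian regularization disappears, in the previous identity at frequency 0: the
    averaged symbol never exceeds 1. *)
Lemma intg_stk t : 0 < t -> intg mu (pt t).
Proof.
move=> t0; apply: intgP; first exact: measurable_stk.
apply: (@le_lt_trans _ _ 1%:E); last exact: ltry.
under eq_integral do rewrite (ger0_norm (stk_ge0 _ t0)).
have [C C0 HC] := stk_sup.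
have ign n : intg mu (fun y => gaussw (eps n) y * pt t y).
  apply: (intgMr (M := C * rs t ^+ d)); [exact: measurable_stk| |exact: intg_gaussw].
  by move=> y; rewrite ger0_norm ?stk_ge0// HC.
apply: (@fatou_le _ _ _ mu (fun n y => gaussw (eps n) y * pt t y)).
- by move=> n; exact: measurable_gauss_stk.
- by move=> n y; rewrite mulr_ge0 ?expR_ge0 ?stk_ge0.
- by move=> y; rewrite -[X in _ --> X]mul1r; exact: cvgMr_tmp.
- move=> n; rewrite -EFin_Rint// lee_fin.
  have := gauss_stk_fourier 0 (eps0 n) t0.
  have -> : (fun y => cos (dotp 0 y) * (gaussw (eps n) y * pt t y)) = fun y => gaussw (eps n) y * pt t y.
    by apply/funext => y; rewrite dotpC dotp0r cos0 mul1r.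
  move=> ->; rewrite mulrC ler_pdivrMr// mul1r -int_g1; apply: le_Rint.
  + exact: im.
  + exact: intg_gaussw.
  + by move=> z; rewrite ler_piMl ?expR_ge0// stsym_le1// ltW.
Qed.

(* Fourier inversion, by Gaussian regularization. *)
Lemma stk_fourier t xi : 0 < t -> \int[mu]_y (cos (dotp xi y) * pt t y) = sw t xi.
Proof.
move=> t0; have ik := intg_stk t0.
have c1 : \int[mu]_y (cos (dotp xi y) * (gaussw (eps n) y * pt t y)) @[n --> \oo] -->
    \int[mu]_y (cos (dotp xi y) * pt t y).
  have [] // := @dct _ _ _ mu (fun n y => cos (dotp xi y) * (gaussw (eps n) y * pt t y))
     (fun y => cos (dotp xi y) * pt t y) (pt t).
  - by move=> n; apply: mmul; [exact: measurable_cosd|exact: measurable_gauss_stk].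
  - move=> y; apply: cvgMl_tmp; rewrite -[X in _ --> X]mul1r; exact: cvgMr_tmp.
  - move=> n y; rewrite normrM (ger0_norm (mulr_ge0 (expR_ge0 _) (stk_ge0 _ t0))).
    have p0 := stk_ge0 y t0.
    rewrite -[leRHS]mul1r; apply: ler_pM; rewrite ?norm_cos_le1//.
      by rewrite mulr_ge0// expR_ge0.
    by rewrite ler_piMl// gauss_le1.
have c2 : (Num.sqrt pi) ^- d * \int[mu]_z (sw t ((2 * Num.sqrt (eps n)) *: z + xi) * gaussw 1 z)
    @[n --> \oo] --> sw t xi.
  have -> : sw t xi = (Num.sqrt pi) ^- d * \int[mu]_z (sw t xi * gaussw 1 z).
    rewrite RintZl ?int_g1; last exact: intg_gaussw.
    by rewrite mulrCA mulVf ?mulr1// gt_eqF.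
  apply: cvgMl_tmp.
  have [] // := @dct _ _ _ mu (fun n z => sw t ((2 * Num.sqrt (eps n)) *: z + xi) * gaussw 1 z)
     (fun z => sw t xi * gaussw 1 z) (gaussw 1).
  - by move=> n; exact: intg_meas (im _ _ t0).
  - move=> z; apply: cvgMr_tmp; apply: cvg_stw.
    rewrite -[X in _ --> X](mulr0 2); apply: cvgMl_tmp.
    have := cvg_comp _ _ eps_cvg (@sqrt_continuous R 0); rewrite sqrtr0; exact.
  - exact: intg_gaussw.
  - move=> n z; rewrite normrM (ger0_norm (stw_ge0 _ _)) (ger0_norm (expR_ge0 _)).
    apply: ler_piMl; first exact: expR_ge0.
    by apply: stsym_le1; exact: ltW.
move: c1; under eq_fun do rewrite (gauss_stk_fourier xi (eps0 _) t0); move=> c1.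
have h := @norm_hausdorff _ R; exact: (cvg_unique h c1 c2).
Qed.

Lemma Rint_stk t : 0 < t -> \int[mu]_y pt t y = 1.
Proof.
move=> t0; have := stk_fourier 0 t0; rewrite /stw dotp0r /stsym powR0; last first.
  by rewrite gt_eqF// divr_gt0.
rewrite mulr0 oppr0 expR0 => <-.
by apply: eq_Rintegral => y _; rewrite dotpC dotp0r cos0 mul1r.
Qed.

Lemma inte_stk t : 0 < t -> (\int[mu]_y (pt t y)%:E = 1)%E.
Proof. by move=> t0; rewrite -EFin_Rint ?Rint_stk//; exact: intg_stk. Qed.

Lemma stk_fourier_sin t xi : 0 < t -> \int[mu]_y (sin (dotp xi y) * pt t y) = 0.
Proof.
move=> t0; apply: Rintegral_odd_rV.
  by apply: mmul; [exact: measurable_sind|exact: measurable_stk].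
by move=> y; rewrite dotpNr sinN stk_even mulNr.
Qed.

Lemma stwD s t xi : sw s xi * sw t xi = sw (s + t) xi.
Proof. by rewrite /stw /stsym -expRD; congr expR; ring. Qed.

Lemma stk_phase t x eta (a b : R) : 0 < t ->
  \int[mu]_z ((a * cos (dotp (x - z) eta) + b * sin (dotp (x - z) eta)) * pt t z) =
  (a * cos (dotp x eta) + b * sin (dotp x eta)) * sw t eta.
Proof.
move=> t0; have ik := intg_stk t0.
have ic : intg mu (fun z => cos (dotp eta z) * pt t z) by exact: intg_cosM.
have is_ : intg mu (fun z => sin (dotp eta z) * pt t z).
  apply: (intgMl (M := 1)) => //; first exact: measurable_sind.
  by move=> z; exact: norm_sin_le1.
have -> : (fun z => (a * cos (dotp (x - z) eta) + b * sin (dotp (x - z) eta)) * pt t z) =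
   fun z => (a * cos (dotp x eta) + b * sin (dotp x eta)) * (cos (dotp eta z) * pt t z) +
     (a * sin (dotp x eta) - b * cos (dotp x eta)) * (sin (dotp eta z) * pt t z).
  by apply/funext => z; rewrite dotpBl cosB sinB (dotpC z); ring.
rewrite RintD; [|exact: intgZl|exact: intgZl].
by rewrite !RintZl// stk_fourier// stk_fourier_sin// mulr0 addr0.
Qed.

(** The semigroup law on the Fourier side, [sw s * sw t = sw (s + t)]. The pair [(a, b)] is [(1, 0)]
    for the kernel and [(0, dotp w)] for its gradient, so both convolution rules come from one
    application of Fubini. *)
Let conv_aux s t x (a b : 'rV[R]_d -> R) : 0 < s -> 0 < t ->
  meas a -> meas b ->
  (forall eta, `|a eta| <= brk eta) -> (forall eta, `|b eta| <= brk eta) ->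
  \int[mu]_z ((\int[mu]_eta ((a eta * cos (dotp (x - z) eta) + b eta * sin (dotp (x - z) eta)) * sw s eta)) * pt t z) =
  \int[mu]_eta ((a eta * cos (dotp x eta) + b eta * sin (dotp x eta)) * sw (s + t) eta).
Proof.
move=> s0 t0 ma mb ha hb; have ik := intg_stk t0.
have ibw := intg_brk_stw s0.
pose A y eta := a eta * cos (dotp y eta) + b eta * sin (dotp y eta).
pose h z eta := A (x - z) eta * sw s eta * pt t z.
have Ab y eta : `|A y eta| <= 2 * brk eta.
  apply: (le_trans (ler_normD _ _)); rewrite !normrM.
  have h1 : `|a eta| * `|cos (dotp y eta)| <= brk eta.
    rewrite -[leRHS]mulr1; apply: ler_pM => //; exact: norm_cos_le1.
  have h2 : `|b eta| * `|sin (dotp y eta)| <= brk eta.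
    rewrite -[leRHS]mulr1; apply: ler_pM => //; exact: norm_sin_le1.
  by lra.
have mA1 (f : 'rV[R]_d * 'rV[R]_d -> 'rV[R]_d) : meas f ->
   meas (fun p : 'rV[R]_d * 'rV[R]_d => A (f p) p.2).
  move=> mf; apply: measurable_funD; apply: mmul.
  - exact: (mcomp ma measurable_snd).
  - apply: (mcomp measurable_cos).
    exact: measurable_fun_dotp.
  - exact: (mcomp mb measurable_snd).
  - apply: (mcomp measurable_sin).
    exact: measurable_fun_dotp.
have mh : meas (uncurry h).
  rewrite (_ : uncurry h = fun p => A (x - p.1) p.2 * sw s p.2 * pt t p.1); last by apply/funext => -[].
  apply: mmul; last exact: (mcomp (measurable_stk t) measurable_fst).
  apply: mmul; last exact: (mcomp (measurable_stw s) measurable_snd).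
  by apply: (mA1 (fun p => x - p.1)); exact: measurable_funB_rV.
have ih : intg (mu \x mu)%E (uncurry h).
  apply: (intg_tensor mh _ (intgZl 2 ik) ibw) => z eta.
  rewrite /h normrM normrM (ger0_norm (stw_ge0 _ _)) (ger0_norm (stk_ge0 z t0)).
  apply: (@le_trans _ _ (2 * brk eta * sw s eta * pt t z)).
    by rewrite !ler_wpM2r ?stk_ge0 ?stw_ge0.
  by apply: eq_leW; ring.
have mA y : meas (A y).
  apply: measurable_funD; apply: mmul => //; [exact: measurable_cosd|exact: measurable_sind].
have iA y : intg mu (fun eta => A y eta * sw s eta).
  apply: intg_le (intgZl 2 ibw); first by apply: mmul => //; exact: measurable_stw.
  by move=> eta; rewrite normrM (ger0_norm (stw_ge0 _ _)) mulrA ler_wpM2r ?stw_ge0.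
transitivity (\int[mu]_z \int[mu]_eta h z eta).
  by apply: eq_Rintegral => z _; rewrite /h RintZr.
rewrite (Rfubini ih); apply: eq_Rintegral => eta _.
have -> : (fun z => h z eta) = fun z => sw s eta * (A (x - z) eta * pt t z).
  by apply/funext => z; rewrite /h; ring.
have iz : intg mu (fun z => A (x - z) eta * pt t z).
  apply: (intgMl (M := 2 * brk eta)) => //.
  apply: (mcomp (f := A^~ eta)); last exact: measurable_sub_rV.
  apply: measurable_funD; apply: mmul => //.
    by apply: (mcomp measurable_cos); exact: measurable_fun_dotp.
  by apply: (mcomp measurable_sin); exact: measurable_fun_dotp.
by rewrite RintZl// /A stk_phase// -stwD; ring.
Qed.

Lemma stk_conv s t x : 0 < s -> 0 < t ->
  \int[mu]_z (pt s (x - z) * pt t z) = pt (s + t) x.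
Proof.
move=> s0 t0.
have b0 (eta : 'rV[R]_d) : `|0 : R| <= brk eta by rewrite normr0 ltW// brk_gt0.
have b1 (eta : 'rV[R]_d) : `|1 : R| <= brk eta by rewrite normr1 brk_ge1.
have := conv_aux x s0 t0 (@measurable_cst _ _ 'rV[R]_d R setT 1) (@measurable_cst _ _ 'rV[R]_d R setT 0) b1 b0.
have E (y eta : 'rV[R]_d) : 1 * cos (dotp y eta) + 0 * sin (dotp y eta) = cos (dotp y eta) by ring.
under eq_Rintegral => z _ do under eq_Rintegral do rewrite E.
under [X in _ = X -> _]eq_Rintegral do rewrite E.
rewrite -/(costr _ _) => H.
have S y : pt s y = (2 * pi) ^- d * \int[mu]_eta (cos (dotp y eta) * sw s eta) by [].
rewrite [RHS](_ : _ = (2 * pi) ^- d * costr (sw (s + t)) x)// -H -RintZl.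
  by apply: eq_Rintegral => z _; rewrite S -mulrA.
have ik := intg_stk t0; have [C C0 HC] := stk_sup.
have i : intg mu (fun z => pt s (x - z) * pt t z).
  apply: (intgMl (M := C * rs s ^+ d)) => //.
    by apply: (mcomp (measurable_stk s)); exact: measurable_sub_rV.
  by move=> z; rewrite ger0_norm ?stk_ge0// HC.
have := intgZl ((2 * pi) ^+ d) i; apply: eq_integrable => // z _ /=; congr EFin.
by rewrite S !mulrA mulfV ?mul1r// expf_neq0// gt_eqF// mulr_gt0// pi_gt0.
Qed.

Lemma dstk_conv s t v x : 0 < s -> 0 < t ->
  \int[mu]_z (dpt s v (x - z) * pt t z) = dpt (s + t) v x.
Proof.
move=> s0 t0; have k0 : 0 < 1 + enorm v by rewrite ltr_wpDr ?enorm_ge0.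
(* Normalization: [conv_aux] wants the weight [dotp w] to be at most [brk]; both sides are linear in
   the direction. *)
pose w := (1 + enorm v)^-1 *: v.
suff H : \int[mu]_z (dpt s w (x - z) * pt t z) = dpt (s + t) w x.
  have vE : v = (1 + enorm v) *: w by rewrite scalerA mulfV ?scale1r// gt_eqF.
  have ik := intg_stk t0; have [C C0 HC] := dstk_le_stk.
  have [C' C'0 HC'] := stk_sup.
  have i : intg mu (fun z => dpt s w (x - z) * pt t z).
    apply: (intgMl (M := C * enorm w * rs s * (C' * rs s ^+ d))) => //.
      by apply: (mcomp (measurable_dstk s w)); exact: measurable_sub_rV.
    move=> z; apply: (le_trans (HC _ _ _ s0)).
    have r0 := rs_gt0 s0.
    have k1 : 0 <= C * enorm w * rs s by rewrite !mulr_ge0 ?enorm_ge0 ?(ltW C0) ?(ltW r0).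
    rewrite ler_pdivrMr ?brk_gt0// -[leRHS]mulrA ler_wpM2l//.
    have k2 : 0 <= C' * rs s ^+ d by rewrite mulr_ge0 ?exprn_ge0 ?(ltW C'0) ?(ltW r0).
    by apply: (le_trans (HC' _ _ s0)); rewrite ler_peMr// brk_ge1.
  rewrite {2}vE dstkZ ?addr_gt0// -H -RintZl//; apply: eq_Rintegral => z _.
  by rewrite {1}vE dstkZ// mulrA.
have b0 (eta : 'rV[R]_d) : `|0 : R| <= brk eta by rewrite normr0 ltW// brk_gt0.
have bw (eta : 'rV[R]_d) : `|dotp w eta| <= brk eta.
  apply: (le_trans (dotp_le _ _)); rewrite /w enormZ ger0_norm ?invr_ge0 ?(ltW k0)//.
  apply: (@le_trans _ _ (1 * enorm eta)); last by rewrite mul1r /brk lerDr.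
  by rewrite ler_wpM2r ?enorm_ge0// ler_pdivrMl// mulr1 lerDr.
have := conv_aux x s0 t0 (@measurable_cst _ _ 'rV[R]_d R setT 0) (measurable_dotp w) b0 bw.
have E (y eta : 'rV[R]_d) : 0 * cos (dotp y eta) + dotp w eta * sin (dotp y eta) =
   dotp w eta * sin (dotp y eta) by ring.
under eq_Rintegral => z _ do under eq_Rintegral do rewrite E.
under [X in _ = X -> _]eq_Rintegral do rewrite E.
rewrite -/(sintr _ _ _) => H.
have S y : dpt s w y = - (2 * pi) ^- d * \int[mu]_eta (dotp w eta * sin (dotp y eta) * sw s eta).
  by rewrite mulNr.
rewrite [RHS](_ : _ = - (2 * pi) ^- d * sintr (sw (s + t)) w x); last by rewrite mulNr.
rewrite -H -RintZl.
  by apply: eq_Rintegral => z _; rewrite S -mulrA.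
apply: (intgMl (M := enorm w * \int[mu]_eta (enorm eta * sw s eta))); last exact: intg_stk.
  have := mmul (measurable_cst (- (2 * pi) ^+ d)) (mcomp (measurable_dstk s w) (measurable_sub_rV x)).
  apply: eq_measurable_fun => z _ /=.
  by rewrite S mulrA mulrNN mulfV ?mul1r// expf_neq0// gt_eqF// mulr_gt0// pi_gt0.
move=> z; have i := intg_enorm_stw s0.
apply: le_trans (le_norm_Rint _) _; first by apply: intg_sinM; rewrite //; exact: measurable_stw.
rewrite -RintZl//; apply: le_Rint.
- by apply/intg_norm/intg_sinM; rewrite //; exact: measurable_stw.
- exact: intgZl.
- by move=> xi; have := sintr_bound w (x - z) xi (sw s); rewrite (ger0_norm (stw_ge0 _ _)).
Qed.

Lemma cvg_dstk1 v x w (u e : nat -> R) (r : R) :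
  u n @[n --> \oo] --> r -> e n @[n --> \oo] --> (0 : R) ->
  dpt 1 v (u n *: x - e n *: w) @[n --> \oo] --> dpt 1 v (r *: x).
Proof.
move=> ur e0; rewrite /dstk; apply: cvgN; apply: cvgMl_tmp.
have ie := intg_enorm_stw ltr01.
have [] // := @dct _ _ _ mu
   (fun n xi => dotp v xi * sin (dotp (u n *: x - e n *: w) xi) * sw 1 xi)
   (fun xi => dotp v xi * sin (dotp (r *: x) xi) * sw 1 xi)
   (fun xi => enorm v * (enorm xi * `|sw 1 xi|)).
- move=> n; have := @intg_sinM R d v (u n *: x - e n *: w) (sw 1) ie (measurable_stw 1).
  exact: intg_meas.
- move=> xi; apply: cvgMr_tmp; apply: cvgMl_tmp.
  have h : u n * dotp x xi - e n * dotp w xi @[n --> \oo] --> r * dotp x xi - 0 * dotp w xi.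
    by apply: cvgB; exact: cvgMr_tmp.
  have E n : dotp (u n *: x - e n *: w) xi = u n * dotp x xi - e n * dotp w xi.
    by rewrite dotpBl !dotpZl.
  under eq_fun do rewrite E.
  rewrite dotpZl -[r * _]subr0 -(mul0r (dotp w xi)).
  exact: (cvg_comp _ _ h (@continuous_sin R _)).
- by apply: intg_enormM => //; exact: measurable_stw.
- by move=> n xi; exact: sintr_bound.
Qed.

End stable_fourier.

#[global] Opaque stk dstk.
Variable b : 'rV[R]_d.
Local Notation pt := stk.
Local Notation rt := rs.

(** * The transport kernel and its difference quotients *)

Section transport_kernel.
Implicit Types (x y z : 'rV[R]_d) (s t h r : R).

Let al0 : 0 < alpha. Proof. by case/andP: alpha12 => /(lt_trans ltr01). Qed.

(** The kernel of the Duhamel term: by [grad_stk], [kap (t - s) (x - z)] is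
    [b . grad_z p(t - s, x - z)], sign included. *)
Definition kap t x : R := - dstk t b x.

(* The upwind difference quotient approximating [kap]. *)
Definition dqk h t x : R := (pt t (x - h *: b) - pt t x) / h.

Lemma measurable_kap t : meas (kap t).
Proof. by apply: mcomp => //; exact: measurable_dstk. Qed.

Lemma measurable_dqk h t : meas (dqk h t).
Proof.
apply: mmul => //; apply: measurable_funB; last exact: measurable_stk.
by apply: (mcomp (measurable_stk t)); exact: measurable_shift_rV.
Qed.

Lemma rs_le s t : 0 < s -> s <= t -> rt t <= rt s.
Proof.
move=> s0 st; rewrite /rs !powRN lef_pV2 ?posrE ?powR_gt0//; last exact: lt_le_trans st.
apply: ge0_ler_powR => //; rewrite ?nnegrE ?invr_ge0 ?(ltW al0) ?(ltW s0)//.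
exact: (le_trans (ltW s0)).
Qed.

(** After scaling, both kernels are comparable to [jw d], so a comparison of the scaled brackets
    gives a Harnack-type comparison of the kernels at two points and two times. *)
Lemma stk_harnack : exists2 C : R, 0 < C & forall s t x y (A : R), 0 < s -> 0 < t -> 0 < A ->
  brk (rt t *: x) <= A * brk (rt s *: y) ->
  pt s y <= C * A `^ (d%:R + alpha) * (rt s / rt t) ^+ d * pt t x.
Proof.
have [C C0 HC] := stk1_upper.
have [c c0 Hc] := stk1_lower.
exists (C / c); first by rewrite divr_gt0.
move=> s t x y A s0 t0 A0 H; have rs0 := rs_gt0 s0; have rt0 := rs_gt0 t0.
rewrite (stk_scale y s0) (stk_scale x t0).
have H1 := jw_le_mul d A0 H.
set J := jw d (rt s *: y) in H1; set P := pt 1 (rt t *: x).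
set K := A `^ _ in H1 *; have K0 : 0 <= K by exact: powR_ge0.
have {}H1 : J <= K * (P / c).
  by apply: (le_trans H1); rewrite ler_wpM2l// ler_pdivlMr// mulrC Hc.
have -> : C / c * K * (rt s / rt t) ^+ d * (rt t ^+ d * P) = rt s ^+ d * (C * (K * (P / c))).
  rewrite exprMn exprVn; field; rewrite !gt_eqF// exprn_gt0//.
rewrite ler_wpM2l ?exprn_ge0 ?(ltW rs0)//; apply: (le_trans (HC _)).
by rewrite ler_wpM2l// ltW.
Qed.

Lemma kap_le_stk : exists2 C : R, 0 < C & forall t x, 0 < t ->
  `|kap t x| <= C * rt t * pt t x.
Proof.
have [C C0 HC] := dstk_le_stk.
exists (C * (1 + enorm b)); first by rewrite mulr_gt0// ltr_wpDr ?enorm_ge0.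
move=> t x t0; rewrite /kap normrN; apply: (le_trans (HC t b x t0)).
have r0 := rs_gt0 t0; have p0 := stk_ge0 x t0; have e0 := enorm_ge0 b.
rewrite ler_pdivrMr ?brk_gt0//.
apply: (@le_trans _ _ (C * (1 + enorm b) * rt t * pt t x)).
  by rewrite !ler_wpM2r ?(ltW r0)// ler_wpM2l ?(ltW C0)// lerDr.
rewrite ler_peMr ?brk_ge1//; apply: mulr_ge0 => //; apply: mulr_ge0; last exact: ltW.
by rewrite mulr_ge0 ?(ltW C0)// addr_ge0.
Qed.

Lemma intg_kap t : 0 < t -> intg mu (kap t).
Proof.
move=> t0; have [C C0 HC] := kap_le_stk.
by apply: intg_le (intgZl (C * rt t) (intg_stk t0)) => [|x]; [exact: measurable_kap|exact: HC].
Qed.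

Lemma kap_conv s t x : 0 < s -> 0 < t ->
  \int[mu]_z (kap s (x - z) * pt t z) = kap (s + t) x.
Proof.
move=> s0 t0; rewrite /kap -dstk_conv// -RintN.
  by apply: eq_Rintegral => z _; rewrite mulNr.
have [C C0 HC] := kap_le_stk; have [C' C'0 HC'] := stk_sup.
apply: (intgMl (M := C * rt s * (C' * rt s ^+ d))); last exact: intg_stk.
  by apply: (mcomp (measurable_dstk s b)); exact: measurable_sub_rV.
move=> z; have := HC s (x - z) s0; rewrite /kap normrN => /le_trans; apply.
by rewrite ler_wpM2l ?mulr_ge0 ?(ltW C0) ?(ltW (rs_gt0 _))// HC'.
Qed.

Lemma is_derive_stk_at t x r : 0 < t ->
  is_derive r (1 : R) (fun r : R => pt t (x - r *: b)) (kap t (x - r *: b)).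
Proof.
move=> t0; have := is_derive_stk (x - r *: b) (- b) t0.
rewrite -[- b]scaleN1r dstkZ// mulN1r -/(kap _ _) => H.
rewrite [X in is_derive _ _ X _](_ : _ =
   (fun h => pt t (x - r *: b + h *: (-1 *: b))) \o (fun q : R => q - r)); last first.
  apply/funext => q /=; congr (pt t _).
  by rewrite scaleN1r scalerN -addrA -opprD -scalerDl addrCA subrr addr0.
rewrite -[X in is_derive _ _ _ X]mulr1.
apply: is_derive1_comp; first by rewrite subrr.
by apply: is_derive_eq; rewrite subr0.
Qed.

Lemma dqk_mvt h t x : 0 < h -> 0 < t ->
  exists2 r, 0 < r < h & dqk h t x = kap t (x - r *: b).
Proof.
move=> h0 t0; have D r := is_derive_stk_at x r t0.
have [|r] := MVT h0 (fun r _ => D r).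
  apply: derivable_within_continuous => r _; by case: (D r).
rewrite in_itv/= => rh; rewrite scale0r subr0 => E; exists r => //.
by rewrite /dqk E subr0 mulfK// gt_eqF.
Qed.

(** By the mean value theorem the quotient is [kap] at a point displaced by less than [h b]. The
    condition [h * rt t <= 1] keeps this displacement within the diffusion length, so Harnack
    returns to one kernel [pt t] for all [s] in [[t, 2 t]]: an integrable majorant for dominated
    convergence. *)
Lemma dqk_le_stk : exists2 C : R, 0 < C & forall h s t x, 0 < h -> 0 < t -> t <= s -> s <= 2 * t ->
  h * rt t <= 1 -> `|dqk h s x| <= C * rt t * pt t x.
Proof.
have [C C0 HC] := kap_le_stk; have [K K0 HK] := stk_harnack.
pose A : R := 2 + 2 * enorm b; have A0 : 0 < A by rewrite /A; have := enorm_ge0 b; lra.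
exists (C * (K * A `^ (d%:R + alpha))); first by rewrite !mulr_gt0// powR_gt0.
move=> h s t x h0 t0 ts s2t hr; have s0 : 0 < s by exact: lt_le_trans ts.
have [r /andP[r0 rh] ->] := dqk_mvt x h0 s0.
apply: (le_trans (HC _ _ s0)); have rst := rs_le t0 ts.
have rs0 := rs_gt0 s0; have rt0 := rs_gt0 t0.
have rt2 : rt t <= 2 * rt s.
  have : rt (2 * t) <= rt s by exact: rs_le.
  have : rt t <= 2 * rt (2 * t).
    rewrite rsM ?(ltW t0)// mulrA ler_peMl ?(ltW rt0)//.
    rewrite /rs powRN ler_pdivlMr ?powR_gt0// mul1r.
    rewrite -[leRHS]powRr1//; apply: ler_powR; rewrite ?ler1n//.
    by rewrite invf_le1//; case/andP: alpha12 => /ltW.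
  by lra.
have H : brk (rt t *: x) <= A * brk (rt s *: (x - r *: b)).
  rewrite /brk !enormZ !gtr0_norm//.
  have : enorm x <= enorm (x - r *: b) + r * enorm b.
    by apply: le_trans (_ : _ <= enorm (x - r *: b) + enorm (r *: b)) _;
       rewrite ?(le_trans _ (enormD _ _)) ?subrK// enormZ gtr0_norm.
  set e := enorm (x - r *: b); set f := enorm x => fe.
  have e0 : 0 <= e by exact: enorm_ge0.
  have b0 : 0 <= enorm b by exact: enorm_ge0.
  have h1 : rt t * f <= rt t * e + rt t * r * enorm b.
    by rewrite -mulrA -mulrDr ler_wpM2l// ltW.
  have h2 : rt t * e <= 2 * rt s * e by rewrite ler_wpM2r.
  have h3 : rt t * r * enorm b <= 1 * enorm b.
    rewrite ler_wpM2r//; apply: le_trans hr; rewrite mulrC ler_wpM2r ?(ltW rt0)//; exact: ltW.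
  have h4 : 0 <= enorm b * (rt s * e) by rewrite !mulr_ge0 ?(ltW rs0).
  rewrite /A; move: (rt s * e) (rt t * f) (rt t * e) (rt t * r * enorm b) (enorm b) h1 h2 h3 h4 b0
    (mulrA 2 (rt s) e) => u1 u2 u3 u4 u5 k1 k2 k3 k4 k5 k6.
  by rewrite -k6 in k2; nra.
have := HK s t x _ A s0 t0 A0 H; set y := x - _; set P := A `^ _ => H1.
have P0 : 0 <= P by exact: powR_ge0.
have p0 := stk_ge0 x t0.
have {}H1 : pt s y <= K * P * pt t x.
  apply: (le_trans H1); rewrite ler_wpM2r// ler_piMr ?mulr_ge0 ?(ltW K0)//.
  rewrite exprn_ile1 ?divr_ge0 ?(ltW rs0) ?(ltW rt0)//.
  by rewrite ler_pdivrMr// mul1r.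
rewrite -!mulrA ler_wpM2l ?(ltW C0)//.
apply: (@le_trans _ _ (rt t * (K * P * pt t x))); last by apply: eq_leW; ring.
by apply: ler_pM => //; [exact: ltW|exact: stk_ge0].
Qed.

Lemma intg_dqk h t : 0 < t -> intg mu (dqk h t).
Proof.
move=> t0; apply: intgZr; apply: intgB; last exact: intg_stk.
exact: (intg_shift (- (h *: b)) (intg_stk t0)).
Qed.

Lemma kap_L1 : exists2 C : R, 0 < C & forall t, 0 < t -> \int[mu]_x `|kap t x| <= C * rt t.
Proof.
have [C C0 HC] := kap_le_stk; exists C => // t t0.
rewrite -[leRHS]mulr1 -(Rint_stk t0) -RintZl; last exact: intg_stk.
apply: le_Rint; [exact/intg_norm/intg_kap|exact/intgZl/intg_stk|].
by move=> x; exact: HC.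
Qed.

(** For [h] beyond the diffusion length the trivial bound [2 / h] is already below [2 * rt t], so
    one constant serves all steps. *)
Lemma dqk_L1 : exists2 C : R, 0 < C & forall h t, 0 < h -> 0 < t ->
  \int[mu]_x `|dqk h t x| <= C * rt t.
Proof.
have [C C0 HC] := dqk_le_stk; exists (C + 2); first by lra.
move=> h t h0 t0; have r0 := rs_gt0 t0; have ip := intg_stk t0.
have [hr|hr] := leP (h * rt t) 1.
  apply: (@le_trans _ _ (C * rt t)); last by rewrite ler_wpM2r ?(ltW r0)//; lra.
  rewrite -[leRHS]mulr1 -(Rint_stk t0) -RintZl//.
  apply: le_Rint; [exact/intg_norm/intg_dqk|exact/intgZl|].
  by move=> x; apply: HC => //; lra.
have is_ := intg_shift (- (h *: b)) ip.
apply: (@le_trans _ _ (\int[mu]_x (h^-1 * (pt t (x - h *: b) + pt t x)))).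
  apply: le_Rint; [exact/intg_norm/intg_dqk|by apply/intgZl/intgD|].
  move=> x; rewrite /dqk normrM mulrC ger0_norm ?invr_ge0 ?(ltW h0)// ler_wpM2l ?invr_ge0 ?(ltW h0)//.
  apply: (le_trans (ler_normB _ _)).
  by rewrite !ger0_norm ?stk_ge0.
rewrite RintZl; last exact: intgD.
rewrite RintD// Rint_shift; last exact: measurable_stk.
rewrite Rint_stk// mulrC ler_pdivrMr//.
have := mulr_ge0 (ltW C0) (mulr_ge0 (ltW h0) (ltW r0)); lra.
Qed.

Lemma cvg_dqk t (h s : nat -> R) : 0 < t -> (forall n, 0 < h n) ->
  (forall n, t <= s n <= 2 * t) -> (forall n, h n * rt t <= 1) ->
  h n @[n --> \oo] --> (0 : R) -> s n @[n --> \oo] --> t ->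
  \int[mu]_x `|dqk (h n) (s n) x - kap t x| @[n --> \oo] --> (0 : R).
Proof.
move=> t0 h0 st hr hc sc; have [C C0 HC] := dqk_le_stk.
have s0 n : 0 < s n by case/andP: (st n) => /(lt_le_trans t0).
have rc : rt (s n) @[n --> \oo] --> rt t.
  have ca : {for t, continuous (fun x : R => x `^ (- alpha^-1))}.
    have [ex _] := is_derive1_powR (- alpha^-1) t0.
    by apply/differentiable_continuous/derivable1_diffP.
  exact: (cvg_comp s _ sc ca).
have [] // := @dct _ _ _ mu (fun n => dqk (h n) (s n)) (kap t) (fun x => C * rt t * pt t x).
- by move=> n; exact: measurable_dqk.
- move=> x; have /choice[r Hr] : forall n, exists r, 0 < r < h n /\ dqk (h n) (s n) x = kap (s n) (x - r *: b).
    by move=> n; have [r ? ?] := dqk_mvt x (h0 n) (s0 n); exists r.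
  have rc0 : r n @[n --> \oo] --> (0 : R).
    apply: (squeeze_cvgr (f := fun=> 0) (h := h)) => //; last exact: cvg_cst.
    by apply: nearW => n; case: (Hr n) => /andP[/ltW -> /ltW ->].
  have -> : (fun n => dqk (h n) (s n) x) = fun n =>
      rt (s n) ^+ d.+1 * - dstk 1 b (rt (s n) *: x - (rt (s n) * r n) *: b).
    by apply/funext => n; rewrite (Hr n).2 /kap (dstk_scale _ _ (s0 n)) scalerBr scalerA -mulrN.
  rewrite /kap (dstk_scale _ _ t0) -mulrN; apply: cvgM.
    exact: (cvg_comp _ _ rc (@exprn_continuous R d.+1 (rt t))).
  apply: cvgN; apply: cvg_dstk1 => //.
  by rewrite -[X in _ --> X](mulr0 (rt t)); exact: cvgM.
- exact/intgZl/intg_stk.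
- by move=> n x; apply: HC => //; case/andP: (st n).
Qed.

End transport_kernel.
Local Notation kp := kap.
Local Notation dq := dqk.

(** * The stable semigroup and the monotone upwind step *)

Section heat_semigroup.
Implicit Types (f g : 'rV[R]_d -> R) (x y z : 'rV[R]_d) (s t h : R).

Lemma stk_bounded t : 0 < t -> exists K : R, forall x, `|pt t x| <= K.
Proof.
move=> t0; have [C C0 HC] := stk_sup.
by exists (C * rt t ^+ d) => x; rewrite ger0_norm ?stk_ge0// HC.
Qed.

Lemma kap_bounded t : 0 < t -> exists K : R, forall x, `|kp t x| <= K.
Proof.
move=> t0; have [C C0 HC] := kap_le_stk; have [K HK] := stk_bounded t0.
exists (C * rt t * K) => x; apply: (le_trans (HC t x t0)).
rewrite ler_wpM2l ?mulr_ge0 ?(ltW C0) ?(ltW (rs_gt0 _))//.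
exact: le_trans (ler_norm _) (HK x).
Qed.

Lemma dqk_bounded h t : 0 < t -> exists K : R, forall x, `|dq h t x| <= K.
Proof.
move=> t0; have [K HK] := stk_bounded t0.
exists ((K + K) * `|h^-1|) => x; rewrite normrM ler_wpM2r//.
by apply: (le_trans (ler_normB _ _)); rewrite lerD.
Qed.

Lemma n1_stk t : 0 < t -> n1 (pt t) = 1%:E.
Proof.
move=> t0; rewrite -(inte_stk t0); apply: eq_integral => x _.
by rewrite ger0_norm// stk_ge0.
Qed.

Lemma n1_conv_stk t f : 0 < t -> meas f -> (n1 (conv (pt t) f) <= n1 f)%E.
Proof.
by move=> t0 mf; have := n1_conv (measurable_stk t) mf; rewrite n1_stk// mul1e.
Qed.

Lemma conv_stk_stk s t f x : 0 < s -> 0 < t -> intg mu f ->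
  conv (pt s) (conv (pt t) f) x = conv (pt (s + t)) f x.
Proof.
move=> s0 t0 if_; have [K HK] := stk_bounded s0; have [K2 HK2] := stk_bounded t0.
apply: (conv_conv (measurable_stk s) HK x (intg_stk t0) HK2 if_) => y.
exact: stk_conv.
Qed.

Lemma stk_kap_conv s t x : 0 < s -> 0 < t ->
  \int[mu]_z (pt s (x - z) * kp t z) = kp (s + t) x.
Proof.
move=> s0 t0; rewrite addrC -kap_conv// -(Rint_sub x (f := fun z => pt s (x - z) * kp t z)); last first.
  apply: mmul; last exact: measurable_kap.
  by apply: (mcomp (measurable_stk s)); exact: measurable_sub_rV.
by apply: eq_Rintegral => z _; rewrite subKr mulrC.
Qed.

Lemma stk_dqk_conv h s t x : 0 < s -> 0 < t ->
  \int[mu]_z (pt s (x - z) * dq h t z) = dq h (s + t) x.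
Proof.
move=> s0 t0; have [K HK] := stk_bounded s0; have ip := intg_stk t0.
have ms : meas (fun z => pt s (x - z)).
  by apply: (mcomp (measurable_stk s)); exact: measurable_sub_rV.
have i1 : intg mu (fun z => pt s (x - z) * pt t z) by apply: (intgMl (M := K)).
have i2 : intg mu (fun z => pt s (x - z) * pt t (z - h *: b)).
  by apply: (intgMl (M := K)) => //; exact: (intg_shift (- (h *: b)) ip).
have -> : (fun z => pt s (x - z) * dq h t z) =
   fun z => (pt s (x - z) * pt t (z - h *: b) - pt s (x - z) * pt t z) * h^-1.
  by apply/funext => z; rewrite /dqk mulrA mulrBr.
rewrite RintZr ?RintB//; last exact: intgB.
rewrite /dqk stk_conv//; congr ((_ - _) / _).
rewrite -(stk_conv (x - h *: b) s0 t0).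
rewrite -(Rint_shift (h *: b) (f := fun z => pt s (x - z) * pt t (z - h *: b))); last exact: intg_meas i2.
by apply: eq_Rintegral => z _; rewrite addrK opprD addrA addrAC.
Qed.

Lemma conv_stk_dqk h s t f x : 0 < s -> 0 < t -> intg mu f ->
  conv (pt s) (conv (dq h t) f) x = conv (dq h (s + t)) f x.
Proof.
move=> s0 t0 if_; have [K HK] := stk_bounded s0; have [K2 HK2] := dqk_bounded h t0.
have E y := stk_dqk_conv h y s0 t0.
exact: (conv_conv (measurable_stk s) HK x (intg_dqk h t0) HK2 if_ E).
Qed.

Lemma conv_stk_sup : exists2 C : R, 0 < C & forall t f x, 0 < t -> intg mu f ->
  `|conv (pt t) f x| <= C * rt t ^+ d * \int[mu]_y `|f y|.
Proof.
have [C C0 HC] := stk_sup; exists C => // t f x t0 if_.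
apply: conv_norm_le => //; first exact: measurable_stk.
by move=> y; rewrite ger0_norm ?stk_ge0// HC.
Qed.

Lemma conv_stk_ge0 t f x : 0 < t -> {ae mu, forall y, 0 <= f y} -> intg mu f -> 0 <= conv (pt t) f x.
Proof.
move=> t0 f0 if_; have [K HK] := stk_bounded t0.
have := conv_le (measurable_stk t) HK x (fun y => stk_ge0 y t0) (intg0 mu) if_ f0.
by rewrite {1}/conv; under eq_Rintegral do rewrite mulr0; rewrite Rint0.
Qed.

Section upwind_step.
Variables (F : R -> R) (L : R).
Hypotheses (F0 : F 0 = 0) (F_mono : forall u v : R, u <= v -> F u <= F v)
  (F_lip : forall u v : R, u <= v -> F v - F u <= L * (v - u)).

Lemma F_abs (u v : R) : `|F u - F v| <= L * `|u - v|.
Proof.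
wlog uv : u v / v <= u.
  by move=> H; have [/H//|/ltW/H] := leP v u; rewrite distrC [in leRHS]distrC.
by rewrite !ger0_norm ?subr_ge0// ?F_mono// F_lip.
Qed.

Lemma F_measurable : meas F.
Proof. by apply: nondecreasing_measurable => // u v; exact: F_mono. Qed.

Lemma intg_F w : intg mu w -> intg mu (fun x => F (w x)).
Proof.
move=> iw; apply: intg_le (intgZl L (intg_norm iw)).
  by apply: (mcomp F_measurable); exact: intg_meas iw.
by move=> x; have := F_abs (w x) 0; rewrite F0 !subr0.
Qed.

(* Monotone upwind transport step followed by stable diffusion. *)
Definition upw (lam h : R) (w : 'rV[R]_d -> R) x : R := w x - lam * (F (w x) - F (w (x - h *: b))).

Definition stp (lam k : R) (w : 'rV[R]_d -> R) : 'rV[R]_d -> R := conv (pt k) (upw lam (k / lam) w).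

Lemma intg_upw lam h w : intg mu w -> intg mu (upw lam h w).
Proof.
move=> iw; apply: intgB => //; apply: intgZl; apply: intgB; first exact: intg_F.
by have := intg_shift (- (h *: b)) (intg_F iw).
Qed.

Lemma intg_stp lam k w : 0 < k -> intg mu w -> intg mu (stp lam k w).
Proof. by move=> k0 iw; apply: intg_conv; [exact: intg_stk|exact: intg_upw]. Qed.

Section monotone.
Variables (lam : R).
Hypotheses (lam0 : 0 <= lam) (lamL : lam * L <= 1).

(** The dependence of the upwind step on the local value [w x]; the CFL condition [lam * L <= 1]
    makes it nondecreasing. In the scheme [lam] is the ratio of the time step to the space step, and
    stays fixed under refinement. *)
Let A u := u - lam * F u.

Let A_mono u v : u <= v -> A u <= A v.
Proof.
move=> uv; rewrite /A; have := ler_wpM2l lam0 (F_lip uv); rewrite mulrA.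
have uv0 : 0 <= v - u by rewrite subr_ge0.
by have := ler_wpM2r uv0 lamL; rewrite mulrBr; lra.
Qed.

Let upwE h w x : upw lam h w x = A (w x) + lam * F (w (x - h *: b)).
Proof. by rewrite /upw /A; ring. Qed.

Lemma upw_ge0 h w : (forall x, 0 <= w x) -> forall x, 0 <= upw lam h w x.
Proof.
move=> w0 x; rewrite upwE; have := A_mono (w0 x); rewrite /A F0 mulr0 subr0 => H.
by rewrite addr_ge0// mulr_ge0// -F0 F_mono.
Qed.

(** The step is [A (w x)] plus the nondecreasing [lam * F] at the upwind point. The positive part is
    subadditive and the translation preserves the integral; since both increments [A w - A c] and
    [lam (F w - F c)] have the sign of [w - c], their positive parts recombine into [(w - c)^+]. *)
Lemma upw_posp h (c : R) w : meas w ->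
  (\int[mu]_x (posp c (upw lam h w x))%:E <= \int[mu]_x (posp c (w x))%:E)%E.
Proof.
move=> mw; pose a u := posp (A c) (A u); pose e u := posp (lam * F c) (lam * F u).
have mA : meas A.
  by apply: nondecreasing_measurable => // u v; exact: A_mono.
have ma : meas (fun x => a (w x)).
  by apply: (mcomp (measurable_posp _)); exact: (mcomp mA mw).
have me0 : meas e.
  apply: (mcomp (measurable_posp _)); apply: mmul => //; exact: F_measurable.
have me : meas (fun x => e (w x)) by exact: mcomp.
have me' : meas (fun x => e (w (x - h *: b))).
  by apply: (mcomp me); exact: measurable_shift_rV.
apply: (@le_trans _ _ (\int[mu]_x (a (w x) + e (w (x - h *: b)))%:E)%E).
  apply: le_inte.
  - apply: (mcomp (measurable_posp _)); apply: measurable_funB => //.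
    apply: mmul => //; apply: measurable_funB.
      exact: (mcomp F_measurable mw).
    apply: (mcomp F_measurable); apply: (mcomp mw); exact: measurable_shift_rV.
  - exact: measurable_funD.
  - by move=> x; exact: posp_ge0.
  - move=> x; rewrite upwE /a /e /posp ge_max.
    set u := A (w x); set v := lam * F (w _).
    have u1 : u - A c <= Num.max (u - A c) 0 by rewrite le_max lexx.
    have u0 : 0 <= Num.max (u - A c) 0 by rewrite le_max lexx orbT.
    have v1 : v - lam * F c <= Num.max (v - lam * F c) 0 by rewrite le_max lexx.
    have v0 : 0 <= Num.max (v - lam * F c) 0 by rewrite le_max lexx orbT.
    have -> : u + v - c = (u - A c) + (v - lam * F c) by rewrite /A; ring.
    by apply/andP; split; [exact: lerD|exact: addr_ge0].
rewrite inteD//; try by move=> x; exact: posp_ge0.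
rewrite (inte_shift (- (h *: b)) me) //; last by move=> x; exact: posp_ge0.
rewrite -inteD//; try by move=> x; exact: posp_ge0.
apply: eq_leW; apply: eq_integral => x _; congr EFin.
rewrite /a /e /posp; have [wc|cw] := leP (w x) c.
  have h1 : A (w x) - A c <= 0 by rewrite subr_le0 A_mono.
  have h2 : lam * F (w x) - lam * F c <= 0 by rewrite subr_le0 ler_wpM2l// F_mono.
  by rewrite !max_r// ?addr0// subr_le0.
have {}cw := ltW cw.
have h1 : 0 <= A (w x) - A c by rewrite subr_ge0 A_mono.
have h2 : 0 <= lam * F (w x) - lam * F c by rewrite subr_ge0 ler_wpM2l// F_mono.
by rewrite !max_l// ?subr_ge0// /A; ring.
Qed.

End monotone.
End upwind_step.

(** Jensen's inequality for [s |-> (s - c)^+] against the kernel, a probability density. *)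
Lemma conv_stk_posp t (c : R) w : 0 < t -> intg mu w -> intg mu (fun y => posp c (w y)) ->
  (\int[mu]_x (posp c (conv (pt t) w x))%:E <= \int[mu]_x (posp c (w x))%:E)%E.
Proof.
move=> t0 iw ip; have mw := intg_meas iw.
have [K HK] := stk_bounded t0; have mk := measurable_stk t.
have ik := intg_stk t0.
have pE : (\int[mu]_x (posp c (w x))%:E = n1 (fun x => posp c (w x)))%E.
  by apply: eq_integral => x _; rewrite ger0_norm ?posp_ge0.
rewrite pE; apply: le_trans (n1_conv_stk t0 (intg_meas ip)).
apply: le_inte.
- apply: (mcomp (measurable_posp _)); exact: measurable_conv.
- by apply: mcomp => //; apply: measurable_conv => //; exact: intg_meas ip.
- by move=> x; exact: posp_ge0.
move=> x; apply: le_trans (ler_norm _).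
have i1 := intg_conv_arg mk HK x iw; have i2 := intg_conv_arg mk HK x ip.
have i3 := intg_sub x ik.
rewrite {1}/posp ge_max; apply/andP; split; last first.
  by apply: Rint_ge0 => y; rewrite mulr_ge0 ?posp_ge0 ?stk_ge0.
have -> : conv (pt t) w x - c = \int[mu]_y (pt t (x - y) * w y - c * pt t (x - y)).
  rewrite RintB//; last exact: intgZl.
  rewrite RintZl// (Rint_sub x (f := pt t))// Rint_stk ?mulr1//.
apply: le_Rint => //; first by apply: intgB => //; exact: intgZl.
move=> y; rewrite [c * _]mulrC -mulrBr ler_wpM2l ?stk_ge0//.
by rewrite /posp le_max lexx.
Qed.

End heat_semigroup.

(** * L^2 bounds: layer cake and a discrete Nash inequality *)

Section L2_estimates.
Implicit Types (f g w : 'rV[R]_d -> R) (x y z : 'rV[R]_d) (s t h c : R).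

Let lc c s : R := (0 < c)%R%:R * posp c s.

Let lc_ge0 c s : 0 <= lc c s. Proof. by rewrite mulr_ge0 ?posp_ge0. Qed.

Let measurable_lc1 : meas (fun c => lc c 1).
Proof.
apply: mmul.
  rewrite (_ : (fun c => _) = \1_(`]0, +oo[%classic)); first exact: measurable_indic.
  by apply/funext => c; rewrite indicE mem_setE in_itv/= andbT.
by apply: measurable_maxr => //; apply: measurable_funB.
Qed.

(** The value is [1/2], but positivity and finiteness suffice, and comparison with indicators gives
    them. *)
Let J : exists2 j : R, 0 < j & (\int[leb]_c (lc c 1)%:E = j%:E)%E.
Proof.
have h1 : (\int[leb]_c (lc c 1)%:E <= 1%:E)%E.
  have := inte_oi (@ler01 R); rewrite subr0 => <-.
  apply: le_inte; [exact: measurable_lc1|exact: measurable_oi|by move=> c; exact: lc_ge0|].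
  move=> c; rewrite /lc /posp /oi; case: ltP => //= [c0|]; last by rewrite mul0r.
  rewrite mul1r; case: ltP => [c1|c1]; first by rewrite ge_max ler01 andbT lerBlDr lerDl ltW.
  by rewrite ge_max lexx andbT subr_le0.
have h2 : ((4^-1 : R)%:E <= \int[leb]_c (lc c 1)%:E)%E.
  have h20 : 0 <= 2^-1 :> R by [].
  have := inte_oi h20; rewrite subr0 => H.
  have -> : ((4^-1 : R)%:E = 2^-1%:E * \int[leb]_s (oi 0 2^-1 s)%:E)%E.
    by rewrite H -EFinM; congr EFin; field.
  have E1 : (\int[leb]_s (2^-1 * oi 0 2^-1 s)%:E = 2^-1%:E * \int[leb]_s (oi 0 2^-1 s)%:E)%E.
    by apply: inteZl => //; exact: measurable_oi.
  rewrite -E1; apply: le_inte; [|exact: measurable_lc1|by move=> s; rewrite mulr_ge0 ?oi_ge0|].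
    by apply: mmul => //; exact: measurable_oi.
  move=> c; rewrite /lc /posp /oi mulrC; case: ltP => //= [c0|]; last by rewrite !mul0r.
  case: ltP => [c1|_]; last by rewrite mul0r mulr_ge0 ?le_max ?lexx ?orbT.
  by rewrite !mul1r le_max; apply/orP; left; lra.
move: h1 h2; case: integral => [j| |]//; rewrite !lee_fin => h1 h2.
by exists j => //; apply: lt_le_trans h2; rewrite invr_gt0.
Qed.

Let lc_sq s (j : R) : (\int[leb]_c (lc c 1)%:E = j%:E)%E -> 0 <= s ->
  (\int[leb]_c (lc c s)%:E = (j * s ^+ 2)%:E)%E.
Proof.
move=> jE; rewrite le_eqVlt => /orP[/eqP <-|s0].
  rewrite expr0n mulr0; have E c : lc c 0 = 0.
    rewrite /lc /posp; case: ltP => [c0|]; last by rewrite mul0r.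
    by rewrite max_r ?mulr0// sub0r oppr_le0 ltW.
  by under eq_integral do rewrite E; rewrite integral0.
have ms : meas (fun c => lc c s).
  apply: mmul.
    rewrite (_ : (fun c => _) = \1_(`]0, +oo[%classic)); first exact: measurable_indic.
    by apply/funext => c; rewrite indicE mem_setE in_itv/= andbT.
  by apply: measurable_maxr => //; apply: measurable_funB.
rewrite -(inte_affine1 0 s0 ms) => [|c]; last exact: lc_ge0.
have E c : lc (s * c + 0) s = s * lc c 1.
  rewrite addr0 /lc pmulr_rgt0// mulrCA; congr (_ * _).
  by rewrite /posp maxr_pMr ?(ltW s0)// mulr0 mulrBr mulr1.
under eq_integral do rewrite E.
rewrite inteZl; [|exact: measurable_lc1|by move=> c; exact: lc_ge0|exact: ltW].
by rewrite jE -!EFinM; congr EFin; ring.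
Qed.

(* Layer cake: s^2 is a multiple of the integral of (s - c)^+ over c > 0. *)
Lemma sq_posp f g : meas f -> meas g ->
  (forall x, 0 <= f x) -> (forall x, 0 <= g x) ->
  (forall c, 0 < c -> (\int[mu]_x (posp c (f x))%:E <= \int[mu]_x (posp c (g x))%:E)%E) ->
  (\int[mu]_x (f x ^+ 2)%:E <= \int[mu]_x (g x ^+ 2)%:E)%E.
Proof.
move=> mf mg f0 g0 H; have [j j0 jE] := J.
have mp (e : 'rV[R]_d -> R) : meas e ->
    meas (uncurry (fun c x => lc c (e x)) : ST -> R).
  move=> me; rewrite (_ : uncurry _ = fun p => (0 < (p.1 : R))%R%:R * Num.max (e p.2 - p.1) 0); last first.
    by apply/funext => -[].
  apply: mmul.
    apply: (mcomp (f := fun c : R => (0 < c)%R%:R : R)); last exact: measurable_fst.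
    rewrite (_ : (fun c => _) = \1_(`]0, +oo[%classic)); first exact: measurable_indic.
    by apply/funext => c; rewrite indicE mem_setE in_itv/= andbT.
  apply: measurable_maxr => //; apply: measurable_funB; last exact: measurable_fst.
  exact: (mcomp me measurable_snd).
have K (e : 'rV[R]_d -> R) : meas e -> (forall x, 0 <= e x) ->
    (j%:E * \int[mu]_x (e x ^+ 2)%:E = \int[leb]_c \int[mu]_x (lc c (e x))%:E)%E.
  move=> me e0; rewrite (@tonelli _ _ _ _ _ leb mu (fun c x => lc c (e x)) (mp e me) (fun c x => lc_ge0 c (e x))).
  rewrite -inteZl ?(ltW j0)//; last first.
  - by move=> x; exact: sqr_ge0.
  - exact: measurable_funX.
  by apply: eq_integral => x _; rewrite (lc_sq jE).
have {}H : (j%:E * \int[mu]_x (f x ^+ 2)%:E <= j%:E * \int[mu]_x (g x ^+ 2)%:E)%E.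
  rewrite !K//; apply: ge0_le_integral => //.
  - by move=> c _; apply: inte_ge0 => x; exact: lc_ge0.
  - apply: (@measurable_inte _ _ _ _ _ mu (fun c x => lc c (f x))); first exact: mp.
    by move=> c x; exact: lc_ge0.
  - apply: (@measurable_inte _ _ _ _ _ mu (fun c x => lc c (g x))); first exact: mp.
    by move=> c x; exact: lc_ge0.
  - move=> c _; rewrite /lc; case: ltP => [c0|_].
      under eq_integral do rewrite mul1r; under [leRHS]eq_integral do rewrite mul1r.
      exact: H.
    by under eq_integral do rewrite mul0r; under [leRHS]eq_integral do rewrite mul0r.
by rewrite lee_pmul2l in H.
Qed.

Lemma cauchy_schwarz f g : intg mu (fun x => f x ^+ 2) -> intg mu (fun x => g x ^+ 2) ->
  intg mu (fun x => f x * g x) ->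
  (\int[mu]_x (f x * g x)) ^+ 2 <= (\int[mu]_x (f x ^+ 2)) * \int[mu]_x (g x ^+ 2).
Proof.
move=> if_ ig ifg; set A := Rintegral _ _ (fun x => f x ^+ 2); set D := Rintegral _ _ (fun x => g x ^+ 2).
set B := Rintegral _ _ _.
have H (c : R) : 0 <= A - 2 * c * B + c ^+ 2 * D.
  have : 0 <= \int[mu]_x ((f x - c * g x) ^+ 2) by apply: Rint_ge0 => x; exact: sqr_ge0.
  have -> : (fun x => (f x - c * g x) ^+ 2) = fun x => (f x ^+ 2 - 2 * c * (f x * g x)) + c ^+ 2 * g x ^+ 2.
    by apply/funext => x; ring.
  rewrite RintD; [|by apply: intgB => //; exact: intgZl|exact: intgZl].
  by rewrite RintB ?RintZl//; exact: intgZl.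
have D0 : 0 <= D by apply: Rint_ge0 => x; exact: sqr_ge0.
have A0 : 0 <= A by apply: Rint_ge0 => x; exact: sqr_ge0.
move: D0; rewrite le_eqVlt => /orP[/eqP DE|D0].
  rewrite -DE mulr0; have [B0|B0] := eqVneq B 0; first by rewrite B0 expr0n.
  have := H ((A + 1) / (2 * B)); rewrite -DE mulr0 addr0.
  have -> : 2 * ((A + 1) / (2 * B)) * B = A + 1 by field.
  lra.
have := H (B / D); have -> : A - 2 * (B / D) * B + (B / D) ^+ 2 * D = (A * D - B ^+ 2) / D.
  by field; rewrite gt_eqF.
by rewrite pmulr_lge0 ?invr_gt0// subr_ge0.
Qed.

(** In a log-convex sequence the ratios increase: [a 1 / a 0 <= a j.+1 / a j]. Multiplying them
    gives the claim; [H2] is this comparison without division, with a zero term treated apart. *)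
Lemma log_convex (a : nat -> R) (n : nat) : (forall j, 0 <= a j) ->
  (forall j, a j.+1 ^+ 2 <= a j * a j.+2) -> a 1%N ^+ n.+1 <= a 0%N ^+ n * a n.+1.
Proof.
move=> a0 H.
have H2 j : a 1%N * a j <= a 0%N * a j.+1.
  elim: j => [|j IH]; first by rewrite mulrC.
  have [aj|aj] := eqVneq (a j) 0.
    have : a j.+1 ^+ 2 <= 0 by rewrite (le_trans (H j))// aj mul0r.
    rewrite le_eqVlt ltNge sqr_ge0 orbF sqrf_eq0 => /eqP ->.
    by rewrite mulr0 mulr_ge0.
  have aj0 : 0 < a j by rewrite lt_neqAle eq_sym aj a0.
  rewrite -(ler_pM2l aj0); apply: (@le_trans _ _ (a 0%N * a j.+1 * a j.+1)).
    by rewrite mulrA ler_wpM2r// mulrC.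
  by rewrite -mulrA -expr2 (le_trans (ler_wpM2l (a0 0%N) (H j)))// mulrCA.
elim: n => [|n IH]; first by rewrite expr1 expr0 mul1r.
rewrite exprS (le_trans (ler_wpM2l (a0 1%N) IH))// mulrCA.
by rewrite (exprSr _ n) -mulrA ler_wpM2l ?exprn_ge0.
Qed.

(** Each step raises to the power [n / (n+1)], and [(n / (n+1))^(n+1) <= 1/2]: after [n+1] steps the
    initial value has lost at least a square root, uniformly in [n]. This integrates a Nash
    inequality along the discrete scheme. *)
Lemma power_contraction (y : nat -> R) (n : nat) : (forall j, 0 <= y j) ->
  (forall j, y j.+1 ^+ n.+1 <= y j ^+ n) -> y n.+1 ^+ 2 <= Num.max 1 (y 0%N).
Proof.
move=> y0 H; set Y := Num.max _ _.
have Y1 : 1 <= Y by rewrite /Y le_max lexx.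
have Y0 : 0 <= Y by exact: le_trans Y1.
have K j : y j ^+ (n.+1 ^ j) <= Y ^+ (n ^ j).
  elim: j => [|j IH]; first by rewrite !expn0 !expr1 /Y le_max lexx orbT.
  rewrite expnS exprM (le_trans (lerXn2r _ _ _ (H j))) ?nnegrE ?exprn_ge0//.
  by rewrite -exprM mulnC exprM expnSr exprM lerXn2r ?nnegrE ?exprn_ge0.
(* The first two terms of the binomial expansion of [(n + 1)^(n+1)] are each at least [n^(n+1)]. *)
have B : (2 * n ^ n.+1 <= n.+1 ^ n.+1)%N.
  rewrite -[X in (_ <= X ^ _)%N]addn1 expnDn big_ord_recl big_ord_recl /=.
  rewrite subn0 bin0 mul1n exp1n muln1 /bump /= !addn0 subn1 /= bin1 exp1n muln1.
  rewrite mul2n -addnn leq_add2l; apply: leq_trans (leq_addr _ _).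
  by rewrite expnS leq_mul2r leqnSn orbT.
have N0 : (0 < n.+1 ^ n.+1)%N by rewrite expn_gt0.
rewrite -(ler_pXn2r N0) ?nnegrE ?exprn_ge0// -exprM mulnC exprM.
apply: (le_trans (lerXn2r _ _ _ (K n.+1))); rewrite ?nnegrE ?exprn_ge0//.
by rewrite -exprM mulnC ler_weXn2l.
Qed.

Lemma conv_stk_pairing s t w : 0 < s -> 0 < t -> intg mu w ->
  \int[mu]_x (conv (pt s) w x * conv (pt t) w x) = \int[mu]_x (w x * conv (pt (s + t)) w x).
Proof.
move=> s0 t0 iw; have [K HK] := stk_bounded t0.
have ip := intg_stk s0.
pose g := conv (pt t) w.
have mg : meas g.
  by apply: measurable_conv; [exact: measurable_stk|exact: intg_meas iw].
have ih : intg (mu \x mu)%E (uncurry (fun x y => pt s (x - y) * w y * g x)).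
  rewrite (_ : uncurry _ = fun p => uncurry (fun x y => pt s (x - y) * w y) p * g p.1); last first.
    by apply/funext => -[].
  apply: (intgMr (M := K * \int[mu]_y `|w y|)).
  - by apply: (mcomp mg).
  - by move=> p; apply: conv_norm_le => //; exact: measurable_stk.
  - exact: intg_cprod.
transitivity (\int[mu]_x \int[mu]_y (pt s (x - y) * w y * g x)).
  apply: eq_Rintegral => x _; rewrite RintZr//.
  have [K' HK'] := stk_bounded s0.
  by apply: (intg_conv_arg (measurable_stk s) HK').
rewrite (Rfubini ih); apply: eq_Rintegral => y _.
have -> : (fun x => pt s (x - y) * w y * g x) = fun x => w y * (pt s (y - x) * g x).
  by apply/funext => x; rewrite -opprB stk_even; ring.
rewrite RintZl; last first.
  have [K' HK'] := stk_bounded s0.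
  exact: (intg_conv_arg (measurable_stk s) HK' y (intg_conv (intg_stk t0) iw)).
by congr (_ * _); rewrite -(conv_stk_stk y s0 t0 iw).
Qed.

Lemma intg_sq_bounded f (K : R) : intg mu f -> (forall x, `|f x| <= K) -> intg mu (fun x => f x ^+ 2).
Proof.
move=> if_ fK; rewrite (_ : (fun x => _) = fun x => f x * f x); last by apply/funext => x; rewrite expr2.
by apply: (intgMl (M := K)) => //; exact: intg_meas if_.
Qed.

(** Self-adjointness and Cauchy-Schwarz make [j |-> |P_(j k) w|_2^2] log-convex, so time [k] is
    interpolated between [0] and [(n+1) k]; at the latter the L^1 to L^infinity smoothing applies.
    The inequality is made for [n+1] steps of length [k]: its decay factor sees the total time
    only. *)
Lemma conv_stk_L2 : exists2 C : R, 0 < C & forall (n : nat) (k : R) w, 0 < k -> intg mu w ->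
  intg mu (fun x => w x ^+ 2) ->
  (\int[mu]_x (conv (pt k) w x ^+ 2)) ^+ n.+1 <=
  (\int[mu]_x (w x ^+ 2)) ^+ n * (C * rt (n.+1%:R * k) ^+ d * (\int[mu]_x `|w x|) ^+ 2).
Proof.
have [C C0 HC] := conv_stk_sup; exists C => // n k w k0 iw iw2.
have ic t : 0 < t -> intg mu (conv (pt t) w).
  by move=> t0; apply: intg_conv => //; exact: intg_stk.
have ic2 t : 0 < t -> intg mu (fun x => conv (pt t) w x ^+ 2).
  by move=> t0; apply: (intg_sq_bounded (ic t t0)) => x; exact: HC.
have [T [T0 TD T00 TE]] : exists T : nat -> R, [/\ forall j, 0 < T j,
    forall i j, T i + T j = T (i + j).+1, T 0%N = k & T n = n.+1%:R * k].
  exists (fun j => j.+1%:R * k); split => //; first by move=> j; rewrite mulr_gt0.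
    by move=> i j; rewrite -mulrDl -natrD addSn addnS.
  by rewrite mul1r.
pose phi t := \int[mu]_x (conv (pt t) w x ^+ 2).
pose a j := if j is j'.+1 then phi (T j') else \int[mu]_x (w x ^+ 2).
have a0 j : 0 <= a j by case: j => [|j]; apply: Rint_ge0 => x; exact: sqr_ge0.
have icc s t : 0 < s -> 0 < t -> intg mu (fun x => conv (pt s) w x * conv (pt t) w x).
  move=> s0 t0; apply: (intgMl (M := C * rt s ^+ d * \int[mu]_y `|w y|)); last exact: ic.
  - exact: intg_meas (ic s s0).
  - by move=> x; exact: HC.
have phiE t : 0 < t -> phi t = \int[mu]_x (w x * conv (pt (t + t)) w x).
  by move=> t0; rewrite -(conv_stk_pairing t0 t0 iw); apply: eq_Rintegral => x _; rewrite expr2.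
have H j : a j.+1 ^+ 2 <= a j * a j.+2.
  rewrite /a; case: j => [|j].
    have icw : intg mu (fun x => w x * conv (pt (T 1%N)) w x).
      apply: (intgMr (M := C * rt (T 1%N) ^+ d * \int[mu]_y `|w y|)) => //.
      - exact: intg_meas (ic _ (T0 1%N)).
      - by move=> x; exact: HC.
    have CS := cauchy_schwarz iw2 (ic2 _ (T0 1%N)) icw.
    by rewrite (phiE _ (T0 0%N)) TD; exact: CS.
  have CS := cauchy_schwarz (ic2 _ (T0 j)) (ic2 _ (T0 j.+2)) (icc _ _ (T0 j) (T0 j.+2)).
  rewrite (phiE _ (T0 j.+1)) TD addSnnS -TD -(conv_stk_pairing (T0 j) (T0 j.+2) iw); exact: CS.
have CV := log_convex n a0 H; rewrite /a /phi T00 in CV; apply: (le_trans CV).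
rewrite -TE; move: (T n) (T0 n) => t t0.
rewrite ler_wpM2l ?exprn_ge0//; first by apply: Rint_ge0 => x; exact: sqr_ge0.
set m := \int[mu]_x `|w x|; have m0 : 0 <= m by apply: Rint_ge0.
have r0 := rs_gt0 t0.
have q0 : 0 <= C * rt t ^+ d * m by rewrite !mulr_ge0 ?exprn_ge0 ?(ltW C0) ?(ltW r0).
apply: (@le_trans _ _ (\int[mu]_x (C * rt t ^+ d * m * `|conv (pt t) w x|))).
  apply: le_Rint; [exact: ic2|exact/intgZl/intg_norm/ic|].
  move=> x; rewrite -real_normK ?num_real// expr2 ler_wpM2r//; exact: HC.
rewrite RintZl; last exact/intg_norm/ic.
rewrite expr2 mulrA ler_wpM2l//.
have := n1_conv_stk t0 (intg_meas iw); rewrite (intg_n1 iw) (intg_n1 (ic t t0)) lee_fin.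
by [].
Qed.

End L2_estimates.

(** Integrate [|w|] against the time-1 kernel centred at [n b]: periodicity makes the result
    independent of [n], dominated convergence sends it to 0, and the kernel is positive. *)
Lemma periodic_eq0 (w : 'rV[R]_d -> R) :
  b != 0 -> intg mu w -> (forall x, w (x - b) = w x) -> {ae mu, forall x, w x = 0}.
Proof.
move=> b0 iw wb; pose p1 := pt 1.
have wnb n x : w (x - n%:R *: b) = w x.
  elim: n => [|n IH]; first by rewrite scale0r subr0.
  by rewrite -natr1 scalerDl scale1r opprD addrA wb.
have mp := measurable_stk 1; have mw := intg_meas iw.
have mf v : meas (fun y : 'rV[R]_d => p1 (v - y) * `|w y|).
  apply: mmul; first by apply: (mcomp mp); exact: measurable_sub_rV.
  exact: (mcomp (@normr_measurable R setT)).
have E n : \int[mu]_y (p1 (n.+1%:R *: b - y) * `|w y|) = \int[mu]_y (p1 (0 - y) * `|w y|).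
  rewrite -(Rint_shift (- (n.+1%:R *: b)) (mf 0)); apply: eq_Rintegral => y _.
  by rewrite wnb; congr (p1 _ * _); rewrite sub0r opprB.
have [C C0 HC] := stk1_upper.
have [K HK] := stk_bounded (@ltr01 R).
have e0 : 0 < enorm b by rewrite enorm_gt0.
have [] // := @dct _ _ _ mu (fun n (y : 'rV[R]_d) => p1 (n.+1%:R *: b - y) * `|w y|) (fun=> 0) (fun y => K * `|w y|).
- move=> y; rewrite -[X in _ --> X](mul0r `|w y|); apply: cvgMr_tmp.
  apply: (squeeze_cvgr (f := fun=> 0) (h := fun n : nat => (C * brk y / enorm b) * n.+1%:R^-1)).
  + apply: nearW => n; rewrite stk_ge0//=; apply: le_trans (HC _) _.
    rewrite -!mulrA ler_wpM2l ?(ltW C0)// -invfM.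
    have l1 : brk (n.+1%:R *: b) <= brk (n.+1%:R *: b - y) * brk y by rewrite -{1}(subrK y (n.+1%:R *: b)) brkD.
    have l2 : enorm b * n.+1%:R <= brk (n.+1%:R *: b).
      by rewrite /brk enormZ ger0_norm// mulrC lerDr.
    have b1 := brk_gt0 (n.+1%:R *: b - y).
    apply: (@le_trans _ _ (brk (n.+1%:R *: b - y))^-1).
      rewrite -(powR_inv1 (ltW b1)) /jw ler_powR ?brk_ge1// lerN2.
      by case/andP: alpha12 => /ltW h _; apply: le_trans h _; rewrite lerDr.
    rewrite ler_pdivlMr ?mulr_gt0// mulrC ler_pdivrMr// mulrC.
    by rewrite [leRHS]mulrC; apply: le_trans l1; rewrite mulrC.
  + exact: cvg_cst.
  + by rewrite -[X in _ --> X](mulr0 (C * brk y / enorm b)); apply: cvgMl_tmp; exact: cvg_harmonic.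
- by apply: intgZl; exact: intg_norm.
- by move=> n y; rewrite normrM normr_id ler_wpM2r// HK.
move=> _ _; rewrite Rint0; under eq_cvg => n do rewrite E.
move=> c; have A0 : \int[mu]_y (p1 (0 - y) * `|w y|) = 0.
  exact: (cvg_unique (@norm_hausdorff _ R) (cvg_cst _) c).
have iA : intg mu (fun y => p1 (0 - y) * `|w y|).
  exact: (intg_conv_arg mp HK 0 (intg_norm iw)).
have := @inte_eq0 _ _ _ mu _ (mf 0) _ _.
rewrite -EFin_Rint// A0 => /(_ _ erefl) H.
have /H : forall x : 'rV[R]_d, 0 <= p1 (0 - x) * `|w x| by move=> x; rewrite mulr_ge0// stk_ge0.
apply: aeS => y /eqP.
by rewrite mulf_eq0 normr_eq0 gt_eqF ?stk_gt0//= => /eqP.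
Qed.

(** * Consistency of the difference quotients *)

Section consistency.

Let al0 : 0 < alpha. Proof. by case/andP: alpha12 => /(lt_trans ltr01). Qed.

Lemma ai01 : 0 < alpha^-1 < 1.
Proof. by case/andP: alpha12 => a1 a2; rewrite invr_gt0 al0 invf_lt1. Qed.

Let ai : 0 <= alpha^-1 < 1. Proof. by case/andP: ai01 => /ltW -> ->. Qed.

Definition cerr (lam k s : R) : R := \int[mu]_x `|dq (k / lam) (sigk k s) x - kp s x|.

Lemma measurable_comp_kernel d1 (T : measurableType d1) (K : R -> 'rV[R]_d -> R) (g : T -> R) (y : T -> 'rV[R]_d) :
  meas (fun p : R * 'rV[R]_d => K p.1 p.2) ->
  meas g -> meas y -> meas (fun p : T => K (g p) (y p)).
Proof.
move=> mK mg my.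
have H : meas (fun p : T => (g p, y p)) by exact/measurable_fun_pair.
exact: (mcomp mK H).
Qed.

Lemma measurable_kap2 : meas (fun p : R * 'rV[R]_d => kp p.1 p.2).
Proof. by apply: mcomp => //; exact: measurable_dstk2. Qed.

Lemma measurable_cerr lam k : 0 < k -> meas (cerr lam k).
Proof.
move=> k0; apply: (@measurable_Rint _ _ _ _ _ mu (fun s x => `|dq (k / lam) (sigk k s) x - kp s x|)).
rewrite (_ : uncurry _ = fun p : ST => `|dq (k / lam) (sigk k p.1) p.2 - kp p.1 p.2|); last first.
  by apply/funext => -[].
have m1 := meas_fst.
have m2 := meas_snd.
have ms : meas (fun p : ST => sigk k p.1).
  exact: (mcomp (measurable_sigk k0) m1).
apply: mcomp => //; apply: measurable_funB; last first.
  exact: measurable_comp_kernel measurable_kap2 m1 m2.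
apply: mmul => //; apply: measurable_funB.
  apply: (measurable_comp_kernel (measurable_stk2) ms).
  exact: measurable_funB_rV.
exact: measurable_comp_kernel (measurable_stk2) ms m2.
Qed.

Lemma cerr_le : exists2 C : R, 0 < C & forall lam k s, 0 < lam -> 0 < k -> 0 < s ->
  cerr lam k s <= C * rt s.
Proof.
have [C C0 HC] := dqk_L1; have [C' C'0 HC'] := kap_L1.
exists (C + C'); first exact: addr_gt0.
move=> lam k s l0 k0 s0; have ss := sigk_ge s k0; have sg0 : 0 < sigk k s by exact: lt_le_trans ss.
have h0 : 0 < k / lam by rewrite divr_gt0.
apply: (@le_trans _ _ (\int[mu]_x `|dq (k / lam) (sigk k s) x| + \int[mu]_x `|kp s x|)).
  have i1 := intg_dqk (k / lam) sg0; have i2 := intg_kap s0.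
  rewrite -RintD; [|exact: intg_norm|exact: intg_norm].
  apply: le_Rint; [exact/intg_norm/intgB|by apply: intgD; exact: intg_norm|].
  by move=> x; exact: ler_normB.
rewrite mulrDl lerD ?HC'//; apply: (le_trans (HC _ _ h0 sg0)).
by rewrite ler_wpM2l ?(ltW C0)//; exact: rs_le.
Qed.

Lemma cerr_ge0 lam k s : 0 <= cerr lam k s. Proof. exact: Rint_ge0. Qed.

Lemma intg_cerr (lam k T : R) : 0 < lam -> 0 < k -> intg leb (fun s => oi 0 T s * cerr lam k s).
Proof.
move=> l0 k0; have [C C0 HC] := cerr_le.
apply: intg_le (intgZl C (intg_oipow T ai)) => [|s].
  by apply: mmul; [exact: measurable_oi|exact: measurable_cerr].
by rewrite oi_norm ger0_norm ?cerr_ge0// mulrCA; apply: oi_le => s0 _; exact: HC.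
Qed.

Lemma cerr_cvg (lam T : R) : 0 < lam -> 0 < T ->
  \int[leb]_s (oi 0 T s * cerr lam (T / n.+1%:R) s) @[n --> \oo] --> (0 : R).
Proof.
move=> l0 T0; pose k n : R := T / n.+1%:R; pose h n := k n / lam.
have k0 n : 0 < k n by rewrite divr_gt0.
have h0 n : 0 < h n by rewrite divr_gt0.
have kc : k n @[n --> \oo] --> (0 : R).
  by rewrite -[X in _ --> X](mulr0 T); apply: cvgMl_tmp; exact: cvg_harmonic.
have hc : h n @[n --> \oo] --> (0 : R).
  by rewrite -[X in _ --> X](mul0r lam^-1); exact: cvgMr_tmp.
have [C C0 bnd0] := cerr_le.
have bnd n s : 0 < s -> cerr lam (k n) s <= C * rt s by exact: bnd0.
have [] // := @dct _ _ _ leb (fun n s => oi 0 T s * cerr lam (k n) s) (fun=> 0)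
   (fun s => C * (oi 0 T s * s `^ (- alpha^-1))).
- move=> n; apply: mmul; [exact: measurable_oi|exact: measurable_cerr].
- move=> s; have [s0|s0] := leP s 0.
    by apply: cvg_near_cst; apply: nearW => n; rewrite /oi (le_gtF s0) mul0r.
  rewrite -[X in _ --> X](mulr0 (oi 0 T s)); apply: cvgMl_tmp.
  have r0 := rs_gt0 s0.
  (* [cvg_dqk] asks for its size conditions at every [n]; these truncated sequences satisfy them,
     and eventually coincide with the original ones. *)
  pose s' n := Num.min (sigk (k n) s) (2 * s); pose h' n := Num.min (h n) (rt s)^-1.
  have sc : sigk (k n) s @[n --> \oo] --> s.
    apply: (squeeze_cvgr (f := fun=> s) (h := fun n => s + k n)).
    - by apply: nearW => n; rewrite sigk_ge//= ltW// sigk_lt.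
    - exact: cvg_cst.
    - by rewrite -[X in _ --> X]addr0; apply: cvgD => //; exact: cvg_cst.
  have es : \forall n \near \oo, s' n = sigk (k n) s.
    have s2 : s < 2 * s by rewrite mulr_natl mulr2n ltrDl.
    by apply: filterS (cvgr_lt _ sc _ s2) => n /= l; rewrite /s' min_l// ltW.
  have eh : \forall n \near \oo, h' n = h n.
    have ri : 0 < (rt s)^-1 by rewrite invr_gt0.
    by apply: filterS (cvgr_lt _ hc _ ri) => n /= l; rewrite /h' min_l// ltW.
  have c : \int[mu]_x `|dq (h' n) (s' n) x - kp s x| @[n --> \oo] --> (0 : R).
    apply: cvg_dqk => //.
    - by move=> n; rewrite lt_min h0 invr_gt0 r0.
    - by move=> n; rewrite le_min sigk_ge//= ge_min lexx orbT andbT; lra.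
    - move=> n; rewrite -ler_pdivlMr// mul1r /h' ge_min lexx orbT//.
    - apply: cvg_trans hc; apply: near_eq_cvg; exact: filterS eh => n.
    - apply: cvg_trans sc; apply: near_eq_cvg; exact: filterS es => n.
  apply: cvg_trans c; apply: near_eq_cvg; near=> n.
  rewrite /cerr; have <- : s' n = sigk (k n) s by near: n.
  by have <- : h' n = k n / lam by near: n.
- by apply: intgZl; exact: intg_oipow.
- move=> n s; rewrite oi_norm ger0_norm ?cerr_ge0// mulrCA; apply: oi_le => s0 _; exact: bnd.
by move=> _ _; rewrite Rint0.
Unshelve. all: by end_near. Qed.

End consistency.

(** * Convergence of the scheme on a time window *)

Section scheme.
Implicit Types (w : 'rV[R]_d -> R) (x y z : 'rV[R]_d).

Variables (F : R -> R) (L B : R).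
Hypotheses (F0 : F 0 = 0) (F_mono : forall u v : R, u <= v -> F u <= F v)
  (F_lip : forall u v : R, u <= v -> F v - F u <= L * (v - u))
  (F_bnd : forall u, `|F u| <= B).

Let mF := F_measurable F_mono.

Let L0 : 0 <= L.
Proof. by have := F_lip (@ler01 R); rewrite subr0 mulr1; apply: le_trans; rewrite subr_ge0 F_mono. Qed.

Let B0 : 0 <= B. Proof. exact: le_trans (normr_ge0 _) (F_bnd 0). Qed.

Lemma stpE lam k w x : 0 < lam -> 0 < k -> intg mu w ->
  stp F lam k w x = conv (pt k) w x + k * conv (dq (k / lam) k) (fun y => F (w y)) x.
Proof.
move=> l0 k0 iw; have [K HK] := stk_bounded k0; have mk := measurable_stk k.
have iF := intg_F F0 F_mono F_lip iw.
set h := k / lam; have h0 : 0 < h by rewrite divr_gt0.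
have iFs : intg mu (fun y => F (w (y - h *: b))) by have := intg_shift (- (h *: b)) iF.
rewrite /stp /upw -/h (convB mk HK)//; last by apply: intgZl; exact: intgB.
rewrite (convZ mk HK); last exact: intgB.
rewrite (convB mk HK)// (conv_shift mk (h *: b) x (f := fun y => F (w y))); last exact: intg_meas iF.
rewrite -mulrN opprB; congr (_ + _).
have lamE : lam = k / h by rewrite /h; field; rewrite !gt_eqF.
rewrite lamE -mulrA; congr (_ * _).
have i2 := intg_conv_arg mk HK x iF.
have m3 : meas (fun y => pt k (y - h *: b)).
  by apply: (mcomp mk); exact: measurable_shift_rV.
have i3 := intg_conv_arg m3 (fun y => HK (y - h *: b)) x iF.
rewrite -RintB// -RintZl; last exact: intgB.
by apply: eq_Rintegral => y _; rewrite /dqk; ring.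
Qed.

Lemma conv_sum (k : 'rV[R]_d -> R) (K : R) (J : nat) (c : nat -> R) (f : nat -> 'rV[R]_d -> R) x :
  meas k -> (forall x, `|k x| <= K) -> (forall i, intg mu (f i)) ->
  conv k (fun y => \sum_(i < J) c i * f i y) x = \sum_(i < J) c i * conv k (f i) x.
Proof.
move=> mk kK if_; elim: J => [|J IH].
  by rewrite big_ord0 /conv; under eq_Rintegral do rewrite big_ord0 mulr0; rewrite Rint0.
rewrite big_ord_recr/= -IH -(convZ mk kK)//.
rewrite -(convD mk kK); [|by apply: intg_sum => i; exact: intgZl|exact: intgZl].
by congr (conv k _ x); apply/funext => y; rewrite big_ord_recr.
Qed.

Section window.
Variables (v : R -> 'rV[R]_d -> R) (T m lam : R).
Hypotheses (T0 : 0 < T) (lam0 : 0 < lam)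
  (mv : meas (uncurry v))
  (iv : forall r, 0 <= r <= T -> intg mu (v r))
  (vm : forall r, 0 <= r <= T -> \int[mu]_x `|v r x| <= m)
  (cv : forall e, 0 < e -> exists2 del : R, 0 < del & forall r r', 0 <= r <= T -> 0 <= r' <= T ->
     `|r - r'| <= del -> \int[mu]_x `|v r x - v r' x| <= e)
  (mild : forall r, 0 < r <= T -> {ae mu, forall x, v r x = conv (pt r) (v 0) x +
     \int[leb]_s (oi 0 r s * conv (kp (r - s)) (fun z => F (v s z)) x)}).

Definition itr (k : R) (j : nat) : 'rV[R]_d -> R := iter j (stp F lam k) (v 0).

Let T00 : (0 : R) <= 0 <= T. Proof. by rewrite lexx ltW. Qed.

Let m0 : 0 <= m. Proof. by apply: le_trans (vm T00); exact: Rint_ge0. Qed.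

Lemma intg_itr k j : 0 < k -> intg mu (itr k j).
Proof.
move=> k0; elim: j => [|j IH]; first exact: iv.
exact: (intg_stp F0 F_mono F_lip lam k0 IH).
Qed.

(** A discrete Duhamel formula. For a time [s] in cell [i] the lag [(j.+1 - i) k] is the exact lag
    rounded up by [sigk], which is the reason for the form of [cerr]. *)
Lemma itrE k j x : 0 < k -> itr k j.+1 x = conv (pt (j.+1%:R * k)) (v 0) x +
  \sum_(i < j.+1) k * conv (dq (k / lam) ((j.+1 - i)%:R * k)) (fun y => F (itr k i y)) x.
Proof.
move=> k0; have iF i := intg_F F0 F_mono F_lip (intg_itr i k0).
elim: j x => [|j IH] x.
  by rewrite big_ord_recl big_ord0 addr0 subn0 mul1r /itr /= stpE// iv.
have jk : 0 < j.+1%:R * k by rewrite mulr_gt0.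
have [K HK] := stk_bounded k0; have mk := measurable_stk k.
rewrite {1}/itr iterS -/(itr k j.+1) stpE//; last exact: intg_itr.
have aux (n : nat) : k + n%:R * k = n.+1%:R * k by rewrite -natr1; ring.
pose A := conv (pt (j.+1%:R * k)) (v 0).
pose S x := \sum_(i < j.+1) k * conv (dq (k / lam) ((j.+1 - i)%:R * k)) (fun y => F (itr k i y)) x.
have Ej : itr k j.+1 = fun x => A x + S x by apply/funext => y; exact: IH.
have pos (i : 'I_j.+1) : 0 < (j.+1 - i)%:R * k by rewrite mulr_gt0// ltr0n subn_gt0.
(* [maxn 1] keeps the lag positive for every natural [i], as [conv_sum] wants all the functions
   integrable; for [i < j.+1] it leaves the lag unchanged. *)
pose D (i : nat) := conv (dq (k / lam) ((maxn 1 (j.+1 - i))%:R * k)) (fun y => F (itr k i y)).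
have ic (i : nat) : intg mu (D i).
  by apply: intg_conv => //; apply: intg_dqk => //; rewrite mulr_gt0// ltr0n leq_max.
have ES : S = fun x => \sum_(i < j.+1) k * D i x.
  apply/funext => y; apply: eq_bigr => i _.
  by have /maxn_idPr H : (1 <= j.+1 - i)%N; [rewrite subn_gt0|rewrite /D H].
have iS : intg mu S by rewrite ES; apply: intg_sum => i; exact: intgZl.
have iA : intg mu A by apply: intg_conv; [exact: intg_stk|exact: iv].
have E1 : conv (pt k) (itr k j.+1) x = conv (pt k) A x + conv (pt k) S x.
  by rewrite Ej; exact: (convD mk HK x iA iS).
have E2 : conv (pt k) A x = conv (pt (j.+2%:R * k)) (v 0) x.
  rewrite (conv_stk_stk x k0 jk (iv T00)).
  by rewrite aux.
have E3 : conv (pt k) S x = \sum_(i < j.+1) k * conv (dq (k / lam) ((j.+2 - i)%:R * k)) (fun y => F (itr k i y)) x.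
  rewrite ES (conv_sum j.+1 (fun=> k) x mk HK ic); apply: eq_bigr => i _; congr (_ * _).
  have /maxn_idPr H : (1 <= j.+1 - i)%N by rewrite subn_gt0.
  rewrite /D H (conv_stk_dqk (k / lam) x k0 (pos i) (iF i)).
  have e : (j.+2 - i = (j.+1 - i).+1)%N by rewrite (subSn (ltnW (ltn_ord i))).
  by rewrite e -aux.
by rewrite E1 E2 E3 [in RHS]big_ord_recr/= subSnn mul1r addrA.
Qed.

Let G r s x := conv (kp (r - s)) (fun z => F (v s z)) x.

Let mG r : meas (uncurry (G r)).
Proof.
rewrite (_ : uncurry (G r) = fun p : R * 'rV[R]_d => conv (kp (r - p.1)) (fun z => F (v p.1 z)) p.2); last first.
  by apply/funext => -[].
have := @measurable_conv2 R d _ (measurableTypeR R) (fun s => kp (r - s)) (fun s z => F (v s z)); apply.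
- rewrite (_ : uncurry _ = fun p : R * 'rV[R]_d => kp (r - p.1) p.2); last by apply/funext => -[].
  have m1 : meas (fun p : ST => r - (p.1 : R)).
    by apply: measurable_funB => //; exact: measurable_fst.
  have m2 := meas_snd.
  exact: (@measurable_comp_kernel _ (ST)%type kp (fun p => r - (p.1 : R)) (fun p => p.2) (measurable_kap2) m1 m2).
- rewrite (_ : uncurry _ = F \o uncurry v); last by apply/funext => -[].
  exact: mcomp.
Qed.

Let vF s : 0 <= s <= T -> intg mu (fun z => F (v s z)).
Proof. by move=> sT; exact: (intg_F F0 F_mono F_lip (iv sT)). Qed.

Let G_sup : exists2 C : R, 0 < C & forall r s x, s < r -> `|G r s x| <= C * (r - s) `^ (- alpha^-1).
Proof.
have [C C0 HC] := kap_L1; exists (C * (1 + B)); first by rewrite mulr_gt0// ltr_wpDr.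
move=> r s x sr; have rs0 : 0 < r - s by rewrite subr_gt0.
have mFv : meas (fun z => F (v s z)).
  by apply: (mcomp mF); exact: (measurable_uncurry1 s mv).
have [_ H] := conv_norm_le_sup x (intg_kap rs0) mFv (aeW _ (fun z => F_bnd (v s z))) B0.
apply: (le_trans H); rewrite mulrC mulrAC; apply: ler_pM => //.
- exact: Rint_ge0.
- exact: HC.
- by rewrite lerDr.
Qed.

Let intg_G r x : 0 < r -> intg leb (fun s => oi 0 r s * G r s x).
Proof.
move=> r0; have [C C0 HC] := G_sup.
have i : intg leb (fun s => oi 0 r s * (r - s) `^ (- alpha^-1)).
  apply: intgP; first exact: measurable_oipow_rev.
  under eq_integral => s _ do rewrite (ger0_norm (mulr_ge0 (oi_ge0 0 r s) (powR_ge0 _ (- alpha^-1)))).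
  have /andP[/ltW a0 a1] := ai01.
  have [K K0 HK] := inte_oipow_rev (a := alpha^-1) (andb_true_intro (conj a0 a1)).
  exact: le_lt_trans (HK 0 r r0) (ltry _).
apply: intg_le (intgZl C i) => [|s].
  apply: mmul; first exact: measurable_oi.
  exact: (measurable_uncurry2 x (mG r)).
by rewrite oi_norm mulrCA; apply: oi_le => _; exact: HC.
Qed.

Let nrm w := \int[mu]_x `|w x|.

Let nrmD w w' : intg mu w -> intg mu w' -> nrm (fun x => w x + w' x) <= nrm w + nrm w'.
Proof.
move=> i i'; rewrite /nrm -RintD; [|exact: intg_norm|exact: intg_norm].
apply: le_Rint; [exact/intg_norm/intgD|by apply: intgD; exact: intg_norm|].
by move=> x; exact: ler_normD.
Qed.

Let nrm_conv k w : intg mu k -> intg mu w -> nrm (conv k w) <= nrm k * nrm w.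
Proof.
move=> ik iw; have := n1_conv (intg_meas ik) (intg_meas iw).
by rewrite !intg_n1 ?lee_fin//; exact: intg_conv.
Qed.

(** Stability plus consistency. [F (itr) - F (v)] against the quotient costs the Lipschitz constant
    and the singular factor of [dqk_L1]; the quotient minus [kap], against [F (v s)], costs [cerr]
    times a bound on the mass. *)
Lemma scheme_step_error : exists2 C : R, 0 < C & forall k J s, 0 < k -> J%:R * k <= T ->
  0 <= s -> s < J%:R * k -> forall i : nat, (i < J)%N -> i%:R * k <= s -> s < i.+1%:R * k ->
  nrm (fun x => conv (dq (k / lam) ((J - i)%:R * k)) (fun y => F (itr k i y)) x - G (J%:R * k) s x) <=
  C * (J%:R * k - s) `^ (- alpha^-1) * (L * (nrm (fun x => itr k i x - v (i%:R * k) x) + nrm (fun x => v (i%:R * k) x - v s x)))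
  + L * m * cerr lam k (J%:R * k - s).
Proof.
have [C C0 HC] := dqk_L1; exists C => // k J s k0 JT s0 sJ i iJ l1 l2.
set r := J%:R * k in JT sJ *; set tau := r - s.
have tau0 : 0 < tau by rewrite subr_gt0.
have sT : 0 <= s <= T by rewrite s0/= (le_trans (ltW sJ)).
have ik0 : 0 <= i%:R * k by rewrite mulr_ge0// ltW.
have ikT : 0 <= i%:R * k <= T by rewrite ik0/= (le_trans l1)//; case/andP: sT.
have JiE : (J - i)%N = (J - i.+1).+1 by rewrite subnSK.
pose sg := (J - i)%:R * k.
have sgE : sigk k tau = sg.
  rewrite /sg JiE; apply: sigk_grid => //.
    rewrite natrB// mulrBl ltrD2l ltrN2//.
  by rewrite -JiE natrB 1?ltnW// mulrBl lerD2l lerN2.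
have tsg : tau <= sg by rewrite -sgE; exact: sigk_ge.
have sg0 : 0 < sg by exact: lt_le_trans tsg.
have h0 : 0 < k / lam by rewrite divr_gt0.
have iq := intg_dqk (k / lam) sg0; have ikp := intg_kap tau0.
have iw := intg_itr i k0; have ivi := iv ikT; have ivs := iv sT.
have iFw := intg_F F0 F_mono F_lip iw; have iFs := vF sT.
have [K HK] := dqk_bounded (k / lam) sg0; have [K' HK'] := kap_bounded tau0.
have mq := measurable_dqk (k / lam) sg; have mk := measurable_kap tau.
pose f1 := conv (dq (k / lam) sg) (fun y => F (itr k i y) - F (v s y)).
pose f2 := conv (fun x => dq (k / lam) sg x - kp tau x) (fun y => F (v s y)).
have E x : conv (dq (k / lam) sg) (fun y => F (itr k i y)) x - G r s x = f1 x + f2 x.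
  rewrite /f1 (convB mq HK)// /f2 /G -/tau.
  have -> : conv (fun x => dq (k / lam) sg x - kp tau x) (fun y => F (v s y)) x =
     conv (dq (k / lam) sg) (fun y => F (v s y)) x - conv (kp tau) (fun y => F (v s y)) x.
    rewrite /conv -RintB; [|exact: (intg_conv_arg mq HK)|exact: (intg_conv_arg mk HK')].
    by apply: eq_Rintegral => y _; rewrite mulrBl.
  by ring.
rewrite (_ : (fun x => _ - _) = fun x => f1 x + f2 x); last exact/funext.
have if1 : intg mu f1 by apply: intg_conv => //; exact: intgB.
have if2 : intg mu f2 by apply: intg_conv => //; exact: intgB.
apply: (le_trans (nrmD if1 if2)); apply: lerD.
  apply: (@le_trans _ _ (nrm (dq (k / lam) sg) * nrm (fun y => F (itr k i y) - F (v s y)))).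
    by apply: nrm_conv => //; exact: intgB.
  apply: ler_pM; [exact: Rint_ge0|exact: Rint_ge0| |].
    apply: (le_trans (HC _ _ h0 sg0)); rewrite ler_wpM2l ?(ltW C0)//.
    exact: rs_le.
  have i1 := intgB iw ivi; have i2 := intgB ivi ivs.
  apply: (@le_trans _ _ (\int[mu]_x (L * (`|itr k i x - v (i%:R * k) x| + `|v (i%:R * k) x - v s x|)))).
    apply: le_Rint; [exact/intg_norm/intgB|by apply/intgZl/intgD; exact: intg_norm|].
    move=> x; apply: (le_trans (F_abs F_mono F_lip _ _)); rewrite ler_wpM2l//.
    apply: le_trans (ler_normD _ _); rewrite addrA subrK//.
  rewrite RintZl; last by apply: intgD; exact: intg_norm.
  by rewrite RintD//; exact: intg_norm.
apply: (@le_trans _ _ (nrm (fun x => dq (k / lam) sg x - kp tau x) * nrm (fun y => F (v s y)))).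
  by apply: nrm_conv => //; exact: intgB.
rewrite mulrC /cerr sgE; apply: ler_pM => //; [exact: Rint_ge0|exact: Rint_ge0|].
apply: (@le_trans _ _ (\int[mu]_x (L * `|v s x|))).
  apply: le_Rint; [exact: intg_norm|exact/intgZl/intg_norm|].
  by move=> x; have := F_abs F_mono F_lip (v s x) 0; rewrite F0 !subr0.
by rewrite RintZl ?ler_wpM2l ?vm//; exact: intg_norm.
Qed.

(** The discrete Duhamel formula is a time integral of a step function, so subtracting the mild
    formula leaves the integral of the difference of integrands; Minkowski moves the L^1 norm
    inside. *)
Lemma scheme_duhamel k J (beta : R -> R) : 0 < k -> J.+1%:R * k <= T ->
  meas beta -> (forall s, 0 <= beta s) ->
  (forall s, 0 <= s -> s < J.+1%:R * k -> forall i : nat, (i < J.+1)%N -> i%:R * k <= s -> s < i.+1%:R * k ->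
   nrm (fun x => conv (dq (k / lam) ((J.+1 - i)%:R * k)) (fun y => F (itr k i y)) x - G (J.+1%:R * k) s x) <= beta s) ->
  ((nrm (fun x => itr k J.+1 x - v (J.+1%:R * k) x))%:E <= \int[leb]_s (oi 0 (J.+1%:R * k) s * beta s)%:E)%E.
Proof.
move=> k0 JT mbeta beta0 H; have Jk : 0 < J.+1%:R * k by rewrite mulr_gt0.
set r := J.+1%:R * k in JT H Jk *.
have rT : 0 <= r <= T by rewrite (ltW Jk).
have iw i := intg_itr i k0; have iF i := intg_F F0 F_mono F_lip (iw i).
pose A i := conv (dq (k / lam) ((J.+1 - i)%:R * k)) (fun y => F (itr k i y)).
have mA i : meas (A i).
  by apply: measurable_conv; [exact: measurable_dqk|exact: intg_meas (iF i)].
have iA i : (i < J.+1)%N -> intg mu (A i).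
  by move=> iJ; apply: intg_conv => //; apply: intg_dqk => //; rewrite mulr_gt0// ltr0n subn_gt0.
pose Phi s x := grid k J.+1 A s x - ci 0 r s * G r s x.
have m1 := meas_fst.
have m2 := meas_snd.
have mPhi : meas (uncurry Phi : ST -> R).
  rewrite (_ : uncurry Phi = fun p : ST =>
    grid k J.+1 A p.1 p.2 - ci 0 r p.1 * uncurry (G r) p); last by apply/funext => -[].
  apply: measurable_funB.
    apply: measurable_sum => i; apply: mmul.
      exact: (mcomp (measurable_ci _ _) m1).
    exact: (mcomp (mA i) m2).
  apply: mmul; last exact: mG.
  exact: (mcomp (measurable_ci _ _) m1).
have E : {ae mu, forall x, itr k J.+1 x - v r x = \int[leb]_s Phi s x}.
  have r0T : 0 < r <= T by rewrite Jk.
  apply: filterS (mild r0T) => x Hx; rewrite {}Hx.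
  have mGx : meas (fun s => G r s x) by exact: (measurable_uncurry2 x (mG r)).
  have ig i : intg leb (fun s => ci (i%:R * k) (i.+1%:R * k) s * A i x).
    apply: intg_ci; first exact: measurable_cst.
    by apply: intgZr; apply: intg_oi; rewrite ler_wpM2r ?(ltW k0)// ler_nat.
  rewrite RintB; last 2 first.
  - by apply: intg_sum => i; exact: ig.
  - by apply: intg_ci => //; exact: intg_G.
  rewrite Rint_ci// /grid Rint_sum// itrE// opprD addrACA subrr add0r; congr (_ - _).
  apply: eq_bigr => i _; rewrite Rint_ci_cst; last by rewrite ler_wpM2r ?(ltW k0)// ler_nat.
  by congr (_ * _); rewrite -mulrBl -natr1 addrAC subrr add0r mul1r.
have mw : meas (fun x => itr k J.+1 x - v r x).
  by apply: measurable_funB; [exact: intg_meas (iw _)|exact: intg_meas (iv rT)].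
have mI : meas (fun x => \int[leb]_s Phi s x).
  apply: measurable_Rint; rewrite (_ : uncurry _ = uncurry Phi \o (fun p => (p.2, p.1))); last by apply/funext => -[].
  by apply: (mcomp mPhi); apply: measurable_fun_pair.
rewrite -(intg_n1 (intgB (iw _) (iv rT))) (n1_ae mw mI E) -inte_ci//.
apply: (le_trans (n1_Rint leb mPhi)).
apply: ge0_le_integral => //.
- by move=> s _; exact: n1_ge0.
- apply: (@measurable_inte _ _ _ _ _ mu (fun s x => `|Phi s x|)) => //.
  rewrite (_ : uncurry _ = fun p => `|uncurry Phi p|); last by apply/funext => -[].
  exact: mcomp.
- by apply/measurable_EFinP; apply: mmul => //; exact: measurable_ci.
move=> s _; have [/andP[s0 sr]|nsr] := boolP ((0 <= s) && (s < r)).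
  have [i iJ [l1 l2]] := grid_ex k0 s0 sr.
  have -> : Phi s = fun x => A i x - G r s x.
    by apply/funext => x; rewrite /Phi (grid_pick _ _ k0 iJ l1 l2) /ci s0 sr mul1r.
  rewrite intg_n1; last first.
    apply: intgB; first exact: iA.
    apply: intg_conv; first by apply: intg_kap => //; rewrite subr_gt0.
    by apply: vF; rewrite s0/= (le_trans (ltW sr)).
  by rewrite lee_fin /ci s0 sr mul1r; exact: H.
have -> : Phi s = fun=> 0.
  apply/funext => x; rewrite /Phi (grid_out _ _ k0 nsr) /ci.
  by rewrite (negbTE nsr) mul0r subr0.
rewrite /n1; under eq_integral do rewrite normr0; rewrite integral0 lee_fin.
by rewrite mulr_ge0 ?ci_ge0.
Qed.

Lemma scheme_cvg e : 0 < e -> exists N : nat, forall n, (N <= n)%N ->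
  nrm (fun x => itr (T / n.+1%:R) n.+1 x - v T x) <= e.
Proof.
move=> e0; have [C C0 HC] := scheme_step_error.
have a01 : 0 <= alpha^-1 < 1 by have /andP[/ltW -> ->] := ai01.
have CL0 : 0 <= C * L by rewrite mulr_ge0// ltW.
have eps0 : 0 < (2 * (C * L + 1))^-1 by rewrite invr_gt0 mulr_gt0// ltr_wpDl.
have [nu nu0 Hnu] := inte_oipow_exp T a01 eps0.
have [K K0 HK] := inte_oipow_rev a01.
pose K' := K * T `^ (1 - alpha^-1); have K'0 : 0 <= K' by rewrite mulr_ge0 ?powR_ge0// ltW.
pose R0 := e / (2 * expR (nu * T)); have R00 : 0 < R0 by rewrite divr_gt0// mulr_gt0 ?expR_gt0.
have CLK := mulr_ge0 CL0 K'0.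
have CK0 : 0 < 2 * (C * L * K' + 1) by lra.
pose om := R0 / (2 * (C * L * K' + 1)); have om0 : 0 < om by rewrite divr_gt0.
have [del del0 Hdel] := cv om0.
have Lm0 : 0 <= L * m by rewrite mulr_ge0.
have Lm1 : 0 < 2 * (L * m + 1) by lra.
have [N1 _ HN1] := cvgr_lt _ (cerr_cvg lam0 T0) _ (divr_gt0 R00 Lm1).
have kc : T / n.+1%:R @[n --> \oo] --> (0 : R).
  by rewrite -[X in _ --> X](mulr0 T); apply: cvgMl_tmp; exact: cvg_harmonic.
have lin (A1 A2 A3 r1 r2 : R) : A1 <= r2 -> A2 <= r1 / 2 -> A3 <= r1 / 2 -> r1 <= r2 -> A1 + (A2 + A3) <= 2 * r2.
  by move=> *; lra.
have [N2 _ HN2] := cvgr_lt _ kc _ del0.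
exists (maxn N1 N2) => n; rewrite geq_max => /andP[/HN1 /= I1 /HN2 /= k1].
have n0 : 0 < n.+1%:R :> R by [].
set k := T / n.+1%:R in I1 k1 *; have k0 : 0 < k by rewrite divr_gt0.
have kT : n.+1%:R * k = T by rewrite /k mulrC divfK// gt_eqF.
have ic := intg_cerr T lam0 k0.
set I := Rintegral _ _ _ in I1.
(* Strong induction in a norm weighted by [e^(nu s)]. The rate [nu] makes the propagated error at
   most [R0 e^(nu r)], half of the claimed bound; the time modulus [om] and the consistency error
   cost [R0 / 2] each. [R0] turns the claim at time [T] into [e]. *)
have key J : (J <= n.+1)%N -> nrm (fun x => itr k J x - v (J%:R * k) x) <= 2 * R0 * expR (nu * (J%:R * k)).
  elim/ltn_ind: J => -[|J] IH Jn.
    rewrite mul0r /nrm; under eq_Rintegral do rewrite /itr /= subrr normr0.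
    by rewrite Rint0 mulr_ge0 ?expR_ge0// mulr_ge0// ltW.
  have JT : J.+1%:R * k <= T by rewrite -kT ler_wpM2r ?(ltW k0)// ler_nat.
  have Jk : 0 < J.+1%:R * k by rewrite mulr_gt0.
  pose beta s := C * (J.+1%:R * k - s) `^ (- alpha^-1) * (L * (2 * R0 * expR (nu * s) + om)) +
     L * m * cerr lam k (J.+1%:R * k - s).
  have mr : meas (fun s : R => J.+1%:R * k - s) by exact: measurable_funB.
  have mc : meas (fun s : R => cerr lam k (J.+1%:R * k - s)).
    by apply: (mcomp (measurable_cerr lam k0)).
  have mp : meas (fun s : R => (J.+1%:R * k - s) `^ (- alpha^-1)).
    by apply: (mcomp (measurable_powR _)).
  have mbeta : meas beta.
    apply: measurable_funD; last exact: mmul.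
    apply: mmul; first exact: mmul.
    apply: mmul => //; apply: measurable_funD => //; apply: mmul => //.
    by apply: (mcomp (@measurable_expR R)); exact: mmul.
  have beta0 s : 0 <= beta s.
    rewrite addr_ge0//; last by rewrite mulr_ge0// cerr_ge0.
    apply: mulr_ge0; first by rewrite mulr_ge0 ?powR_ge0// ltW.
    by rewrite mulr_ge0// addr_ge0 ?(ltW om0)// mulr_ge0 ?expR_ge0// mulr_ge0// ltW.
  have := scheme_duhamel k0 JT mbeta beta0.
  set r := J.+1%:R * k in JT Jk beta mr mc mp mbeta beta0 *.
  move=> D; rewrite -lee_fin; apply: (le_trans (D _)) => [s s0 sr i iJ l1 l2|].
    apply: (le_trans (HC k J.+1 s k0 JT s0 sr i iJ l1 l2)); rewrite lerD2r.
    apply: ler_wpM2l; first by rewrite mulr_ge0 ?powR_ge0// ltW.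
    apply: ler_wpM2l => //; apply: lerD.
      apply: (le_trans (IH i iJ (leq_trans (ltnW iJ) Jn))).
      apply: ler_wpM2l; first by apply: mulr_ge0 => //; exact: ltW.
      by rewrite ler_expR; apply: ler_wpM2l => //; exact: ltW.
    have sT : s <= T by exact: le_trans (ltW sr) JT.
    have ik0 : 0 <= i%:R * k by apply: mulr_ge0 => //; exact: ltW.
    have ikT : i%:R * k <= T by exact: le_trans sT.
    apply: Hdel; [by rewrite ik0|by rewrite s0|].
    rewrite distrC ger0_norm ?subr_ge0//; apply: le_trans (ltW k1).
    have l3 : i.+1%:R * k = i%:R * k + k by rewrite -natr1; ring.
    by rewrite l3 in l2; rewrite lerBlDl ltW.
  have E s : oi 0 r s * beta s =
     C * L * (2 * R0) * expR (nu * r) * (oi 0 r s * ((r - s) `^ (- alpha^-1) * expR (- (nu * (r - s)))))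
     + (C * L * om * (oi 0 r s * (r - s) `^ (- alpha^-1)) + L * m * (oi 0 r s * cerr lam k (r - s))).
    rewrite /beta; have -> : expR (nu * s) = expR (nu * r) * expR (- (nu * (r - s))).
      by rewrite -expRD; congr expR; ring.
    by move: (expR _) (expR _) (powR _ _) (cerr _ _ _) (oi _ _ _) => *; ring.
  under eq_integral do rewrite E.
  have moi : meas (oi 0 r) by exact: measurable_oi.
  have g1 : meas (fun s : R => oi 0 r s * ((r - s) `^ (- alpha^-1) * expR (- (nu * (r - s))))).
    apply: mmul => //; apply: mmul => //.
    apply: (mcomp (@measurable_expR R)); apply: (mcomp (@oppr_measurable R setT)).
    exact: mmul.
  have g2 : meas (fun s : R => oi 0 r s * (r - s) `^ (- alpha^-1)) by exact: mmul.
  have g3 : meas (fun s : R => oi 0 r s * cerr lam k (r - s)) by exact: mmul.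
  have p1 s : 0 <= oi 0 r s * ((r - s) `^ (- alpha^-1) * expR (- (nu * (r - s)))).
    by rewrite !mulr_ge0 ?oi_ge0 ?powR_ge0 ?expR_ge0.
  have p2 s : 0 <= oi 0 r s * (r - s) `^ (- alpha^-1) by rewrite !mulr_ge0 ?oi_ge0 ?powR_ge0.
  have p3 s : 0 <= oi 0 r s * cerr lam k (r - s) by rewrite !mulr_ge0 ?oi_ge0 ?cerr_ge0.
  have c1 : 0 <= C * L * (2 * R0) * expR (nu * r) by rewrite mulr_ge0 ?expR_ge0// mulr_ge0// mulr_ge0// ltW.
  have c2 : 0 <= C * L * om by rewrite mulr_ge0// ltW.
  have P1 s := mulr_ge0 c1 (p1 s).
  have P2 s := mulr_ge0 c2 (p2 s).
  have P3 s := mulr_ge0 Lm0 (p3 s).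
  have M1 : meas (fun s : R => C * L * (2 * R0) * expR (nu * r) * (oi 0 r s * ((r - s) `^ (- alpha^-1) * expR (- (nu * (r - s)))))).
    exact: mmul.
  have M2 : meas (fun s : R => C * L * om * (oi 0 r s * (r - s) `^ (- alpha^-1))) by exact: mmul.
  have M3 : meas (fun s : R => L * m * (oi 0 r s * cerr lam k (r - s))) by exact: mmul.
  have M23 : meas (fun s : R => C * L * om * (oi 0 r s * (r - s) `^ (- alpha^-1)) + L * m * (oi 0 r s * cerr lam k (r - s))).
    exact: measurable_funD M2 M3.
  rewrite (inteD leb M1 M23 P1 (fun s => addr_ge0 (P2 s) (P3 s))) (inteD leb M2 M3 P2 P3).
  rewrite !inteZl//.
  have h1 := Hnu r JT.
  have h2 : (\int[leb]_s (oi 0 r s * (r - s) `^ (- alpha^-1))%:E <= K'%:E)%E.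
    have := HK 0 r Jk; rewrite subr0 => /le_trans; apply; rewrite lee_fin ler_wpM2l ?(ltW K0)//.
    apply: ge0_ler_powR; rewrite ?nnegrE ?(ltW Jk) ?(ltW T0)// subr_ge0.
    by case/andP: a01 => _ /ltW.
  have h3 : (\int[leb]_s (oi 0 r s * cerr lam k (r - s))%:E <= I%:E)%E.
    have mf := mmul moi (measurable_cerr lam k0).
    have f0 s : 0 <= oi 0 r s * cerr lam k s by rewrite mulr_ge0 ?oi_ge0 ?cerr_ge0.
    have -> : (\int[leb]_s (oi 0 r s * cerr lam k (r - s))%:E = \int[leb]_s (oi 0 r s * cerr lam k s)%:E)%E.
      apply: etrans (@inte_reflect R r (fun s => oi 0 r s * cerr lam k s) mf f0).
      apply: eq_integral => s _; congr (_ * _)%:E.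
      by rewrite /oi subr_gt0 ltrBlDr ltrDl andbC.
    rewrite /I EFin_Rint//.
    have f1 s : oi 0 r s * cerr lam k s <= oi 0 T s * cerr lam k s.
      rewrite ler_wpM2r ?cerr_ge0// /oi.
      by case: (0 < s) => //=; case: (ltP s r) => //= sr; rewrite (lt_le_trans sr JT).
    exact: (le_inte leb mf (intg_meas ic) f0 f1).
  apply: (le_trans (leeD (lee_wpmul2l _ h1) (leeD (lee_wpmul2l _ h2) (lee_wpmul2l _ h3)))); rewrite ?lee_fin//.
  set ex := expR (nu * r) in c1 *; have ex1 : 1 <= ex by rewrite /ex -expR0 ler_expR mulr_ge0 ?(ltW Jk).
  have ex0 : 0 <= ex by exact: le_trans ex1.
  have fr1 (c : R) : 0 <= c -> c / (c + 1) <= 1.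
    by move=> c0; rewrite ler_pdivrMr ?mul1r ?lerDl//; lra.
  have q1 : C * L * (2 * R0) * ex * (2 * (C * L + 1))^-1 <= R0 * ex.
    have -> : C * L * (2 * R0) * ex * (2 * (C * L + 1))^-1 = (C * L / (C * L + 1)) * (R0 * ex).
      by field; rewrite gt_eqF//; lra.
    apply: ler_piMl; first by apply: mulr_ge0 => //; exact: ltW.
    apply: fr1; exact: CL0.
  have q2 : C * L * om * K' <= R0 / 2.
    have -> : C * L * om * K' = (C * L * K' / (C * L * K' + 1)) * (R0 / 2).
      by rewrite /om; field; rewrite gt_eqF//; have := mulr_ge0 CL0 K'0; lra.
    apply: ler_piMl; first by lra.
    apply: fr1; exact: CLK.
  have q3 : L * m * I <= R0 / 2.
    apply: (@le_trans _ _ (L * m * (R0 / (2 * (L * m + 1))))); first by rewrite ler_wpM2l// ltW.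
    have -> : L * m * (R0 / (2 * (L * m + 1))) = (L * m / (L * m + 1)) * (R0 / 2).
      by field; rewrite gt_eqF//; lra.
    apply: ler_piMl; first by lra.
    apply: fr1; exact: Lm0.
  have q4 : R0 <= R0 * ex by rewrite ler_peMr// ltW.
  have E2 : 2 * R0 * ex = 2 * (R0 * ex) := esym (mulrA _ _ _).
  rewrite E2; exact: (lin _ _ _ _ _ q1 q2 q3 q4).
have := key n.+1 (leqnn _); rewrite kT => /le_trans; apply.
rewrite /R0; apply: eq_leW; field.
by rewrite gt_eqF// expR_gt0.
Qed.

End window.
End scheme.

(** * Mass, positive parts and L^2 norm of the iterates *)

Section iterates.
Variables (F : R -> R) (L : R).
Hypotheses (F0 : F 0 = 0) (F_mono : forall u v : R, u <= v -> F u <= F v)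
  (F_lip : forall u v : R, u <= v -> F v - F u <= L * (v - u)).
Variables (lam : R).
Hypotheses (lam0 : 0 < lam) (lamL : lam * L <= 1).
Variable v : R -> 'rV[R]_d -> R.
Hypothesis iv0 : intg mu (v 0).
Local Notation it := (itr F v lam).

Lemma Rint_upw h w : intg mu w -> \int[mu]_x upw F lam h w x = \int[mu]_x w x.
Proof.
move=> iw; have iF := intg_F F0 F_mono F_lip iw.
have iS : intg mu (fun x => F (w (x - h *: b))) by have := intg_shift (- (h *: b)) iF.
rewrite /upw RintB//; last exact/intgZl/intgB.
rewrite RintZl; last exact: intgB.
by rewrite RintB// (Rint_shift (- (h *: b)) (f := fun x => F (w x))) ?subrr ?mulr0 ?subr0//; exact: intg_meas iF.
Qed.

Let intg_it k j : 0 < k -> intg mu (it k j).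
Proof.
move=> k0; elim: j => [|j IH]; first exact: iv0.
exact: (intg_stp F0 F_mono F_lip lam k0 IH).
Qed.

Let intg_up k j h : 0 < k -> intg mu (upw F lam h (it k j)).
Proof. by move=> k0; apply: (intg_upw F0 F_mono F_lip); exact: intg_it. Qed.

Lemma Rint_itr k j : 0 < k -> \int[mu]_x it k j x = \int[mu]_x v 0 x.
Proof.
move=> k0; elim: j => [//|j IH].
have E : it k j.+1 = conv (pt k) (upw F lam (k / lam) (it k j)) by [].
by rewrite E Rint_conv ?Rint_stk ?mul1r ?Rint_upw//; [exact: intg_it|exact: intg_stk|exact: intg_up].
Qed.

Lemma itr_posp k j c : 0 < k -> 0 <= c ->
  \int[mu]_x posp c (it k j x) <= \int[mu]_x posp c (v 0 x).
Proof.
move=> k0 c0; elim: j => [//|j IH]; apply: le_trans IH.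
have E : it k j.+1 = conv (pt k) (upw F lam (k / lam) (it k j)) by [].
have i1 := intg_it j k0; have i2 := intg_up j (k / lam) k0.
rewrite -lee_fin EFin_Rint; last by apply: intg_posp => //; exact: intg_it.
rewrite EFin_Rint; last exact: intg_posp.
rewrite E; apply: le_trans (conv_stk_posp k0 i2 (intg_posp c0 i2)) _.
exact: (upw_posp F_mono F_lip (ltW lam0) lamL _ _ (intg_meas i1)).
Qed.

Lemma itr_ge0 k j : 0 < k -> (forall x, 0 <= v 0 x) -> forall x, 0 <= it k j x.
Proof.
move=> k0 v00; elim: j => [//|j IH] x.
apply: (conv_stk_ge0 x k0); last exact: intg_up.
by apply: nearW => y; exact: (upw_ge0 F0 F_mono F_lip (ltW lam0) lamL).
Qed.

(** The upwind step does not increase the L^2 norm, by layer cake over [upw_posp]; diffusion obeys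
    the discrete Nash inequality. Dividing by [c] gives the recursion of [power_contraction], so the
    bound is free of [n] and survives the limit. [C] is a parameter so that all time windows share
    it. *)
Lemma itr_sq (C : R) : 0 < C ->
  (forall (n : nat) (k : R) w, 0 < k -> intg mu w -> intg mu (fun x => w x ^+ 2) ->
  (\int[mu]_x (conv (pt k) w x ^+ 2)) ^+ n.+1 <=
  (\int[mu]_x (w x ^+ 2)) ^+ n * (C * rt (n.+1%:R * k) ^+ d * (\int[mu]_x `|w x|) ^+ 2)) ->
  forall T m K n, 0 < T -> 0 < m ->
  (forall x, 0 <= v 0 x) -> (forall x, v 0 x <= K) -> \int[mu]_x v 0 x <= m ->
  let c := C * rt T ^+ d * m ^+ 2 in let w := it (T / n.+1%:R) n.+1 in
  intg mu (fun x => w x ^+ 2) /\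
  (\int[mu]_x w x ^+ 2) ^+ 2 <= c * Num.max c (\int[mu]_x v 0 x ^+ 2).
Proof.
move=> C0 HC T m K n T0 m0 v00 vK vm c w.
pose k := T / n.+1%:R; have k0 : 0 < k by rewrite divr_gt0.
have [A A0 HA] := conv_stk_sup.
have wsq j : intg mu (fun x => it k j x ^+ 2).
  case: j => [|j].
    have bd x : `|v 0 x| <= K by rewrite ger0_norm.
    exact: (intg_sq_bounded iv0 bd).
  apply: intg_sq_bounded (intg_it j.+1 k0) _ => x.
  exact: (HA k (upw F lam (k / lam) (it k j)) x k0 (intg_up j _ k0)).
have it0 j := itr_ge0 j k0 v00.
have c0 : 0 < c by rewrite /c mulr_gt0 ?exprn_gt0// mulr_gt0// exprn_gt0// rs_gt0.
have kT : n.+1%:R * k = T by rewrite /k mulrC divfK.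
pose Z j := \int[mu]_x it k j x ^+ 2; have Z0 j : 0 <= Z j by apply: Rint_ge0 => x; exact: sqr_ge0.
have step j : Z j.+1 ^+ n.+1 <= Z j ^+ n * c.
  pose w' := upw F lam (k / lam) (it k j).
  have w'0 x : 0 <= w' x by exact: (upw_ge0 F0 F_mono F_lip (ltW lam0) lamL).
  have iw' : intg mu w' by exact: intg_up.
  have sq : (\int[mu]_x (w' x ^+ 2)%:E <= (Z j)%:E)%E.
    rewrite EFin_Rint//; apply: sq_posp => //; [exact: intg_meas iw'|exact: intg_meas (intg_it j k0)|].
    move=> e e0; exact: (upw_posp F_mono F_lip (ltW lam0) lamL _ _ (intg_meas (intg_it j k0))).
  have iw'2 : intg mu (fun x => w' x ^+ 2).
    apply: intgP; first by apply: measurable_funX; exact: intg_meas iw'.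
    under eq_integral => x _ do rewrite (ger0_norm (sqr_ge0 _)).
    exact: le_lt_trans sq (ltry _).
  apply: le_trans (HC n k w' k0 iw' iw'2) _.
  rewrite kT; apply: ler_pM.
  - by apply: exprn_ge0; apply: Rint_ge0 => x; exact: sqr_ge0.
  - by rewrite mulr_ge0 ?sqr_ge0// mulr_ge0 ?(ltW C0)// exprn_ge0// ltW// rs_gt0.
  - by apply: lerXn2r; rewrite ?nnegrE//; [apply: Rint_ge0 => x; exact: sqr_ge0|rewrite -lee_fin EFin_Rint].
  - rewrite /c ler_wpM2l//; first by rewrite mulr_ge0 ?(ltW C0)// exprn_ge0// ltW// rs_gt0.
    apply: lerXn2r; rewrite ?nnegrE ?(ltW m0)//; first exact: Rint_ge0.
    apply: le_trans vm; rewrite -(Rint_itr j k0) -(Rint_upw (k / lam) (intg_it j k0)).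
    by apply: eq_leW; apply: eq_Rintegral => x _; rewrite ger0_norm.
split; first exact: wsq.
pose y j := Z j / c.
have yn j : 0 <= y j by rewrite divr_ge0// ltW.
have ys j : y j.+1 ^+ n.+1 <= y j ^+ n.
  rewrite /y !expr_div_n ler_pdivrMr ?exprn_gt0//.
  have cn : c ^+ n != 0 by rewrite expf_neq0// gt_eqF.
  by rewrite [c ^+ n.+1]exprSr mulrA divfK.
have := power_contraction yn ys; rewrite /y expr_div_n ler_pdivrMr ?exprn_gt0// => /le_trans; apply.
rewrite expr2 mulrA mulrC; apply: ler_wpM2l; first exact: ltW.
rewrite mulrC maxr_pMr ?(ltW c0)// mulr1 mulrC divfK ?gt_eqF//.
Qed.

End iterates.

(** * Weights that dominate kernel differences along the drift *)

Section weights.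
Local Notation jj := jw.
Local Notation P := (d.+2%:R + alpha).
Implicit Types (x y z : 'rV[R]_d).

Let P0 : 0 <= P.
Proof. by rewrite addr_ge0//; case/andP: alpha12 => /(lt_trans ltr01)/ltW. Qed.

(* Two powers of decay weaker than the kernel itself: differences of the heat
   kernel along [b] gain these two powers up to the factor [1 + |b.x|]. *)
Definition wt x : R := (1 + `|dotp b x|) * jj d.+2 x.

Lemma wt_gt0 x : 0 < wt x.
Proof. by rewrite mulr_gt0 ?jw_gt0// ltr_wpDr. Qed.

Lemma brk_scale_le r x : 0 <= r -> brk (r *: x) <= (1 + r) * brk x.
Proof.
move=> r0; rewrite /brk enormZ ger0_norm//.
have := enorm_ge0 x; move: (enorm x) => e e0.
rewrite mulrDr mulrDl mul1r mulr1; have := mulr_ge0 r0 e0; lra.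
Qed.

Lemma brk_le_scale r x : 0 < r -> brk x <= (1 + r^-1) * brk (r *: x).
Proof.
move=> r0; have E : r^-1 *: (r *: x) = x by rewrite scalerA mulVf ?scale1r// gt_eqF.
by rewrite -{1}E; apply: brk_scale_le; rewrite invr_ge0 ltW.
Qed.

(** For lags in a compact interval of positive times, scaling costs only constants. The lower bound
    cannot contain the [1 +] of [wt], because [kap] vanishes on the hyperplane [dotp b x = 0];
    [wt_split] repairs this. *)
Lemma kap_wt s1 s2 : 0 < s1 -> s1 <= s2 -> exists2 C : R, 0 < C &
  forall s x, s1 <= s -> s <= s2 -> `|kp s x| <= C * wt x /\ `|dotp b x| * jj d.+2 x <= C * `|kp s x|.
Proof.
move=> s10 s12; have s20 := lt_le_trans s10 s12.
have [C C0 HC] := dstk1_upper; have [c c0 Hc] := dstk1_lower.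
set r1 := rt s1; set r2 := rt s2; have r10 : 0 < r1 by exact: rs_gt0. have r20 : 0 < r2 by exact: rs_gt0.
pose A := 1 + r2^-1; pose B := 1 + r1.
have A0 : 0 < A by rewrite addr_gt0// invr_gt0.
have B0 : 0 < B by rewrite addr_gt0.
pose C1 := r1 ^+ d.+1 * (C * (1 + r1 + enorm b) * A `^ P).
pose C2 := (r2 ^+ d.+2 * c)^-1 * B `^ P.
have C10 : 0 < C1.
  rewrite mulr_gt0 ?exprn_gt0// mulr_gt0 ?powR_gt0// mulr_gt0//.
  by rewrite ltr_wpDr ?enorm_ge0// addr_gt0.
have C20 : 0 < C2 by rewrite mulr_gt0 ?powR_gt0// invr_gt0 mulr_gt0// exprn_gt0.
exists (C1 + C2); first exact: addr_gt0.
move=> s x h1 h2; have s0 := lt_le_trans s10 h1.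
set r := rt s; have r0 : 0 < r by exact: rs_gt0.
have rr1 : r <= r1 by exact: rs_le.
have rr2 : r2 <= r by exact: rs_le.
have kE : `|kp s x| = r ^+ d.+1 * `|dstk 1 b (r *: x)|.
  by rewrite /kap normrN dstk_scale// normrM ger0_norm// exprn_ge0// ltW.
have b1 : jj d.+2 (r *: x) <= A `^ P * jj d.+2 x.
  apply: jw_le_mul => //; apply: le_trans (brk_le_scale x r0) _.
  by rewrite ler_wpM2r ?(ltW (brk_gt0 _))// lerD2l lef_pV2 ?posrE.
have b2 : jj d.+2 x <= B `^ P * jj d.+2 (r *: x).
  apply: jw_le_mul => //; apply: le_trans (brk_scale_le x (ltW r0)) _.
  by rewrite ler_wpM2r ?(ltW (brk_gt0 _))// lerD2l.
have D0 := normr_ge0 (dotp b x).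
split.
  apply: (@le_trans _ _ (C1 * wt x)); last by rewrite ler_wpM2r ?lerDl ?(ltW C20)// ltW// wt_gt0.
  rewrite kE /C1 -mulrA; apply: ler_pM => //; first by rewrite exprn_ge0// ltW.
    by apply: lerXn2r; rewrite ?nnegrE ?(ltW r0) ?(ltW r10).
  apply: le_trans (HC b (r *: x)) _; rewrite dotpZl normrM (ger0_norm (ltW r0)) dotpC /wt.
  apply: (@le_trans _ _ (C * ((1 + r1 + enorm b) * (1 + `|dotp b x|)) * (A `^ P * jj d.+2 x))); last first.
    by apply: eq_leW; ring.
  have e0 := enorm_ge0 b; apply: ler_pM => //.
  - by rewrite mulr_ge0 ?(ltW C0)// addr_ge0 ?mulr_ge0// ltW.
  - exact/ltW/jw_gt0.
  - rewrite ler_wpM2l ?(ltW C0)//.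
    have : r * `|dotp b x| <= r1 * `|dotp b x| by rewrite ler_wpM2r.
    have : 0 <= enorm b * `|dotp b x| by exact: mulr_ge0.
    move: (r * _) => y1; move: (enorm b) e0 => e e0; move: (`|dotp b x|) D0 => D D0.
    by rewrite mulrDr mulr1 !mulrDl; lra.
apply: (@le_trans _ _ (C2 * `|kp s x|)); last by rewrite ler_wpM2r ?lerDr// ltW.
have r2c : 0 < r2 ^+ d.+2 * c by rewrite mulr_gt0// exprn_gt0.
rewrite kE /C2 -mulrA ler_pdivlMl//.
apply: (@le_trans _ _ (r2 ^+ d.+2 * c * (`|dotp b x| * (B `^ P * jj d.+2 (r *: x))))).
  by rewrite ler_wpM2l ?(ltW r2c)// ler_wpM2l.
have := Hc b (r *: x); rewrite dotpZl normrM (ger0_norm (ltW r0)) (dotpC x) => H.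
apply: (@le_trans _ _ (B `^ P * (r ^+ d.+1 * (c * (r * `|dotp b x|) * jj d.+2 (r *: x))))); last first.
  by rewrite ler_wpM2l ?powR_ge0// ler_wpM2l// exprn_ge0// ltW.
rewrite [leLHS](_ : _ = r2 ^+ d.+2 * (c * `|dotp b x| * B `^ P * jj d.+2 (r *: x))); last by ring.
rewrite [leRHS](_ : _ = r ^+ d.+2 * (c * `|dotp b x| * B `^ P * jj d.+2 (r *: x))); last by rewrite [r ^+ d.+2]exprSr; move: (r ^+ d.+1) => ?; ring.
rewrite ler_wpM2r//; first by rewrite !mulr_ge0 ?powR_ge0 ?(ltW c0)// ltW// jw_gt0.
by apply: lerXn2r; rewrite ?nnegrE ?(ltW r0) ?(ltW r20).
Qed.

Lemma jw_shift m x v : jj m x <= brk v `^ (m%:R + alpha) * jj m (x + v).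
Proof. by apply: jw_le_mul => //; [exact: brk_gt0|rewrite mulrC brkD]. Qed.

(** The step is 1 because the restart compares values at [x] and [x - b]; the mean value theorem
    then gives [kap] at a shift bounded by [b], which costs a power of [brk b]. *)
Lemma dqk1_wt s : 0 < s -> exists2 C : R, 0 < C & forall x, `|dq 1 s x| <= C * wt x.
Proof.
move=> s0; have [C C0 HC] := kap_wt s0 (lexx s).
pose e := dotp b b; have e0 : 0 <= e by exact: dotpp_ge0.
exists (C * ((1 + e) * brk b `^ P)).
  by rewrite !mulr_gt0 ?powR_gt0 ?brk_gt0// ltr_wpDr.
move=> x; have [r /andP[r0 r1] ->] := dqk_mvt x ltr01 s0.
have [H _] := HC s (x - r *: b) (lexx _) (lexx _); apply: le_trans H _.
rewrite -mulrA ler_wpM2l ?(ltW C0)// /wt mulrACA; apply: ler_pM.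
- by rewrite addr_ge0.
- exact/ltW/jw_gt0.
- rewrite dotpBr dotpZr; have := ler_normB (dotp b x) (r * e).
  have : `|r * e| <= e by rewrite ger0_norm ?mulr_ge0 ?(ltW r0)// ler_piMl// ltW.
  have := mulr_ge0 e0 (normr_ge0 (dotp b x)); rewrite -/e.
  move: (`|_ - _|) (`|r * e|) (`|dotp b x|) => *; lra.
- have := jw_shift d.+2 (x - r *: b) (r *: b); rewrite subrK => /le_trans; apply.
  rewrite ler_wpM2r ?(ltW (jw_gt0 _ _))//; apply: ge0_ler_powR; rewrite ?nnegrE ?(ltW (brk_gt0 _))//.
  by rewrite /brk lerD2l enormZ gtr0_norm// ler_piMl ?enorm_ge0// ltW.
Qed.

Lemma wt_le_stk : exists2 C : R, 0 < C & forall x,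
  (1 + `|dotp b x|) * wt x <= C * pt 1 x.
Proof.
have [c c0 Hc] := stk1_lower.
exists ((1 + enorm b) ^+ 2 / c).
  by rewrite divr_gt0// exprn_gt0// ltr_wpDr ?enorm_ge0.
move=> x; have e0 := enorm_ge0 b; have e1 := enorm_ge0 x.
have h : 1 + `|dotp b x| <= (1 + enorm b) * brk x.
  have := dotp_le b x; have := mulr_ge0 e0 e1; rewrite /brk mulrDr mulrDl mul1r mulr1 mulrDl mul1r.
  by move: (`|_|) (_ * _) => *; lra.
apply: (@le_trans _ _ ((1 + enorm b) ^+ 2 * jj d x)).
  rewrite -jwS -(jwS d.+1) /wt.
  rewrite [leRHS](_ : _ = ((1 + enorm b) * brk x) * (((1 + enorm b) * brk x) * jj d.+2 x)); last by ring.
  have h0 : 0 <= 1 + `|dotp b x| by rewrite addr_ge0.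
  apply: ler_pM => //; first by rewrite mulr_ge0// ltW// jw_gt0.
  by rewrite ler_wpM2r// ltW// jw_gt0.
by rewrite -mulrA ler_wpM2l ?exprn_ge0 ?addr_ge0// ler_pdivlMl.
Qed.

(** A 3P-type inequality. If [|x - y| <= |y|] then [|x| <= 2 |y|], so [y] carries the decay in [x];
    what is lost in the factor [1 + |dotp b y|] is paid by the other weight, and the outcome is
    below the integrable kernel by [wt_le_stk]. The other case is symmetric. *)
Lemma wt_conv : exists2 C : R, 0 < C & forall x y, wt (x - y) * wt y <= C * wt x * (pt 1 (x - y) + pt 1 y).
Proof.
have [C C0 HC] := wt_le_stk; pose A : R := 2 `^ P.
have A0 : 0 < A by rewrite powR_gt0.
exists (A * C); first exact: mulr_gt0.
have key x y : enorm (x - y) <= enorm y -> wt (x - y) * wt y <= A * C * wt x * pt 1 (x - y).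
  move=> h; have h1 : brk x <= 2 * brk y.
    have := enormD (x - y) y; rewrite subrK /brk => h2.
    by move: (enorm x) (enorm y) (enorm _) h h2 => *; lra.
  have h2 : jj d.+2 y <= A * jj d.+2 x by exact: jw_le_mul.
  have h3 : 1 + `|dotp b y| <= (1 + `|dotp b x|) * (1 + `|dotp b (x - y)|).
    have -> : dotp b y = dotp b x - dotp b (x - y) by rewrite dotpBr; ring.
    have := ler_normB (dotp b x) (dotp b (x - y)).
    have := mulr_ge0 (normr_ge0 (dotp b x)) (normr_ge0 (dotp b (x - y))).
    by rewrite mulrDr mulr1 mulrDl mul1r; lra.
  have h4 := HC (x - y).
  apply: (@le_trans _ _ (A * wt x * ((1 + `|dotp b (x - y)|) * wt (x - y)))).
    rewrite mulrC [leRHS](_ : _ = ((1 + `|dotp b x|) * (1 + `|dotp b (x - y)|)) * (A * jj d.+2 x) * wt (x - y)); last by rewrite /wt; ring.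
    apply: ler_wpM2r; first exact/ltW/wt_gt0.
    by rewrite {1}/wt; apply: ler_pM => //; exact/ltW/jw_gt0.
  rewrite [leRHS](_ : _ = A * wt x * (C * pt 1 (x - y))); last by ring.
  by rewrite ler_wpM2l// mulr_ge0 ?(ltW A0)// ltW// wt_gt0.
move=> x y; have Q0 : 0 <= A * C * wt x by apply: mulr_ge0; [exact/ltW/mulr_gt0|exact/ltW/wt_gt0].
rewrite mulrDr; have [h|h] := leP (enorm (x - y)) (enorm y).
  by apply: le_trans (key x y h) _; rewrite lerDl mulr_ge0// stk_ge0.
have := key x (x - y); rewrite opprB addrCA subrr addr0 mulrC => /(_ (ltW h)) /le_trans; apply.
by rewrite lerDr mulr_ge0// stk_ge0.
Qed.

(** [dotp b (x + b)] and [dotp b (x - b)] differ by twice [dotp b b > 0], so they are not small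
    together. The weight is thus controlled by the transport kernel at [x + b] and [x - b], where
    the mild formula asserts convergence. *)
Lemma wt_split s1 s2 : b != 0 -> 0 < s1 -> s1 <= s2 -> exists2 C : R, 0 < C &
  forall s x, s1 <= s -> s <= s2 -> wt x <= C * (`|kp s (x + b)| + `|kp s (x - b)|).
Proof.
move=> b0 s10 s12; have [C C0 HC] := kap_wt s10 s12.
pose e := dotp b b; have e0 : 0 < e by rewrite lt0r dotpp_eq0 b0 dotpp_ge0.
pose D := brk b `^ P; have D0 : 0 < D by rewrite powR_gt0// brk_gt0.
pose A := 1 + e^-1; have A1 : 1 <= A by rewrite lerDl invr_ge0 ltW.
have A0 : 0 < A by exact: lt_le_trans A1.
exists (A * D * C); first by rewrite !mulr_gt0.
move=> s x h1 h2; have [_ H1] := HC s (x + b) h1 h2; have [_ H2] := HC s (x - b) h1 h2.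
have j1 := jw_shift d.+2 x b; have j2 := jw_shift d.+2 x (- b); rewrite brkN -/D in j1 j2.
have k1 : 1 + `|dotp b x| <= A * (`|dotp b (x + b)| + `|dotp b (x - b)|).
  rewrite dotpDr dotpBr -/e; set t := dotp b x.
  have q1 : e <= `|t + e| + `|t - e|.
    have := ler_normB (t + e) (t - e); rewrite (_ : t + e - (t - e) = 2 * e); last by ring.
    rewrite normrM (ger0_norm (ler0n R 2)) (ger0_norm (ltW e0)) => h; by apply: le_trans h; rewrite ler_peMl ?(ltW e0)// ler1n.
  have q2 : `|t| <= `|t + e| + `|t - e|.
    have := ler_normD (t + e) (t - e); rewrite (_ : t + e + (t - e) = 2 * t); last by ring.
    rewrite normrM (ger0_norm (ler0n R 2)) => h; apply: le_trans h; by rewrite ler_peMl// ler1n.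
  have q3 : 1 <= e^-1 * (`|t + e| + `|t - e|) by rewrite ler_pdivlMl// mulr1.
  by rewrite /A [leRHS]mulrDl mul1r addrC; exact: lerD.
have J0 := ltW (jw_gt0 d.+2 x).
apply: (@le_trans _ _ (A * (`|dotp b (x + b)| * jj d.+2 x + `|dotp b (x - b)| * jj d.+2 x))).
  by rewrite /wt -mulrDl mulrA ler_wpM2r.
rewrite -!mulrA ler_wpM2l ?(ltW A0)// mulrDr mulrDr; apply: lerD.
  apply: (@le_trans _ _ (D * (`|dotp b (x + b)| * jj d.+2 (x + b)))).
    by rewrite mulrCA ler_wpM2l.
  by rewrite ler_wpM2l ?(ltW D0).
apply: (@le_trans _ _ (D * (`|dotp b (x - b)| * jj d.+2 (x - b)))).
  by rewrite mulrCA ler_wpM2l.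
by rewrite ler_wpM2l ?(ltW D0).
Qed.

End weights.

(** * Smoothing of equi-integrable data *)

Section smoothing.

Lemma rs_d_root (y : R) : (0 < d)%N -> 0 < y -> exists2 s : R, 0 < s & rt s ^+ d = y.
Proof.
move=> d0 y0; exists (y `^ (- (alpha / d%:R))); first exact: powR_gt0.
rewrite /rs -powR_mulrn ?powR_ge0// -!powRrM -[RHS](powRr1 (ltW y0)); congr (_ `^ _).
have a0 : alpha != 0 by case/andP: alpha12 => /(lt_trans ltr01) h _; rewrite gt_eqF.
by field; rewrite a0 pnatr_eq0 -lt0n.
Qed.

Lemma rs_d_le s t : 0 < s -> s <= t -> rt t ^+ d <= rt s ^+ d.
Proof.
move=> s0 st; have t0 := lt_le_trans s0 st.
by apply: lerXn2r; rewrite ?nnegrE ?(ltW (rs_gt0 _))// rs_le.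
Qed.

Lemma rs_d_gt0 s : 0 < s -> 0 < rt s ^+ d.
Proof. by move=> s0; rewrite exprn_gt0// rs_gt0. Qed.

Lemma rs_d_mul s t : 0 < s -> 0 < t -> rt (s * t) ^+ d = rt s ^+ d * rt t ^+ d.
Proof. by move=> s0 t0; rewrite rsM ?(ltW s0) ?(ltW t0)// exprMn. Qed.

Lemma conv_stk_trunc : exists2 C : R, 0 < C & forall s f x c, 0 < s -> 0 <= c -> intg mu f ->
  conv (pt s) f x <= c + C * rt s ^+ d * \int[mu]_y posp c (f y).
Proof.
have [C C0 HC] := conv_stk_sup; exists C => // s f x c s0 c0 if_.
have [K HK] := stk_bounded s0; have mk := measurable_stk s.
have ip := intg_posp c0 if_.
have i1 : intg mu (fun y => pt s (x - y) * c) by apply: intgZr; apply: (intg_sub x); exact: intg_stk.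
have i2 := intg_conv_arg mk HK x ip.
have I1 : \int[mu]_y (pt s (x - y) * c) = c.
  rewrite RintZr; last by apply: (intg_sub x); exact: intg_stk.
  have -> : \int[mu]_y pt s (x - y) = 1 by apply: etrans (Rint_sub x mk) _; exact: Rint_stk.
  by rewrite mul1r.
apply: (@le_trans _ _ (c + conv (pt s) (fun y => posp c (f y)) x)).
  apply: (@le_trans _ _ (\int[mu]_y (pt s (x - y) * c + pt s (x - y) * posp c (f y)))); last by rewrite RintD// I1.
  apply: le_Rint; [exact: (intg_conv_arg mk HK)|exact: intgD|].
  move=> y; rewrite -mulrDr ler_wpM2l ?stk_ge0// -lerBlDl.
  by rewrite /posp le_max lexx.
rewrite lerD2l; apply: le_trans (ler_norm _) _; apply: le_trans (HC s _ x s0 ip) _.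
apply: eq_leW; congr (_ * _); apply: eq_Rintegral => y _.
by rewrite ger0_norm// posp_ge0.
Qed.

Lemma posp_tail (f : 'rV[R]_d -> R) (e : R) : intg mu f -> 0 < e ->
  exists2 c : R, 0 < c & \int[mu]_x posp c (f x) <= e.
Proof.
move=> if_ e0.
have [] // := @dct _ _ _ mu (fun n x => posp n.+1%:R (f x)) (fun=> 0) (fun x => `|f x|).
- by move=> n; exact: (mcomp (measurable_posp n.+1%:R) (intg_meas if_)).
- move=> x; apply: cvg_near_cst; near=> n; rewrite /posp max_r// subr_le0.
  apply: le_trans (ler_norm _) _; apply: (@le_trans _ _ n%:R); last by rewrite ler_nat.
  by near: n; exact: nbhs_infty_ger.
- exact: intg_norm.
- by move=> n x; exact: posp_norm_le.
move=> _ _; rewrite Rint0 => c; have [N _ HN] := cvgr_lt _ c _ e0.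
by exists N.+1%:R => //; apply/ltW/HN => /=.
Unshelve. all: by end_near. Qed.

(** Cut [f] at a height [c] above which [f0] has little mass: the part above gains a small factor in
    the L^1 smoothing bound. The part below is at most [c], which is less than [e / 2 * rt s ^+ d]
    for small [s], since this rate blows up. Only the positive parts of [f0] enter, so [del] is
    common to all such [f]. *)
Lemma conv_stk_small (f0 : 'rV[R]_d -> R) (e : R) : (0 < d)%N -> intg mu f0 -> 0 < e -> exists2 del : R, 0 < del &
  forall f s x, intg mu f -> (forall c, 0 <= c -> \int[mu]_y posp c (f y) <= \int[mu]_y posp c (f0 y)) ->
  0 < s -> s <= del -> conv (pt s) f x <= e * rt s ^+ d.
Proof.
move=> d0 if0 e0; have [C C0 HC] := conv_stk_trunc.
have e1 : 0 < e / 2 / C by rewrite !divr_gt0.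
have [c c0 Hc] := posp_tail if0 e1.
have [del del0 Hdel] := rs_d_root d0 (divr_gt0 c0 (divr_gt0 e0 (ltr0n R 2))).
exists del => // f s x if_ Hf s0 sd; apply: le_trans (HC s f x c s0 (ltW c0) if_) _.
have rs0 := rs_d_gt0 s0.
have l1 : c <= e / 2 * rt s ^+ d.
  by have := rs_d_le s0 sd; rewrite Hdel ler_pdivrMr ?divr_gt0// mulrC.
have l2 : C * rt s ^+ d * \int[mu]_y posp c (f y) <= e / 2 * rt s ^+ d.
  apply: (@le_trans _ _ (C * rt s ^+ d * (e / 2 / C))).
    by rewrite ler_wpM2l ?mulr_ge0 ?(ltW C0) ?(ltW rs0)// (le_trans (Hf c (ltW c0))).
  by apply: eq_leW; field; rewrite gt_eqF.
by apply: le_trans (lerD l1 l2) _; rewrite -mulrDl -splitr.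
Qed.

End smoothing.

(** * Cut-off functions and transport of mass *)

Section cutoff.
Implicit Types (x y z : 'rV[R]_d) (rho : R).

(** Lipschitz with constant [1 / rho], which measures how much mass the drift can carry beyond
    radius [rho]. *)
Definition cut rho x : R := Num.min 1 (Num.max 0 (enorm x / rho - 1)).

Lemma cut_ge0 rho x : 0 <= cut rho x.
Proof. by rewrite /cut le_min ler01 le_max lexx. Qed.

Lemma cut_le1 rho x : cut rho x <= 1.
Proof. by rewrite /cut ge_min lexx. Qed.

Lemma cut_norm rho x : `|cut rho x| <= 1.
Proof. by rewrite ger0_norm ?cut_ge0 ?cut_le1. Qed.

Lemma cut1 rho x : 0 < rho -> 2 * rho <= enorm x -> cut rho x = 1.
Proof.
move=> r0 h; rewrite /cut min_l// le_max; apply/orP; right.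
have : 2 <= enorm x / rho by rewrite ler_pdivlMr.
lra.
Qed.

Lemma cut0 rho x : 0 < rho -> enorm x <= rho -> cut rho x = 0.
Proof.
move=> r0 h; rewrite /cut max_l ?min_r//.
by rewrite subr_le0 ler_pdivrMr// mul1r.
Qed.

Lemma cut_mono rho rho' x : 0 < rho -> rho <= rho' -> cut rho' x <= cut rho x.
Proof.
move=> r0 rr; have r'0 := lt_le_trans r0 rr.
rewrite /cut le_min ge_min lexx /= ge_min; apply/orP; right.
rewrite ge_max le_max lexx /= le_max lerD2r ler_wpM2l ?enorm_ge0 ?orbT//.
by rewrite lef_pV2 ?posrE.
Qed.

Lemma cut_lip rho x y : 0 < rho -> `|cut rho x - cut rho y| <= enorm (x - y) / rho.
Proof.
move=> r0; set a := enorm x / rho; set c := enorm y / rho; set e := _ / rho.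
have e1 : enorm x <= enorm y + enorm (x - y) by have := enormD y (x - y); rewrite addrC subrK.
have e2 : enorm y <= enorm x + enorm (x - y).
  by have := enormD x (y - x); rewrite addrC subrK -(enormN (x - y)) opprB.
have h1 : a <= c + e by rewrite -mulrDl ler_wpM2r// invr_ge0 ltW.
have h2 : c <= a + e by rewrite -mulrDl ler_wpM2r// invr_ge0 ltW.
rewrite /cut -/a -/c ler_norml; move: a c e h1 h2 => a c e h1 h2.
by have [|] := leP 0 (a - 1) => ?; have [|] := leP 0 (c - 1) => ?;
  have [|] := leP 1 (a - 1) => ?; have [|] := leP 1 (c - 1) => ?;
  rewrite ?(min_r (ler01 _)); have [|] := leP 1 (0 : R) => ?; apply/andP; split; lra.
Qed.

Lemma measurable_cut rho : meas (cut rho).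
Proof.
apply: measurable_minr => //; apply: measurable_maxr => //; apply: measurable_funB => //.
by apply: mmul => //; exact: measurable_enorm.
Qed.

(** If [|x| > rho], one of [|x - y|] and [|y|] is at least [rho / 2], where the cut-off of radius
    [rho / 4] is already 1. *)
Lemma cut_add rho x y : 0 < rho -> cut rho x <= cut (rho / 4) (x - y) + cut (rho / 4) y.
Proof.
move=> r0; have r40 : 0 < rho / 4 by rewrite divr_gt0.
have [h|h] := leP (enorm x) rho; first by rewrite cut0// addr_ge0 ?cut_ge0.
apply: le_trans (cut_le1 _ _) _.
have := enormD (x - y) y; rewrite subrK => e.
have [h1|h1] := leP (2 * (rho / 4)) (enorm (x - y)); first by rewrite cut1// lerDl cut_ge0.
rewrite (@cut1 (rho / 4) y) ?lerDr ?cut_ge0//; lra.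
Qed.

Lemma cut_tail (f : 'rV[R]_d -> R) e : intg mu f -> (forall x, 0 <= f x) -> 0 < e ->
  exists2 rho : R, 0 < rho & forall rho', rho <= rho' -> \int[mu]_x (cut rho' x * f x) <= e.
Proof.
move=> if_ f0 e0.
have ic rho : intg mu (fun x => cut rho x * f x).
  exact: (intgMl (measurable_cut rho) (cut_norm rho) if_).
have [] // := @dct _ _ _ mu (fun n x => cut n.+1%:R x * f x) (fun=> 0) f.
- by move=> n; exact: intg_meas (ic _).
- move=> x; apply: cvg_near_cst; near=> n; rewrite cut0 ?mul0r//.
  by apply: (@le_trans _ _ n%:R); [near: n; exact: nbhs_infty_ger|rewrite ler_nat].
- by move=> n x; rewrite normrM (ger0_norm (f0 x)) ler_piMl// cut_norm.
move=> _ _; rewrite Rint0 => c; have [N _ HN] := cvgr_lt _ c _ e0.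
exists N.+1%:R => // rho' h; apply: le_trans (ltW (HN N (leqnn N))).
by apply: le_Rint => // x; rewrite ler_wpM2r// cut_mono.
Unshelve. all: by end_near. Qed.

(** Summation by parts: the shift by [h b] is moved from the kernel to the cut-off, whose Lipschitz
    constant absorbs [1 / h]. The bound is uniform in [s], so the singularity of the kernel gradient
    at lag 0 does not enter tail estimates. *)
Lemma cut_dq rho h s z : 0 < rho -> 0 < h -> 0 < s ->
  `|\int[mu]_x (cut rho x * dq h s (x - z))| <= enorm b / rho.
Proof.
move=> r0 h0 s0; have ip := intg_stk s0.
have fin (a : R) : `|a| <= h * (enorm b / rho) -> `|h^-1 * a| <= enorm b / rho.
  by rewrite normrM gtr0_norm ?invr_gt0// ler_pdivrMl.
have xb (x : 'rV[R]_d) : x + h *: b - x = h *: b by rewrite addrAC subrr add0r.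
have mc := measurable_cut rho; have mp := measurable_stk s.
have ipz : intg mu (fun x => pt s (x - z)) by have := intg_shift (- z) ip.
have ips : intg mu (fun x => pt s (x - z - h *: b)).
  rewrite (_ : (fun x => _) = fun x => pt s (x + (- z - h *: b))); last by apply/funext => x; rewrite addrA.
  exact: (intg_shift (- z - h *: b) ip).
have i1 : intg mu (fun x => cut rho x * pt s (x - z)) by exact: (intgMl mc (cut_norm rho) ipz).
have i2 : intg mu (fun x => cut rho x * pt s (x - z - h *: b)) by exact: (intgMl mc (cut_norm rho) ips).
have mcs : meas (fun x => cut rho (x + h *: b)).
  by apply: (mcomp mc); exact: measurable_shift_rV.
have i3 : intg mu (fun x => cut rho (x + h *: b) * pt s (x - z)).
  by apply: (intgMl mcs (fun x => cut_norm rho _) ipz).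
have E2 : \int[mu]_x (cut rho x * pt s (x - z - h *: b)) = \int[mu]_x (cut rho (x + h *: b) * pt s (x - z)).
  rewrite -(Rint_shift (h *: b) (f := fun x => cut rho x * pt s (x - z - h *: b))); last exact: intg_meas i2.
  by apply: eq_Rintegral => x _; congr (_ * pt s _); rewrite addrAC addrK.
pose J := \int[mu]_x ((cut rho (x + h *: b) - cut rho x) * pt s (x - z)).
have E : \int[mu]_x (cut rho x * dq h s (x - z)) = h^-1 * J.
  transitivity (h^-1 * (\int[mu]_x (cut rho x * pt s (x - z - h *: b)) - \int[mu]_x (cut rho x * pt s (x - z)))).
    apply: etrans (f_equal (fun r => h^-1 * r) (RintB i2 i1)).
    apply: etrans (RintZl h^-1 (intgB i2 i1)).
    by apply: eq_Rintegral => x _; rewrite /dqk; ring.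
  rewrite E2; apply: etrans (f_equal (fun r => h^-1 * r) (esym (RintB i3 i1))) _.
  by congr (_ * _); apply: eq_Rintegral => x _; ring.
have i4 : intg mu (fun x => (cut rho (x + h *: b) - cut rho x) * pt s (x - z)).
  by rewrite (_ : (fun x => _) = fun x => cut rho (x + h *: b) * pt s (x - z) - cut rho x * pt s (x - z)); [exact: intgB|apply/funext => x; ring].
have I1 : \int[mu]_x pt s (x - z) = 1.
  by have := Rint_shift (- z) mp => ->; exact: Rint_stk.
have bJ : `|J| <= h * (enorm b / rho).
  apply: le_trans (le_norm_Rint i4) _.
  apply: (@le_trans _ _ (\int[mu]_x (h * (enorm b / rho) * pt s (x - z)))); last first.
    by rewrite (RintZl _ ipz) I1 mulr1.
  apply: le_Rint; [exact: intg_norm|exact: intgZl|].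
  move=> x; rewrite normrM (ger0_norm (stk_ge0 (x - z) s0)); apply: ler_wpM2r; first exact: stk_ge0.
  apply: le_trans (cut_lip _ _ r0) _.
  by rewrite xb enormZ (gtr0_norm h0) mulrA.
by rewrite E; exact: fin bJ.
Qed.

(** The limit of [cut_dq] along steps [h] tending to 0, by the L^1 convergence of the quotients. *)
Lemma cut_kap rho s z : 0 < rho -> 0 < s -> `|\int[mu]_x (cut rho x * kp s (x - z))| <= enorm b / rho.
Proof.
move=> r0 s0; apply/ler_addgt0Pr => e e0.
pose h n : R := (rt s)^-1 / n.+1%:R.
have rs0 := rs_gt0 s0.
have h0 n : 0 < h n by rewrite divr_gt0// invr_gt0.
have hc : h n @[n --> \oo] --> (0 : R).
  by rewrite -[X in _ --> X](mulr0 (rt s)^-1); apply: cvgMl_tmp; exact: cvg_harmonic.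
have c := cvg_dqk s0 h0 (s := fun=> s).
have [||| |N _ HN] := cvgr_lt _ (c _ _ _ _) _ e0.
- by move=> n; rewrite lexx mulr_natl mulr2n lerDl ltW.
- move=> n; rewrite /h mulrAC mulVf ?gt_eqF// mul1r invf_le1 ?ler1n//.
- exact: hc.
- exact: cvg_cst.
have {HN} HN := HN N (leqnn N).
have ik := intg_kap s0; have iq := intg_dqk (h N) s0.
have ikz : intg mu (fun x => kp s (x - z)) by have := intg_shift (- z) ik.
have iqz : intg mu (fun x => dq (h N) s (x - z)) by have := intg_shift (- z) iq.
have mc := measurable_cut rho.
have i1 := intgMl mc (cut_norm rho) ikz; have i2 := intgMl mc (cut_norm rho) iqz.
have i3 := intgB i2 i1.
rewrite -(subrK (\int[mu]_x (cut rho x * dq (h N) s (x - z))) (\int[mu]_x _)) addrC.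
apply: le_trans (ler_normD _ _) _; apply: lerD; first exact: cut_dq.
rewrite distrC -RintB//; apply: le_trans (le_norm_Rint i3) _.
apply: le_trans (ltW HN).
have id := intg_norm (intgB iq ik).
rewrite -(Rint_shift (- z) (intg_meas id)); apply: le_Rint; [exact: intg_norm|by have := intg_shift (- z) id|].
by move=> x; rewrite -mulrBr normrM ler_piMl// cut_norm.
Qed.

Lemma cut_conv_kap rho s g : 0 < rho -> 0 < s -> intg mu g ->
  `|\int[mu]_x (cut rho x * conv (kp s) g x)| <= enorm b / rho * \int[mu]_x `|g x|.
Proof.
move=> r0 s0 ig; have ik := intg_kap s0.
have iP := intg_cprod ik ig.
have mc := measurable_cut rho.
have mc1 : meas (fun p : 'rV[R]_d * 'rV[R]_d => cut rho p.1).
  exact: (mcomp mc measurable_fst).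
pose f x y := cut rho x * (kp s (x - y) * g y).
have iF : intg (mu \x mu)%E (uncurry f).
  rewrite (_ : uncurry f = fun p => cut rho p.1 * uncurry (fun x y => kp s (x - y) * g y) p); last by apply/funext => -[].
  exact: (intgMl mc1 (fun p => cut_norm rho p.1) iP).
have [K HK] := kap_bounded s0; have mk := measurable_kap s.
have E : \int[mu]_x (cut rho x * conv (kp s) g x) = \int[mu]_y (g y * \int[mu]_x (cut rho x * kp s (x - y))).
  transitivity (\int[mu]_x \int[mu]_y f x y).
    by apply: eq_Rintegral => x _; rewrite RintZl//; exact: (intg_conv_arg mk HK).
  rewrite (Rfubini iF); apply: eq_Rintegral => y _; rewrite -RintZl.
    by apply: eq_Rintegral => x _; rewrite /f; ring.
  apply: (intgMl mc (cut_norm rho)); have := intg_shift (- y) ik; exact.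
have iG := intg_fubiniG iF.
have iE : intg mu (fun y => g y * \int[mu]_x (cut rho x * kp s (x - y))).
  rewrite (_ : (fun y => _) = fun y => \int[mu]_x f x y)//; apply/funext => y; rewrite -RintZl.
    by apply: eq_Rintegral => x _; rewrite /f; ring.
  apply: (intgMl mc (cut_norm rho)); have := intg_shift (- y) ik; exact.
rewrite E; apply: le_trans (le_norm_Rint iE) _; rewrite -RintZl; last exact: intg_norm.
apply: le_Rint; [exact: intg_norm|exact/intgZl/intg_norm|].
by move=> y; rewrite normrM mulrC ler_wpM2r// cut_kap.
Qed.

Lemma cut_conv_stk rho t f : 0 < rho -> 0 < t -> intg mu f -> {ae mu, forall x, 0 <= f x} ->
  \int[mu]_x (cut rho x * conv (pt t) f x) <=
  (\int[mu]_x (cut (rho / 4) x * pt t x)) * \int[mu]_x f x + \int[mu]_x (cut (rho / 4) x * f x).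
Proof.
move=> r0 t0 if_ f0; have ip := intg_stk t0.
have mc := measurable_cut rho; have mc4 := measurable_cut (rho / 4).
have i1 := intgMl mc4 (cut_norm (rho / 4)) ip; have i2 := intgMl mc4 (cut_norm (rho / 4)) if_.
have ic : intg mu (conv (pt t) f) by exact: intg_conv.
have E1 : \int[mu]_x conv (fun x => cut (rho / 4) x * pt t x) f x = (\int[mu]_x (cut (rho / 4) x * pt t x)) * \int[mu]_x f x.
  exact: Rint_conv.
have E2 : \int[mu]_x conv (pt t) (fun x => cut (rho / 4) x * f x) x = \int[mu]_x (cut (rho / 4) x * f x).
  by rewrite Rint_conv// Rint_stk// mul1r.
rewrite -E1 -E2.
have j1 := intg_conv i1 if_; have j2 := intg_conv ip i2.
rewrite -RintD//; apply: le_Rint; [exact: (intgMl mc (cut_norm rho) ic)|exact: intgD|].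
move=> x; have [K HK] := stk_bounded t0; have mp := measurable_stk t.
have b1 y : `|cut (rho / 4) y * pt t y| <= K.
  by rewrite normrM; apply: le_trans (HK y); rewrite ler_piMl// cut_norm.
have k1 := intg_conv_arg (intg_meas i1) b1 x if_; have k2 := intg_conv_arg mp HK x i2.
have k0 := intg_conv_arg mp HK x if_.
rewrite /conv -RintZl// -RintD//; apply: ae_le_Rint; [exact: intgZl|exact: intgD|].
apply: (aeS _ f0) => y fy.
have := cut_add x y r0 => h.
rewrite [leRHS](_ : _ = (cut (rho / 4) (x - y) + cut (rho / 4) y) * (pt t (x - y) * f y)); last by ring.
by rewrite ler_wpM2r// mulr_ge0// stk_ge0.
Qed.

Lemma cut_scale rho (r : R) x : 0 < r -> cut rho (r *: x) = cut (rho / r) x.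
Proof.
move=> r0; rewrite /cut enormZ gtr0_norm//; congr (Num.min 1 (Num.max 0 (_ - 1))).
by rewrite invf_div mulrCA mulrA.
Qed.

Lemma cut_stk_scale rho t : 0 < t -> \int[mu]_x (cut (rho / rt t) x * pt t x) = \int[mu]_x (cut rho x * pt 1 x).
Proof.
move=> t0; have r0 := rs_gt0 t0.
have mf : meas (fun x => cut rho x * pt 1 x).
  by apply: mmul; [exact: measurable_cut|exact: measurable_stk].
rewrite -(Rint_affine 0 r0 mf) -RintZl.
  by apply: eq_Rintegral => x _; rewrite addr0 cut_scale// (stk_scale x t0); ring.
have ip := intg_stk (@ltr01 R).
exact: (intg_affine 0 r0 (intgMl (measurable_cut rho) (cut_norm rho) ip)).
Qed.

Lemma jw_le_inv x : (0 < d)%N -> jw d x <= (brk x)^-1.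
Proof.
move=> d0; rewrite -(powR_inv1 (ltW (brk_gt0 x))) /jw ler_powR ?brk_ge1// lerN2.
by case/andP: alpha12 => /ltW h _; apply: le_trans h _; rewrite lerDr.
Qed.

End cutoff.

(** * What a mild solution provides: regularity and joint measurability *)

Section mild_flow.
Variables (q : R) (u0 : 'rV[R]_d -> R) (u : R -> 'rV[R]_d -> R).
Hypothesis q0 : 0 < q.
Hypothesis b0 : b != 0.
Hypothesis sol : mild_solution alpha q b u0 u.

Section unpack.

Lemma Linf_ae (f : 'rV[R]_d -> R) (M : R) : ('N[mu]_+oo[EFin \o f] <= M%:E)%E ->
  {ae mu, forall x, `|f x| <= M}.
Proof.
rewrite unlock; case: ifPn => [m0 /ess_sup_inf.ess_supP H|].
  by apply: (aeS _ H) => x /=; rewrite lee_fin.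
rewrite -leNgt => m0 _; exists setT; split; [exact: (@measurableT _ 'rV[R]_d)| |by []].
by apply/le_anti; rewrite m0 measure_ge0.
Qed.

Lemma sol_intg t : 0 <= t -> intg mu (u t).
Proof.
move=> t0; have [[H _] _ _ _] := sol; apply/Lfun1_integrable; apply: H.
by rewrite /= in_itv/= andbT.
Qed.

Lemma sol_L1 t e : 0 <= t -> 0 < e -> exists2 del : R, 0 < del &
  forall s, 0 <= s -> `|s - t| < del -> \int[mu]_x `|u s x - u t x| <= e.
Proof.
move=> t0 e0; have [[_ H] _ _ _] := sol.
have tI : `[0, +oo[%classic t by rewrite /= in_itv/= andbT.
have := H t tI => /fine_cvgP[h1 h2].
have h3 := cvgr_lt _ h2 _ e0.
have [del /= del0 Hd] := h1; have [del' /= del'0 Hd'] := h3.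
exists (Num.min del del'); first by rewrite lt_min del0.
move=> s s0 st; have sI : `[0, +oo[%classic s by rewrite /= in_itv/= andbT.
have st1 : `|t - s| < del by rewrite distrC; apply: lt_le_trans st _; rewrite ge_min lexx.
have st2 : `|t - s| < del' by rewrite distrC; apply: lt_le_trans st _; rewrite ge_min lexx orbT.
have := Hd' s st2 sI; rewrite /= Lnorm1 => /ltW.
by [].
Qed.

Lemma Lfun_oo_bd (f : 'rV[R]_d -> R) : f \in Lfun (mu) +oo%E ->
  exists2 M : R, 0 < M & {ae mu, forall x, `|f x| <= M}.
Proof.
rewrite inE => /andP[_]; rewrite inE /finite_norm /= => fin.
exists (Num.max 1 (fine 'N[mu]_+oo[EFin \o f])%E); first by rewrite lt_max ltr01.
apply: Linf_ae; rewrite -[leLHS]fineK; first by rewrite lee_fin le_max lexx orbT.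
by rewrite ge0_fin_numE// Lnorm_ge0.
Qed.

Lemma sol_bd t : 0 < t -> exists2 M : R, 0 < M & {ae mu, forall x, `|u t x| <= M}.
Proof.
by move=> t0; have [_ [H _] _ _] := sol; apply: Lfun_oo_bd; apply: H; rewrite /= in_itv/= andbT.
Qed.

Lemma sol_Linf t e : 0 < t -> 0 < e -> exists2 del : R, 0 < del &
  forall s, 0 < s -> `|s - t| < del -> {ae mu, forall x, `|u s x - u t x| <= e}.
Proof.
move=> t0 e0; have [_ [_ H] _ _] := sol.
have tI : `]0, +oo[%classic t by rewrite /= in_itv/= andbT.
have := H t tI => /fine_cvgP[h1 h2].
have h3 := cvgr_lt _ h2 _ e0.
have [del /= del0 Hd] := h1; have [del' /= del'0 Hd'] := h3.
exists (Num.min del del'); first by rewrite lt_min del0.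
move=> s s0 st; have sI : `]0, +oo[%classic s by rewrite /= in_itv/= andbT.
have st1 : `|t - s| < del by rewrite distrC; apply: lt_le_trans st _; rewrite ge_min lexx.
have st2 : `|t - s| < del' by rewrite distrC; apply: lt_le_trans st _; rewrite ge_min lexx orbT.
apply: (@Linf_ae (fun x => u s x - u t x)).
have f1 := Hd s st1 sI; have f2 := Hd' s st2 sI.
by rewrite -[leLHS]fineK// lee_fin ltW.
Qed.

Lemma sol_u0 : {ae mu, forall x, u 0 x = u0 x}. Proof. by have [] := sol. Qed.

Local Notation g s := (fun z => pwn q (u s z)).

Let duhE t x s z : 0 < s -> s < t -> duhamel alpha q b u t x s z = kp (t - s) (x - z) * pwn q (u s z).
Proof.
move=> s0 st; rewrite /duhamel /kap -grad_stk//; last by rewrite subr_gt0.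
by congr (dotp b (grad _ z) * _); apply/funext => y; rewrite heat_kernelE.
Qed.

Lemma sol_mild t x : 0 < t ->
  intg (leb \x mu)%E (fun p => oi 0 t p.1 * (kp (t - p.1) (x - p.2) * pwn q (u p.1 p.2))) /\
  u t x = conv (pt t) u0 x + \int[leb]_s (oi 0 t s * conv (kp (t - s)) (g s) x).
Proof.
move=> t0; have [_ _ _ H] := sol; have [i ->] := H t x t0.
have mD : measurable (`]0, t[%classic `*` [set: 'rV[R]_d] : set (ST)).
  by apply: measurableX.
split.
  move: i => /(integrable_mkcond _ mD); apply: eq_integrable => //.
  move=> [s z] _; rewrite /patch /= /oi; case: ifPn.
    by rewrite inE /= in_itv/= => -[/andP[s0 st] _]; rewrite s0 st mul1r duhE.
  rewrite notin_setE /= in_itv/= => n.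
  by rewrite (_ : (_ && _) = false) ?mul0r//; apply/negP => h; apply: n.
congr (_ + _).
  by rewrite /stable_semigroup /conv; apply: eq_Rintegral => y _; rewrite heat_kernelE.
rewrite Rintegral_mkcond; apply: eq_Rintegral => s _; rewrite /patch /oi.
case: ifPn => [|].
  rewrite inE /= in_itv/= => /andP[s0 st]; rewrite s0 st mul1r.
  by apply: eq_Rintegral => z _; rewrite duhE.
by rewrite notin_setE /= in_itv/= => /negP/negbTE ->; rewrite mul0r.
Qed.

(** Extends the solution by 0 to nonpositive times, so that joint measurability can be stated on the
    whole line. *)
Definition ug s z : R := (0 < s)%R%:R * u s z.

Lemma kap_neq0 t x : 0 < t -> dotp b x != 0 -> kp t x != 0.
Proof.
move=> t0 bx; rewrite /kap oppr_eq0 dstk_scale//; apply: mulf_neq0.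
  by rewrite expf_neq0// gt_eqF// rs_gt0.
have [c c0 Hc] := dstk1_lower; rewrite -normr_gt0.
apply: lt_le_trans (Hc b (rt t *: x)); rewrite mulr_gt0 ?jw_gt0// mulr_gt0// normr_gt0.
by rewrite dotpZl dotpC mulf_neq0// gt_eqF// rs_gt0.
Qed.

(** Extracted from the mild formula: its integrand is jointly measurable in [(s, z)], the kernel
    factor can be divided out where [dotp b (x - z)] is nonzero, and [pwnK] undoes the nonlinearity.
    A limit over integer times covers all [s > 0]. *)
Lemma measurable_ug : meas (uncurry ug : ST -> R).
Proof.
pose gg s z : R := (0 < s)%R%:R * pwn q (u s z).
pose dd t x (p : ST) := oi 0 t p.1 * (kp (t - p.1) (x - p.2) * pwn q (u p.1 p.2)).
have mdd t x : 0 < t -> meas (dd t x).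
  by move=> t0; have [/intg_meas] := sol_mild x t0.
have m1 := meas_fst.
have m2 := meas_snd.
have mk t x : meas (fun p : ST => kp (t - p.1) (x - p.2)).
  have m3 : meas (fun p : ST => t - (p.1 : R)) by exact: measurable_funB.
  have m4 : meas (fun p : ST => x - p.2).
    by apply: measurable_funB_rV => //; exact: measurable_cst.
  exact: (@measurable_comp_kernel _ (ST)%type kp (fun p => t - (p.1 : R)) (fun p => x - p.2) (measurable_kap2) m3 m4).
have mV (f : ST -> R) : meas f -> meas (fun p => (f p)^-1).
  move=> mf; rewrite (_ : (fun p => _) = fun p => f p * `|f p| `^ (- 2)); last first.
    apply/funext => p; have [->|fp] := eqVneq (f p) 0; first by rewrite mul0r invr0.
    by rewrite powRN powR_mulrn// real_normK ?num_real// expr2 invfM mulrA divff// mul1r.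
  apply: mmul => //; apply: (mcomp (measurable_powR _)); exact: mcomp.
have mb : measurable [set p : ST | dotp b p.2 = 0].
  rewrite (_ : mkset _ = (fun p : ST => dotp b p.2) @^-1` [set 0]); last by apply/seteqP; split.
  rewrite -[X in measurable X]setTI; apply: (mcomp (measurable_dotp b) m2) => //.
(* Two base points cover all [z]: the origin when [dotp b z] is nonzero, and [b] otherwise, where
   [dotp b (b - z) = dotp b b]. *)
pose h n (p : ST) : R :=
  if p \in [set p : ST | dotp b p.2 = 0]
  then dd n.+1%:R b p / kp (n.+1%:R - p.1) (b - p.2)
  else dd n.+1%:R 0 p / kp (n.+1%:R - p.1) (0 - p.2).
have mh n : meas (h n).
  apply: measurable_fun_if => //.
  - apply: (measurable_fun_bool true).
    rewrite (_ : _ `&` _ = [set p : ST | dotp b p.2 = 0]) //.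
    apply/seteqP; split => p /=; first by move=> [_ /set_mem].
    by move=> h0; split => //; exact/mem_set.
  - by apply: measurable_funTS; apply: mmul; [exact: mdd|exact: mV].
  - by apply: measurable_funTS; apply: mmul; [exact: mdd|exact: mV].
have hE n p : h n p = oi 0 n.+1%:R p.1 * pwn q (u p.1 p.2).
  rewrite /h /dd; case: p => s z /=.
  have [/andP[s0 sn]|ns] := boolP ((0 < s) && (s < n.+1%:R)); last first.
    by rewrite /oi (negbTE ns) !mul0r if_same.
  rewrite oiT// !mul1r; have sn0 : 0 < n.+1%:R - s by rewrite subr_gt0.
  case: ifPn => [|].
    rewrite inE /= => bz; rewrite mulrC mulKf//; apply: kap_neq0 => //.
    by rewrite dotpBr bz subr0 dotpp_eq0.
  rewrite notin_setE /= => /eqP bz; rewrite mulrC mulKf//; apply: kap_neq0 => //.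
  by rewrite sub0r dotpNr oppr_eq0.
have mgg : meas (uncurry gg : ST -> R).
  apply: (@measurable_fun_cvg _ _ _ setT h) => //.
  move=> [s z] _; apply: cvg_near_cst; near=> n; rewrite hE /gg /= /oi.
  have -> : s < n.+1%:R; last by rewrite andbT.
  apply: lt_trans (_ : n%:R < _); last by rewrite ltr_nat.
  near: n; exact: nbhs_infty_gtr.
have E : uncurry ug = fun p => uncurry gg p * `|uncurry gg p| `^ (- (q / (1 + q))).
  apply/funext => -[s z]; rewrite /ug /gg /=.
  by case: (0 < s); rewrite ?mul0r// !mul1r pwnK.
rewrite E; apply: mmul => //.
apply: (mcomp (measurable_powR _)); exact: mcomp.
Unshelve. all: by end_near. Qed.

End unpack.

(** * Uniformity on compact time intervals *)

Section compactness.

Lemma Rint_norm_tri (f g : 'rV[R]_d -> R) : intg mu f -> intg mu g ->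
  \int[mu]_x `|f x| <= \int[mu]_x `|g x| + \int[mu]_x `|f x - g x|.
Proof.
move=> i j; rewrite -RintD; [|exact: intg_norm|exact/intg_norm/intgB].
apply: le_Rint; [exact: intg_norm|by apply: intgD; [exact: intg_norm|exact/intg_norm/intgB]|].
by move=> x; rewrite -{1}(subrK (g x) (f x)) addrC ler_normD.
Qed.

Lemma sol_L1_bounded a c : 0 <= a -> exists2 m : R, 0 <= m &
  forall s, a <= s <= c -> \int[mu]_x `|u s x| <= m.
Proof.
move=> a0; pose P (n : nat) s := \int[mu]_x `|u s x| <= n%:R.
have [|s /andP[as_ sc]|N HN] := @segment_near R a c P; last by exists N%:R.
  by move=> n m s nm /le_trans; apply; rewrite ler_nat.
have s0 : 0 <= s by exact: le_trans as_.
have [del del0 Hd] := sol_L1 s0 ltr01; exists del => //.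
pose A := \int[mu]_x `|u s x|; have A0 : 0 <= A by exact: Rint_ge0.
exists (Num.bound (A + 1)) => s' s's /andP[as' _]; have s'0 := le_trans a0 as'.
apply: (@le_trans _ _ (A + 1)); last by apply/ltW/archi_boundP; rewrite addr_ge0.
apply: le_trans (Rint_norm_tri (sol_intg s'0) (sol_intg s0)) _.
by rewrite lerD2l; exact: Hd.
Qed.

Lemma sol_bounded a c : 0 < a -> exists2 M : R, 0 < M &
  forall s, a <= s <= c -> {ae mu, forall x, `|u s x| <= M}.
Proof.
move=> a0; pose P (n : nat) s := {ae mu, forall x, `|u s x| <= n%:R}.
have [|s /andP[as_ sc]|N HN] := @segment_near R a c P.
- move=> n m s nm; apply: aeS => x /le_trans; apply.
  by rewrite ler_nat.
- have s0 : 0 < s by exact: lt_le_trans as_.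
  have [del del0 Hd] := sol_Linf s0 ltr01; exists del => //.
  have [M M0 HM] := sol_bd s0.
  exists (Num.bound (M + 1)) => s' s's /andP[as' _]; have s'0 := lt_le_trans a0 as'.
  have := Hd s' s'0 s's; apply: (aeS2 _ HM) => x h1 h2.
  apply: (@le_trans _ _ (M + 1)); last by apply/ltW/archi_boundP; rewrite addr_ge0// ltW.
  by rewrite -(subrK (u s x) (u s' x)) addrC (le_trans (ler_normD _ _))// lerD.
exists N.+1%:R => // s /HN; apply: aeS => x /le_trans; apply.
by rewrite ler_nat.
Qed.

Lemma sol_L1_unif a c e : 0 <= a -> 0 < e -> exists2 del : R, 0 < del &
  forall s s', a <= s <= c -> a <= s' <= c -> `|s - s'| <= del -> \int[mu]_x `|u s x - u s' x| <= e.
Proof.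
move=> a0 e0; pose P (n : nat) s := forall s', a <= s' <= c -> `|s - s'| <= n.+1%:R^-1 ->
  \int[mu]_x `|u s x - u s' x| <= e.
have [|s /andP[as_ sc]|N HN] := @segment_near R a c P; last by exists N.+1%:R^-1 => // s s' /HN; apply.
- move=> n m s nm H s' s'ac h; apply: H => //; apply: le_trans h _.
  by rewrite lef_pV2 ?posrE// ler_nat.
have s0 : 0 <= s by exact: le_trans as_.
have e20 : 0 < e / 2 by rewrite divr_gt0.
have [del del0 Hd] := sol_L1 s0 e20; exists (del / 2); first by rewrite divr_gt0.
have de : 0 <= (del / 2)^-1 by rewrite invr_ge0 divr_ge0// ltW.
exists (Num.bound (del / 2)^-1) => s1 s1s /andP[as1 _] s2 /andP[as2 _] s12.
have lt2 : `|s1 - s2| < del / 2.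
  apply: le_lt_trans s12 _; rewrite invf_plt ?posrE ?divr_gt0//.
  by apply: lt_trans (archi_boundP de) _; rewrite ltr_nat.
have s10 := le_trans a0 as1; have s20 := le_trans a0 as2.
have h1 : \int[mu]_x `|u s1 x - u s x| <= e / 2.
  by apply: Hd => //; apply: lt_trans s1s _; rewrite ltr_pdivrMr// ltr_pMr// ltr1n.
have h2 : \int[mu]_x `|u s2 x - u s x| <= e / 2.
  apply: Hd => //; rewrite -(subrK s1 s2) -addrA [del]splitr.
  by apply: le_lt_trans (ler_normD _ _) _; rewrite ltrD// distrC.
have i1 := sol_intg s10; have i2 := sol_intg s20; have i := sol_intg s0.
rewrite [e]splitr; apply: le_trans (lerD h1 h2).
rewrite -RintD; [|exact/intg_norm/intgB|exact/intg_norm/intgB].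
apply: le_Rint; [exact/intg_norm/intgB|by apply: intgD; exact/intg_norm/intgB|].
move=> x; rewrite -(subrK (u s x) (u s1 x)) -addrA.
by apply: le_trans (ler_normD _ _) _; rewrite (distrC (u s2 x)) subrK.
Qed.

End compactness.

Hypothesis iu0 : intg mu u0.

(** * Restarting the mild formula at a positive time *)

Section restart.
Local Notation LM := (leb \x mu)%E.
Local Notation LMs := (prodm (@lebesgue_measure R) (@lebesgue_rV R d)).
Local Notation gu := (fun s z => pwn q (ug s z)).
Implicit Types (s t tau : R) (x y z : 'rV[R]_d).

Let mug := measurable_ug.

Lemma ugE s z : 0 < s -> ug s z = u s z.
Proof. by move=> s0; rewrite /ug s0 mul1r. Qed.

Lemma measurable_gu : meas (uncurry gu : ST -> R).
Proof.
rewrite (_ : uncurry gu = pwn q \o uncurry (ug)); last by apply/funext => -[].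
exact: (mcomp (measurable_pwn q) mug).
Qed.

Lemma sol_pwn_bound s M : 0 < s -> {ae mu, forall x, `|u s x| <= M} ->
  intg mu (fun z => pwn q (u s z)) /\ \int[mu]_z `|pwn q (u s z)| <= M `^ q * \int[mu]_z `|u s z|.
Proof.
move=> s0 HM; have iu := sol_intg (ltW s0).
have mg : meas (fun z => pwn q (u s z)).
  exact: (mcomp (measurable_pwn q) (intg_meas iu)).
have iM := intgZl (M `^ q) (intg_norm iu).
have H : (n1 (fun z => pwn q (u s z)) <= n1 (fun z => M `^ q * `|u s z|)%R)%E.
  apply: n1_le; [exact: mg|exact: intg_meas iM|].
  apply: (aeS _ HM) => x; exact: norm_pwn_le.
have ig : intg mu (fun z => pwn q (u s z)).
  by apply: (n1_intg mg); apply: le_lt_trans H _; rewrite (intg_n1 iM) ltry.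
split => //; rewrite -RintZl; last exact: intg_norm.
rewrite -lee_fin -(intg_n1 ig); apply: le_trans H _; rewrite (intg_n1 iM) lee_fin.
apply: eq_leW; apply: eq_Rintegral => z _.
by rewrite ger0_norm// mulr_ge0 ?powR_ge0.
Qed.

Lemma sol_pwn_intg s : 0 < s -> intg mu (fun z => pwn q (u s z)).
Proof. by move=> s0; have [M _ HM] := sol_bd s0; have [] := sol_pwn_bound s0 HM. Qed.

Lemma sol_pwn_L1 a c : 0 < a -> exists2 m : R, 0 <= m &
  forall s, a <= s <= c -> \int[mu]_z `|pwn q (u s z)| <= m.
Proof.
move=> a0; have [M M0 HM] := sol_bounded c a0.
have [m m0 Hm] := sol_L1_bounded c (ltW a0).
exists (M `^ q * m); first by rewrite mulr_ge0 ?powR_ge0.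
move=> s sac; have s0 : 0 < s by case/andP: sac => /(lt_le_trans a0).
have [_ H] := sol_pwn_bound s0 (HM s sac); apply: le_trans H _.
by rewrite ler_wpM2l ?powR_ge0// Hm.
Qed.

Lemma intg_oi_gu a c (h : R -> R) : 0 < a -> intg leb (fun s => oi a c s * h s) -> (forall s, 0 <= h s) ->
  meas h ->
  intg LM (fun p => oi a c p.1 * h p.1 * `|gu p.1 p.2|).
Proof.
move=> a0 ih h0 mh; have [m m0 Hm] := sol_pwn_L1 c a0.
have m1 := meas_fst.
have mF : meas (uncurry (fun s z => oi a c s * h s * `|gu s z|) : ST -> R).
  rewrite (_ : uncurry _ = fun p : ST => oi a c p.1 * h p.1 * `|uncurry gu p|); last by apply/funext => -[].
  apply: mmul; last by apply: mcomp => //; exact: measurable_gu.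
  by apply: mmul; [exact: (mcomp (measurable_oi a c) m1)|exact: (mcomp mh m1)].
rewrite (_ : (fun p => _) = uncurry (fun s z => oi a c s * h s * `|gu s z|)); last by apply/funext => -[].
apply: (intg_prod mF).
have im := intgZl m ih.
apply: (@le_lt_trans _ _ (\int[leb]_s (m * (oi a c s * h s))%:E)%E); last by exact: intg_ltyr im.
apply: ge0_le_integral => //.
- by move=> s _; exact: inte_ge0.
- apply: (@measurable_inte _ _ _ _ _ mu (fun s z => `|oi a c s * h s * `|gu s z| |)) => //.
  rewrite (_ : uncurry _ = fun p => `|uncurry (fun s z => oi a c s * h s * `|gu s z|) p|); last by apply/funext => -[].
  exact: (mcomp (@normr_measurable R setT) mF).
- by case/integrableP: im.
move=> s _; have [/andP[as_ sc]|n] := boolP ((a < s) && (s < c)); last first.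
  rewrite /oi (negbTE n) mul0r mulr0; under eq_integral do rewrite mul0r normr0.
  by rewrite integral0.
have s0 : 0 < s by exact: lt_trans as_.
have -> : (\int[mu]_z `|oi a c s * h s * `|gu s z| |%:E)%E = (h s * \int[mu]_z `|pwn q (u s z)|)%:E.
  rewrite EFinM (EFin_Rint (intg_norm (sol_pwn_intg s0))) -inteZl//; last first.
    exact: intg_meas (intg_norm (sol_pwn_intg s0)).
  apply: eq_integral => z _; rewrite oiT// mul1r ger0_norm ?ugE//.
  by rewrite mulr_ge0.
by rewrite lee_fin oiT// mul1r mulrC ler_wpM2r// Hm// (ltW as_) ltW.
Qed.

Lemma conv_dq1 s f x : 0 < s -> intg mu f -> conv (dq 1 s) f x = conv (pt s) f (x - b) - conv (pt s) f x.
Proof.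
move=> s0 if_; have [K HK] := stk_bounded s0; have mk := measurable_stk s.
rewrite /conv -RintB; [|exact: (intg_conv_arg mk HK)|exact: (intg_conv_arg mk HK)].
apply: eq_Rintegral => y _; rewrite /dqk scale1r divr1 mulrBl; congr (pt s _ * _ - _).
by rewrite addrAC.
Qed.

Lemma dq1_kap_conv s r x z : 0 < s -> 0 < r ->
  \int[mu]_y (dq 1 s (x - y) * kp r (y - z)) = kp (s + r) (x - b - z) - kp (s + r) (x - z).
Proof.
move=> s0 r0; have [K HK] := stk_bounded s0; have mk := measurable_stk s.
have ik := intg_kap r0.
have mf : meas (fun y => dq 1 s (x - y) * kp r (y - z)).
  apply: mmul; first by apply: (mcomp (measurable_dqk 1 s)); exact: measurable_sub_rV.
  by apply: (mcomp (measurable_kap r)); exact: measurable_shift_rV.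
rewrite -(Rint_shift z mf) -!(stk_kap_conv _ s0 r0).
rewrite -RintB; [|exact: (intg_conv_arg mk HK)|exact: (intg_conv_arg mk HK)].
apply: eq_Rintegral => y _; rewrite addrK /dqk scale1r divr1 -mulrBl.
by congr ((pt s _ - pt s _) * _); apply/rowP => i; rewrite !mxE; ring.
Qed.

Section two_times.
Variables (tau t : R).
Hypotheses (tau0 : 0 < tau) (taut : tau < t).
Let t0 : 0 < t := lt_trans tau0 taut.
Let sg0 : 0 < t - tau. Proof. by rewrite subr_gt0. Qed.

Let Phi r y (p : R * 'rV[R]_d) := oi 0 r p.1 * (kp (r - p.1) (y - p.2) * gu p.1 p.2).

Let PhiE r y : Phi r y = fun p => oi 0 r p.1 * (kp (r - p.1) (y - p.2) * pwn q (u p.1 p.2)).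
Proof. by apply/funext => -[s z]; apply: oi_eq => /= s0 _; rewrite ugE. Qed.

Let iPhi r y : 0 < r -> intg LM (Phi r y).
Proof. by move=> r0; rewrite PhiE; have [] := sol_mild y r0. Qed.

Let uPhi r y : 0 < r -> u r y = conv (pt r) u0 y + \int[LM]_p Phi r y p.
Proof.
move=> r0; have [_ ->] := sol_mild y r0; congr (_ + _).
have H : intg LM (uncurry (fun s z => Phi r y (s, z))) by rewrite (_ : uncurry _ = Phi r y); [exact: iPhi|apply/funext => -[]].
transitivity (\int[LM]_p Phi r y (p.1, p.2)); last by apply: eq_Rintegral => -[].
rewrite -(Rfubini1 H); apply: eq_Rintegral => s _; rewrite /Phi /= /oi.
have [/andP[s0 sr]|n] := boolP ((0 < s) && (s < r)); last first.
  by rewrite mul0r; under eq_Rintegral do rewrite mul0r; rewrite Rint0.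
by rewrite mul1r; apply: eq_Rintegral => z _; rewrite mul1r ugE.
Qed.

Let Psi x (p : ST) y := dq 1 (t - tau) (x - y) * Phi tau y p.

Let mPsi x : meas (uncurry (Psi x)).
Proof.
rewrite (_ : uncurry (Psi x) = fun w => dq 1 (t - tau) (x - w.2) * (oi 0 tau w.1.1 * (kp (tau - w.1.1) (w.2 - w.1.2) * gu w.1.1 w.1.2))); last by apply/funext => -[].
pose X := (ST)%type; pose Y := 'rV[R]_d.
have m1 : meas (fun w : X * Y => w.1) by exact: measurable_fst.
have m2 : meas (fun w : X * Y => w.2) by exact: measurable_snd.
have m11 : meas (fun w : X * Y => (w.1.1 : R)) by exact: (mcomp (@measurable_fst _ _ (measurableTypeR R) 'rV[R]_d) m1).
have m12 : meas (fun w : X * Y => w.1.2) by exact: (mcomp (@measurable_snd _ _ (measurableTypeR R) 'rV[R]_d) m1).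
have m3 : meas (fun w : X * Y => w.2 - w.1.2) by exact: measurable_funB_rV.
have m4 : meas (fun w : X * Y => x - w.2) by apply: measurable_funB_rV => //; exact: measurable_cst.
have m5 : meas (fun w : X * Y => tau - w.1.1) by exact: measurable_funB.
apply: mmul; first exact: (mcomp (measurable_dqk 1 (t - tau)) m4).
apply: mmul; first exact: (mcomp (measurable_oi 0 tau) m11).
apply: mmul.
  exact: (@measurable_comp_kernel _ (X * Y)%type kp (fun w => tau - w.1.1) (fun w => w.2 - w.1.2) (measurable_kap2) m5 m3).
rewrite (_ : (fun w : X * Y => _) = fun w => uncurry gu w.1); last by apply/funext => -[[]].
exact: (mcomp measurable_gu m1).
Qed.

(** The domination behind Fubini. For [s > tau / 2] the L^1 bound on [u^(1+q)] away from time 0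
    suffices ([Hb]). For [s <= tau / 2], where no such bound is at hand, the difference quotient and
    [kap] are replaced by weights: [wt_conv] integrates the intermediate variable, and [wt_split]
    leads back to the Duhamel integrands at [x + b] and [x - b], integrable by hypothesis ([Ha]). *)
Let bnd x : exists2 H : ST -> R, intg LM H &
  forall p, (\int[mu]_y `|Psi x p y|%:E <= (H p)%:E)%E.
Proof.
have h0 : 0 < tau / 2 by rewrite divr_gt0.
have h1 : tau / 2 <= tau by rewrite ler_pdivrMr// ler_peMr ?ler1n// ltW.
have [C1 C10 H1] := kap_wt h0 h1.
have [C2 C20 H2] := dqk1_wt sg0.
have [C3 C30 H3] := wt_conv.
have [C4 C40 H4] := wt_split b0 h0 h1.
have [K HK] := dqk_bounded 1 sg0.
have K0 : 0 <= K by exact: le_trans (normr_ge0 _) (HK 0).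
have [C5 C50 H5] := kap_L1.
pose A := C2 * (C1 * (C3 * (C4 * 2))).
have A0 : 0 <= A by rewrite /A ltW// !mulr_gt0.
pose Ha (p : ST) := A * (`|Phi tau (x + b) p| + `|Phi tau (x - b) p|).
pose Hb (p : ST) := oi (tau / 2) tau p.1 * (K * C5 * (tau - p.1) `^ (- alpha^-1)) * `|gu p.1 p.2|.
exists (fun p => Ha p + Hb p).
  apply: intgD; first by apply/intgZl/intgD; exact/intg_norm/iPhi.
  have a01 : 0 <= alpha^-1 < 1 by have /andP[/ltW -> ->] := ai01.
  have [Ka Ka0 HKa] := inte_oipow_rev a01.
  have mp : meas (fun s => (tau - s) `^ (- alpha^-1)).
    by apply: (mcomp (measurable_powR _)); exact: measurable_funB.
  have i1 : intg leb (fun s => oi (tau / 2) tau s * (tau - s) `^ (- alpha^-1)).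
    apply: intgP; first exact: measurable_oipow_rev.
    under eq_integral => s _ do rewrite ger0_norm ?mulr_ge0 ?oi_ge0 ?powR_ge0//.
    have h2 : tau / 2 < tau by rewrite ltr_pdivrMr// ltr_pMr// ltr1n.
    exact: le_lt_trans (HKa _ _ h2) (ltry _).
  apply: (@intg_oi_gu _ _ (fun s => K * C5 * (tau - s) `^ (- alpha^-1))) => //.
  - rewrite (_ : (fun s => _) = fun s => K * C5 * (oi (tau / 2) tau s * (tau - s) `^ (- alpha^-1))); first exact: intgZl.
    by apply/funext => s; ring.
  - by move=> s; rewrite mulr_ge0 ?powR_ge0// mulr_ge0// ltW.
  - exact: mmul.
move=> [s z]; have Ha0 : 0 <= Ha (s, z) by rewrite mulr_ge0// addr_ge0.
have Hb0 : 0 <= Hb (s, z).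
  by rewrite !mulr_ge0 ?oi_ge0 ?powR_ge0// ltW.
have [/andP[s0 st]|n] := boolP ((0 < s) && (s < tau)); last first.
  rewrite (_ : (\int[mu]_y _)%E = 0%E) ?lee_fin ?addr_ge0//.
  by rewrite /Psi /Phi /oi /= (negbTE n); under eq_integral do rewrite mul0r mulr0 normr0; rewrite integral0.
have ts0 : 0 < tau - s by rewrite subr_gt0.
have mk : meas (fun y => `|dq 1 (t - tau) (x - y)| * `|kp (tau - s) (y - z)|).
  apply: mmul; apply: mcomp => //.
    by apply: (mcomp (measurable_dqk 1 (t - tau))); exact: measurable_sub_rV.
  by apply: (mcomp (measurable_kap (tau - s))); exact: measurable_shift_rV.
have -> : (\int[mu]_y `|Psi x (s, z) y|%:E)%E =
    ((`|gu s z|)%:E * \int[mu]_y (`|dq 1 (t - tau) (x - y)| * `|kp (tau - s) (y - z)|)%:E)%E.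
  rewrite -inteZl//.
  apply: eq_integral => y _; rewrite /Psi /Phi /= oiT// mul1r (normrM (dq 1 (t - tau) (x - y))) (normrM (kp (tau - s) (y - z))).
  by move: (`|dq _ _ _|) (`|kp _ _|) (`|pwn _ _|) => *; congr (_%:E); ring.
have [s2|s2] := leP s (tau / 2).
  have r1 : tau / 2 <= tau - s by lra.
  have r2 : tau - s <= tau by lra.
  have e1 y : `|dq 1 (t - tau) (x - y)| * `|kp (tau - s) (y - z)| <=
      C2 * (C1 * (C3 * wt (x - z))) * (pt 1 (x - y) + pt 1 (y - z)).
    apply: (@le_trans _ _ (C2 * wt (x - y) * (C1 * wt (y - z)))).
      by apply: ler_pM => //; have [] := H1 _ (y - z) r1 r2.
    have := H3 (x - z) (y - z); rewrite (_ : x - z - (y - z) = x - y); last by rewrite opprB addrA subrK.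
    move=> h; rewrite mulrACA.
    rewrite [leRHS](_ : _ = C2 * C1 * (C3 * wt (x - z) * (pt 1 (x - y) + pt 1 (y - z)))); last by ring.
    by rewrite ler_wpM2l// mulr_ge0// ltW.
  have mp1 : meas (fun y => pt 1 (x - y)).
    by apply: (mcomp (measurable_stk 1)); exact: measurable_sub_rV.
  have mp2 : meas (fun y => pt 1 (y - z)).
    by apply: (mcomp (measurable_stk 1)); exact: measurable_shift_rV.
  have Q0 : 0 <= C2 * (C1 * (C3 * wt (x - z))).
    by apply/ltW/mulr_gt0 => //; apply: mulr_gt0 => //; apply: mulr_gt0 => //; exact: wt_gt0.
  have I1 : (\int[mu]_y (`|dq 1 (t - tau) (x - y)| * `|kp (tau - s) (y - z)|)%:E <=
      (C2 * (C1 * (C3 * wt (x - z))) * 2)%:E)%E.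
    apply: (@le_trans _ _ (\int[mu]_y (C2 * (C1 * (C3 * wt (x - z))) * (pt 1 (x - y) + pt 1 (y - z)))%:E)%E).
      by apply: le_inte => //; apply: mmul => //; exact: measurable_funD.
    rewrite inteZl//; [|exact: measurable_funD|by move=> y; rewrite addr_ge0 ?stk_ge0].
    rewrite inteD//; [|by move=> y; exact: stk_ge0|by move=> y; exact: stk_ge0].
    have ms := measurable_stk 1; have ps y := stk_ge0 y (@ltr01 R).
    rewrite (inte_sub x ms ps) (inte_shift (- z) ms ps) inte_stk// -EFinD -EFinM lee_fin.
  apply: (@le_trans _ _ (Ha (s, z))%:E); last by rewrite lee_fin lerDl.
  apply: le_trans (lee_wpmul2l _ I1) _; first by rewrite lee_fin.
  have := H4 (tau - s) (x - z) r1 r2 => h.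
  rewrite -EFinM lee_fin /Ha /Phi /= !oi_norm oiT// !mul1r (normrM (kp (tau - s) (x + b - z))) (normrM (kp (tau - s) (x - b - z))) -mulrDl.
  rewrite [leLHS](_ : _ = (C2 * (C1 * C3)) * 2 * `|gu s z| * wt (x - z)); last by ring.
  rewrite [leRHS](_ : _ = (C2 * (C1 * C3)) * 2 * `|gu s z| * (C4 * (`|kp (tau - s) (x + b - z)| + `|kp (tau - s) (x - b - z)|))); last by rewrite /A; ring.
  rewrite ler_wpM2l//; first by rewrite !mulr_ge0 ?(ltW C10) ?(ltW C20) ?(ltW C30).
  by move: h; rewrite addrAC (addrAC x (- z) (- b)).
apply: (@le_trans _ _ (Hb (s, z))%:E); last by rewrite lee_fin lerDr.
have ik := intg_norm (intg_kap ts0).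
have I2 : (\int[mu]_y (`|dq 1 (t - tau) (x - y)| * `|kp (tau - s) (y - z)|)%:E <=
    (K * (C5 * rt (tau - s)))%:E)%E.
  apply: (@le_trans _ _ (\int[mu]_y (K * `|kp (tau - s) (y - z)|)%:E)%E).
    apply: le_inte => //.
    - exact: intg_meas (intgZl K (intg_shift (- z) ik)).
    - by move=> y; rewrite ler_wpM2r.
  rewrite inteZl//; last exact: intg_meas (intg_shift (- z) ik).
  rewrite (inte_shift (- z) (f := fun y => `|kp (tau - s) y|))//; last exact: intg_meas ik.
  by rewrite -EFin_Rint// -EFinM lee_fin ler_wpM2l// H5.
apply: le_trans (lee_wpmul2l _ I2) _; first by rewrite lee_fin.
rewrite -EFinM lee_fin /Hb /= oiT// /rs; apply: eq_leW.
by move: (`|pwn _ _|) (_ `^ _) => *; ring.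
Qed.

Let iPsi x : intg (LMs \x mu)%E (uncurry (Psi x)).
Proof.
apply: (intg_prod (mPsi x)); have [H iH HH] := bnd x.
apply: (@le_lt_trans _ _ (\int[LM]_p (H p)%:E)%E); last exact: intg_ltyr iH.
apply: ge0_le_integral => //.
- by move=> p _; exact: inte_ge0.
- apply: (@measurable_inte _ _ _ _ _ mu (fun p y => `|Psi x p y|)) => //.
  rewrite (_ : uncurry _ = fun w => `|uncurry (Psi x) w|); last by apply/funext => -[].
  exact: (mcomp (@normr_measurable R setT) (mPsi x)).
- by case/integrableP: iH.
Qed.

Local Notation Kc s x := (conv (kp (t - s)) (fun z => pwn q (u s z)) x).

(** The difference quotient is applied to the formula at time [tau]; [bnd] allows the exchange of
    integrals, and the semigroup law carries each lag from [tau - s] to [t - s]. *)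
Lemma restart_dq x : conv (dq 1 (t - tau)) (u tau) x =
  conv (dq 1 t) u0 x + \int[leb]_s (oi 0 tau s * (Kc s (x - b) - Kc s x)).
Proof.
have [K HK] := dqk_bounded 1 sg0; have mk := measurable_dqk 1 (t - tau).
have iA : intg mu (conv (pt tau) u0) by apply: intg_conv => //; exact: intg_stk.
pose I y := \int[LM]_p Phi tau y p.
have uE y : u tau y = conv (pt tau) u0 y + I y by exact: uPhi.
have iI : intg mu I.
  rewrite (_ : I = fun y => u tau y - conv (pt tau) u0 y); last by apply/funext => y; rewrite uE; ring.
  by apply: intgB => //; exact: (sol_intg (ltW tau0)).
rewrite (_ : u tau = fun y => conv (pt tau) u0 y + I y); last exact/funext.
rewrite (convD mk HK x iA iI); congr (_ + _).
  have [K' HK'] := stk_bounded sg0.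
  rewrite conv_dq1// (conv_stk_stk _ sg0 tau0 iu0) (conv_stk_stk _ sg0 tau0 iu0).
  by rewrite subrK conv_dq1.
transitivity (\int[mu]_y \int[LM]_p Psi x p y).
  by apply: eq_Rintegral => y _; rewrite RintZl//; exact: iPhi.
rewrite -(Rfubini (iPsi x)).
have H := intg_fubiniF (iPsi x).
pose J s z := \int[mu]_y Psi x (s, z) y.
have HJ : intg LM (uncurry J) by rewrite (_ : uncurry J = fun p => \int[mu]_y Psi x p y); [exact: H|apply/funext => -[]].
transitivity (\int[LM]_p J p.1 p.2); first by apply: eq_Rintegral => -[].
rewrite -(Rfubini1 HJ); apply: eq_Rintegral => s _; rewrite /J /Psi /Phi /=.
have [/andP[s0 st]|n] := boolP ((0 < s) && (s < tau)); last first.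
  rewrite /oi (negbTE n) mul0r.
  by under eq_Rintegral => z _ do under eq_Rintegral do rewrite mul0r mulr0; rewrite -[RHS](@Rint0 _ _ R mu); apply: eq_Rintegral => z _; rewrite Rint0.
have ts0 : 0 < tau - s by rewrite subr_gt0.
have tts0 : 0 < t - s by rewrite subr_gt0 (lt_trans st).
rewrite oiT// mul1r /conv.
have [K2 HK2] := kap_bounded tts0; have mk2 := measurable_kap (t - s).
have ig := sol_pwn_intg s0.
rewrite -RintB; [|exact: (intg_conv_arg mk2 HK2)|exact: (intg_conv_arg mk2 HK2)].
apply: eq_Rintegral => z _; rewrite -mulrBl -(_ : t - tau + (tau - s) = t - s); last by rewrite addrA subrK.
rewrite -(dq1_kap_conv x z sg0 ts0) ugE// -RintZr.
  by apply: eq_Rintegral => y _; rewrite mul1r mulrA.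
have [Kb HKb] := dqk_bounded 1 sg0.
apply: (intgMl (M := Kb)).
- by apply: (mcomp mk); exact: measurable_sub_rV.
- by move=> y; exact: HKb.
- exact: (intg_shift (- z) (intg_kap ts0)).
Qed.

Let rem x := u t x - (conv (pt (t - tau)) (u tau) x + \int[leb]_s (oi tau t s * Kc s x)).

Let iKc x : intg leb (fun s => oi 0 t s * Kc s x).
Proof.
have H : intg LM (uncurry (fun s z => Phi t x (s, z))) by rewrite (_ : uncurry _ = Phi t x); [exact: iPhi|apply/funext => -[]].
have := intg_fubiniF H; rewrite (_ : (fun s => \int[mu]_z _) = fun s => oi 0 t s * Kc s x)//.
apply/funext => s; rewrite /Phi /= /oi.
have [/andP[s0 sr]|n] := boolP ((0 < s) && (s < t)); last first.
  by rewrite mul0r; under eq_Rintegral do rewrite mul0r; rewrite Rint0.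
by rewrite mul1r; apply: eq_Rintegral => z _; rewrite mul1r ugE.
Qed.

Let rem_periodic x : rem (x - b) = rem x.
Proof.
have lin (a1 a2 a3 a4 a5 a6 D c1 c2 c3 c4 : R) : a1 = a2 - a3 -> a4 = a5 - a6 -> a1 = a4 + D -> D = c1 - c2 ->
    a5 + (c1 + c3) - (a2 + c3) = a6 + (c2 + c4) - (a3 + c4).
  by move=> *; lra.
have iut := sol_intg (ltW tau0).
have E1 := conv_dq1 x sg0 iut; have E2 := conv_dq1 x t0 iu0; have E3 := restart_dq x.
have ii y : intg leb (fun s => oi tau t s * Kc s y) /\ intg leb (fun s => oi 0 tau s * Kc s y).
  split; [apply: intg_oi_sub (iKc y) => //; exact: ltW|].
  by apply: intg_oi_sub (iKc y) => //; exact: ltW.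
have split y : \int[leb]_s (oi 0 t s * Kc s y) = \int[leb]_s (oi 0 tau s * Kc s y) + \int[leb]_s (oi tau t s * Kc s y).
  have [i1 i2] := ii y; rewrite -RintD//; apply: ae_eq_Rint; [exact: intg_meas (iKc y)|exact: intg_meas (intgD i2 i1)|].
  exists [set tau]; split; [exact: measurable_set1|exact: lebesgue_measure_set1|].
  move=> s /=; apply: contra_notP => /eqP sa; rewrite -mulrDl; congr (_ * _); rewrite /oi.
  case: (ltgtP s tau) sa => // h _.
    by rewrite (lt_trans h taut) !andbT /= addr0.
  by rewrite (lt_trans tau0 h) /= add0r.
have uE y : u t y = conv (pt t) u0 y + (\int[leb]_s (oi 0 tau s * Kc s y) + \int[leb]_s (oi tau t s * Kc s y)).
  by have [_ ->] := sol_mild y t0; rewrite split.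
have E4 : \int[leb]_s (oi 0 tau s * (Kc s (x - b) - Kc s x)) =
    \int[leb]_s (oi 0 tau s * Kc s (x - b)) - \int[leb]_s (oi 0 tau s * Kc s x).
  have [_ i1] := ii (x - b); have [_ i2] := ii x; apply: etrans (RintB i1 i2).
  by apply: eq_Rintegral => s _; rewrite mulrBr.
by rewrite /rem !uE; exact: (lin _ _ _ _ _ _ _ _ _ _ _ E1 E2 E3 E4).
Qed.

Let intg_rem : intg mu rem.
Proof.
have iut := sol_intg (ltW tau0); have iuu := sol_intg (ltW t0).
apply: intgB => //; apply: intgD; first by apply: intg_conv => //; exact: intg_stk.
pose phi s x := oi tau t s * conv (kp (t - s)) (gu s) x.
rewrite (_ : (fun x => _) = fun x => \int[leb]_s phi s x); last first.
  apply/funext => x; apply: eq_Rintegral => s _; apply: oi_eq => l1 l2.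
  by apply: eq_Rintegral => z _; rewrite ugE// (lt_trans tau0).
have m1 := meas_fst.
have m2 := meas_snd.
have m3 : meas (fun p : ST => t - (p.1 : R)) by exact: measurable_funB.
have mphi : meas (uncurry phi : ST -> R).
  rewrite (_ : uncurry phi = fun p : ST => oi tau t p.1 * conv (kp (t - p.1)) (gu p.1) p.2); last by apply/funext => -[].
  apply: mmul; first exact: (mcomp (measurable_oi tau t) m1).
  have := @measurable_conv2 R d _ (measurableTypeR R) (fun s => kp (t - s)) gu; apply; last exact: measurable_gu.
  rewrite (_ : uncurry _ = fun p : ST => kp (t - p.1) p.2); last by apply/funext => -[].
  exact: (@measurable_comp_kernel _ (ST)%type kp (fun p => t - (p.1 : R)) (fun p => p.2) (measurable_kap2) m3 m2).
have mI : meas (fun x => \int[leb]_s phi s x).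
  apply: measurable_Rint; rewrite (_ : uncurry _ = uncurry phi \o (fun p => (p.2, p.1))); last by apply/funext => -[].
  by apply: (mcomp mphi); apply: measurable_fun_pair.
apply: (n1_intg mI); apply: le_lt_trans (n1_Rint leb mphi) _.
have [m mm0 Hm] := sol_pwn_L1 t tau0; have [C C0 HC] := kap_L1.
have a01 : 0 <= alpha^-1 < 1 by have /andP[/ltW -> ->] := ai01.
have [K K0 HK] := inte_oipow_rev a01.
have i1 : intg leb (fun s => oi tau t s * (t - s) `^ (- alpha^-1)).
  apply: intgP; first exact: measurable_oipow_rev.
  under eq_integral => s _ do rewrite ger0_norm ?mulr_ge0 ?oi_ge0 ?powR_ge0//.
  exact: le_lt_trans (HK _ _ taut) (ltry _).
have i2 := intgZl (C * m) i1.
apply: (@le_lt_trans _ _ (\int[leb]_s (C * m * (oi tau t s * (t - s) `^ (- alpha^-1)))%:E)%E); last exact: intg_ltyr i2.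
apply: ge0_le_integral => //.
- by move=> s _; exact: n1_ge0.
- apply: (@measurable_inte _ _ _ _ _ mu (fun s z => `|phi s z|)) => //.
  rewrite (_ : uncurry _ = fun p => `|uncurry phi p|); last by apply/funext => -[].
  exact: (mcomp (@normr_measurable R setT) mphi).
- by case/integrableP: i2.
move=> s _; have [/andP[ls st]|n] := boolP ((tau < s) && (s < t)); last first.
  rewrite /phi /n1 /oi (negbTE n) mul0r mulr0; under eq_integral do rewrite mul0r normr0.
  by rewrite integral0.
have s0 : 0 < s by exact: lt_trans ls.
have ts0 : 0 < t - s by rewrite subr_gt0.
have ik := intg_kap ts0; have ig := sol_pwn_intg s0.
have -> : phi s = conv (kp (t - s)) (fun z => pwn q (u s z)).
  by apply/funext => x; rewrite /phi oiT// mul1r; apply: eq_Rintegral => z _; rewrite ugE.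
apply: le_trans (n1_conv (intg_meas ik) (intg_meas ig)) _.
rewrite !intg_n1// -EFinM lee_fin oiT// mul1r mulrAC; apply: ler_pM.
- exact: Rint_ge0.
- exact: Rint_ge0.
- exact: HC.
- by apply: Hm; rewrite (ltW ls) ltW.
Qed.

(** After differencing along [b] the restarted formula is exact, so its defect [rem] is
    [b]-periodic; being integrable, it vanishes almost everywhere. *)
Lemma restart : {ae mu, forall x, u t x = conv (pt (t - tau)) (u tau) x +
  \int[leb]_s (oi tau t s * conv (kp (t - s)) (fun z => pwn q (u s z)) x)}.
Proof.
have := periodic_eq0 b0 intg_rem rem_periodic.
apply: aeS => x /eqP.
by rewrite subr_eq0 => /eqP.
Qed.

End two_times.
End restart.

(** * From the scheme to the solution *)

Section window.
Local Notation gu := (fun s z => pwn q (ug s z)).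

Lemma measurable_duh a t x : meas (fun s : R => oi a t s * conv (kp (t - s)) (gu s) x).
Proof.
have m1 := meas_fst.
have m2 := meas_snd.
have m3 : meas (fun p : ST => t - (p.1 : R)) by exact: measurable_funB.
apply: mmul; first exact: measurable_oi.
have H : meas (fun p : ST => conv (kp (t - p.1)) (gu p.1) p.2).
  have := @measurable_conv2 R d _ (measurableTypeR R) (fun s => kp (t - s)) gu; apply; last exact: (measurable_gu).
  rewrite (_ : uncurry _ = fun p : ST => kp (t - p.1) p.2); last by apply/funext => -[].
  exact: (@measurable_comp_kernel _ (ST)%type kp (fun p => t - (p.1 : R)) (fun p => p.2) (measurable_kap2) m3 m2).
have H' : meas (uncurry (fun (s : measurableTypeR R) z => conv (kp (t - s)) (gu s) z)).
  by rewrite (_ : uncurry _ = fun p : ST => conv (kp (t - p.1)) (gu p.1) p.2)//; apply/funext => -[].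
exact: (measurable_uncurry2 x H').
Qed.

Variables (tau t : R).
Hypotheses (tau0 : 0 < tau) (taut : tau < t).

(** Stated for any measurable version [v] of the solution: [ug] serves for mass and positive parts,
    and a version clipped to be nonnegative and bounded everywhere serves for the L^2 bound. *)
Lemma window_cvg (v : R -> 'rV[R]_d -> R) :
  meas (uncurry v : ST -> R) ->
  (forall r, 0 <= r <= t - tau -> {ae mu, forall x, v r x = u (tau + r) x}) ->
  exists (F : R -> R) (L lam : R), [/\ F 0 = 0, forall u v : R, u <= v -> F u <= F v,
    forall u v : R, u <= v -> F v - F u <= L * (v - u), 0 < lam /\ lam * L <= 1 &
    forall e, 0 < e -> exists N : nat, forall n, (N <= n)%N ->
      \int[mu]_x `|itr F v lam ((t - tau) / n.+1%:R) n.+1 x - u t x| <= e].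
Proof.
move=> mv vE; set T := t - tau; have T0 : 0 < T by rewrite subr_gt0.
have [M M0 HM] := sol_bounded t tau0.
have [L [B [F0 F_mono F_lip F_bnd]]] := tpw_facts q0 M0.
(* [tpw_facts] does not give the sign of [L]; with [|L| + 1] the CFL condition holds and [lam] is
   positive. *)
pose lam := (`|L| + 1)^-1; have L1 : 0 < `|L| + 1 by rewrite ltr_wpDl.
have lam0 : 0 < lam by rewrite invr_gt0.
have lamL : lam * L <= 1.
  by rewrite mulrC ler_pdivrMr// mul1r; have := ler_norm L; lra.
exists (tpw q M), L, lam; split => // e e0.
have rT r : 0 <= r <= T -> tau <= tau + r <= t.
  by move=> /andP[r0 rT]; rewrite lerDl r0 -lerBrDl.
have tr r : 0 <= r <= T -> 0 <= tau + r by move=> /rT/andP[+ _]; exact: le_trans (ltW tau0).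
have iu r (h : 0 <= r <= T) := sol_intg (tr r h).
have vE' r : 0 <= r <= T -> {ae mu, forall x, u (tau + r) x = v r x}.
  by move=> /vE; apply: aeS => x ->.
have iv r : 0 <= r <= T -> intg mu (v r).
  by move=> h; apply: ae_intg (vE' r h) (iu r h); exact: measurable_uncurry1 mv.
have [m m0 Hm] := sol_L1_bounded t (ltW tau0).
have vm r : 0 <= r <= T -> \int[mu]_x `|v r x| <= m.
  by move=> h; rewrite (ae_eq_Rint_norm (iv r h) (iu r h) (vE r h)); apply: Hm; exact: rT.
have cv e' : 0 < e' -> exists2 del : R, 0 < del & forall r r', 0 <= r <= T -> 0 <= r' <= T ->
     `|r - r'| <= del -> \int[mu]_x `|v r x - v r' x| <= e'.
  move=> e'0; have [del del0 Hd] := sol_L1_unif t (ltW tau0) e'0; exists del => // r r' h h' rr.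
  rewrite (ae_eq_Rint_norm (intgB (iv r h) (iv r' h')) (intgB (iu r h) (iu r' h'))); last first.
    by have := vE' r' h'; apply: (aeS2 _ (vE' r h)) => x -> ->.
  by apply: Hd; rewrite ?rT// opprD addrACA subrr add0r.
have h0 : (0 : R) <= 0 <= T by rewrite lexx ltW.
have mild r : 0 < r <= T -> {ae mu, forall x, v r x = conv (pt r) (v 0) x +
     \int[leb]_s (oi 0 r s * conv (kp (r - s)) (fun z => tpw q M (v s z)) x)}.
  move=> /andP[r0 rT']; have h : 0 <= r <= T by rewrite ltW.
  have tt : tau < tau + r by rewrite ltrDl.
  have := restart tau0 tt.
  apply: (aeS2 _ (vE r h)) => x -> ->.
  have E1 : conv (pt (tau + r - tau)) (u tau) x = conv (pt r) (v 0) x.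
    rewrite addrAC subrr add0r; apply: conv_ae; [exact: measurable_stk|exact: intg_meas (sol_intg (ltW tau0))|exact: intg_meas (iv 0 h0)|].
    by have := vE' 0 h0; rewrite addr0.
  have E2 : \int[leb]_s (oi tau (tau + r) s * conv (kp (tau + r - s)) (fun z => pwn q (u s z)) x) =
      \int[leb]_s (oi 0 r s * conv (kp (r - s)) (fun z => tpw q M (v s z)) x).
    transitivity (\int[leb]_s (oi tau (tau + r) s * conv (kp (tau + r - s)) (gu s) x)).
      apply: eq_Rintegral => s _; apply: oi_eq => l1 l2.
      by apply: eq_Rintegral => z _; rewrite ugE// (lt_trans tau0).
    apply: etrans (esym (Rint_shift1 tau (measurable_duh tau (tau + r) x))) _.
    apply: eq_Rintegral => s _.
    have -> : oi tau (tau + r) (tau + s) = oi 0 r s by rewrite /oi ltrDl ltrD2l.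
    apply: oi_eq => s0 sr; have -> : tau + r - (tau + s) = r - s by ring.
    have hs : 0 <= s <= T by rewrite ltW//= ltW// (lt_le_trans sr).
    have ts : 0 < tau + s by rewrite addr_gt0.
    have mgs : meas (gu (tau + s)).
      exact: measurable_uncurry1 (measurable_gu).
    apply: conv_ae; [exact: measurable_kap|exact: mgs| |].
      by apply: (mcomp (F_measurable F_mono)); exact: measurable_uncurry1 mv.
    have := HM _ (rT s hs); apply: (aeS2 _ (vE s hs)) => z -> hz.
    by rewrite ugE// tpwE.
  exact: (f_equal2 (fun a c : R => a + c) E1 E2).
have [N HN] := scheme_cvg F0 F_mono F_lip F_bnd T0 lam0 mv iv vm cv mild e0.
exists N => n Nn; apply: le_trans (HN n Nn).
have hT : 0 <= T <= T by rewrite lexx ltW.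
have k0 : 0 < T / n.+1%:R by rewrite divr_gt0.
have ii : intg mu (itr (tpw q M) v lam (T / n.+1%:R) n.+1).
  exact: (intg_itr F0 F_mono F_lip lam T0 iv).
have uT : u t = u (tau + T) by congr u; rewrite /T addrC subrK.
rewrite uT (ae_eq_Rint_norm (intgB ii (iu T hT)) (intgB ii (iv T hT)))//.
by apply: (aeS _ (vE' T hT)) => x ->.
Qed.

Let vv r := ug (tau + r).

Let mvv : meas (uncurry vv : ST -> R).
Proof.
have H : meas (fun p : ST => (tau + p.1 : measurableTypeR R, p.2)).
  by apply: measurable_fun_pair => //; apply: measurable_funD => //; exact: measurable_fst.
rewrite (_ : uncurry vv = uncurry (ug) \o (fun p : ST => (tau + p.1 : measurableTypeR R, p.2))).
  exact: (mcomp (measurable_ug) H).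
by apply/funext => -[].
Qed.

Let vvE r : 0 <= r -> vv r = u (tau + r).
Proof. by move=> r0; apply/funext => x; rewrite /vv ugE// ltr_wpDr. Qed.

Let vvE' r : 0 <= r <= t - tau -> {ae mu, forall x, vv r x = u (tau + r) x}.
Proof. by move=> /andP[r0 _]; apply: nearW => x; rewrite vvE. Qed.

Let vv0 : vv 0 = u tau. Proof. by rewrite vvE// addr0. Qed.

Let ivv0 : intg mu (vv 0). Proof. by rewrite vv0; exact: (sol_intg (ltW tau0)). Qed.

Let iut : intg mu (u t). Proof. exact: (sol_intg (ltW (lt_trans tau0 taut))). Qed.

Let k0 (n : nat) : 0 < (t - tau) / n.+1%:R. Proof. by rewrite divr_gt0// subr_gt0. Qed.

Lemma sol_posp c : 0 <= c -> \int[mu]_x posp c (u t x) <= \int[mu]_x posp c (u tau x).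
Proof.
move=> c0; have [F [L [lam [F0 F_mono F_lip [lam0 lamL] cvg]]]] := window_cvg mvv vvE'.
apply/ler_addgt0Pr => e e0; have [N HN] := cvg _ e0.
have i1 : intg mu (itr F vv lam ((t - tau) / N.+1%:R) N.+1).
  elim: {2}N.+1 => [|j IH]; first exact: ivv0.
  exact: (intg_stp F0 F_mono F_lip lam (k0 N) IH).
apply: le_trans (Rint_posp_lip c0 iut i1) _; apply: lerD.
  by rewrite -vv0; exact: (itr_posp F0 F_mono F_lip lam0 lamL ivv0).
apply: le_trans (HN N (leqnn N)); apply: eq_leW.
by apply: eq_Rintegral => x _; rewrite distrC.
Qed.

Lemma sol_mass_step : \int[mu]_x u t x = \int[mu]_x u tau x.
Proof.
have [F [L [lam [F0 F_mono F_lip [lam0 lamL] cvg]]]] := window_cvg mvv vvE'.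
apply/eqP; rewrite -subr_eq0 -normr_le0; apply/ler_addgt0Pr => e e0; have [N HN] := cvg _ e0.
have i1 : intg mu (itr F vv lam ((t - tau) / N.+1%:R) N.+1).
  elim: {2}N.+1 => [|j IH]; first exact: ivv0.
  exact: (intg_stp F0 F_mono F_lip lam (k0 N) IH).
rewrite add0r; apply: le_trans (HN N (leqnn N)).
rewrite -vv0 -(Rint_itr F0 F_mono F_lip lam ivv0 N.+1 (k0 N)) distrC -RintB//.
by apply: le_norm_Rint; exact: intgB.
Qed.

Lemma sol_sq_intg s : 0 < s -> intg mu (fun x => u s x ^+ 2).
Proof.
move=> s0; have [M M0 HM] := sol_bd s0; have iu := sol_intg (ltW s0).
pose cl x := Num.max (- M) (Num.min M (u s x)).
have mcl : meas cl.
  by apply: measurable_maxr => //; apply: measurable_minr => //; exact: intg_meas iu.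
have clM x : `|cl x| <= M.
  rewrite ler_norml /cl le_max lexx /= ge_max ge_min lexx andbT.
  by rewrite ge0_cp ?(ltW M0).
apply: ae_intg (intgMr mcl clM iu).
  by apply: measurable_funX; exact: intg_meas iu.
apply: (aeS _ HM) => x; rewrite ler_norml => /andP[h1 h2].
by rewrite /cl min_r// max_r.
Qed.

Hypothesis u_ge0 : forall s, 0 < s -> {ae mu, forall x, 0 <= u s x}.

(** The scheme is started from the clipped version of [u tau], whose pointwise bounds [itr_sq]
    requires; the resulting estimate depends on the length of the window but not on the number of
    steps. *)
Lemma sol_L2_step (C : R) : 0 < C ->
  (forall (n : nat) (k : R) w, 0 < k -> intg mu w -> intg mu (fun x => w x ^+ 2) ->
  (\int[mu]_x (conv (pt k) w x ^+ 2)) ^+ n.+1 <=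
  (\int[mu]_x (w x ^+ 2)) ^+ n * (C * rt (n.+1%:R * k) ^+ d * (\int[mu]_x `|w x|) ^+ 2)) ->
  forall m, 0 < m -> \int[mu]_x u tau x <= m ->
  forall c, c = C * rt (t - tau) ^+ d * m ^+ 2 ->
  (\int[mu]_x u t x ^+ 2) ^+ 2 <= c * Num.max c (\int[mu]_x u tau x ^+ 2).
Proof.
move=> C0 HC m m0 um c cE; have t0 := lt_trans tau0 taut.
have T0 : 0 < t - tau by rewrite subr_gt0.
have [M M0 HM] := sol_bounded t tau0.
pose v r x := Num.max 0 (Num.min M (vv r x)).
have mv : meas (uncurry v : ST -> R).
  rewrite (_ : uncurry v = fun p => Num.max 0 (Num.min M (uncurry vv p))); last by apply/funext => -[].
  by apply: measurable_maxr => //; exact: measurable_minr.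
have vE r : 0 <= r <= t - tau -> {ae mu, forall x, v r x = u (tau + r) x}.
  move=> /andP[r0 rT]; have s0 : 0 < tau + r by rewrite ltr_wpDr.
  have hs : tau <= tau + r <= t by rewrite lerDl r0/= addrC -lerBrDr.
  have := HM _ hs; apply: (aeS2 _ (u_ge0 s0)) => x h1 h2.
  by rewrite /v vvE// min_r ?max_r//; apply: le_trans h2; exact: ler_norm.
have [F [L [lam [F0 F_mono F_lip [lam0 lamL] cvg]]]] := window_cvg mv vE.
have h0 : (0 : R) <= 0 <= t - tau by rewrite lexx ltW.
have v0E : {ae mu, forall x, u tau x = v 0 x}.
  by have := vE 0 h0; rewrite addr0; apply: aeS => x ->.
have iuu := sol_intg (ltW tau0).
have mv0 : meas (v 0) by exact: measurable_uncurry1 mv.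
have iv0 : intg mu (v 0) by exact: ae_intg mv0 v0E iuu.
have v00 x : 0 <= v 0 x by rewrite /v le_max lexx.
have v0M x : v 0 x <= M by rewrite /v ge_max (ltW M0)/= ge_min lexx.
have Ev : \int[mu]_x v 0 x = \int[mu]_x u tau x.
  by apply: ae_eq_Rint => //; [exact: intg_meas iuu|apply: (aeS _ v0E) => x ->].
have Ev2 : \int[mu]_x v 0 x ^+ 2 = \int[mu]_x u tau x ^+ 2.
  apply: ae_eq_Rint; [exact: measurable_funX|by apply: measurable_funX; exact: intg_meas iuu|].
  by apply: (aeS _ v0E) => x ->.
pose Z0 := \int[mu]_x u tau x ^+ 2; pose Y := Num.sqrt (c * Num.max c Z0).
have c0 : 0 < c by rewrite cE mulr_gt0 ?exprn_gt0// mulr_gt0// exprn_gt0// rs_gt0.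
have Q0 : 0 <= c * Num.max c Z0 by rewrite mulr_ge0 ?(ltW c0)// le_max (ltW c0).
have X0 : 0 <= \int[mu]_x u t x ^+ 2 by apply: Rint_ge0 => x; exact: sqr_ge0.
suff H : \int[mu]_x u t x ^+ 2 <= Y.
  by rewrite -(sqr_sqrtr Q0); apply: lerXn2r; rewrite ?nnegrE ?sqrtr_ge0.
apply/ler_addgt0Pr => e e0; have M20 : 0 < 2 * M by rewrite mulr_gt0.
have [N HN] := cvg _ (divr_gt0 e0 M20).
have vm : \int[mu]_x v 0 x <= m by rewrite Ev.
have [isq Hsq] := itr_sq F0 F_mono F_lip lam0 lamL iv0 C0 HC N T0 m0 v00 v0M vm.
have w0 := itr_ge0 F0 F_mono F_lip lam0 lamL iv0 N.+1 (k0 N) v00.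
set w := itr F v lam ((t - tau) / N.+1%:R) N.+1 in isq Hsq w0.
have iw : intg mu w.
  rewrite /w; elim: {2}N.+1 => [|j IH]; first exact: iv0.
  exact: (intg_stp F0 F_mono F_lip lam (k0 N) IH).
have wY : \int[mu]_x w x ^+ 2 <= Y.
  rewrite -(ger0_norm (_ : 0 <= \int[mu]_x w x ^+ 2)); last by apply: Rint_ge0 => x; exact: sqr_ge0.
  rewrite -sqrtr_sqr; apply: ler_wsqrtr; apply: le_trans Hsq _.
  by rewrite Ev2 -cE.
have iwu := intg_norm (intgB iw iut).
(* Only L^1 convergence of the iterates is known; since [0 <= u <= M] and [0 <= w],
   [u^2 <= w^2 + 2 M |w - u|] transfers the L^2 bound. *)
apply: (@le_trans _ _ (\int[mu]_x (w x ^+ 2 + 2 * M * `|w x - u t x|))).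
  apply: ae_le_Rint; [exact: sol_sq_intg|by apply: intgD => //; exact: intgZl|].
  have ht : tau <= t <= t by rewrite (ltW taut) lexx.
  have := HM _ ht; apply: (aeS2 _ (u_ge0 t0)) => x h1 h2.
  have uM : u t x <= M by apply: le_trans h2; exact: ler_norm.
  have [l|l] := leP (u t x) (w x).
    apply: (@le_trans _ _ (w x ^+ 2)); last by rewrite lerDl mulr_ge0// ltW.
    by apply: lerXn2r; rewrite ?nnegrE.
  have wu : 0 <= u t x - w x by rewrite subr_ge0 ltW.
  rewrite distrC (ger0_norm wu) -lerBlDl subr_sqr mulrC ler_wpM2r//.
  by rewrite mulr_natl mulr2n lerD// ltW// (lt_le_trans l).
rewrite RintD//; last exact: intgZl.
rewrite RintZl//; apply: lerD => //.
rewrite mulrC -ler_pdivlMr//; exact: HN.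
Qed.

End window.

Hypothesis u0_ge0 : {ae mu, forall x, 0 <= u0 x}.
Hypothesis u0_pos : 0 < \int[mu]_x u0 x.

(** * Sign, mass, maximum principle and L^2 decay *)

Section flow_basic.

Lemma sol_small_time e t : 0 < e -> 0 < t -> exists2 tau : R, 0 < tau < t & \int[mu]_x `|u tau x - u0 x| <= e.
Proof.
move=> e0 t0; have [del del0 Hd] := sol_L1 (lexx 0) e0.
pose tau := Num.min del t / 2; have m0 : 0 < Num.min del t by rewrite lt_min del0.
have tau0 : 0 < tau by rewrite divr_gt0.
have tm : tau < Num.min del t by rewrite ltr_pdivrMr// ltr_pMr// ltr1n.
exists tau; first by rewrite tau0 (lt_le_trans tm)// ge_min lexx orbT.
have iu := sol_intg (ltW tau0); have iu' := sol_intg (lexx 0).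
rewrite (ae_eq_Rint_norm (intgB iu iu0) (intgB iu iu')).
  by apply: Hd; [exact: ltW|rewrite subr0 gtr0_norm// (lt_le_trans tm)// ge_min lexx].
by apply: (aeS _ (sol_u0)) => x ->.
Qed.

Lemma sol_posp0 c t : 0 <= c -> 0 < t -> \int[mu]_x posp c (u t x) <= \int[mu]_x posp c (u0 x).
Proof.
move=> c0 t0; apply/ler_addgt0Pr => e e0; have [tau /andP[tau0 taut] H] := sol_small_time e0 t0.
apply: le_trans (sol_posp tau0 taut c0) _.
apply: le_trans (Rint_posp_lip c0 (sol_intg (ltW tau0)) iu0) _.
by rewrite lerD2l.
Qed.

Lemma sol_mass t : 0 < t -> \int[mu]_x u t x = \int[mu]_x u0 x.
Proof.
move=> t0; apply/eqP; rewrite -subr_eq0 -normr_le0; apply/ler_addgt0Pr => e e0.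
have [tau /andP[tau0 taut] H] := sol_small_time e0 t0.
have iu := sol_intg (ltW tau0).
rewrite add0r (sol_mass_step tau0 taut) -RintB//.
by apply: le_trans H; apply: le_norm_Rint; exact: intgB.
Qed.

(** The negative part is [posp 0 u - u]. Its integral is at most that of [posp 0 u0 - u0], because
    mass is conserved and the positive part does not increase; the latter is 0. *)
Lemma sol_ge0 t : 0 < t -> {ae mu, forall x, 0 <= u t x}.
Proof.
move=> t0; have iu := sol_intg (ltW t0); have iN := intgN iu.
have H : \int[mu]_x posp 0 (- u t x) <= 0.
  have -> : (fun x => posp 0 (- u t x)) = fun x => posp 0 (u t x) - u t x.
    apply/funext => x; rewrite /posp !subr0; have [|] := leP 0 (u t x) => h.
      by rewrite max_r ?subrr// oppr_le0.
    by rewrite max_l ?sub0r// oppr_ge0 ltW.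
  rewrite RintB//; last exact: intg_posp.
  rewrite subr_le0 sol_mass//; apply: le_trans (sol_posp0 (lexx 0) t0) _.
  apply: ae_le_Rint => //; first exact: intg_posp.
  by apply: (aeS _ u0_ge0) => x; move=> /posp0E ->.
have := posp_ae0 (lexx 0) iN H; apply: aeS => x.
by rewrite oppr_le0.
Qed.

Lemma sol_L1norm t : 0 < t -> \int[mu]_x `|u t x| = \int[mu]_x u0 x.
Proof.
move=> t0; have iu := sol_intg (ltW t0); rewrite -(sol_mass t0).
apply: ae_eq_Rint; [exact: intg_meas (intg_norm iu)|exact: intg_meas iu|].
by apply: (aeS _ (sol_ge0 t0)) => x /ger0_norm ->.
Qed.

Lemma sol_sup M t : 0 <= M -> 0 < t -> {ae mu, forall x, u0 x <= M} -> {ae mu, forall x, u t x <= M}.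
Proof.
move=> M0 t0 H; apply: posp_ae0 => //; first exact: (sol_intg (ltW t0)).
apply: le_trans (sol_posp0 M0 t0) _; rewrite -[leRHS](@Rint0 _ _ R mu).
apply: ae_le_Rint; [exact: intg_posp|exact: intg0|].
apply: (aeS _ H) => x h.
by rewrite /posp ge_max lexx andbT subr_le0.
Qed.

Local Notation m := (\int[mu]_x u0 x).

Lemma rs_mul2 t : 0 < t -> rt (2 * t) = rt 2 * rt t.
Proof. by move=> t0; rewrite rsM// ltW. Qed.

Lemma sol_L2_decay del : 0 < del -> exists2 A : R, 0 < A & forall t, del <= t ->
  \int[mu]_x u t x ^+ 2 <= A * rt t ^+ d.
Proof.
move=> del0; have [C C0 HC] := conv_stk_L2.
pose c t := C * rt t ^+ d * m ^+ 2.
have c0 t : 0 < t -> 0 < c t.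
  by move=> t0; rewrite /c mulr_gt0 ?exprn_gt0// mulr_gt0// exprn_gt0// rs_gt0.
pose X t := \int[mu]_x u t x ^+ 2; have X0 t : 0 <= X t by apply: Rint_ge0 => x; exact: sqr_ge0.
have step t : 0 < t -> X (2 * t) ^+ 2 <= c t * Num.max (c t) (X t).
  move=> t0; have t2 : t < 2 * t by rewrite mulr_natl mulr2n ltrDl.
  apply: (sol_L2_step t0 t2 sol_ge0 C0 HC u0_pos); first by rewrite sol_mass.
  by rewrite /c mulr_natl mulr2n addrK.
pose rho := rt 2 ^+ d; have rho0 : 0 < rho by rewrite exprn_gt0// rs_gt0.
have c2 t : 0 < t -> c (2 * t) = rho * c t.
  by move=> t0; rewrite /c rs_mul2// exprMn [C * _]mulrCA !mulrA.
have [M M0 HM] := sol_bounded (2 * del) del0.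
(* With [X (2 t)^2 <= c t * max (c t) (X t)] and [c (2 t) = rho * c t], a bound [X <= A c] is stable
   under doubling as soon as [A >= rho^-2]. The second entry starts the induction on
   [[del, 2 del]]. *)
pose A := Num.max (rho^-1 ^+ 2) (M * m / c (2 * del)).
have del20 : 0 < 2 * del by rewrite mulr_gt0.
have A0 : 0 < A by rewrite lt_max exprn_gt0// invr_gt0.
have base t : del <= t -> t <= 2 * del -> X t <= A * c t.
  move=> l1 l2; have t0 := lt_le_trans del0 l1.
  apply: (@le_trans _ _ (M * m)).
    rewrite -(sol_mass t0) -RintZl; last exact: (sol_intg (ltW t0)).
    apply: ae_le_Rint; [exact: (sol_sq_intg)|apply: intgZl; exact: (sol_intg (ltW t0))|].
    have ht : del <= t <= 2 * del by rewrite l1.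
    apply: (aeS2 _ (sol_ge0 t0) (HM t ht)) => x h1 h2.
    by rewrite expr2 ler_wpM2r// (le_trans _ h2)// ler_norm.
  have cc : c (2 * del) <= c t.
    rewrite /c ler_wpM2r ?sqr_ge0// ler_wpM2l ?(ltW C0)//.
    by apply: lerXn2r; rewrite ?nnegrE ?(ltW (rs_gt0 _))// rs_le.
  apply: (@le_trans _ _ (M * m / c (2 * del) * c t)).
    have Mm0 : 0 <= M * m by apply: mulr_ge0; exact: ltW.
    by rewrite mulrAC ler_pdivlMr ?c0// ler_wpM2l.
  by rewrite ler_wpM2r ?(ltW (c0 _ t0))// /A le_max lexx orbT.
have dbl t : 0 < t -> X t <= A * c t -> X (2 * t) <= A * c (2 * t).
  move=> t0 H; have ct := c0 t t0.
  have A1 : 1 <= A * rho ^+ 2.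
    have r2 : 0 < rho ^+ 2 by exact: exprn_gt0.
    by rewrite -ler_pdivrMr// mul1r -exprVn /A le_max lexx.
  have rho1 : rho <= 1.
    apply: exprn_ile1; first exact/ltW/rs_gt0.
    have l12 : (1 : R) <= 2 by rewrite ler1n.
    by rewrite -[leRHS](rs1); exact: rs_le.
  have A1' : 1 <= A.
    apply: le_trans A1 _; rewrite ler_piMr ?(ltW A0)// exprn_ile1// ltW//.
  have p1 : 0 <= A * c (2 * t) by apply: mulr_ge0; [exact: ltW|apply/ltW/c0; exact: mulr_gt0].
  rewrite -(ler_pXn2r (isT : (0 < 2)%N)) ?nnegrE//.
  apply: le_trans (step t t0) _.
  apply: (@le_trans _ _ (c t * (A * c t))).
    by rewrite ler_wpM2l ?(ltW ct)// ge_max H andbT ler_peMl// ltW.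
  rewrite c2// [leRHS](_ : _ = (A * rho ^+ 2) * (c t * (A * c t))); last by ring.
  by rewrite ler_peMl// mulr_ge0 ?(ltW ct)// mulr_ge0 ?(ltW A0)// ltW.
have all n t : del <= t -> t <= 2 ^+ n.+1 * del -> X t <= A * c t.
  elim: n t => [|n IH] t l1 l2; first by apply: base; rewrite // -[2]expr1.
  have [h|h] := leP t (2 * del); first exact: base.
  have -> : t = 2 * (t / 2) by field.
  have t20 : 0 < t / 2 by rewrite divr_gt0// (lt_le_trans del0).
  apply: dbl => //; apply: IH; first by rewrite ler_pdivlMr// mulrC ltW.
  by rewrite ler_pdivrMr// mulrAC -exprSr.
exists (A * (C * m ^+ 2)); first by rewrite mulr_gt0// mulr_gt0// exprn_gt0.
move=> t dt; have t0 := lt_le_trans del0 dt.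
have [n Hn] : exists n, t <= 2 ^+ n.+1 * del.
  exists (Num.bound (t / del)); rewrite -ler_pdivrMr//; apply/ltW.
  apply: lt_le_trans (archi_boundP (ltW (divr_gt0 t0 del0))) _.
  by rewrite -natrX ler_nat; apply: leq_trans (ltnW (ltn_expl _ (isT : (1 < 2)%N))) _; rewrite leq_exp2l.
by apply: le_trans (all n t dt Hn) _; rewrite /c; apply: eq_leW; ring.
Qed.

Lemma conv_stk_L2sup : exists2 C : R, 0 < C & forall s f x, 0 < s -> intg mu f ->
  intg mu (fun y => f y ^+ 2) -> conv (pt s) f x ^+ 2 <= C * rt s ^+ d * \int[mu]_y f y ^+ 2.
Proof.
have [C C0 HC] := stk_sup; exists C => // s f x s0 if_ if2.
have [K HK] := stk_bounded s0; have mk := measurable_stk s.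
have ip := intg_stk s0.
have ip2 := intg_sq_bounded ip HK.
have is2 : intg mu (fun y => pt s (x - y) ^+ 2) by exact: (intg_sub x ip2).
apply: le_trans (cauchy_schwarz is2 if2 (intg_conv_arg mk HK x if_)) _.
rewrite ler_wpM2r//; first by apply: Rint_ge0 => y; exact: sqr_ge0.
rewrite (Rint_sub x (f := fun y => pt s y ^+ 2)); last exact: intg_meas ip2.
rewrite -[leRHS]mulr1 -(Rint_stk s0) -RintZl//.
apply: le_Rint => //; first exact: intgZl.
by move=> y; rewrite expr2 ler_wpM2r ?stk_ge0// HC.
Qed.

End flow_basic.

Local Notation qc := ((alpha - 1) / d%:R).
Hypothesis d0 : (0 < d)%N.
Variable A : R.
Hypothesis A0 : 0 < A.
Hypothesis hA : forall s, 0 < s -> {ae mu, forall x, `|u s x| `^ q <= A * `|u s x| `^ qc}.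

(** * Duhamel estimates at the critical power *)

Section duhamel_bounds.

Lemma conv_abs_le (k p : 'rV[R]_d -> R) (C : R) (g w : 'rV[R]_d -> R) x :
  meas k -> meas p -> 0 <= C ->
  {ae mu, forall y, `|k (x - y) * g y| <= C * (p (x - y) * w y)} ->
  meas g -> (forall y, 0 <= p y) -> (forall y, 0 <= w y) ->
  intg mu (fun y => p (x - y) * w y) -> `|conv k g x| <= C * conv p w x.
Proof.
move=> mk mp C0 kg mg p0 w0 ip.
have mkg : meas (fun y : 'rV[R]_d => k (x - y) * g y).
  by apply: mmul => //; apply: (mcomp mk); exact: measurable_sub_rV.
rewrite -lee_fin; apply: le_trans (le_norm_Rinte mu mkg) _.
rewrite /conv -RintZl// EFin_Rint; last exact: intgZl.
apply: ae_le_inte => //.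
- exact: (mcomp (@normr_measurable R setT) mkg).
- exact: intg_meas (intgZl C ip).
- by move=> y; rewrite mulr_ge0// mulr_ge0.
Qed.

Lemma duh_le a t x (Phi : R -> R) (I : R) : 0 <= a ->
  (forall s, a < s -> s < t -> `|conv (kp (t - s)) (fun z => pwn q (u s z)) x| <= Phi s) ->
  meas Phi -> (forall s, 0 <= Phi s) ->
  (\int[leb]_s (oi a t s * Phi s)%:E <= I%:E)%E ->
  `|\int[leb]_s (oi a t s * conv (kp (t - s)) (fun z => pwn q (u s z)) x)| <= I.
Proof.
move=> a0 H mP P0 HI; have mD := measurable_duh a t x.
have E : (fun s => oi a t s * conv (kp (t - s)) (fun z => pwn q (u s z)) x) =
    fun s => oi a t s * conv (kp (t - s)) (fun z => pwn q (ug s z)) x.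
  apply/funext => s; apply: oi_eq => l1 _; apply: eq_Rintegral => z _.
  by rewrite ugE// (le_lt_trans a0).
rewrite E -lee_fin; apply: le_trans (le_norm_Rinte leb mD) _; apply: le_trans HI.
have mDn := mcomp (@normr_measurable R setT) mD.
have mo := mmul (measurable_oi a t) mP.
apply: (le_inte leb mDn mo) => [s|s]; first exact: normr_ge0.
rewrite /= oi_norm; apply: oi_le => l1 l2; apply: le_trans (H s l1 l2).
have -> : conv (kp (t - s)) (fun z => pwn q (ug s z)) x = conv (kp (t - s)) (fun z => pwn q (u s z)) x.
  have s0 := le_lt_trans a0 l1.
  by apply: eq_Rintegral => z _; rewrite (ugE z s0).
exact: lexx.
Qed.

Lemma inte_oibeta_shift (a : R) : 0 < a < 1 -> exists2 K : R, 0 < K & forall tau t, tau < t ->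
  (\int[leb]_s (oi tau t s * ((t - s) `^ (- a) * (s - tau) `^ (- (1 - a))))%:E <= K%:E)%E.
Proof.
move=> a01; have [K K0 HK] := inte_oibeta a01; exists K => // tau t tt.
have tt0 : 0 < t - tau by rewrite subr_gt0.
pose f s := oi tau t s * ((t - s) `^ (- a) * (s - tau) `^ (- (1 - a))).
have mf : meas f.
  apply: mmul; first exact: measurable_oi.
  by apply: mmul; apply: (mcomp (measurable_powR _)); exact: measurable_funB.
have f0 s : 0 <= f s by rewrite mulr_ge0 ?oi_ge0// mulr_ge0 ?powR_ge0.
have := inte_affine1 tau (@ltr01 R) mf f0; rewrite mul1e => <-.
apply: le_trans (HK _ tt0); apply: eq_leW.
apply: eq_integral => s _; congr (_%:E); rewrite /f mul1r addrK.
by congr (_ * (_ `^ _ * _)); [rewrite /oi ltrDr -ltrBrDr|ring].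
Qed.

Lemma rs_d_powR (s : R) : 0 < s ->
  (rt s ^+ d) `^ ((alpha - 1) / d%:R) = s `^ (- (1 - alpha^-1)).
Proof.
move=> s0; rewrite /rs -powR_mulrn ?powR_ge0// -!powRrM; congr (_ `^ _).
have a0 : alpha != 0 by case/andP: alpha12 => /(lt_trans ltr01) h _; rewrite gt_eqF.
by field; rewrite a0 pnatr_eq0 -lt0n.
Qed.

Lemma sol_Linf_unif a c e : 0 < a -> 0 < e -> exists2 del : R, 0 < del &
  forall s s', a <= s <= c -> a <= s' <= c -> `|s - s'| <= del -> {ae mu, forall x, `|u s x - u s' x| <= e}.
Proof.
move=> a0 e0; pose P (n : nat) s := forall s', a <= s' <= c -> `|s - s'| <= n.+1%:R^-1 ->
  {ae mu, forall x, `|u s x - u s' x| <= e}.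
have [|s /andP[as_ sc]|N HN] := @segment_near R a c P; last by exists N.+1%:R^-1 => // s s' /HN; apply.
- move=> n m s nm H s' s'ac h; apply: H => //; apply: le_trans h _.
  by rewrite lef_pV2 ?posrE// ler_nat.
have s0 : 0 < s by exact: lt_le_trans as_.
have e20 : 0 < e / 2 by rewrite divr_gt0.
have [del del0 Hd] := sol_Linf s0 e20; exists (del / 2); first by rewrite divr_gt0.
have de : 0 <= (del / 2)^-1 by rewrite invr_ge0 divr_ge0// ltW.
exists (Num.bound (del / 2)^-1) => s1 s1s /andP[as1 _] s2 /andP[as2 _] s12.
have lt2 : `|s1 - s2| < del / 2.
  apply: le_lt_trans s12 _; rewrite invf_plt ?posrE ?divr_gt0//.
  by apply: lt_trans (archi_boundP de) _; rewrite ltr_nat.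
have s10 := lt_le_trans a0 as1; have s20 := lt_le_trans a0 as2.
have h1 : {ae mu, forall x, `|u s1 x - u s x| <= e / 2}.
  by apply: Hd => //; apply: lt_trans s1s _; rewrite ltr_pdivrMr// ltr_pMr// ltr1n.
have h2 : {ae mu, forall x, `|u s2 x - u s x| <= e / 2}.
  apply: Hd => //; rewrite -(subrK s1 s2) -addrA [del]splitr.
  by apply: le_lt_trans (ler_normD _ _) _; rewrite ltrD// distrC.
apply: (aeS2 _ h1 h2) => x l1 l2.
rewrite -(subrK (u s x) (u s1 x)) -addrA; apply: le_trans (ler_normD _ _) _.
by rewrite [e]splitr lerD// distrC.
Qed.

Let al0 : 0 < alpha. Proof. by case/andP: alpha12 => /(lt_trans ltr01). Qed.

Let dR : 0 < d%:R :> R. Proof. by rewrite ltr0n. Qed.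

Lemma qc_gt0 : 0 < qc.
Proof. by rewrite divr_gt0// subr_gt0; case/andP: alpha12. Qed.

Let u_ge0 s (s0 : 0 < s) := sol_ge0 s0.

(* The critical power of the decay rate [G s^(-d/alpha)] is [s^(-(1 - 1/alpha))]. *)
Lemma pwn_decay (r G y w : R) : 0 < r -> 0 <= G -> 0 <= y -> y <= G * rt r ^+ d -> y <= w ->
  `|y| `^ q <= A * `|y| `^ qc -> `|pwn q y| <= A * G `^ qc * r `^ (- (1 - alpha^-1)) * w.
Proof.
move=> r0 G0 y0 yG yw yA; rewrite norm_pwn; apply: ler_pM => //; last by rewrite ger0_norm.
apply: le_trans yA _; rewrite -mulrA ler_wpM2l ?(ltW A0)// ger0_norm//.
rewrite -(rs_d_powR r0) -powRM ?exprn_ge0 ?(ltW (rs_gt0 r0))//.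
by apply: ge0_ler_powR; rewrite ?nnegrE ?(ltW qc_gt0)//; exact: le_trans yG.
Qed.

Lemma sol_pwn_decay s r (G : R) (w : 'rV[R]_d -> R) : 0 < s -> 0 < r -> 0 <= G ->
  {ae mu, forall x, u s x <= G * rt r ^+ d} -> {ae mu, forall x, u s x <= w x} ->
  {ae mu, forall x, `|pwn q (u s x)| <= A * G `^ qc * r `^ (- (1 - alpha^-1)) * w x}.
Proof.
move=> s0 r0 G0 HG Hw.
by apply: (aeS2 _ (aeI (u_ge0 s0) HG) (aeI Hw (hA s0))) => x [ux uG] [uw uA]; exact: pwn_decay.
Qed.

(** Smallness at the critical rate makes the Duhamel term at most half of any majorant [2 P + e] of
    the solution, where [P = P_r u(tau)]: the power of [u] costs [eta^qc s^(-(1 - 1/alpha))] and the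
    time integral is scale invariant; [eta] is tuned to reach exactly [1/2]. So [e] is halved at
    every round, starting from a sup bound [M]. *)
Lemma core_iter : exists2 eta : R, 0 < eta & forall tau del, 0 < tau ->
  (forall s, 0 < s -> s <= del -> {ae mu, forall x, u (tau + s) x <= eta * rt s ^+ d}) ->
  forall r, 0 < r -> r <= del -> {ae mu, forall x, u (tau + r) x <= 2 * conv (pt r) (u tau) x}.
Proof.
have [Ck Ck0 HCk] := kap_le_stk.
have [B B0 HB] := inte_oibeta_shift (ai01).
pose X := 2 * Ck * A * B; have X0 : 0 < X by rewrite !mulr_gt0.
pose eta := X^-1 `^ (qc^-1).
have eta0 : 0 < eta by apply: powR_gt0; rewrite invr_gt0.
have etaE : Ck * (A * eta `^ qc) * B = 2^-1.
  rewrite /eta -powRrM mulVf ?gt_eqF ?qc_gt0// powRr1 ?invr_ge0 ?(ltW X0)//.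
  by rewrite /X; field; rewrite !gt_eqF.
exists eta => // tau del tau0 Hdel.
have iut := sol_intg (ltW tau0).
have [M M0 HM] := sol_bounded (tau + del) tau0.
have step n : forall r, 0 < r -> r <= del -> {ae mu, forall x, u (tau + r) x <= 2 * conv (pt r) (u tau) x + M * 2^-1 ^+ n}.
  elim: n => [|n IH] r r0 rd.
    have h : tau <= tau + r <= tau + del by rewrite lerDl (ltW r0) lerD2l.
    apply: (aeS _ (HM _ h)) => x hx.
    rewrite expr0 mulr1; apply: (le_trans (ler_norm _)); apply: (le_trans hx).
    by rewrite lerDr mulr_ge0// (conv_stk_ge0)//; exact: u_ge0.
  have tt : tau < tau + r by rewrite ltrDl.
  have := restart tau0 tt.
  apply: aeS => x ->.
  rewrite addrAC subrr add0r; set P := conv (pt r) (u tau) x; set e := M * 2^-1 ^+ n.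
  have e0 : 0 <= e by rewrite mulr_ge0 ?exprn_ge0// ltW.
  have P0 : 0 <= P by rewrite (conv_stk_ge0)//; exact: u_ge0.
  have PE : conv (pt r) (u tau) x = P by [].
  clearbody P.
  have W0 : 0 <= 2 * P + e by rewrite addr_ge0// mulr_ge0.
  pose c := Ck * (A * eta `^ qc) * (2 * P + e).
  have c0 : 0 <= c by rewrite mulr_ge0// mulr_ge0 ?(ltW Ck0)// mulr_ge0 ?powR_ge0// ltW.
  have D : `|\int[leb]_s (oi tau (tau + r) s * conv (kp (tau + r - s)) (fun z => pwn q (u s z)) x)| <= (2 * P + e) / 2.
    pose ph s := (tau + r - s) `^ (- alpha^-1) * (s - tau) `^ (- (1 - alpha^-1)).
    have mph : meas ph.
      by apply: mmul; apply: (mcomp (measurable_powR _)); exact: measurable_funB.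
    have ph0 s : 0 <= ph s by rewrite mulr_ge0 ?powR_ge0.
    apply: (@duh_le _ _ _ (fun s => c * ph s)); first exact: ltW.
    - move=> s ls sl; pose s' := s - tau.
      have s'0 : 0 < s' by rewrite subr_gt0.
      have sE : tau + s' = s by rewrite addrC subrK.
      have s'd : s' <= del by apply: le_trans rd; rewrite /s' lerBlDl ltW.
      have sp : 0 < s by exact: lt_trans ls.
      have tsp : 0 < tau + r - s by rewrite subr_gt0.
      pose w y := 2 * conv (pt s') (u tau) y + e.
      have w0 y : 0 <= w y := addr_ge0 (mulr_ge0 (ler0n R 2) (conv_stk_ge0 y s'0 (u_ge0 tau0) iut)) e0.
      have Hw : {ae mu, forall y, u s y <= w y} by have := IH s' s'0 s'd; rewrite sE.
      have HG : {ae mu, forall y, u s y <= eta * rt s' ^+ d} by have := Hdel s' s'0 s'd; rewrite sE.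
      have Hg := sol_pwn_decay sp s'0 (ltW eta0) HG Hw.
      have [K HK] := stk_bounded tsp; have mp := measurable_stk (tau + r - s).
      have ic : intg mu (conv (pt s') (u tau)) by apply: intg_conv => //; exact: intg_stk.
      have i1 := intg_conv_arg mp HK x (intgZl 2 ic).
      have i2 : intg mu (fun y => pt (tau + r - s) (x - y) * e).
        by apply: intgZr; apply: (intg_sub x); exact: intg_stk.
      have iw : intg mu (fun y => pt (tau + r - s) (x - y) * w y).
        rewrite (_ : (fun y => _) = fun y => pt (tau + r - s) (x - y) * (2 * conv (pt s') (u tau) y) + pt (tau + r - s) (x - y) * e); first exact: intgD.
        by apply/funext => y; rewrite mulrDr.
      have Ew : conv (pt (tau + r - s)) w x = 2 * P + e.
        transitivity (conv (pt (tau + r - s)) (fun y => 2 * conv (pt s') (u tau) y) x + \int[mu]_y (pt (tau + r - s) (x - y) * e)).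
          by rewrite /conv -(RintD i1 i2); apply: eq_Rintegral => y _; rewrite mulrDr.
        rewrite (convZ mp HK)// (conv_stk_stk x tsp s'0 iut) RintZr; last by apply: (intg_sub x); exact: intg_stk.
        have I1 : \int[mu]_y pt (tau + r - s) (x - y) = 1 by apply: etrans (Rint_sub x mp) _; exact: Rint_stk.
        have rE : tau + r - s + s' = r by rewrite /s'; ring.
        by rewrite I1 mul1r rE PE.
      have mg : meas (fun z => pwn q (u s z)).
        by apply: (mcomp (measurable_pwn q)); exact: intg_meas (sol_intg (ltW sp)).
      have H0 : 0 <= A * eta `^ qc * s' `^ (- (1 - alpha^-1)) by rewrite !mulr_ge0 ?powR_ge0// ltW.
      have C0 : 0 <= Ck * rt (tau + r - s) * (A * eta `^ qc * s' `^ (- (1 - alpha^-1))).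
        by rewrite mulr_ge0// mulr_ge0 ?(ltW Ck0)// ltW// rs_gt0.
      have HK' : {ae mu, forall y, `|kp (tau + r - s) (x - y) * pwn q (u s y)| <=
          Ck * rt (tau + r - s) * (A * eta `^ qc * s' `^ (- (1 - alpha^-1))) * (pt (tau + r - s) (x - y) * w y)}.
        apply: (aeS _ Hg) => y hy.
        rewrite normrM [leRHS]mulrACA; apply: ler_pM => //; exact: HCk.
      have pp y : 0 <= pt (tau + r - s) y by exact: stk_ge0.
      have HF := conv_abs_le (measurable_kap (tau + r - s)) mp C0 HK' mg pp w0 iw.
      apply: (le_trans HF).
      rewrite Ew /c /ph /rs -/s'; apply: eq_leW.
      by move: (_ `^ _) (_ `^ _) (_ `^ _) => *; ring.
    - exact: mmul.
    - by move=> s; exact: mulr_ge0.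
    - have mph' : meas (fun s => oi tau (tau + r) s * ph s) by apply: mmul => //; exact: measurable_oi.
      have ph0' s : 0 <= oi tau (tau + r) s * ph s by rewrite mulr_ge0 ?oi_ge0.
      under eq_integral => s _ do rewrite mulrCA.
      rewrite (inteZl leb mph' ph0' c0); apply: le_trans (lee_wpmul2l _ (HB _ _ tt)) _; first by rewrite lee_fin.
      by rewrite -EFinM lee_fin /c mulrAC etaE mulrC.
  have := ler_norm (\int[leb]_s (oi tau (tau + r) s * conv (kp (tau + r - s)) (fun z => pwn q (u s z)) x)).
  move=> /le_trans/(_ D) D'; apply: (@le_trans _ _ (P + (2 * P + e) / 2)); first by rewrite lerD2l.
  by rewrite exprS -/e; apply: eq_leW; rewrite /e; field.
move=> r r0 rd; have := ae_foralln (fun n => step n r r0 rd).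
apply: aeS => x H.
apply/ler_addgt0Pr => e e0.
have c : M * 2^-1 ^+ n @[n --> \oo] --> (0 : R).
  rewrite -[X in _ --> X](mulr0 M); apply: cvgMl_tmp; apply: cvg_expr.
  by rewrite ger0_norm ?invf_lt1// ?ltr1n// invr_ge0.
have [N _ HN] := cvgr_lt _ c _ e0.
by apply: le_trans (H N) _; rewrite lerD2l; apply/ltW/HN => /=.
Qed.

End duhamel_bounds.

(** * Short multiplicative time steps and decay of the supremum *)

Section flow_decay.
Local Notation m := (\int[mu]_x u0 x).

Let u_ge0 s (s0 : 0 < s) := sol_ge0 s0.

(** A continuation argument: the smallness required by [core_iter] is deduced from that of the
    linear flow. It holds at small [r], since [rt s ^+ d] blows up while [u] is bounded. If it holds
    up to [r], then [u <= 2 P] spends half of [eta], and L^infinity continuity the other half, on a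
    further step of fixed length. The factor [rt 2 ^+ d] in [e] pays for comparing times
    [r < s <= 2 r]. *)
Lemma core : exists2 e : R, 0 < e & forall tau del, 0 < tau -> 0 < del ->
  (forall s x, 0 < s -> s <= del -> conv (pt s) (u tau) x <= e * rt s ^+ d) ->
  forall r, 0 < r -> r <= del -> {ae mu, forall x, u (tau + r) x <= 2 * conv (pt r) (u tau) x}.
Proof.
have [eta eta0 Heta] := core_iter.
have r20 : 0 < rt 2 ^+ d by exact: rs_d_gt0.
exists (eta * rt 2 ^+ d / 4); first by rewrite divr_gt0// mulr_gt0.
set e := eta * _ / 4 => tau del tau0 del0 Hs.
have lin (us ur cv n a c y : R) : ur <= 2 * cv -> n <= c -> cv <= a -> us - ur <= n -> a <= y -> c <= 2 * y ->
    us <= 4 * y by move=> *; lra.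
pose Good r := forall s, 0 < s -> s <= r -> {ae mu, forall x, u (tau + s) x <= eta * rt s ^+ d}.
suff G : Good del by exact: Heta.
have [M M0 HM] := sol_bounded (tau + del) tau0.
have [r1 r10 Hr1] := rs_d_root d0 (divr_gt0 M0 eta0).
pose r0 := Num.min r1 del; have r00 : 0 < r0 by rewrite lt_min r10.
have r0d : r0 <= del by rewrite ge_min lexx orbT.
have G0 : Good r0.
  move=> s s0 sr; have h : tau <= tau + s <= tau + del by rewrite lerDl (ltW s0) lerD2l (le_trans sr).
  apply: (aeS _ (HM _ h)) => x hx.
  apply: le_trans (ler_norm _) _; apply: le_trans hx _.
  have sr1 : s <= r1 by apply: le_trans sr _; rewrite ge_min lexx.
  by have := rs_d_le s0 sr1; rewrite Hr1 ler_pdivrMr// mulrC.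
have e'0 : 0 < eta / 2 * rt del ^+ d by rewrite mulr_gt0 ?divr_gt0// rs_d_gt0.
have tr0 : 0 < tau + r0 by rewrite addr_gt0.
have [sig sig0 Hsig] := sol_Linf_unif (tau + del) tr0 e'0.
pose st := Num.min sig r0; have st0 : 0 < st by rewrite lt_min sig0.
have step r : r0 <= r -> r <= del -> Good r -> Good (Num.min (r + st) del).
  move=> r0r rd Gr s s0; rewrite le_min => /andP[srs sd].
  have [sr|rs_] := leP s r; first exact: Gr.
  have rp := lt_le_trans r00 r0r.
  have H1 := Heta tau r tau0 Gr r rp (lexx r).
  have H2 : {ae mu, forall x, `|u (tau + s) x - u (tau + r) x| <= eta / 2 * rt del ^+ d}.
    apply: Hsig; rewrite ?lerD2l ?sd ?rd ?r0r ?(le_trans r0r (ltW rs_))//.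
    rewrite opprD addrACA subrr add0r gtr0_norm ?subr_gt0// lerBlDl.
    by apply: le_trans srs _; rewrite lerD2l ge_min lexx.
  apply: (aeS2 _ H1 H2) => x h1 h2.
  have h3 := Hs r x rp rd.
  have s2 : s <= 2 * r.
    apply: le_trans srs _; rewrite mulr_natl mulr2n lerD2l; apply: le_trans r0r.
    by rewrite ge_min lexx orbT.
  have h4 : rt 2 ^+ d * rt r ^+ d <= rt s ^+ d.
    by rewrite -rs_d_mul//; exact: rs_d_le.
  have h5 := rs_d_le s0 sd.
  have h6 := ler_norm (u (tau + s) x - u (tau + r) x).
  have h7 : e * rt r ^+ d <= eta / 4 * rt s ^+ d.
    rewrite /e [leLHS](_ : _ = eta / 4 * (rt 2 ^+ d * rt r ^+ d)); last by move: (rt 2 ^+ d) (rt r ^+ d) => *; field.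
    by rewrite ler_wpM2l// divr_ge0// ltW.
  have h8 : eta / 2 * rt del ^+ d <= eta / 2 * rt s ^+ d by rewrite ler_wpM2l// divr_ge0// ltW.
  have h9 : eta * rt s ^+ d = 4 * (eta / 4 * rt s ^+ d) by rewrite !mulrA [4 * eta]mulrC mulfK.
  have h10 : eta / 2 * rt s ^+ d = 2 * (eta / 4 * rt s ^+ d).
    by rewrite mulrA; congr (_ * _); field.
  rewrite h9; rewrite h10 in h8.
  exact: (lin _ _ _ _ _ _ _ h1 h2 h3 h6 h7 h8).
have all n : Good (Num.min (r0 + n%:R * st) del).
  elim: n => [|n IH]; first by rewrite mul0r addr0 min_l.
  have n0 : 0 <= n%:R * st by rewrite mulr_ge0// ltW.
  have l1 : r0 <= Num.min (r0 + n%:R * st) del by rewrite le_min r0d lerDl n0.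
  have l2 : Num.min (r0 + n%:R * st) del <= del by rewrite ge_min lexx orbT.
  move=> s s0; rewrite le_min => /andP[h1 h2]; apply: (step _ l1 l2 IH) => //.
  rewrite le_min h2 andbT; have [l|l] := leP (r0 + n%:R * st) del.
    by apply: le_trans h1 _; rewrite -natr1 mulrDl mul1r addrA.
  by apply: le_trans h2 _; rewrite lerDl ltW.
pose n := Num.bound (del / st).
have := all n; rewrite min_r//.
have h : del / st < n%:R by apply: archi_boundP; rewrite divr_ge0 ?ltW.
by have := ltW h; rewrite ler_pdivrMr// => /le_trans; apply; rewrite lerDr ltW.
Qed.

(** The integrals of [(u tau - c)^+] are bounded by those of [(u0 - c)^+], so [conv_stk_small]
    yields one [del] for all [tau]. *)
Lemma small_time : exists2 del : R, 0 < del & forall tau r, 0 < tau -> 0 < r -> r <= del ->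
  {ae mu, forall x, u (tau + r) x <= 2 * conv (pt r) (u tau) x}.
Proof.
have [e e0 He] := core; have [del del0 Hd] := conv_stk_small d0 iu0 e0.
exists del => // tau r tau0 r0 rd; apply: (He tau del) => // s x s0 sd.
apply: Hd => //; first exact: (sol_intg (ltW tau0)).
by move=> c c0; exact: (sol_posp0).
Qed.

(** The limit [tau -> 0] of [small_time], taken in the integral of the positive part of [u - 2 P],
    with L^1 continuity at the times [0] and [r]. *)
Lemma small_time0 : exists2 del : R, 0 < del & forall r, 0 < r -> r <= del ->
  {ae mu, forall x, u r x <= 2 * conv (pt r) u0 x}.
Proof.
have [del del0 Hd] := small_time; exists del => // r r0 rd.
have iur := sol_intg (ltW r0); have ip := intg_stk r0.
have ic f : intg mu f -> intg mu (conv (pt r) f) by move=> i; exact: intg_conv.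
have iw : intg mu (fun x => u r x - 2 * conv (pt r) u0 x) by apply: intgB => //; apply: intgZl; exact: ic.
suff H : \int[mu]_x posp 0 (u r x - 2 * conv (pt r) u0 x) <= 0.
  have := posp_ae0 (lexx 0) iw H; apply: aeS => x.
  by rewrite subr_le0.
apply/ler_addgt0Pr => e e0; rewrite add0r; have e3 : 0 < e / 3 by rewrite divr_gt0.
have [del' del'0 Hd'] := sol_L1 (ltW r0) e3.
have [tau /andP[tau0 taud] Htau] := sol_small_time e3 del'0.
have iut := sol_intg (ltW tau0).
have tr0 : 0 < tau + r by rewrite addr_gt0.
have iutr := sol_intg (ltW tr0).
have h1 : \int[mu]_x `|u (tau + r) x - u r x| <= e / 3.
  by apply: Hd'; [exact: ltW|rewrite addrK gtr0_norm].
have [K HK] := stk_bounded r0; have mk := measurable_stk r.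
have idf := intgB iut iu0.
have h2 : \int[mu]_x `|conv (pt r) (fun y => u tau y - u0 y) x| <= e / 3.
  rewrite -lee_fin -(intg_n1 (ic _ idf)); apply: le_trans (n1_conv_stk r0 (intg_meas idf)) _.
  by rewrite (intg_n1 idf) lee_fin.
have ia := intg_norm (intgB iutr iur); have ib := intgZl 2 (intg_norm (ic _ idf)).
apply: (@le_trans _ _ (\int[mu]_x (`|u (tau + r) x - u r x| + 2 * `|conv (pt r) (fun y => u tau y - u0 y) x|))).
  apply: ae_le_Rint; [exact: intg_posp|exact: intgD|].
  apply: (aeS _ (Hd tau r tau0 r0 rd)) => x hx.
  rewrite (convB mk HK x iut iu0) /posp subr0 ge_max; apply/andP; split; last by rewrite addr_ge0 ?mulr_ge0.
  have := ler_norm (conv (pt r) (u tau) x - conv (pt r) u0 x).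
  have := ler_norm (u r x - u (tau + r) x); rewrite distrC.
  move: (conv (pt r) (u tau) x) (conv (pt r) u0 x) (u r x) (u (tau + r) x) hx (`|_|) (`|_|) => *; lra.
rewrite RintD// RintZl; last exact/intg_norm/ic.
by move: (\int[mu]_x `|_|) (\int[mu]_x `|_|) h1 h2 => *; lra.
Qed.

(** At large times smallness comes from the L^2 decay: [(P_s u(t))^2] is at most a constant times
    [rt s ^+ d * rt t ^+ d], which is small compared with the square of [rt s ^+ d] once
    [s <= del * t]. Hence steps proportional to [t]; small times are handled by [small_time]. *)
Lemma loc_time : exists2 del : R, 0 < del <= 1 & forall t r, 0 < t -> 0 < r -> r <= del * t ->
  {ae mu, forall x, u (t + r) x <= 2 * conv (pt r) (u t) x}.
Proof.
have [e e0 He] := core; have [ds ds0 Hds] := small_time.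
have [B B0 HB] := sol_L2_decay ds0.
have [C C0 HC] := conv_stk_L2sup.
have k0 : 0 < e ^+ 2 / (C * B) by rewrite divr_gt0 ?exprn_gt0// mulr_gt0.
have [s0 s00 Hs0] := rs_d_root d0 k0.
pose del := Num.min 1 s0^-1.
have del0 : 0 < del by rewrite lt_min ltr01 invr_gt0.
exists del; first by rewrite del0 ge_min lexx.
move=> t r t0 r0 rt_.
have [tds|dst] := leP t ds.
  apply: Hds => //; apply: le_trans rt_ _; apply: le_trans tds.
  by rewrite ler_piMl ?(ltW t0)// ge_min lexx.
have iut := sol_intg (ltW t0).
apply: (He t (del * t)) => //; first by rewrite mulr_gt0.
move=> s x sp st; apply: le_trans (ler_norm _) _.
have rsp := @rs_d_gt0 s sp.
rewrite -(ler_pXn2r (isT : (0 < 2)%N)) ?nnegrE ?mulr_ge0 ?(ltW e0) ?(ltW rsp)//.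
rewrite real_normK ?num_real//; apply: le_trans (HC s (u t) x sp iut (sol_sq_intg t0)) _.
have l1 : rt t ^+ d <= e ^+ 2 / (C * B) * rt s ^+ d.
  rewrite -Hs0 -rs_d_mul//; apply: rs_d_le => //; first by rewrite mulr_gt0.
  rewrite -ler_pdivlMl//; apply: le_trans st _; rewrite ler_wpM2r ?(ltW t0)//.
  by rewrite ge_min lexx orbT.
apply: (@le_trans _ _ (C * rt s ^+ d * (B * (e ^+ 2 / (C * B) * rt s ^+ d)))).
  rewrite ler_wpM2l ?mulr_ge0 ?(ltW C0) ?(ltW rsp)//; apply: le_trans (HB t (ltW dst)) _.
  by rewrite ler_wpM2l// ltW.
apply: eq_leW; move: (rt s ^+ d) => y.
by field; rewrite !gt_eqF.
Qed.

(** One [loc_time] step from [t / (1 + del)] to [t], then L^1 to L^infinity smoothing with a lag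
    that is a fixed fraction of [t]. *)
Lemma sol_decay : exists2 H : R, 0 < H & forall t, 0 < t -> {ae mu, forall x, u t x <= H * rt t ^+ d}.
Proof.
have [del /andP[del0 del1] Hdel] := loc_time; have [C C0 HC] := conv_stk_sup.
have d1 : 0 < 1 + del by rewrite addr_gt0.
have dd : 0 < del / (1 + del) by rewrite divr_gt0.
exists (2 * (C * rt (del / (1 + del)) ^+ d * m)).
  by rewrite mulr_gt0// mulr_gt0// mulr_gt0// rs_d_gt0.
move=> t t0; pose t' := t / (1 + del); have t'0 : 0 < t' by rewrite divr_gt0.
pose r := del * t'; have r0 : 0 < r by rewrite mulr_gt0.
have tE : t' + r = t by rewrite /r -{1}(mul1r t') -mulrDl /t' mulrC divfK// gt_eqF.
have := Hdel t' r t'0 r0 (lexx _); rewrite tE; apply: aeS => x hx.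
apply: le_trans hx _; rewrite -mulrA ler_wpM2l//; apply: le_trans (ler_norm _) _.
apply: le_trans (HC r (u t') x r0 (sol_intg (ltW t'0))) _.
rewrite (sol_L1norm t'0).
have -> : r = del / (1 + del) * t by rewrite /r /t'; field; rewrite gt_eqF.
rewrite rs_d_mul//; apply: eq_leW.
by move: (rt _ ^+ d) (rt t ^+ d) (Rintegral _ _ _) => *; ring.
Qed.

End flow_decay.

(** * Tightness at the self-similar scale *)

Section flow_tight.
Local Notation m := (\int[mu]_x u0 x).
Variable H : R.
Hypothesis H0 : 0 < H.
Hypothesis hH : forall t, 0 < t -> {ae mu, forall x, u t x <= H * rt t ^+ d}.

Let u_ge0 s (s0 : 0 < s) := sol_ge0 s0.

Local Notation Q := (A * H `^ qc).
Local Notation a1 := (1 - alpha^-1).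

Lemma sol_pwn_decay_L1 s : 0 < s -> \int[mu]_x `|pwn q (u s x)| <= Q * s `^ (- a1) * m.
Proof.
move=> s0; have iu := sol_intg (ltW s0).
rewrite -(sol_mass s0) -RintZl//.
apply: ae_le_Rint; [exact: intg_norm (sol_pwn_intg s0)|exact: intgZl|].
apply: (sol_pwn_decay s0 s0 (ltW H0) (hH s0)).
by apply: nearW => x; exact: lexx.
Qed.

Let a1_itv : 0 <= a1 < 1.
Proof. by have /andP[h1 h2] := ai01; rewrite subr_ge0 (ltW h2) ltrBlDr ltrDl. Qed.

Lemma sol_mild_slice t x : 0 < t -> intg leb (fun s => oi 0 t s * conv (kp (t - s)) (fun z => pwn q (u s z)) x).
Proof.
move=> t0; have [i _] := sol_mild x t0.
have i' : intg (leb \x mu)%E (uncurry (fun s z => oi 0 t s * (kp (t - s) (x - z) * pwn q (u s z)))).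
  by rewrite (_ : uncurry _ = fun p => oi 0 t p.1 * (kp (t - p.1) (x - p.2) * pwn q (u p.1 p.2))); [exact: i|apply/funext => -[]].
have := intg_fubiniF i'; rewrite (_ : (fun s => \int[mu]_y _) = fun s => oi 0 t s * conv (kp (t - s)) (fun z => pwn q (u s z)) x)//.
apply/funext => s; rewrite /oi.
have [/andP[s0 sr]|n] := boolP ((0 < s) && (s < t)); last first.
  by rewrite mul0r; under eq_Rintegral do rewrite mul0r; rewrite Rint0.
by rewrite mul1r; apply: eq_Rintegral => z _; rewrite mul1r.
Qed.

(** [cut_conv_kap] bounds the mass moved at each time by [|b| / rho] times the L^1 norm of
    [u^(1+q)], with no singularity in [t - s]. That norm is of order [s^(-(1 - 1/alpha))], whose
    integral is of order [t^(1/alpha)]. *)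
Lemma cut_duh : exists2 K : R, 0 < K & forall rho t, 0 < rho -> 0 < t ->
  `|\int[mu]_x (cut rho x * (u t x - conv (pt t) u0 x))| <= enorm b / rho * (K * t `^ alpha^-1).
Proof.
have [K K0 HK] := inte_oipow a1_itv.
have Q0 : 0 < Q by rewrite mulr_gt0// powR_gt0.
exists (Q * m * K); first by apply: mulr_gt0 => //; exact: mulr_gt0.
move=> rho t r0 t0.
pose ph s x := oi 0 t s * (cut rho x * conv (kp (t - s)) (fun z => pwn q (ug s z)) x).
have E : \int[mu]_x (cut rho x * (u t x - conv (pt t) u0 x)) = \int[mu]_x \int[leb]_s ph s x.
  apply: eq_Rintegral => x _; have [_ ->] := sol_mild x t0.
  rewrite addrAC subrr add0r -RintZl; last exact: sol_mild_slice.
  apply: eq_Rintegral => s _; rewrite mulrCA; apply: oi_eq => s0 _; congr (_ * _).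
  by apply: eq_Rintegral => z _; rewrite ugE.
have m1 := meas_fst.
have m2 := meas_snd.
have m3 : meas (fun p : ST => t - (p.1 : R)) by exact: measurable_funB.
have mph : meas (uncurry ph : ST -> R).
  rewrite (_ : uncurry ph = fun p : ST => oi 0 t p.1 * (cut rho p.2 * conv (kp (t - p.1)) (fun z => pwn q (ug p.1 z)) p.2)); last by apply/funext => -[].
  apply: mmul; first exact: (mcomp (measurable_oi 0 t) m1).
  apply: mmul; first exact: (mcomp (measurable_cut rho) m2).
  have := @measurable_conv2 R d _ (measurableTypeR R) (fun s => kp (t - s)) (fun s z => pwn q (ug s z)); apply; last exact: (measurable_gu).
  rewrite (_ : uncurry _ = fun p : ST => kp (t - p.1) p.2); last by apply/funext => -[].
  exact: (@measurable_comp_kernel _ (ST)%type kp (fun p => t - (p.1 : R)) (fun p => p.2) (measurable_kap2) m3 m2).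
have [C C0 HC] := kap_L1.
have [B B0 HB] := inte_oibeta_shift (ai01).
pose f s := oi 0 t s * ((t - s) `^ (- alpha^-1) * (s - 0) `^ (- a1)).
have mf : meas f.
  apply: mmul; first exact: measurable_oi.
  by apply: mmul; apply: (mcomp (measurable_powR _)); exact: measurable_funB.
have f0 s : 0 <= f s by rewrite mulr_ge0 ?oi_ge0// mulr_ge0 ?powR_ge0.
have if_ : intg leb f.
  apply: intgP; first exact: mf.
  under eq_integral => s _ do rewrite ger0_norm//.
  exact: le_lt_trans (HB 0 t t0) (ltry _).
have i2 := intgZl (C * (Q * m)) if_.
have guE s : 0 < s -> (fun z => pwn q (ug s z)) = (fun z => pwn q (u s z)).
  by move=> s0; apply/funext => z; rewrite ugE.
have iph : intg (leb \x mu)%E (uncurry ph).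
  apply: (intg_prod mph).
  apply: (@le_lt_trans _ _ (\int[leb]_s (C * (Q * m) * f s)%:E)%E); last exact: intg_ltyr i2.
  apply: ge0_le_integral => //.
  - by move=> s _; exact: inte_ge0.
  - apply: (@measurable_inte _ _ _ _ _ mu (fun s z => `|ph s z|)) => //.
    rewrite (_ : uncurry _ = fun p => `|uncurry ph p|); last by apply/funext => -[].
    exact: (mcomp (@normr_measurable R setT) mph).
  - by case/integrableP: i2.
  move=> s _; have [/andP[s0 st]|n] := boolP ((0 < s) && (s < t)); last first.
    rewrite /ph /f /oi (negbTE n) mul0r mulr0; under eq_integral do rewrite mul0r normr0.
    by rewrite integral0.
  have ts0 : 0 < t - s by rewrite subr_gt0.
  have ik := intg_kap ts0; have ig := sol_pwn_intg s0.
  have ic := intg_conv ik ig.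
  apply: (@le_trans _ _ (n1 (conv (kp (t - s)) (fun z => pwn q (u s z))))).
    apply: le_inte => //.
    - apply: (mcomp (@normr_measurable R setT)); exact: measurable_uncurry1 mph.
    - exact: intg_meas (intg_norm ic).
    - by move=> x; rewrite /ph oiT// mul1r guE// normrM ler_piMl// cut_norm.
  apply: le_trans (n1_conv (intg_meas ik) (intg_meas ig)) _.
  rewrite !intg_n1// -EFinM lee_fin /f oiT// mul1r subr0.
  apply: (@le_trans _ _ (C * rt (t - s) * (Q * s `^ (- a1) * m))).
    by apply: ler_pM; [exact: Rint_ge0|exact: Rint_ge0|exact: HC|exact: sol_pwn_decay_L1].
  rewrite /rs; apply: eq_leW.
  by move: (_ `^ _) (_ `^ _) (_ `^ _) => *; ring.
have iS := intg_fubiniF iph.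
rewrite E -(Rfubini iph); apply: le_trans (le_norm_Rint iS) _.
have ip := intg_oipow t a1_itv.
have c0 : 0 <= enorm b / rho * (Q * m) by rewrite mulr_ge0 ?divr_ge0 ?enorm_ge0 ?(ltW r0)// mulr_ge0// ltW.
apply: (@le_trans _ _ (\int[leb]_s (enorm b / rho * (Q * m) * (oi 0 t s * s `^ (- a1))))).
  apply: le_Rint; [exact: intg_norm|exact: intgZl|].
  move=> s; have [/andP[s0 st]|n] := boolP ((0 < s) && (s < t)); last first.
    have -> : \int[mu]_x ph s x = 0 by rewrite /ph /oi (negbTE n); under eq_Rintegral do rewrite mul0r; rewrite Rint0.
    by rewrite normr0 mulr_ge0// mulr_ge0 ?oi_ge0 ?powR_ge0.
  have ts0 : 0 < t - s by rewrite subr_gt0.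
  have -> : \int[mu]_x ph s x = \int[mu]_x (cut rho x * conv (kp (t - s)) (fun z => pwn q (u s z)) x).
    by apply: eq_Rintegral => x _; rewrite /ph oiT// mul1r guE.
  apply: le_trans (cut_conv_kap r0 ts0 (sol_pwn_intg s0)) _.
  rewrite -[leRHS]mulrA ler_wpM2l ?divr_ge0 ?enorm_ge0 ?(ltW r0)//.
  apply: le_trans (sol_pwn_decay_L1 s0) _; rewrite oiT// mul1r mulrAC.
  by apply: lexx.
rewrite RintZl//; have := HK t t0; rewrite (_ : 1 - a1 = alpha^-1); last by ring.
rewrite -EFin_Rint// lee_fin => h.
rewrite -!mulrA ler_wpM2l ?enorm_ge0// ler_wpM2l ?invr_ge0 ?(ltW r0)//.
apply: ler_wpM2l; first exact: ltW.
apply: ler_wpM2l; first exact: powR_ge0.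
by apply: ler_wpM2l => //; exact: ltW.
Qed.

Lemma L1_tail e del : 0 < e -> 0 < del -> exists2 M : R, 0 < M & forall t, del <= t ->
  \int[mu]_x (cut (M / rt t) x * u t x) <= e.
Proof.
move=> e0 del0; have [K K0 HK] := cut_duh; have e30 : 0 < e / 3 by rewrite divr_gt0.
have ip := intg_stk (@ltr01 R).
have [R1 R10 HR1] := cut_tail ip (fun x => stk_ge0 x (@ltr01 R)) (divr_gt0 e30 u0_pos).
have [R2 R20 HR2] := cut_tail (intg_norm iu0) (fun x => normr_ge0 (u0 x)) e30.
have rd0 := rs_gt0 del0.
pose R3 := enorm b * K * 3 / e; have R30 : 0 <= R3 by rewrite divr_ge0 ?(ltW e0)// !mulr_ge0 ?enorm_ge0// ltW.
(* Each term makes one contribution at most [e / 3]: the tail of the kernel, the tail of [u0] and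
   the transported mass. The factors 4 come from [cut_add]; the tail of [u0] lives at a fixed scale,
   which is why times are bounded below by [del]. *)
pose M := 4 * R1 + 4 * R2 * rt del + R3.
have p1 : 0 < 4 * R1 by rewrite mulr_gt0.
have p2 : 0 < 4 * R2 * rt del by rewrite !mulr_gt0.
have M0 : 0 < M by rewrite ltr_pwDl// addr_gt0.
exists M => // t dt; have t0 := lt_le_trans del0 dt; have r0 := rs_gt0 t0.
set rho := M / rt t; have rho0 : 0 < rho by rewrite divr_gt0.
have mc := measurable_cut rho.
have iut := sol_intg (ltW t0).
have ic : intg mu (conv (pt t) u0) := intg_conv (intg_stk t0) iu0.
have j1 := intgMl mc (cut_norm rho) ic; have j2 := intgMl mc (cut_norm rho) (intgB iut ic).
have E : \int[mu]_x (cut rho x * u t x) = \int[mu]_x (cut rho x * conv (pt t) u0 x) + \int[mu]_x (cut rho x * (u t x - conv (pt t) u0 x)).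
  by rewrite -RintD//; apply: eq_Rintegral => x _; ring.
rewrite E; have -> : e = (e / 3 / m * m + e / 3) + e / 3 by field; rewrite gt_eqF.
apply: lerD; last first.
  apply: le_trans (ler_norm _) _; apply: le_trans (HK rho t rho0 t0) _.
  have E2 : t `^ alpha^-1 * rt t = 1 by rewrite /rs powRN divff// gt_eqF// powR_gt0.
  rewrite (_ : _ * _ = enorm b * K * (t `^ alpha^-1 * rt t) / M); last by rewrite /rho; field; rewrite !gt_eqF.
  rewrite E2 mulr1 ler_pdivrMr//; apply: (@le_trans _ _ (e / 3 * R3)).
    by rewrite /R3; apply: eq_leW; field; rewrite gt_eqF.
  by rewrite ler_wpM2l ?(ltW e30)// /M lerDr ltW// addr_gt0.
apply: le_trans (cut_conv_stk rho0 t0 iu0 u0_ge0) _; apply: lerD.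
  rewrite ler_wpM2r ?(ltW u0_pos)//.
  have -> : rho / 4 = M / 4 / rt t by rewrite /rho mulrAC.
  rewrite cut_stk_scale//; apply: HR1; rewrite ler_pdivlMr// mulrC /M -addrA lerDl.
  by rewrite addr_ge0// ltW.
have mc4 := measurable_cut (rho / 4).
apply: (@le_trans _ _ (\int[mu]_x (cut (rho / 4) x * `|u0 x|))).
  apply: le_Rint; [exact: (intgMl mc4 (cut_norm _) iu0)|exact: (intgMl mc4 (cut_norm _) (intg_norm iu0))|].
  by move=> x; rewrite ler_wpM2l ?cut_ge0// ler_norm.
apply: HR2; rewrite ler_pdivlMr// /rho ler_pdivlMr//.
apply: (@le_trans _ _ (4 * R2 * rt del)); last by rewrite /M addrAC lerDr addr_ge0 ?(ltW p1).
by rewrite [R2 * 4]mulrC ler_wpM2l ?mulr_ge0 ?(ltW R20)// rs_le.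
Qed.

(** For small [t] the bound holds at every [z], by equi-integrability. Otherwise
    [u(t) <= 2 P_r u(s)] with [s] and [r] fixed fractions of [t]: mass of [u(s)] beyond the
    self-similar scale is small by [L1_tail], and from the remaining mass [z] is so far that the
    kernel is small. *)
Lemma tight e : 0 < e -> exists2 M : R, 0 < M & forall t, 0 < t ->
  {ae mu, forall z, M <= rt t * enorm z -> u t z <= e * rt t ^+ d}.
Proof.
move=> e0; have e20 : 0 < e / 2 by rewrite divr_gt0.
have [d1 d10 Hd1] := small_time0.
have [d2 d20 Hd2] := conv_stk_small d0 iu0 e20.
have [del /andP[del0 del1] Hdel] := loc_time.
have [C C0 HC] := stk_sup; have [C1 C10 HC1] := stk1_upper.
pose d3 := Num.min d1 d2; have d30 : 0 < d3 by rewrite lt_min d10.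
have dd : 0 < 1 + del by rewrite addr_gt0.
pose th := del / (1 + del); have th0 : 0 < th by rewrite divr_gt0.
have th1 : th <= 1 by rewrite ler_pdivrMr// mul1r lerDr.
have thd : th <= del by rewrite ler_pdivrMr// ler_peMr ?(ltW del0)// lerDl ltW.
set k1 := rt th; have k10 : 0 < k1 by exact: rs_gt0.
have k11 : 1 <= k1 by rewrite -(rs1); exact: rs_le.
have kd0 : 0 < k1 ^+ d by rewrite exprn_gt0.
(* [e1] and [L] make the far and near contributions [e / 4 * rt t ^+ d] each, and [loc_time] doubles
   the sum. *)
pose e1 := e / (4 * k1 ^+ d * C); have e10 : 0 < e1 by rewrite divr_gt0// !mulr_gt0.
pose L := 4 * k1 ^+ d * C1 * m / e; have L0 : 0 < L by rewrite divr_gt0// !mulr_gt0.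
have [M' M'0 HM'] := L1_tail e10 (divr_gt0 d30 dd).
exists (2 * M' + L); first by rewrite addr_gt0// mulr_gt0.
move=> t t0; have rt0 := rs_gt0 t0.
have [td3|d3t] := leP t d3.
  have td1 : t <= d1 by apply: le_trans td3 _; rewrite ge_min lexx.
  have td2 : t <= d2 by apply: le_trans td3 _; rewrite ge_min lexx orbT.
  apply: (aeS _ (Hd1 t t0 td1)) => z hz _.
  apply: le_trans hz _; have := Hd2 u0 t z iu0 (fun c _ => lexx _) t0 td2 => h.
  have -> : e * rt t ^+ d = 2 * (e / 2 * rt t ^+ d) by move: (rt t ^+ d) => ?; field.
  by rewrite ler_wpM2l.
pose s := t / (1 + del); have s0 : 0 < s by rewrite divr_gt0.
pose r := del * s; have r0 : 0 < r by rewrite mulr_gt0.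
have tE : s + r = t by rewrite /r -{1}(mul1r s) -mulrDl /s mulrC divfK// gt_eqF.
have rE : r = th * t by rewrite /r /s /th; field; rewrite gt_eqF.
have ds : d3 / (1 + del) <= s by rewrite ler_pM2r ?invr_gt0// ltW.
have rsr : rt r = k1 * rt t by rewrite rE rsM ?(ltW th0) ?(ltW t0).
have rsr' : rt r = rt del * rt s by rewrite rsM ?(ltW del0) ?(ltW s0).
have rs0 := rs_gt0 s0; have rr0 := rs_gt0 r0.
set rho := M' / rt s; have rho0 : 0 < rho by rewrite divr_gt0.
have ius := sol_intg (ltW s0).
have := Hdel s r s0 r0 (lexx _); rewrite tE.
apply: aeS => z hz hM; apply: le_trans hz _.
have rrho : rt r * rho <= k1 * M'.
  have -> : rt r * rho = rt del * M' by rewrite rsr' /rho; field; rewrite gt_eqF.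
  by apply: ler_wpM2r; [exact: ltW|exact: rs_le].
pose B1 := rt r ^+ d * (C1 / L).
have mp := measurable_stk r; have [K HK] := stk_bounded r0.
have mc := measurable_cut rho.
have j1 := intgZl (C * rt r ^+ d) (intgMl mc (cut_norm rho) ius).
have j2 := intgZl B1 ius.
have cv : conv (pt r) (u s) z <= C * rt r ^+ d * e1 + B1 * m.
  apply: (@le_trans _ _ (\int[mu]_y (C * rt r ^+ d * (cut rho y * u s y) + B1 * u s y))).
    apply: ae_le_Rint; [exact: (intg_conv_arg mp HK)|exact: intgD|].
    apply: (aeS _ (u_ge0 s0)) => y uy.
    have Crs : 0 <= C * rt r ^+ d by rewrite mulr_ge0 ?(ltW C0)// exprn_ge0// ltW.
    have B10 : 0 <= B1 by rewrite mulr_ge0 ?exprn_ge0 ?(ltW rr0)// divr_ge0// ltW.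
    have [h|h] := leP (2 * rho) (enorm y).
      rewrite cut1// mul1r; apply: (@le_trans _ _ (C * rt r ^+ d * u s y)).
        by rewrite ler_wpM2r// HC.
      by rewrite lerDl mulr_ge0.
    apply: (@le_trans _ _ (B1 * u s y)); last by rewrite lerDr mulr_ge0// mulr_ge0// cut_ge0.
    rewrite ler_wpM2r// (stk_scale _ r0) /B1 ler_wpM2l ?exprn_ge0 ?(ltW rr0)//.
    apply: le_trans (HC1 _) _; rewrite ler_wpM2l ?(ltW C10)//.
    apply: le_trans (jw_le_inv _ d0) _; rewrite lef_pV2 ?posrE ?brk_gt0//.
    rewrite /brk enormZ (gtr0_norm rr0).
    have h1 : enorm z <= enorm (z - y) + enorm y by have := enormD (z - y) y; rewrite subrK.
    have h2 : rt r * enorm z <= rt r * enorm (z - y) + rt r * enorm y by rewrite -mulrDr ler_wpM2l// ltW.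
    have h3 : rt r * enorm y <= 2 * (k1 * M').
      apply: (@le_trans _ _ (rt r * (2 * rho))); first by rewrite ler_wpM2l ?ltW.
      by rewrite mulrCA ler_wpM2l.
    have h4 : k1 * (2 * M' + L) <= rt r * enorm z by rewrite rsr -mulrA ler_wpM2l// ltW.
    have h5 : L <= k1 * L by rewrite ler_peMl// ltW.
    move: h4; rewrite mulrDr => h4.
    move: (k1 * L) (rt r * enorm z) (rt r * enorm (z - y)) (rt r * enorm y) (k1 * M') (k1 * (2 * M')) (mulrCA k1 2 M') h2 h3 h4 h5 => *; lra.
  rewrite RintD// RintZl; last exact: (intgMl mc (cut_norm rho) ius).
  rewrite RintZl// (sol_mass s0) lerD2r ler_wpM2l//.
    by rewrite mulr_ge0 ?(ltW C0)// exprn_ge0// ltW.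
  exact: HM'.
apply: (@le_trans _ _ (2 * (C * rt r ^+ d * e1 + B1 * m))); first by rewrite ler_wpM2l.
rewrite /B1 rsr exprMn /e1 /L; apply: eq_leW.
by field; rewrite !gt_eqF.
Qed.

End flow_tight.

(** * Comparison with the linear flow away from the origin *)

Section flow_far.

Let u_ge0 s (s0 : 0 < s) := sol_ge0 s0.
Local Notation a1 := (1 - alpha^-1).
Local Notation P t := (conv (pt t) u0).

Lemma far th : 0 < th -> exists2 M : R, 0 < M & forall t x F, 0 < t -> M <= rt t * enorm x -> 0 <= F ->
  (forall s, 0 < s -> s < t -> {ae mu, forall z, u s z <= F * P s z}) ->
  `|u t x - P t x| <= th * F * P t x.
Proof.
move=> th0.
have lin1 (a v c : R) : a <= c + v -> 2 * v < a -> a <= 2 * c by move=> *; lra.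
have lin2 (a v : R) : a <= 2 * v -> a <= 2 * (1 + v) by move=> *; lra.
have lin3 (a v : R) : a <= v / 2 -> a + v / 2 <= v by move=> *; lra.
have [H H0 hH] := sol_decay.
have [Cd Cd0 HCd] := dstk_le_stk.
have [Ck Ck0 HCk] := kap_le_stk.
have a1i : 0 <= a1 < 1 by case/andP: (ai01) => h1 h2; rewrite subr_ge0 (ltW h2) gtrBl.
have [K1 K10 HK1] := inte_oipow a1i.
have [K2 K20 HK2] := inte_oibeta_shift (ai01).
pose X := 2 * Ck * A * K2; have X0 : 0 < X by rewrite !mulr_gt0.
(* Makes the contribution of [|z| >= |x| / 2] at most [th / 2], after the scale-invariant time
   integral [K2]. *)
pose eps := (th / X) `^ (qc^-1); have qc0 := qc_gt0.
have eps0 : 0 < eps by rewrite powR_gt0// divr_gt0.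
have epsE : Ck * (A * eps `^ qc) * K2 = th / 2.
  rewrite /eps -powRrM mulVf ?gt_eqF// powRr1 ?divr_ge0 ?(ltW X0) ?(ltW th0)//.
  by rewrite /X; field; rewrite !gt_eqF.
have [M1 M10 HM1] := tight H0 hH eps0.
pose c0 := 2 * (Cd * enorm b) * (A * H `^ qc).
have c00 : 0 <= c0.
  have h1 : 0 <= Cd * enorm b by rewrite mulr_ge0 ?enorm_ge0// ltW.
  have h2 : 0 <= A * H `^ qc by rewrite mulr_ge0 ?powR_ge0// ltW.
  by rewrite /c0 mulr_ge0// mulr_ge0.
(* The first entry puts every [|z| >= |x| / 2] in the tight region of each earlier time [s], as
   [rt s >= rt t]. The second makes the gain [c0 / |x|], integrated to
   [c0 * K1 * t^(1/alpha) / |x|], at most [th / 2]. *)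
pose M := Num.max (2 * M1) (2 * (c0 * K1) / th).
have M0 : 0 < M by rewrite lt_max mulr_gt0.
exists M => // t x F t0 xM F0 HF.
have rt0 := rs_gt0 t0.
have x0 : 0 < enorm x by rewrite -(pmulr_rgt0 _ rt0); exact: lt_le_trans xM.
have [_ ->] := sol_mild x t0.
rewrite addrAC subrr add0r; set p := P t x.
have p0 : 0 <= p by exact: conv_stk_ge0.
have pE : P t x = p by [].
clearbody p.
pose c1 := c0 / enorm x; have c10 : 0 <= c1 by rewrite divr_ge0// ltW.
pose c2 := Ck * (A * eps `^ qc).
have c20 : 0 <= c2 by rewrite mulr_ge0 ?(ltW Ck0)// mulr_ge0 ?powR_ge0// ltW.
have xM1 : 2 * M1 <= rt t * enorm x by apply: le_trans xM; rewrite le_max lexx.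
have xM2 : 2 * (c0 * K1) / th <= rt t * enorm x by apply: le_trans xM; rewrite le_max lexx orbT.
pose f1 s := s `^ (- a1); pose f2 s := (t - s) `^ (- alpha^-1) * (s - 0) `^ (- a1).
have mf1 : meas f1 by apply: measurable_powR.
have mf2 : meas f2.
  by apply: mmul; apply: (mcomp (measurable_powR _)); exact: measurable_funB.
have f10 s : 0 <= f1 s by exact: powR_ge0.
have f20 s : 0 <= f2 s by rewrite mulr_ge0 ?powR_ge0.
have mo := measurable_oi 0 t.
have of1 s : 0 <= oi 0 t s * f1 s by rewrite mulr_ge0 ?oi_ge0.
have of2 s : 0 <= oi 0 t s * f2 s by rewrite mulr_ge0 ?oi_ge0.
pose B := F * p; have B0 : 0 <= B by exact: mulr_ge0.
have mc1 := mmul (measurable_cst c1) mf1.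
have mc2 := mmul (measurable_cst c2) mf2.
apply: (@duh_le _ _ _ (fun s => B * (c1 * f1 s + c2 * f2 s))) => //.
- move=> s s0 st; have ts0 : 0 < t - s by rewrite subr_gt0.
  have mg : meas (fun z => pwn q (u s z)).
    by apply: (mcomp (measurable_pwn q)); exact: intg_meas (sol_intg (ltW s0)).
  have [K HK] := stk_bounded ts0; have mp := measurable_stk (t - s).
  have ic : intg mu (P s) by apply: intg_conv => //; exact: intg_stk.
  have iw := intg_conv_arg mp HK x (intgZl F ic).
  have w0 z : 0 <= F * P s z by rewrite mulr_ge0// (conv_stk_ge0).
  have pp z : 0 <= pt (t - s) z by exact: stk_ge0.
  have rts0 := rs_gt0 ts0.
  pose C := c1 * f1 s + c2 * f2 s.
  have C0 : 0 <= C by rewrite addr_ge0// mulr_ge0.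
  have E : conv (pt (t - s)) (fun z => F * P s z) x = B.
    by rewrite (convZ mp HK)// (conv_stk_stk x ts0 s0 iu0) subrK pE.
  rewrite -/C mulrC -E.
  apply: (conv_abs_le (measurable_kap (t - s)) mp C0 _ mg pp w0 iw).
  have G1 := aeI (u_ge0 s0) (hH s s0).
  have G2 := aeI (HF s s0 st) (hA s0).
  have G3 := aeI G1 G2.
  apply: (aeS2 _ G3 (HM1 s s0)) => z [[uz uH] [uF uA]] uM.
  have k0 : 0 <= pt (t - s) (x - z) by exact: pp.
  have W0 : 0 <= pt (t - s) (x - z) * (F * P s z) by exact: mulr_ge0.
  (* In the far case the tight decay rate [eps] is used with the plain bound on [kap]; in the near
     case [|x - z| >= |x| / 2], and the factor [1 / brk] of the gradient trades the singular
     [rt (t - s)] for [1 / |x|]. *)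
  rewrite normrM; have [hz|hz] := leP (enorm x) (2 * enorm z).
    apply: (@le_trans _ _ ((Ck * rt (t - s) * pt (t - s) (x - z)) * (A * eps `^ qc * s `^ (- a1) * (F * P s z)))).
      apply: ler_pM => //; first exact: HCk.
      apply: pwn_decay => //; first exact: ltW.
      apply: uM; rewrite -(ler_pM2l (_ : 0 < 2 :> R))//; apply: le_trans xM1 _.
      rewrite mulrCA; apply: ler_pM => //; [exact: ltW|exact: enorm_ge0|exact: rs_le (ltW st)].
    apply: (@le_trans _ _ (c2 * f2 s * (pt (t - s) (x - z) * (F * P s z)))); last first.
      by apply: ler_wpM2r => //; rewrite lerDr mulr_ge0.
    rewrite /c2 /f2 subr0 /rs; apply: eq_leW.
    by move: (_ `^ _) (_ `^ _) (_ `^ _) => *; ring.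
  apply: (@le_trans _ _ ((2 * (Cd * enorm b) / enorm x * pt (t - s) (x - z)) * (A * H `^ qc * s `^ (- a1) * (F * P s z)))).
    apply: ler_pM => //; last by apply: pwn_decay => //; exact: ltW.
    rewrite /kap normrN; apply: le_trans (HCd _ _ _ ts0) _.
    have xz : enorm x <= 2 * enorm (x - z).
      by have := enormD (x - z) z; rewrite subrK => /lin1; exact.
    have bl : rt (t - s) * enorm x <= 2 * brk (rt (t - s) *: (x - z)).
      rewrite /brk enormZ (gtr0_norm rts0).
      by have := ler_wpM2l (ltW rts0) xz; rewrite mulrCA => /lin2.
    have bp := brk_gt0 (rt (t - s) *: (x - z)).
    have cb : 0 <= Cd * enorm b * pt (t - s) (x - z) by rewrite mulr_ge0// mulr_ge0 ?enorm_ge0// ltW.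
    rewrite ler_pdivrMr//.
    rewrite [leLHS](_ : _ = Cd * enorm b * pt (t - s) (x - z) / enorm x * (rt (t - s) * enorm x)); last first.
      by field; rewrite gt_eqF.
    rewrite [leRHS](_ : _ = Cd * enorm b * pt (t - s) (x - z) / enorm x * (2 * brk (rt (t - s) *: (x - z)))); last first.
      by field; rewrite gt_eqF.
    by rewrite ler_wpM2l// divr_ge0// ltW.
  apply: (@le_trans _ _ (c1 * f1 s * (pt (t - s) (x - z) * (F * P s z)))); last first.
    by apply: ler_wpM2r => //; rewrite lerDl mulr_ge0.
  rewrite /c1 /c0 /f1; apply: eq_leW.
  by move: (_ `^ _) (_ `^ _) => *; ring.
- apply: mmul => //; exact: measurable_funD.
- by move=> s; rewrite mulr_ge0// addr_ge0// mulr_ge0.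
- have m1 := mmul mo mf1; have m2 := mmul mo mf2.
  have mm1 := mmul (measurable_cst c1) m1.
  have mm2 := mmul (measurable_cst c2) m2.
  have e1 s : 0 <= c1 * (oi 0 t s * f1 s) by exact: mulr_ge0.
  have e2 s : 0 <= c2 * (oi 0 t s * f2 s) by exact: mulr_ge0.
  have mmD := measurable_funD mm1 mm2.
  have eD s : 0 <= c1 * (oi 0 t s * f1 s) + c2 * (oi 0 t s * f2 s) by exact: addr_ge0.
  under eq_integral => s _ do rewrite mulrCA mulrDr [oi _ _ _ * (c1 * _)]mulrCA [oi _ _ _ * (c2 * _)]mulrCA.
  rewrite (inteZl leb mmD eD B0) (inteD leb mm1 mm2 e1 e2) (inteZl leb m1 of1 c10) (inteZl leb m2 of2 c20).
  apply: (@le_trans _ _ (B%:E * (c1%:E * (K1 * t `^ (1 - a1))%:E + c2%:E * K2%:E))%E).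
    apply: lee_wpmul2l; first by rewrite lee_fin.
    by apply: leeD; apply: lee_wpmul2l; rewrite ?lee_fin//; [exact: HK1|exact: HK2].
  rewrite -(EFinM c1) -(EFinM c2) -EFinD -EFinM lee_fin.
  rewrite -mulrA mulrC -/B ler_wpM2r// /c2 epsE.
  have -> : 1 - a1 = alpha^-1 by ring.
  have : c1 * (K1 * t `^ alpha^-1) <= th / 2.
    rewrite /c1 mulrAC ler_pdivrMr// mulrA.
    have : c0 * K1 <= th / 2 * (rt t * enorm x).
      have := ler_wpM2l (ltW th0) xM2; rewrite mulrC divfK ?gt_eqF// => h.
      rewrite -(ler_pM2l (_ : 0 < 2 :> R))//; apply: le_trans h _.
      by rewrite [leRHS]mulrA [2 * _]mulrC divfK.
    have tt1 : rt t * t `^ alpha^-1 = 1 by rewrite /rs -powRD ?addNr ?powRr0// (gt_eqF t0) implybT.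
    move/(ler_wpM2r (powR_ge0 t alpha^-1)) => /le_trans; apply.
    by rewrite le_eqVlt -!mulrA [enorm x * _]mulrC [rt t * _]mulrA tt1 mul1r eqxx.
  exact: lin3.
Qed.

(** At least half of the mass of [u0] is kept within radius [2 rho]; seen from there, [x] lies at
    scaled distance at most [M + rt del * (2 * rho)], where the kernel has a lower bound. *)
Lemma conv_stk_lower del M : 0 < del -> 0 <= M -> exists2 c : R, 0 < c & forall t x, del <= t ->
  rt t * enorm x <= M -> c * rt t ^+ d <= P t x.
Proof.
move=> del0 M0; have [c1 c10 Hc1] := stk1_lower.
have m20 : 0 < (\int[mu]_x u0 x) / 2 by rewrite divr_gt0.
have [rho rho0 Hrho] := cut_tail (intg_norm iu0) (fun x => normr_ge0 (u0 x)) m20.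
have mc := measurable_cut rho.
have icu : intg mu (fun x => cut rho x * u0 x) := intgMl mc (@cut_norm rho) iu0.
have icu' : intg mu (fun x => cut rho x * `|u0 x|) := intgMl mc (@cut_norm rho) (intg_norm iu0).
pose L := 1 + (M + rt del * (2 * rho)); have rd0 := rs_gt0 del0.
have L0 : 0 < L by rewrite addr_gt0// ltr_wpDl// mulr_gt0// mulr_gt0.
pose c := c1 * L `^ (- (d%:R + alpha)); have c0 : 0 < c by rewrite mulr_gt0// powR_gt0.
exists (c * ((\int[mu]_x u0 x) / 2)); first by rewrite mulr_gt0.
move=> t x dt xM; have t0 := lt_le_trans del0 dt; have rt0 := rs_gt0 t0.
have mp := measurable_stk t; have [K HK] := stk_bounded t0.
have H1 : (\int[mu]_x u0 x) / 2 <= \int[mu]_x (u0 x - cut rho x * u0 x).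
  rewrite RintB// lerBrDr -[leRHS](@divfK _ 2)// mulr_natr mulr2n lerD2l.
  apply: le_trans (Hrho rho (lexx _)); apply: ae_le_Rint => //.
  by apply: filterE => y; rewrite ler_wpM2l ?cut_ge0// ler_norm.
have ir : intg mu (fun y => u0 y - cut rho y * u0 y) by exact: intgB.
apply: (@le_trans _ _ (\int[mu]_y (c * rt t ^+ d * (u0 y - cut rho y * u0 y)))).
  by rewrite RintZl// mulrAC ler_wpM2l// mulr_ge0 ?exprn_ge0// ltW.
apply: ae_le_Rint; [exact: intgZl|exact: (intg_conv_arg mp HK)|].
apply: (aeS _ u0_ge0) => y uy.
have cp : 0 <= c * rt t ^+ d by rewrite mulr_ge0 ?exprn_ge0// ltW.
have [hy|hy] := leP (2 * rho) (enorm y).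
  by rewrite cut1// mul1r subrr mulr0 mulr_ge0// stk_ge0.
apply: (@le_trans _ _ (c * rt t ^+ d * u0 y)).
  by rewrite ler_wpM2l// gerBl mulr_ge0// cut_ge0.
rewrite ler_wpM2r// (stk_scale _ t0) mulrC ler_wpM2l ?exprn_ge0 ?(ltW rt0)//.
apply: le_trans (Hc1 _); rewrite /c ler_wpM2l ?(ltW c10)// /jw !powRN.
have da : 0 <= d%:R + alpha by case/andP: alpha12 => /(lt_trans ltr01)/ltW h _; rewrite addr_ge0.
have bl : brk (rt t *: (x - y)) <= L.
  rewrite /brk /L enormZ (gtr0_norm rt0) lerD2l.
  apply: (@le_trans _ _ (rt t * (enorm x + enorm y))).
    by rewrite ler_wpM2l ?(ltW rt0)//; apply: le_trans (enormD _ _) _; rewrite enormN.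
  rewrite mulrDr; apply: lerD => //; apply: ler_pM; rewrite ?enorm_ge0 ?(ltW rt0) ?(ltW hy)//.
  exact: rs_le.
have bp := brk_gt0 (rt t *: (x - y)).
rewrite lef_pV2 ?posrE ?powR_gt0//; apply: ge0_ler_powR; rewrite ?nnegrE ?(ltW L0) ?(ltW bp)//.
Qed.

Lemma conv_stk_gt0 t x : 0 < t -> 0 < P t x.
Proof.
move=> t0; have rt0 := rs_gt0 t0.
have [c c0 Hc] := conv_stk_lower t0 (mulr_ge0 (ltW rt0) (enorm_ge0 x)).
by apply: lt_le_trans (Hc t x (lexx _) (lexx _)); rewrite mulr_gt0// rs_d_gt0.
Qed.

(** Each use of [loc_time] reaches a later time at the price of a factor 2. The constant grows with
    the horizon; it serves only as the starting value in [flow_le]. *)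
Lemma flow_le_local T : exists2 F : R, 0 < F & forall s, 0 < s -> s <= T -> {ae mu, forall z, u s z <= F * P s z}.
Proof.
have [d1 d10 H1] := small_time0.
have [d2 /andP[d20 _] H2] := loc_time.
have all (n : nat) s : 0 < s -> s <= d1 + n%:R * (d2 * d1) -> {ae mu, forall z, u s z <= 2 ^+ n.+1 * P s z}.
  elim: n s => [|n IH] s s0 sn; first by rewrite mul0r addr0 in sn; rewrite expr1; exact: H1.
  have d21 : 0 < 1 + d2 by rewrite addr_gt0.
  pose s' := s / (1 + d2); have s'0 : 0 < s' by rewrite divr_gt0.
  pose r := d2 * s'; have r0 : 0 < r by rewrite mulr_gt0.
  have sE : s' + r = s by rewrite /r -{1}(mul1r s') -mulrDl /s' mulrC divfK// gt_eqF.
  have s'n : s' <= d1 + n%:R * (d2 * d1).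
    rewrite ler_pdivrMr//; apply: le_trans sn _; rewrite -natr1 -subr_ge0.
    rewrite (_ : _ - _ = n%:R * (d2 * d1) * d2); last by ring.
    by apply: mulr_ge0 (ltW d20); rewrite mulr_ge0 ?mulr_ge0 ?(ltW d20) ?(ltW d10).
  have := H2 s' r s'0 r0 (lexx _); rewrite sE.
  apply: aeS => z hz; apply: le_trans hz _.
  rewrite exprS -mulrA ler_wpM2l//.
  have mp := measurable_stk r; have [K HK] := stk_bounded r0.
  have ic : intg mu (P s') by apply: intg_conv => //; exact: intg_stk.
  rewrite -sE addrC -(conv_stk_stk z r0 s'0 iu0) -(convZ mp HK)//.
  apply: (conv_le mp HK) => //; [by move=> y; exact: stk_ge0|exact: (sol_intg (ltW s'0))|exact: intgZl|exact: IH].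
pose n := Num.bound (T / (d2 * d1)); have dd : 0 < d2 * d1 by exact: mulr_gt0.
exists (2 ^+ n.+1); first by rewrite exprn_gt0.
move=> s s0 sT; apply: all => //; have [T0|T0] := leP T 0.
  by have := lt_le_trans s0 (le_trans sT T0); rewrite ltxx.
have h : T / (d2 * d1) < n%:R by apply: archi_boundP; rewrite divr_ge0 ?ltW.
by apply: le_trans sT _; have := ltW h; rewrite ler_pdivrMr// => /le_trans; apply; rewrite lerDr ltW.
Qed.

Lemma flow_le : exists2 K : R, 0 < K & forall t, 0 < t -> {ae mu, forall z, u t z <= K * P t z}.
Proof.
have lin (K e : R) : 2 <= K -> 1 + 2^-1 * (K + e) <= K + 2^-1 * e by move=> *; lra.
have lin2 (v p w : R) : `|v - p| <= w * p -> v <= (1 + w) * p.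
  by rewrite mulrDl mul1r => h; rewrite -lerBlDl; apply: le_trans (ler_norm _) h.
have [H H0 hH] := sol_decay.
have [d1 d10 H1] := small_time0.
have [|M M0 HM] := @far 2^-1; first by rewrite invr_gt0.
have [c c0 Hc] := conv_stk_lower d10 (ltW M0).
(* [K >= 2] gives [1 + (K + a) / 2 <= K + a / 2], so each use of [far] halves the excess over [K].
   The same [K] covers small times (constant 2) and the region [rt s * |z| <= M] (constant [H / c]).
   It is fixed before the horizon [T], unlike [F]. *)
pose K := Num.max 2 (H / c); have K2 : 2 <= K by rewrite le_max lexx.
have K0 : 0 < K := lt_le_trans (ltr0n R 2) K2.
exists (K + 1); first by rewrite addr_gt0.
move=> T T0; have [F F0 HF] := flow_le_local T.
have all (n : nat) s : 0 < s -> s <= T -> {ae mu, forall z, u s z <= (K + 2^-1 ^+ n * F) * P s z}.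
  elim: n s => [|n IH] s s0 sT.
    apply: (aeS _ (HF s s0 sT)) => z h; apply: le_trans h _.
    by rewrite expr0 mul1r ler_wpM2r ?lerDr ?(ltW K0)// ltW// conv_stk_gt0.
  have e0 k : 0 <= 2^-1 ^+ k * F by rewrite mulr_ge0 ?exprn_ge0 ?invr_ge0// ltW.
  have KP z : K * P s z <= (K + 2^-1 ^+ n.+1 * F) * P s z.
    by rewrite ler_wpM2r ?(ltW (conv_stk_gt0 _ _))// lerDl.
  have [sd|ds] := leP s d1.
    apply: (aeS _ (H1 s s0 sd)) => z h; apply: le_trans h _.
    by apply: le_trans (KP z); rewrite ler_wpM2r ?(ltW (conv_stk_gt0 _ _)).
  apply: (aeS _ (hH s s0)) => z hz.
  have [zM|zM] := leP (rt s * enorm z) M.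
    apply: le_trans hz _; apply: le_trans (KP z).
    apply: (@le_trans _ _ (H / c * P s z)).
      by rewrite -[leLHS](_ : H / c * (c * rt s ^+ d) = _) ?ler_wpM2l ?divr_ge0 ?(ltW H0) ?(ltW c0)// ?Hc// ?(ltW ds)// mulrA divfK ?gt_eqF.
    by rewrite ler_wpM2r ?(ltW (conv_stk_gt0 _ _))// le_max lexx orbT.
  have Kn0 : 0 <= K + 2^-1 ^+ n * F by rewrite addr_ge0// ltW.
  have := HM s z _ s0 (ltW zM) Kn0 (fun r r0 rs => IH r r0 (le_trans (ltW rs) sT)).
  move/lin2 => h; apply: le_trans h _; rewrite ler_wpM2r ?(ltW (conv_stk_gt0 _ _))//.
  by rewrite exprS -mulrA; exact: lin.
pose n := Num.bound F.
apply: (aeS _ (all n T T0 (lexx _))) => z h; apply: le_trans h _.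
rewrite ler_wpM2r ?(ltW (conv_stk_gt0 _ _))// lerD2l exprVn mulrC ler_pdivrMr ?exprn_gt0// mul1r.
have hn : F < n%:R by apply: archi_boundP; exact: ltW.
by apply: le_trans (ltW hn) _; rewrite -natrX ler_nat ltnW// ltn_expl.
Qed.

Lemma duh_far e : 0 < e -> exists2 M : R, 0 < M & forall t x, 0 < t -> M <= rt t * enorm x ->
  `|u t x - P t x| <= e * P t x.
Proof.
move=> e0; have [K K0 HK] := flow_le; have [M M0 HM] := far (divr_gt0 e0 K0).
exists M => // t x t0 xM; have := HM t x K t0 xM (ltW K0) (fun s s0 _ => HK s s0).
by rewrite divfK// gt_eqF.
Qed.

End flow_far.
End mild_flow.
End stable_flow.

(** * The limit in self-similar variables *)

Theorem theorem4p3 (R : realType) (d : nat) (alpha q : R) (b : 'rV[R]_d)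
    (u0 : 'rV[R]_d -> R) (u : R -> 'rV[R]_d -> R) :
  (0 < d)%N ->
  1 < alpha < 2 ->
  (alpha - 1) / d%:R <= q ->
  {ae lebesgue_rV d, forall x, 0 <= u0 x} ->
  (0 < 'N[lebesgue_rV d]_1[EFin \o u0])%E ->
  (q = (alpha - 1) / d%:R /\ u0 \in Lfun (lebesgue_rV d) 1%E) \/
  ((alpha - 1) / d%:R < q /\ u0 \in Lfun (lebesgue_rV d) 1%E /\
    u0 \in Lfun (lebesgue_rV d) +oo%E) ->
  mild_solution alpha q b u0 u ->
  ereal_sup [set `|1 - selfsim alpha u t x /
                       selfsim alpha (fun s => stable_semigroup alpha s u0) t x|%:E
            | t in `]0, +oo[ ] @[x --> enorm_infty] --> 0%E.
Proof.
move=> d0 al hq u0_ge0 u0_pos hu0 sol.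
have iu0 : intg (lebesgue_rV d) u0 by apply/Lfun1_integrable; case: hu0 => [[_ //]|[_ [//]]].
have m0 : 0 < \int[(lebesgue_rV d)]_x u0 x.
  rewrite (_ : \int[(lebesgue_rV d)]_x u0 x = \int[(lebesgue_rV d)]_x `|u0 x|).
    by rewrite -lte_fin EFin_Rint ?intg_norm//; rewrite Lnorm1 in u0_pos.
  apply: ae_eq_Rint; [exact: intg_meas iu0|exact: intg_meas (intg_norm iu0)|].
  by apply: (aeS _ u0_ge0) => x /ger0_norm ->.
have q0 : 0 < q := lt_le_trans (qc_gt0 al d0) hq.
have PE t x : stable_semigroup alpha t u0 x = conv (stk alpha t) u0 x.
  by apply: eq_Rintegral => y _; rewrite heat_kernelE.
have main e : 0 < e -> exists2 M : R, 0 < M & forall t x, 0 < t -> M <= rs alpha t * enorm x ->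
    `|u t x - conv (stk alpha t) u0 x| <= e * conv (stk alpha t) u0 x.
  (* Without drift the Duhamel term is 0 and the two flows coincide. The general argument divides by
     the transport kernel and uses translations by [b], so it is run for [b <> 0]. *)
  move=> e0; have [b0|b0] := eqVneq b 0.
    exists 1 => // t x t0 _; have [_ _ _ /(_ t x t0)[_ ->]] := sol.
    have D0 s z : duhamel alpha q b u t x s z = 0.
      by rewrite /duhamel b0 /dotp big1 ?mul0r// => i _; rewrite mxE mul0r.
    have E s : \int[lebesgue_rV d]_z duhamel alpha q b u t x s z = 0.
      by under eq_Rintegral => z _ do rewrite D0; rewrite Rint0.
    rewrite PE addrAC subrr add0r; under eq_Rintegral => s _ do rewrite E.
    rewrite /Rintegral integral0 normr0.
    by rewrite mulr_ge0 ?(ltW e0)// ltW// conv_stk_gt0.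
  (* The two cases enter only here: [A = 1] at the critical power, and [A = M^(q - qc)], with
     [qc = (alpha - 1) / d] and [M] a bound for [u0], above it, by the maximum principle. *)
  suff [A A0 hA] : exists2 A : R, 0 < A & forall s, 0 < s ->
      {ae (lebesgue_rV d), forall x, `|u s x| `^ q <= A * `|u s x| `^ ((alpha - 1) / d%:R)}.
    exact: (duh_far al q0 b0 sol iu0 u0_ge0 m0 d0 A0 hA e0).
  case: hu0 => [[qE _]|[qlt [_ u0oo]]].
    by exists 1 => // s s0; rewrite qE; apply: filterE => x; rewrite mul1r.
  have [M M0 HM] := Lfun_oo_bd u0oo.
  have q'0 : 0 < q - (alpha - 1) / d%:R by rewrite subr_gt0.
  exists (M `^ (q - (alpha - 1) / d%:R)); first exact: powR_gt0.
  move=> s s0; have uM : {ae (lebesgue_rV d), forall x, u s x <= M}.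
    apply: (sol_sup al q0 b0 sol iu0 (ltW M0) s0).
    by apply: (aeS _ HM) => x; exact: le_trans (ler_norm _).
  apply: (aeS2 _ (sol_ge0 al q0 b0 sol iu0 u0_ge0 s0) uM) => x x0 xM.
  rewrite ger0_norm// -[X in _ `^ X <= _](subrK ((alpha - 1) / d%:R)) (@powRD _ (u s x)); last first.
    by rewrite subrK (gt_eqF q0).
  by rewrite ler_wpM2r ?powR_ge0//; apply: ge0_ler_powR; rewrite ?nnegrE ?(ltW q'0) ?(ltW M0).
set S := fun x => ereal_sup _.
(* The supremum of an empty set would be [-oo]; the time 1 witnesses that the set is nonempty. *)
have S0 x : (0 <= S x)%E.
  apply: le_trans (ereal_sup_ubound _); last by exists 1 => //=; rewrite in_itv/= ltr01.
  by rewrite lee_fin.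
have Sle e : 0 < e -> exists M : R, forall x, M < enorm x -> (S x <= e%:E)%E.
  move=> e0; have [M M0 HM] := main e e0; exists M => x Mx.
  apply: ge_ereal_sup => z /= [t]; rewrite in_itv/= andbT => t0 <-; rewrite lee_fin /selfsim.
  pose y := t `^ alpha^-1 *: x; rewrite -/y PE; have P0 := conv_stk_gt0 al iu0 u0_ge0 m0 y t0.
  (* Rescaling space turns the self-similar condition [M <= rs t * |y|] into [M <= |x|], which does
     not involve [t]: this gives the supremum over all times. *)
  have ty : rs alpha t * enorm y = enorm x.
    rewrite /y enormZ ger0_norm ?powR_ge0// mulrA /rs -powRD ?addNr ?powRr0 ?mul1r//.
    by rewrite (gt_eqF t0) implybT.
  have := HM t y t0; rewrite ty => /(_ (ltW Mx)).
  rewrite -ler_pdivrMr// => h; apply: le_trans h.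
  rewrite -{3}(gtr0_norm P0) -normf_div.
  apply: eq_leW; rewrite distrC; congr `|_|.
  by field; rewrite !gt_eqF// powR_gt0.
apply/fine_cvgP; split.
  have [M HM] := Sle 1 ltr01; exists M => x /HM h.
  by rewrite ge0_fin_numE// (le_lt_trans h) ?ltry.
apply/cvgr0Pnorm_le => e e0; have [M HM] := Sle e e0; exists M => x /HM h /=.
by rewrite ger0_norm ?fine_ge0// -lee_fin fineK// ge0_fin_numE// (le_lt_trans h) ?ltry.
Qed.
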